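(* Let $B$ be a ball such that $3B\subset\Omega$, and let $u\in W_r(3B)$ be a non-negative solution of $Lu=0$ in $3B$. Then $$\sup_Bu\ \le\ C\inf_Bu,$$ where $C$ depends only on $n$, $d$ and $C_1$.
   Context: Let $n\ge2$ and let $0<d<n-1$ be a real number. $\Gamma\subset\mathbb R^n$ is a nonempty closed set which is Ahlfors regular of dimension $d$: there is $C_0\ge1$ with $C_0^{-1}r^d\le\mathcal H^d(\Gamma\cap B(x,r))\le C_0r^d$ for all $x\in\Gamma$, $r>0$. Set $\Omega=\mathbb R^n\setminus\Gamma$, $\delta(z)=\operatorname{dist}(z,\Gamma)$ and $w(z)=\delta(z)^{d+1-n}$. $3B$ is the ball with the same center as $B$ and three times its radius. $\sup$ and $\inf$ mean essential supremum and infimum. $W=\{u\in L^1_{loc}(\Omega):\nabla u\in L^2(\Omega,w)\}$ (distributional gradient in $\Omega$; $L^2(\Omega,w)=L^2(\Omega,w\,dz)$). For an open set $E\subset\mathbb R^n$, $W_r(E)=\{f\in L^1_{loc}(E):\varphi f\in W\text{ for all }\varphi\in C_0^\infty(E)\}$, with $\varphi f$ extended by $0$. $A:\Omega\to M_n(\mathbb R)$ is measurable and satisfies, for some $C_1\ge1$, $|A(x)\xi\cdot\zeta|\le C_1w(x)|\xi||\zeta|$ and $A(x)\xi\cdot\xi\ge C_1^{-1}w(x)|\xi|^2$ for all $x\in\Omega$, $\xi,\zeta\in\mathbb R^n$; $L=-\operatorname{div}A\nabla$. For an open set $E\subset\Omega$, $u\in W_r(E)$ is a solution of $Lu=0$ in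 $E$ if $\int_\Omega A\nabla u\cdot\nabla\varphi\,dz=0$ for all $\varphi\in C_0^\infty(E)$. *)

(* Defs.v *)
From HB Require Import structures.
From mathcomp Require Import all_boot all_order all_algebra.
From mathcomp Require Import all_classical all_reals all_analysis.
From mathcomp Require Import measurable_realfun ess_sup_inf.
Set Implicit Arguments.
Unset Strict Implicit.
Unset Printing Implicit Defensive.
Import Order.TTheory GRing.Theory Num.Theory.
Import numFieldNormedType.Exports.
Local Open Scope classical_set_scope.
Local Open Scope ring_scope.

(* 'rV[R]_n carries the sup norm in the library; the topology is the usual
   one, but Euclidean lengths and balls have to be spelled out. *)
Section euclidean.
Context {R : realType} {n : nat}.
Implicit Types (x y z : 'rV[R]_n) (E : set 'rV[R]_n).

Definition dotv x y : R := \sum_i x 0 i * y 0 i.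

Definition enorm x : R := Num.sqrt (dotv x x).

Definition eball x (r : R) : set 'rV[R]_n := [set y | enorm (y - x) < r].

Definition edist_set z E : R := inf [set enorm (z - y) | y in E].

(* The value 0 is added so that the empty set has diameter 0, not -oo. *)
Definition ediam E : \bar R :=
  ereal_sup (0%E |` [set (enorm (p.1 - p.2))%:E | p in E `*` E]).

End euclidean.

Section hausdorff_measure.
Context {R : realType} {n : nat}.
Variable d : R.
Local Open Scope ereal_scope.

Definition hausdorff_content (eps : R) (E : set 'rV[R]_n) : \bar R :=
  ereal_inf [set \sum_(k <oo) (ediam (U k) `^ d) | U in
    [set U : nat -> set 'rV[R]_n |
      E `<=` \bigcup_k U k /\ forall k, ediam (U k) <= eps%:E]].

(* H^d for d > 0, without normalizing constant. *)
Definition hausdorff (E : set 'rV[R]_n) : \bar R :=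
  ereal_sup [set hausdorff_content eps E | eps in [set eps : R | (0 < eps)%R]].

Definition ahlfors_regular (Gam : set 'rV[R]_n) : Prop :=
  exists C0 : R, (1 <= C0)%R /\
    forall x (r : R), Gam x -> (0 < r)%R ->
      (C0^-1 * r `^ d)%:E <= hausdorff (Gam `&` eball x r) /\
      hausdorff (Gam `&` eball x r) <= (C0 * r `^ d)%:E.

End hausdorff_measure.

(* The product sigma-algebra on 'rV[R]_n, i.e. the Borel one; same construction
   as the library's for n.-tuple R. *)
Definition rV_display : measure_display.
Proof. exact. Qed.

Section measurable_rV.
Context {R : realType} {n : nat}.

Let coors (i : 'I_n) (v : 'rV[R]_n) : R := v 0 i.

Let rV_set0 : g_sigma_preimage coors set0.
Proof. exact: sigma_algebra0. Qed.

Let rV_setC A : g_sigma_preimage coors A -> g_sigma_preimage coors (~` A).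
Proof. exact: sigma_algebraC. Qed.

Let rV_bigcup (F : (set 'rV[R]_n)^nat) :
  (forall i, g_sigma_preimage coors (F i)) ->
  g_sigma_preimage coors (\bigcup_i (F i)).
Proof. exact: sigma_algebra_bigcup. Qed.

HB.instance Definition _ := @isMeasurable.Build rV_display
  'rV[R]_n (g_sigma_preimage coors) rV_set0 rV_setC rV_bigcup.

Lemma measurable_coord (i : 'I_n) :
  measurable_fun [set: 'rV[R]_n] (fun v : 'rV[R]_n => v 0 i : R).
Proof.
move=> _ Y mY; rewrite setTI; apply: sub_sigma_algebra => /=.
rewrite -bigcup_seq/=; exists i => /=; first by rewrite mem_index_enum.
by exists Y => //; rewrite setTI.
Qed.

Lemma measurable_fun_rV d (T : measurableType d) (f : T -> 'rV[R]_n) :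
  (forall i, measurable_fun [set: T] (fun t => f t 0 i : R)) ->
  measurable_fun [set: T] f.
Proof.
move=> mf _ A mA; rewrite setTI.
suff sub : g_sigma_preimage coors `<=` [set B | measurable (f @^-1` B)].
  exact: sub.
apply: smallest_sub.
  split => /=.
  - by rewrite preimage_set0.
  - by move=> B mB; rewrite setTD preimage_setC; exact: measurableC.
  - by move=> F mF; rewrite preimage_bigcup; exact: bigcup_measurable.
rewrite -bigcup_seq => B [i _ [Y mY <-]] /=; rewrite setTI.
by have := mf i measurableT Y mY; rewrite setTI.
Qed.

Lemma measurable_enorm (x : 'rV[R]_n) :
  measurable_fun [set: 'rV[R]_n] (fun y => enorm (y - x) : R).
Proof.
have /measurable_funTS ms : measurable_fun [set: R] (@Num.sqrt R).
  by apply: continuous_measurable_fun => y; exact: sqrt_continuous.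
apply: (measurableT_comp (f := @Num.sqrt R)) => //.
apply: measurable_sum => i; under eq_fun do rewrite !mxE.
by apply: measurable_funM; apply: measurable_funB => //; exact: measurable_coord.
Qed.

Lemma measurable_eball (x : 'rV[R]_n) (r : R) : measurable (eball x r).
Proof.
have := @measurable_enorm x measurableT _ (measurable_itv `]-oo, r[).
by rewrite setTI; congr (measurable _); apply/seteqP; split=> y /=; rewrite in_itv.
Qed.

End measurable_rV.

(* Lebesgue measure on R^(n+1), given Lebesgue measure m on R^n. *)
Section lebesgue_step.
Context {R : realType} {n : nat}.
Variable m : {sigma_finite_measure set 'rV[R]_n -> \bar R}.

Definition cons_rV (p : measurableTypeR R * 'rV[R]_n) : 'rV[R]_n.+1 :=
  row_mx (p.1)%:M p.2.

Lemma cons_rV0 p : cons_rV p 0 0 = p.1.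
Proof.
by rewrite mxE; case: splitP => [j _|j //]; rewrite ord1 mxE eqxx mulr1n.
Qed.

Lemma cons_rVS p j : cons_rV p 0 (lift 0 j) = p.2 0 j.
Proof.
rewrite mxE; case: splitP => [i|k /=]; first by rewrite ord1.
by rewrite /bump /= !add1n => -[/val_inj ->].
Qed.

Lemma measurable_cons_rV : measurable_fun setT cons_rV.
Proof.
apply: measurable_fun_rV => i; case: (unliftP 0 i) => [j|] ->.
  under eq_fun do rewrite cons_rVS.
  exact: (measurableT_comp (measurable_coord j) measurable_snd).
by under eq_fun do rewrite cons_rV0; exact: measurable_fst.
Qed.

Definition lebesgue_rVS : set 'rV[R]_n.+1 -> \bar R :=
  pushforward (lebesgue_measure \x m)%E cons_rV.

Let lebesgue_rVS0 : lebesgue_rVS set0 = 0%E.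
Proof. by rewrite /lebesgue_rVS /pushforward preimage_set0 measure0. Qed.

Let lebesgue_rVS_ge0 A : (0 <= lebesgue_rVS A)%E.
Proof. by rewrite /lebesgue_rVS /pushforward measure_ge0. Qed.

Let lebesgue_rVS_sigma_additive : semi_sigma_additive lebesgue_rVS.
Proof.
exact: (@measure_semi_sigma_additive _ _ _
  (measure_function_pushforward__canonical__measure_function_Measure
    (lebesgue_measure \x m)%E measurable_cons_rV)).
Qed.

HB.instance Definition _ := isMeasure.Build _ _ _ lebesgue_rVS
  lebesgue_rVS0 lebesgue_rVS_ge0 lebesgue_rVS_sigma_additive.

Lemma lebesgue_rVSE (A : 'I_n.+1 -> set R) : (forall i, measurable (A i)) ->
  lebesgue_rVS [set v : 'rV[R]_n.+1 | forall i, A i (v 0 i)] =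
  (lebesgue_measure (A 0%R : set (measurableTypeR R)) *
   m [set v : 'rV[R]_n | forall j, A (lift 0%R j) (v 0%R j)])%E.
Proof.
move=> mA; rewrite -product_measure1E//; [|exact: mA|]; last first.
  rewrite [X in measurable X](_ : _ =
    \big[setI/setT]_(j < n) ((fun v : 'rV[R]_n => v 0 j : R) @^-1` A (lift 0 j))).
    apply: bigsetI_measurable => j _.
    by have := @measurable_coord R n j measurableT _ (mA (lift 0 j)); rewrite setTI.
  rewrite -bigcap_seq; apply/seteqP; split => v /= h j.
    by move=> _; exact: h.
  by apply: h; exact: mem_index_enum.
rewrite /lebesgue_rVS /pushforward; congr ((lebesgue_measure \x m)%E _).
apply/seteqP; split => [p /= h|p /= [h0 h] i].
  split=> [|j]; first by have := h 0; rewrite cons_rV0.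
  by have := h (lift 0 j); rewrite cons_rVS.
by case: (unliftP 0 i) => [j|] ->; rewrite ?cons_rV0// cons_rVS.
Qed.

Let uncons_rV (v : 'rV[R]_n.+1) : measurableTypeR R * 'rV[R]_n :=
  (v 0 0, \row_j v 0 (lift 0 j)).

Let cons_rVK : cancel cons_rV uncons_rV.
Proof.
case=> a v; rewrite /uncons_rV cons_rV0 /=; congr pair.
by apply/rowP => j; rewrite mxE cons_rVS.
Qed.

Let measurable_uncons_rV : measurable_fun setT uncons_rV.
Proof.
apply/measurable_fun_pairP; split; first exact: measurable_coord.
apply: measurable_fun_rV => j /=.
under eq_fun do rewrite mxE.
exact: measurable_coord.
Qed.

Let lebesgue_rVS_sigma_finite : sigma_finite setT lebesgue_rVS.
Proof.
have /sigma_finiteP[F [TF ndF Foo]] :=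
  sigma_finiteT (@lebesgue_measure R : {sigma_finite_measure set _ -> \bar R}).
have /sigma_finiteP[G [TG ndG Goo]] := sigma_finiteT m.
exists (fun k => uncons_rV @^-1` (F k `*` G k)).
  apply/seteqP; split=> [v _|//].
  have : [set: measurableTypeR R] (uncons_rV v).1 by [].
  have : [set: 'rV[R]_n] (uncons_rV v).2 by [].
  rewrite TF TG => -[k _ Gk] [l _ Fl]; exists (maxn k l) => //; split.
    by move: Fl; exact/subsetPset/ndF/leq_maxr.
  by move: Gk; exact/subsetPset/ndG/leq_maxl.
move=> k; have [mF Fkoo] := Foo k; have [mG Gkoo] := Goo k; split.
  by rewrite -[X in measurable X]setTI; apply: measurable_uncons_rV => //;
    exact: measurableX.
rewrite /lebesgue_rVS /pushforward -comp_preimage (_ : _ \o _ = id); last first.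
  by apply/funext => p /=; rewrite cons_rVK.
by rewrite product_measure1E// lte_mul_pinfty// ge0_fin_numE.
Qed.

HB.instance Definition _ := Measure_isSigmaFinite.Build _ _ _ lebesgue_rVS
  lebesgue_rVS_sigma_finite.

End lebesgue_step.

Fixpoint lebesgue_rV (R : realType) (n : nat) :
    {sigma_finite_measure set 'rV[R]_n -> \bar R} :=
  match n with
  | 0 => \d_(0 : 'rV[R]_0)
  | n'.+1 => lebesgue_rVS (lebesgue_rV R n')
  end.

Lemma lebesgue_rVE (R : realType) (n : nat) (A : 'I_n -> set R) :
    (forall i, measurable (A i)) ->
  lebesgue_rV R n [set v : 'rV[R]_n | forall i, A i (v 0 i)] =
  (\prod_(i < n) lebesgue_measure (A i : set (measurableTypeR R)))%E.
Proof.
elim: n A => [|n IH] A mA.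
  by rewrite big_ord0 /= diracE mem_set// => -[].
rewrite [LHS]lebesgue_rVSE// big_ord_recl; congr (_ * _)%E.
exact: (IH (fun j => A (lift 0 j))).
Qed.

Section function_spaces.
Context {R : realType} {n : nat}.
Implicit Types (E : set 'rV[R]_n) (f u phi : 'rV[R]_n -> R)
  (g : 'rV[R]_n -> 'rV[R]_n).

Local Notation leb := (lebesgue_rV R n).

(* Lebesgue measurability on E: the library's measurable_fun is Borel
   measurability, and a function is Lebesgue measurable iff it agrees almost
   everywhere with a Borel one. *)
Definition lebesgue_measurable_fun E f : Prop :=
  exists2 h : 'rV[R]_n -> R, measurable_fun E h &
    {ae leb, forall x, E x -> f x = h x}.

Definition L1loc E f : Prop :=
  lebesgue_measurable_fun E f /\
  forall K, compact K -> K `<=` E ->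
    (\int[leb]_(x in K) `|f x|%:E < +oo)%E.

Definition partial (i : 'I_n) f : 'rV[R]_n -> R :=
  fun x => 'D_(delta_mx 0 i) f x.

Definition grad f : 'rV[R]_n -> 'rV[R]_n := fun x => \row_i partial i f x.

(* All iterated partial derivatives exist and are continuous. *)
Definition smooth f : Prop :=
  forall s : seq 'I_n,
    continuous (foldr partial f s) /\
    forall i x, derivable (foldr partial f s) x (delta_mx 0 i).

Definition supp f : set 'rV[R]_n := closure [set x | f x != 0].

(* C_0^infty(E); elements are extended by 0 outside E. *)
Definition test_fun E phi : Prop :=
  [/\ smooth phi, compact (supp phi) & supp phi `<=` E].

Definition distr_grad E u g : Prop :=
  [/\ L1loc E u,
      forall i, L1loc E (fun x => g x 0 i) &
      forall phi (i : 'I_n), test_fun E phi ->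
        \int[leb]_(x in E) (u x * partial i phi x) =
        - \int[leb]_(x in E) (g x 0 i * phi x)].

End function_spaces.

(* The matrix A acts on column vectors: for a row vector xi, A xi is xi *m A^T. *)
Section degenerate_elliptic.
Context {R : realType} {n : nat}.
Variables (Gam : set 'rV[R]_n) (d : R).
Implicit Types (E : set 'rV[R]_n) (f u : 'rV[R]_n -> R).

Local Notation leb := (lebesgue_rV R n).
Local Notation Omega := (~` Gam).

Definition weight (z : 'rV[R]_n) : R := edist_set z Gam `^ (d + 1 - n%:R).

(* A distributional gradient in L^2(Omega, w) is automatically in
   L^1_loc(Omega), because w is locally bounded below there; so asking for it
   among the L^1_loc gradients loses nothing. *)
Definition W u : Prop :=
  exists2 g : 'rV[R]_n -> 'rV[R]_n, distr_grad Omega u g &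
    (\int[leb]_(x in Omega) (enorm (g x) ^+ 2 * weight x)%:E < +oo)%E.

Definition Wr E f : Prop :=
  L1loc E f /\ forall phi, test_fun E phi -> W (fun x => phi x * f x).

Definition elliptic (C1 : R) (A : 'rV[R]_n -> 'M[R]_n) : Prop :=
  [/\ forall i j, lebesgue_measurable_fun Omega (fun x => A x i j),
      forall x (xi zeta : 'rV[R]_n), Omega x ->
        `|dotv (xi *m (A x)^T) zeta| <= C1 * weight x * enorm xi * enorm zeta &
      forall x (xi : 'rV[R]_n), Omega x ->
        C1^-1 * weight x * enorm xi ^+ 2 <= dotv (xi *m (A x)^T) xi].

(* u is only defined on E, and so is its gradient g; the integrand vanishes on
   Omega `\` E because grad phi does. *)
Definition solution (A : 'rV[R]_n -> 'M[R]_n) E u : Prop :=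
  Wr E u /\
  exists2 g : 'rV[R]_n -> 'rV[R]_n, distr_grad E u g &
    forall phi, test_fun E phi ->
      \int[leb]_(x in Omega) dotv (g x *m (A x)^T) (grad phi x) = 0.

End degenerate_elliptic.

Definition ess_sup_ball (R : realType) (n : nat) (x : 'rV[R]_n) (r : R)
    (u : 'rV[R]_n -> R) : \bar R :=
  ess_sup (mrestr (lebesgue_rV R n) (measurable_eball x r)) (EFin \o u).

Definition ess_inf_ball (R : realType) (n : nat) (x : 'rV[R]_n) (r : R)
    (u : 'rV[R]_n -> R) : \bar R :=
  ess_inf (mrestr (lebesgue_rV R n) (measurable_eball x r)) (EFin \o u).

(* Main.v *)
(* De Giorgi's method. On a ball of radius 2r the weight is comparable to a constant,
   with ratio at most 5^(n-1-d), so that u is there a solution of a uniformly elliptic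
   equation. Testing that equation with cut-off truncations of u gives the Caccioppoli
   inequality for u and - u. Together with estimates of difference quotients by gradients,
   which play the part of the Sobolev and isoperimetric inequalities, it yields the local
   boundedness of u and the expansion of positivity of De Giorgi. The Harnack inequality
   on small balls follows by choosing a point and a scale where u is almost maximal for a
   suitable weight, and is then propagated along a chain of balls.
   Truncations are only available through smooth approximations, because weak gradients
   are defined by duality: u and its gradient are first shown to be L^2 limits of smooth
   functions and of their gradients, and the chain rule is passed to the limit. *)
Require Import Defs.
From HB Require Import structures.
From mathcomp Require Import all_boot all_order all_algebra.
From mathcomp Require Import all_classical all_reals all_analysis.
From mathcomp Require Import measurable_realfun ess_sup_inf ring lra.
Set Implicit Arguments.
Unset Strict Implicit.
Unset Printing Implicit Defensive.
Import Order.TTheory GRing.Theory Num.Theory.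
Import numFieldNormedType.Exports.
Local Open Scope classical_set_scope.
Local Open Scope ring_scope.

(** * Euclidean space and Lebesgue measure *)

(** The gain behind the iteration comes from scale, not from an exponent above 2: if f vanishes
    outside a set smaller than half a cube of side comparable to h, its L^2 norm is at most a
    multiple of h times that of its gradient. Chebyshev's inequality makes the supports of higher
    truncations small, and h shrinks along with the radii. The class [dg] has a single constant
    [Gam], which for a solution is 64 (Lam / lam)^2. Only the ratio of the ellipticity bounds
    enters, so the size of the weight cancels and the final constant does not depend on the ball.
    The factor 5 arises because 3B avoids the closed set: on 2B the distance to it stays between 1/3
    and 5/3 of its value at the centre. Two obstacles shape the passage from the definitions to
    [dg]. Membership in [Wr] controls only gradients of products phi u, so square integrability of u
    has to be extracted. And u, its gradient and A are Borel only up to null sets, while the given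
    integrals involve these very functions; one null set is therefore removed once and for all, and
    the estimates are made for the Borel functions that remain. *)

Section continuity.
Context {R : realType} (T : topologicalType).
Implicit Types f g : T -> R.

Lemma cont_cst (c : R) : continuous (fun _ : T => c).
Proof. by move=> t; exact: cvg_cst. Qed.

Lemma contD f g : continuous f -> continuous g -> continuous (fun t => f t + g t).
Proof. by move=> cf cg t; exact: (cvgD (cf t) (cg t)). Qed.

Lemma contB f g : continuous f -> continuous g -> continuous (fun t => f t - g t).
Proof. by move=> cf cg t; exact: (cvgB (cf t) (cg t)). Qed.

Lemma contM f g : continuous f -> continuous g -> continuous (fun t => f t * g t).
Proof. by move=> cf cg t; exact: (cvgM (cf t) (cg t)). Qed.

Lemma cont_comp (U V : topologicalType) (f : T -> U) (g : U -> V) :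
  continuous f -> continuous g -> continuous (fun t => g (f t)).
Proof. by move=> cf cg t; exact: (cvg_comp _ _ (cf t) (cg (f t))). Qed.

End continuity.

Section euclidean_facts.
Context {R : realType} {n : nat}.
Implicit Types (x y z : 'rV[R]_n) (c : R).

Lemma dotvC x y : dotv x y = dotv y x.
Proof. by rewrite /dotv; apply: eq_bigr => i _; rewrite mulrC. Qed.

Lemma dotvDl x y z : dotv (x + y) z = dotv x z + dotv y z.
Proof. by rewrite /dotv -big_split/=; apply: eq_bigr => i _; rewrite mxE mulrDl. Qed.

Lemma dotvZl c x y : dotv (c *: x) y = c * dotv x y.
Proof. by rewrite /dotv mulr_sumr; apply: eq_bigr => i _; rewrite mxE mulrA. Qed.

Lemma dotvDr x y z : dotv x (y + z) = dotv x y + dotv x z.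
Proof. by rewrite dotvC dotvDl !(dotvC x). Qed.

Lemma dotvZr c x y : dotv x (c *: y) = c * dotv x y.
Proof. by rewrite dotvC dotvZl dotvC. Qed.

Lemma dotvNl x y : dotv (- x) y = - dotv x y.
Proof. by rewrite -scaleN1r dotvZl mulN1r. Qed.

Lemma dotvNr x y : dotv x (- y) = - dotv x y.
Proof. by rewrite dotvC dotvNl dotvC. Qed.

Lemma dotv0l x : dotv 0 x = 0.
Proof. by rewrite -(scale0r 0) dotvZl mul0r. Qed.

Lemma dotv0r x : dotv x 0 = 0.
Proof. by rewrite dotvC dotv0l. Qed.

Lemma dotvv_ge0 x : 0 <= dotv x x.
Proof. by apply: sumr_ge0 => i _; rewrite -expr2 sqr_ge0. Qed.

Lemma enorm_ge0 x : 0 <= enorm x.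
Proof. exact: sqrtr_ge0. Qed.

Lemma sqr_enorm x : enorm x ^+ 2 = dotv x x.
Proof. by rewrite sqr_sqrtr// dotvv_ge0. Qed.

Lemma sqr_enormE x : enorm x ^+ 2 = \sum_i x 0 i ^+ 2.
Proof. by rewrite sqr_enorm; apply: eq_bigr => i _; rewrite expr2. Qed.

Lemma dotvv_eq0 x : dotv x x = 0 -> x = 0.
Proof.
move/eqP; rewrite psumr_eq0 => [/allP h|i _]; last by rewrite -expr2 sqr_ge0.
apply/rowP => i; rewrite mxE; apply/eqP; rewrite -sqrf_eq0 expr2.
exact: (h i (mem_index_enum i)).
Qed.

Lemma enorm0 : enorm (0 : 'rV[R]_n) = 0.
Proof. by rewrite /enorm dotv0l sqrtr0. Qed.

Lemma enormZ c x : enorm (c *: x) = `|c| * enorm x.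
Proof.
by rewrite /enorm dotvZl dotvZr mulrA -expr2 sqrtrM ?sqr_ge0// sqrtr_sqr.
Qed.

Lemma enormN x : enorm (- x) = enorm x.
Proof. by rewrite -scaleN1r enormZ normrN1 mul1r. Qed.

Lemma enormB x y : enorm (x - y) = enorm (y - x).
Proof. by rewrite -enormN opprB. Qed.

(** The Cauchy-Schwarz inequality, from |y - t x|^2 >= 0 at the minimizing t = <x, y> / <x, x>. *)
Lemma dotv_le x y : `|dotv x y| <= enorm x * enorm y.
Proof.
have [->|x0] := eqVneq x 0; first by rewrite dotv0l normr0 enorm0 mul0r.
have xp : 0 < dotv x x.
  by rewrite lt_neqAle dotvv_ge0 andbT eq_sym; apply: contra_neq x0 => /dotvv_eq0.
set t := dotv x y / dotv x x.
have tE : t * dotv x x = dotv x y by rewrite divfK// gt_eqF.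
have := dotvv_ge0 (y - t *: x).
rewrite !(dotvDl,dotvDr,dotvNl,dotvNr,dotvZl,dotvZr) tE (dotvC y x) => h0.
have h : 0 <= dotv y y - t * dotv x y by lra.
have {}h : dotv x y ^+ 2 <= dotv x x * dotv y y.
  by have := mulr_ge0 (ltW xp) h; rewrite mulrBr mulrA (mulrC _ t) tE expr2; lra.
rewrite -(ler_pXn2r (n := 2))// ?nnegrE  ?mulr_ge0 ?enorm_ge0//.
by rewrite exprMn !sqr_enorm real_normK ?num_real.
Qed.

Lemma dotv_ub x y : dotv x y <= enorm x * enorm y.
Proof. exact: le_trans (ler_norm _) (dotv_le x y). Qed.

Lemma enormD x y : enorm (x + y) <= enorm x + enorm y.
Proof.
rewrite -(ler_pXn2r (n := 2))// ?nnegrE ?addr_ge0 ?enorm_ge0//.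
rewrite sqrrD !sqr_enorm dotvDl !dotvDr (dotvC y x).
have := dotv_ub x y; lra.
Qed.

Lemma enorm_triangle z x y : enorm (x - y) <= enorm (x - z) + enorm (z - y).
Proof. by rewrite (_ : x - y = (x - z) + (z - y)) ?enormD// addrA subrK. Qed.

Lemma coord_le_enorm x i : `|x 0 i| <= enorm x.
Proof.
rewrite -(ler_pXn2r (n := 2))// ?nnegrE ?enorm_ge0 //.
rewrite sqr_enormE real_normK ?num_real// (bigD1 i)//= lerDl.
by apply: sumr_ge0 => j _; exact: sqr_ge0.
Qed.

Lemma enorm_le_sum x : enorm x <= \sum_i `|x 0 i|.
Proof.
rewrite -(ler_pXn2r (n := 2))// ?nnegrE ?enorm_ge0 ?sumr_ge0//.
rewrite sqr_enormE expr2 mulr_suml; apply: ler_sum => i _.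
rewrite -real_normK ?num_real// expr2 ler_wpM2l//.
by rewrite (bigD1 i)//= lerDl sumr_ge0.
Qed.

Lemma enorm_le_coord x c : (forall i, `|x 0 i| <= c) -> enorm x <= n%:R * c.
Proof.
move=> h; apply: le_trans (enorm_le_sum x) _.
apply: (@le_trans _ _ (\sum_(i < n) c)); first exact: ler_sum.
by rewrite sumr_const card_ord mulr_natl.
Qed.

Lemma coord_le_norm x i : `|x 0 i| <= `|x|.
Proof.
rewrite [leRHS]/Num.norm /= mx_normrE; apply/bigmax_geP; right => /=.
by exists (0, i).
Qed.

Lemma norm_le_enorm x : `|x| <= enorm x.
Proof.
rewrite [leLHS]/Num.norm /= mx_normrE; apply/bigmax_leP; split; first exact: enorm_ge0.
by move=> [i j] _ /=; rewrite ord1 coord_le_enorm.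
Qed.

Lemma eball_sub x y (a b : R) : enorm (y - x) + a <= b -> eball y a `<=` eball x b.
Proof.
move=> h z /= yz; apply: lt_le_trans h; apply: le_lt_trans (enorm_triangle y _ _) _.
by rewrite addrC ltrD2l.
Qed.

Lemma eball_subr x (a b : R) : a <= b -> eball x a `<=` eball x b.
Proof. by move=> ab; apply: eball_sub; rewrite subrr enorm0 add0r. Qed.

Lemma eball_center x (a : R) : 0 < a -> eball x a x.
Proof. by rewrite /eball/= subrr enorm0. Qed.

Lemma eball_convex x (r t : R) y z : 0 <= t <= 1 -> eball x r y -> eball x r z ->
  eball x r (y + t *: (z - y)).
Proof.
move=> /andP[t0 t1]; rewrite /eball/= => yr zr.
have -> : y + t *: (z - y) - x = (1 - t) *: (y - x) + t *: (z - x).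
  by apply/rowP => i; rewrite !mxE; ring.
apply: le_lt_trans (enormD _ _) _; rewrite !enormZ !ger0_norm ?subr_ge0//.
(* The strict inequality is taken from the term with the factor t, so the case t = 0, where that
   term vanishes, is treated apart. *)
have [->|tn0] := eqVneq t 0; first by rewrite subr0 mul0r addr0 mul1r.
have tp : 0 < t by rewrite lt_neqAle eq_sym tn0.
have h1 : (1 - t) * enorm (y - x) <= (1 - t) * r by rewrite ler_wpM2l ?subr_ge0// ltW.
have h2 : t * enorm (z - x) < t * r by rewrite ltr_pM2l.
lra.
Qed.

Lemma continuous_coord i : continuous (fun v : 'rV[R]_n => v 0 i : R).
Proof.
move=> v A /= nA; exists (fun _ j => if j == i then A else setT) => /=.
  by move=> i0 j; rewrite ord1; case: eqP => [->//|_]; exact: filterT.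
by move=> w /= /(_ 0 i); rewrite eqxx.
Qed.

Lemma cvg_rV (T : Type) (F : set_system T) (FF : Filter F) (f : T -> 'rV[R]_n) (l : 'rV[R]_n) :
  (forall i, f x 0 i @[x --> F] --> l 0 i) -> f x @[x --> F] --> l.
Proof.
move=> h A /= [B nB BA].
have : F [set t | forall i, B 0 i (f t 0 i)].
  by apply: filter_forall => i; exact: (h i (B 0 i) (nB 0 i)).
apply: (@filterS _ F FF) => t /= Bt; apply: BA => i j; rewrite ord1; exact: Bt.
Qed.

Lemma continuous_rV (T : topologicalType) (f : T -> 'rV[R]_n) :
  (forall i, continuous (fun t => f t 0 i : R)) -> continuous f.
Proof. by move=> cf t; apply: (@cvg_rV T (nbhs t) (nbhs_filter t)) => i; exact: cf. Qed.

Lemma continuous_rsum (T : topologicalType) (I : Type) (r : seq I) (f : I -> T -> R) :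
  (forall i, continuous (f i)) -> continuous (fun t => \sum_(i <- r) f i t).
Proof.
move=> cf; elim: r => [|i r IH] t.
  by under eq_fun do rewrite big_nil; exact: cvg_cst.
by rewrite /continuous_at; under eq_fun do rewrite big_cons; rewrite big_cons; apply: cvgD; [exact: cf|exact: IH].
Qed.

Lemma continuous_dotv (T : topologicalType) (f g : T -> 'rV[R]_n) :
  continuous f -> continuous g -> continuous (fun t => dotv (f t) (g t)).
Proof.
move=> cf cg; apply: continuous_rsum => i t; apply: cvgM.
  exact: (cvg_comp _ _ (cf t) (@continuous_coord i (f t))).
exact: (cvg_comp _ _ (cg t) (@continuous_coord i (g t))).
Qed.

Lemma continuous_enorm x : continuous (fun y => enorm (y - x) : R).
Proof.
have cB : continuous (fun y : 'rV[R]_n => y - x).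
  apply: continuous_rV => i; under eq_fun do rewrite !mxE.
  by apply: contB; [exact: continuous_coord|exact: cont_cst].
apply: (cont_comp (f := fun y => dotv (y - x) (y - x)) (g := @Num.sqrt R)).
  exact: continuous_dotv.
exact: sqrt_continuous.
Qed.

Lemma open_eball x (r : R) : open (eball x r).
Proof.
rewrite /eball; apply: (@open_comp _ _ (fun y => enorm (y - x)) [set t : R | t < r]).
  by move=> y _; exact: continuous_enorm.
exact: open_lt.
Qed.

Lemma closed_cball x (r : R) : closed [set y | enorm (y - x) <= r].
Proof.
apply: (@closed_comp _ _ (fun y => enorm (y - x)) [set t : R | t <= r]).
  by move=> y _; exact: continuous_enorm.
exact: closed_le.
Qed.

Lemma compact_cball x (r : R) : compact [set y | enorm (y - x) <= r].
Proof.
apply: bounded_closed_compact; last exact: closed_cball.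
exists (enorm x + r); split; first exact: num_real.
move=> M Mr y /= yr; apply: le_trans (norm_le_enorm _) _.
apply: le_trans (ltW Mr); rewrite -{1}(subrK x y) addrC.
by apply: le_trans (enormD _ _) _; rewrite lerD2l.
Qed.

(** An open set is the union of the cubes with rational centre and radius 1 / (k + 1) that it
    contains. There are countably many of them, and each is a finite intersection of preimages of
    intervals under the coordinates. *)
Lemma open_measurable_rV (U : set 'rV[R]_n) : open U -> measurable U.
Proof.
move=> oU.
pose B (p : 'rV[rat]_n * nat) : set 'rV[R]_n :=
  [set v | forall i, `|ratr (p.1 0 i) - v 0 i| < p.2.+1%:R^-1].
have mB p : measurable (B p).
  rewrite (_ : B p = \bigcap_(i in [set: 'I_n])
     ((fun v : 'rV[R]_n => v 0 i : R) @^-1`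
        [set t | `|ratr (p.1 0 i) - t| < p.2.+1%:R^-1])); last first.
    by apply/seteqP; split => v /= h i; [move=> _|]; exact: h.
  apply: fin_bigcap_measurable => // i _.
  have := @measurable_coord R n i measurableT [set t | `|ratr (p.1 0 i) - t| < p.2.+1%:R^-1].
  rewrite setTI; apply.
  have -> : [set t : R | `|ratr (p.1 0 i) - t| < p.2.+1%:R^-1] =
     `]ratr (p.1 0 i) - p.2.+1%:R^-1, ratr (p.1 0 i) + p.2.+1%:R^-1[%classic.
    by apply/seteqP; split=> t /=; rewrite in_itv/= distrC ltr_distl.
  exact: measurable_itv.
(* Cubes not contained in U are replaced by the empty set, so that the union runs over a whole
   countable type. *)
have -> : U = \bigcup_p (if `[< B p `<=` U >] then B p else set0).
  apply/seteqP; split=> [v Uv|v [p _]]; last by case: ifPn => // /asboolP; exact.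
  have /nbhs_ballP[e /= e0 eU] : nbhs v U by apply: open_nbhs_nbhs; split.
  have [k ke] : exists k : nat, k.+1%:R^-1 < e / 2.
    have := near_infty_natSinv_lt (PosNum (divr_gt0 e0 (ltr0n R 2))).
    by case => N _ h; exists N; exact: (h N (leqnn N)).
  have kp : 0 < k.+1%:R^-1 :> R by rewrite invr_gt0.
  have /choice[q hq] : forall i : 'I_n, exists q : rat, `|ratr q - v 0 i| < k.+1%:R^-1.
    move=> i; have [|q] := @rat_in_itvoo R (v 0 i - k.+1%:R^-1) (v 0 i + k.+1%:R^-1).
      by rewrite ltrBlDr -addrA ltrDl addr_gt0.
    by rewrite in_itv/= => h; exists q; rewrite ltr_distl.
  have Bv : B (\row_i q i, k) v by move=> i /=; rewrite mxE.
  exists (\row_i q i, k) => //; case: ifPn => // /asboolP; case => w /= Bw.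
  apply: eU; rewrite /ball /=; split => // i j; rewrite ord1.
  have := Bw j; have := Bv j; rewrite /= !mxE => h1 h2.
  rewrite /ball/=; apply: lt_trans (_ : k.+1%:R^-1 + k.+1%:R^-1 < e); last by rewrite [ltRHS]splitr ltrD.
  apply: le_lt_trans (ler_distD (ratr (q j)) _ _) _.
  by apply: ltrD => //; rewrite distrC.
apply: countable_bigcupT_measurable; first exact: countableP.
by move=> p; case: ifPn.
Qed.

Lemma closed_measurable_rV (F : set 'rV[R]_n) : closed F -> measurable F.
Proof.
move=> cF; rewrite -[F]setCK; apply: measurableC; apply: open_measurable_rV.
exact: closed_openC.
Qed.

Lemma continuous_measurable_rV (f : 'rV[R]_n -> R) :
  continuous f -> measurable_fun setT f.
Proof.
move=> /continuousP cf.
apply: (measurability _ (RGenOInfty.measurableE R)).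
move=> _ [_ [a ->] <-]; rewrite setTI; apply: open_measurable_rV; apply: cf.
exact: interval_open.
Qed.

End euclidean_facts.

Section measure_rV.
Context {R : realType}.

Lemma lebesgue_translate (a : R) (A : set (measurableTypeR R)) : measurable A ->
  lebesgue_measure ((fun x : R => x + a) @^-1` A) = lebesgue_measure A.
Proof.
move=> mA; apply/esym.
have mf : measurable_fun [set: measurableTypeR R] (fun x : measurableTypeR R => x + a : measurableTypeR R).
  by apply: measurable_funD => //; exact: measurable_cst.
pose f : {mfun measurableTypeR R >-> measurableTypeR R} := HB.pack (fun x : measurableTypeR R => x + a : measurableTypeR R) (isMeasurableFun.Build _ _ _ _ _ mf).
apply: (@lebesgue_measure_unique R (pushforward lebesgue_measure f)) => // X [[u v] _ <-] /=.
rewrite /pushforward (_ : _ @^-1` _ = `]u - a, v - a]%classic); last first.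
  by apply/seteqP; split=> x /=; rewrite !in_itv/= ltrBlDr lerBrDr.
rewrite !lebesgue_measure_itv/= !lte_fin ltrD2r.
by case: ifP => // _; rewrite -!EFinD; congr EFin; ring.
Qed.

Lemma ge0_integral_translate1 (a : R) (f : measurableTypeR R -> \bar R) :
  measurable_fun setT f -> (forall x, 0 <= f x)%E ->
  (\int[lebesgue_measure]_x f (x + a)%R = \int[lebesgue_measure]_x f x)%E.
Proof.
move=> mf f0.
have mt : measurable_fun [set: measurableTypeR R] (fun x : measurableTypeR R => x + a : measurableTypeR R).
  by apply: measurable_funD => //; exact: measurable_cst.
transitivity (\int[pushforward lebesgue_measure (fun x : measurableTypeR R => (x + a)%R : measurableTypeR R)]_x f x)%E.
  by rewrite (ge0_integral_pushforward mt).
by apply: eq_measure_integral => A mA _; exact: lebesgue_translate.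
Qed.

Lemma measurable_translate n (z : 'rV[R]_n) : measurable_fun setT (fun x : 'rV[R]_n => x + z).
Proof.
apply: measurable_fun_rV => i; under eq_fun do rewrite mxE.
by apply: measurable_funD; [exact: measurable_coord|exact: measurable_cst].
Qed.

(** Induction on the dimension: the measure is the integral of the measures of sections, the shift
    of the first coordinate is absorbed by one-dimensional invariance, and the shift of the others
    by the induction hypothesis on each section. *)
Lemma lebesgue_rV_translate n (z : 'rV[R]_n) (A : set 'rV[R]_n) : measurable A ->
  lebesgue_rV R n ((fun x => x + z) @^-1` A) = lebesgue_rV R n A.
Proof.
elim: n z A => [|n IH] z A mA.
  by rewrite (_ : _ @^-1` A = A)//; apply/seteqP; split => x /=; rewrite (thinmx0 z) addr0.
rewrite /= /lebesgue_rVS /pushforward.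
set X := @cons_rV R n @^-1` A.
have mX : measurable X by rewrite -[X]setTI; apply: measurable_cons_rV.
pose z' : 'rV[R]_n := \row_j z 0 (lift 0 j).
have -> : @cons_rV R n @^-1` ((fun x => x + z) @^-1` A) =
   (fun p => (p.1 + z 0 0, p.2 + z')) @^-1` X.
  suff E : forall p, cons_rV p + z = cons_rV (p.1 + z 0 0, p.2 + z').
    by apply/seteqP; split => p /=; rewrite E.
  move=> p; apply/rowP => i; rewrite mxE; case: (unliftP 0 i) => [j|] ->.
    by rewrite !cons_rVS/= !mxE.
  by rewrite !cons_rV0.
rewrite /product_measure1/=.
rewrite -(@ge0_integral_translate1 (z 0 0) (fun x => lebesgue_rV R n (xsection X x))); last 2 first.
- exact: measurable_fun_xsection.
- by move=> x; exact: measure_ge0.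
apply: eq_integral => x _ /=.
rewrite -(IH z' (xsection X (x + z 0 0))); last exact: measurable_xsection.
by congr (lebesgue_rV R n _); rewrite /xsection; apply/seteqP; split => y /=; rewrite !inE.
Qed.

Lemma ge0_integral_translate n (z : 'rV[R]_n) (f : 'rV[R]_n -> \bar R) :
  measurable_fun setT f -> (forall x, 0 <= f x)%E ->
  (\int[lebesgue_rV R n]_x f (x + z)%R = \int[lebesgue_rV R n]_x f x)%E.
Proof.
move=> mf f0.
transitivity (\int[pushforward (lebesgue_rV R n) (fun x : 'rV[R]_n => (x + z)%R)]_x f x)%E.
  by rewrite (ge0_integral_pushforward (measurable_translate z)).
apply: (@eq_measure_integral _ _ _ _ _ (measure_function_pushforward__canonical__measure_function_Measure
  (lebesgue_rV R n) (measurable_translate z))) => A mA _.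
exact: lebesgue_rV_translate.
Qed.

(** Balls for the sup norm: being products of intervals they have an explicit measure, with which
    Euclidean balls are compared. *)
Definition cube n (x : 'rV[R]_n) (a : R) : set 'rV[R]_n := [set y | forall i, `|y 0 i - x 0 i| < a].

Lemma measurable_cube n x a : measurable (@cube n x a).
Proof.
rewrite (_ : cube x a = \bigcap_(i in [set: 'I_n])
     ((fun v : 'rV[R]_n => v 0 i : R) @^-1` `]x 0 i - a, x 0 i + a[%classic)); last first.
  apply/seteqP; split => v /= h i.
    by move=> _; rewrite /= in_itv/= -ltr_distl; exact: h.
  by have := h i Logic.I; rewrite /= in_itv/= -ltr_distl.
apply: fin_bigcap_measurable => // i _.
by have := @measurable_coord R n i measurableT _ (measurable_itv `]x 0 i - a, x 0 i + a[); rewrite setTI.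
Qed.

Lemma lebesgue_cube n (x : 'rV[R]_n) a : 0 < a -> lebesgue_rV R n (cube x a) = ((2 * a) ^+ n)%:E.
Proof.
move=> a0; rewrite (_ : cube x a = [set v | forall i, `]x 0 i - a, x 0 i + a[%classic (v 0 i)]); last first.
  by apply/seteqP; split => v /= h i; have := h i; rewrite in_itv/= -ltr_distl.
rewrite (@lebesgue_rVE R n (fun i => `]x 0 i - a, x 0 i + a[%classic))//.
rewrite (eq_bigr (fun=> (2 * a)%:E)); last first.
  move=> i _; rewrite lebesgue_measure_itv/= lte_fin ltrBlDr -addrA ltrDl addr_gt0// -EFinB.
  by congr EFin; ring.
rewrite prodEFin; congr EFin.
by rewrite prodr_const card_ord.
Qed.

Lemma cube_sub_eball n (x : 'rV[R]_n) a : (0 < n)%N -> cube x (a / n%:R) `<=` [set y | enorm (y - x) <= a].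
Proof.
move=> n0 y /= h; rewrite -[leRHS](divfK (_ : n%:R != 0)) ?pnatr_eq0 -?lt0n// mulrC.
by apply: enorm_le_coord => i; rewrite !mxE; exact/ltW.
Qed.

Lemma eball_sub_cube n (x : 'rV[R]_n) a : eball x a `<=` cube x a.
Proof.
move=> y /= h i; apply: le_lt_trans h.
by have := coord_le_enorm (y - x) i; rewrite !mxE.
Qed.

Lemma lebesgue_eball_le n (x : 'rV[R]_n) a : 0 < a -> (lebesgue_rV R n (eball x a) <= ((2 * a) ^+ n)%:E)%E.
Proof.
move=> a0; rewrite -(lebesgue_cube x a0); apply: le_measure; rewrite ?inE.
- exact: measurable_eball.
- exact: measurable_cube.
- exact: eball_sub_cube.
Qed.

Lemma lebesgue_compact n (K : set 'rV[R]_n) : compact K -> (lebesgue_rV R n K < +oo)%E.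
Proof.
move=> cK; have [M [_ MK]] := compact_bounded cK.
pose M' := `|M| + 1.
have M'0 : 0 < M' by rewrite ltr_wpDl.
have KM : K `<=` cube 0 (M' + 1).
  move=> y Ky i; rewrite mxE subr0; apply: le_lt_trans (coord_le_norm _ _) _.
  apply: le_lt_trans (_ : M' < M' + 1); last by rewrite ltrDl.
  by apply: (MK M') => //; rewrite /M' (le_lt_trans (ler_norm _))// ltrDl.
apply: le_lt_trans (_ : lebesgue_rV R n (cube 0 (M' + 1)) < +oo)%E.
  apply: le_measure; rewrite ?inE//; last exact: measurable_cube.
  by apply: closed_measurable_rV; apply: compact_closed => //; exact: norm_hausdorff.
by rewrite lebesgue_cube ?ltry// addr_gt0.
Qed.

End measure_rV.

(** * Smooth functions *)

Section derivative_rules.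
Context {R : realType} {V : normedModType R}.
Implicit Types (f g : V -> R) (x v : V).

Lemma isderD f g x v a b : is_derive x v f a -> is_derive x v g b ->
  is_derive x v (fun y => f y + g y) (a + b).
Proof. by move=> df dg; exact: (is_deriveD df dg). Qed.

Lemma isderM f g x v a b : is_derive x v f a -> is_derive x v g b ->
  is_derive x v (fun y => f y * g y) (f x * b + g x * a).
Proof. by move=> df dg; exact: (is_deriveM df dg). Qed.

Lemma isder_cst x v (c : R) : is_derive x v (fun _ => c) 0.
Proof. exact: is_derive_cst. Qed.

(** Both difference quotients are the same function of the increment. This is how one-variable
    results (chain rule, mean value theorem, fundamental theorem of calculus) are brought to
    directional derivatives. *)
Lemma isder_line f x v (t l : R) :
  is_derive t 1 (fun s : R => f (x + s *: v)) l <-> is_derive (x + t *: v) v f l.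
Proof.
have E : (fun h : R => h^-1 *: (((fun s : R => f (x + s *: v)) \o shift t) (h *: 1)
            - f (x + t *: v))) =
         (fun h => h^-1 *: ((f \o shift (x + t *: v)) (h *: v) - f (x + t *: v))).
  apply/funext => h /=; congr (_ *: (f _ - _)).
  by rewrite [h *: 1]mulr1 scalerDl addrCA.
split=> -[]; rewrite /derivable /derive.
  by rewrite E => h1 h2; split.
by rewrite -E => h1 h2; split.
Qed.

Lemma isder_comp (h : R -> R) f x v a b : is_derive (f x) 1 h a -> is_derive x v f b ->
  is_derive x v (fun y => h (f y)) (a * b).
Proof.
move=> dh df; have E0 : x = x + 0 *: v by rewrite scale0r addr0.
rewrite E0; apply/isder_line.
apply: (@is_derive1_comp R h (fun s => f (x + s *: v)) 0 a b).
  by rewrite -E0.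
by apply/isder_line; rewrite -E0.
Qed.

Lemma isder_cont1 (h : R -> R) (t l : R) : is_derive t 1 h l -> {for t, continuous h}.
Proof.
move=> [dh _]; apply: differentiable_continuous; exact/derivable1_diffP.
Qed.

End derivative_rules.

(** * Flat functions and a smooth positive part *)

Section flat.
Context {R : realType}.
Implicit Types (a s x : R) (p : {poly R}).

Definition flat a p s : R := if 0 < s then s * p.[s^-1] * expR (- a * s^-1) else 0.

(** With K = k + 1, expR (a x) is the K-th power of expR (a x / K) >= 1 + a x / K, and x <= (K / a)
    (1 + a x / K). Taking K-th powers gives C = (K / a)^K. *)
Lemma monomial_expR a k : 0 < a -> exists2 C, 0 <= C & forall x, 0 < x ->
  x ^+ k * expR (- a * x) <= C / x.
Proof.
move=> a0; exists ((k.+1%:R / a) ^+ k.+1) => [|x x0].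
  by rewrite exprn_ge0// divr_ge0// ltW.
rewrite ler_pdivlMr// mulrAC -exprSr mulNr expRN ler_pdivrMr ?expR_gt0//.
have -> : a * x = k.+1%:R * (a * x / k.+1%:R) by rewrite [RHS]mulrC divfK// pnatr_eq0.
rewrite expRM_natl -exprMn; apply: lerXn2r; rewrite ?nnegrE ?(ltW x0)//.
  by rewrite mulr_ge0 ?expR_ge0// divr_ge0// ltW.
apply: (@le_trans _ _ (k.+1%:R / a * (1 + a * x / k.+1%:R))).
  rewrite mulrDr mulr1; apply: ler_wpDl; first by rewrite divr_ge0// ltW.
  have K0 : k.+1%:R != 0 :> R by rewrite pnatr_eq0.
  move: (k.+1%:R) K0 => K K0; rewrite le_eqVlt; apply/orP; left; apply/eqP.
  by field; rewrite K0 gt_eqF.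
by rewrite ler_wpM2l ?expR_ge1Dx// divr_ge0// ltW.
Qed.

Lemma poly_expR a p : 0 < a -> exists2 C, 0 <= C & forall x, 0 < x ->
  `|p.[x] * expR (- a * x)| <= C / x.
Proof.
move=> a0.
have /choice[C hC] : forall k, exists C, 0 <= C /\ forall x, 0 < x ->
  x ^+ k * expR (- a * x) <= C / x.
  by move=> k; have [C C0 h] := monomial_expR k a0; exists C.
exists (\sum_(i < size p) `|p`_i| * C i) => [|x x0].
  by apply: sumr_ge0 => i _; rewrite mulr_ge0//; case: (hC i).
rewrite horner_coef mulr_suml (le_trans (ler_norm_sum _ _ _))// mulr_suml.
apply: ler_sum => i _.
rewrite -mulrA normrM -mulrA ler_wpM2l// ger0_norm; first by case: (hC i) => _; exact.
by rewrite mulr_ge0 ?expR_ge0// exprn_ge0// ltW.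
Qed.

(* The derivative of s p(1/s) exp(-a/s) is s q(1/s) exp(-a/s) with q = flat_step a p,
   so flat functions are stable under derivation, hence smooth. *)
Definition flat_step a p : {poly R} := 'X * p + 'X^2 * (a *: p - p^`()).

Lemma is_derive_flat a p s : 0 < a -> is_derive s 1 (flat a p) (flat a (flat_step a p) s).
Proof.
move=> a0; case: (ltgtP s 0) => [s0|s0|->].
- rewrite {2}/flat ltNge (ltW s0)/=.
  have h0 : is_derive s 1 (fun _ : R => 0 : R) 0 := is_derive_cst _ _ _.
  apply: near_eq_is_derive h0.
  near=> t; rewrite /flat ltNge (_ : t <= 0)//=.
  by apply: ltW; near: t; exact: lt_nbhsl.
- have E : \forall t \near s, t * p.[t^-1] * expR (- a * t^-1) = flat a p t.
    by near=> t; rewrite /flat (_ : 0 < t)//; near: t; exact: lt_nbhsr.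
  apply: (near_eq_is_derive E).
  have dV : is_derive s 1 (fun t : R => t^-1) (- s ^- 2).
    have := @is_deriveV R id s 1 1 (lt0r_neq0 s0) (is_derive_id _ _).
    by move=> /is_derive_eq; apply; rewrite /= [_ *: _]mulr1.
  have dE := @isder_comp R R expR (fun t => - a * t^-1) s 1 _ _
    (is_derive_expR (- a * s^-1)) (isderM (isder_cst s 1 (- a)) dV).
  have dP := @isder_comp R R (fun y => p.[y]) (fun t => t^-1) s 1 _ _
    (is_derive_poly p s^-1) dV.
  have := isderM (isderM (is_derive_id s 1) dP) dE.
  move=> /is_derive_eq; apply.
  rewrite /flat s0 /flat_step !(hornerD, hornerM, hornerX, hornerXn, hornerZ, hornerN).
  by field; exact: lt0r_neq0.
- have F0 q : flat a q 0 = 0 by rewrite /flat ltxx.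
  rewrite F0.
  have [C C0 hC] := poly_expR p a0.
  (* [poly_expR] at 1 / t bounds p(1/t) exp(-a/t) by C t for t > 0, so [flat a p] is O(t^2) at 0 and
     its difference quotient there tends to 0. *)
  have hb t : `|flat a p t| <= C * t ^+ 2.
    rewrite /flat; case: ifPn => [t0|_]; last by rewrite normr0 mulr_ge0// sqr_ge0.
    rewrite -mulrA normrM gtr0_norm// expr2 mulrCA ler_wpM2l ?(ltW t0)//.
    by have := hC t^-1; rewrite invr_gt0 invrK => /(_ t0).
  have lim0 : (fun h : R => h^-1 *: ((flat a p \o shift 0) (h *: 1) - flat a p 0)) @ 0^' --> (0 : R).
    apply/cvgrPdist_le => e e0; near=> t.
    rewrite sub0r normrN /= F0 subr0 addr0 [t *: 1]mulr1 [_ *: _]mulrC normrM normfV.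
    have t0 : t != 0 by near: t; exact: nbhs_dnbhs_neq.
    rewrite ler_pdivrMr ?normr_gt0//; apply: le_trans (hb t) _.
    rewrite -real_normK ?num_real// expr2 mulrA ler_wpM2r//.
    apply: le_trans (_ : (C + 1) * `|t| <= e); first by rewrite ler_wpM2r// lerDl.
    rewrite mulrC -ler_pdivlMr ?ltr_wpDl//.
    by near: t; apply: dnbhs0_le; rewrite divr_gt0// ltr_wpDl.
  split; first by apply/cvg_ex; exists 0.
  exact/cvg_lim.
Unshelve. all: by end_near. Qed.

Definition smooth1 (h : R -> R) := forall k t, derivable (derive1n k h) t 1.

Lemma derive1n_flat a p k : 0 < a -> derive1n k (flat a p) = flat a (iter k (flat_step a) p).
Proof.
move=> a0; elim: k => [//|k IH]; rewrite /derive1n /= -/(derive1n k _) IH.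
by apply/funext => t; rewrite derive1E; apply: derive_val; exact: is_derive_flat.
Qed.

Lemma smooth1_flat a p : 0 < a -> smooth1 (flat a p).
Proof.
move=> a0 k t; rewrite derive1n_flat//.
exact: (@ex_derive _ _ _ _ _ _ _ (is_derive_flat _ _ a0)).
Qed.

Lemma smooth1_derive (h : R -> R) : smooth1 h -> smooth1 (derive1 h).
Proof. by move=> sh k t; have := sh k.+1 t; rewrite /derive1n -iterSr. Qed.

Lemma smooth1_is_derive (h : R -> R) (t : R) : smooth1 h -> is_derive t 1 h (derive1 h t).
Proof. by move=> sh; rewrite derive1E; apply: derivableP; exact: (sh 0%N). Qed.

(* s exp(-a/s) for s > 0: a smooth approximation of the positive part as a -> 0. *)
Definition ppart a s : R := flat a 1 s.
Definition dppart a s : R := flat a (flat_step a 1) s.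

Lemma ppartE a s : ppart a s = if 0 < s then s * expR (- a * s^-1) else 0.
Proof. by rewrite /ppart /flat hornerE mulr1. Qed.

Lemma dppartE a s : dppart a s = if 0 < s then (1 + a / s) * expR (- a * s^-1) else 0.
Proof.
rewrite /dppart /flat /flat_step derivC subr0 !(hornerD, hornerM, hornerX, hornerXn, hornerZ, hornerC).
case: ifPn => // s0.
by congr (_ * _); field; exact: lt0r_neq0.
Qed.

Lemma derive1_ppart a : 0 < a -> derive1 (ppart a) = dppart a.
Proof.
move=> a0; apply/funext => t; rewrite derive1E; apply: derive_val; exact: is_derive_flat.
Qed.

Lemma dppart_ge0 a s : 0 < a -> 0 <= dppart a s.
Proof.
move=> a0; rewrite dppartE; case: ifPn => // s0.
by rewrite mulr_ge0 ?expR_ge0// addr_ge0// divr_ge0// ltW.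
Qed.

(** This is 1 + x <= expR x at x = a / s. The bound is uniform in a, which provides the majorant
    when a tends to 0. *)
Lemma dppart_le1 a s : 0 < a -> dppart a s <= 1.
Proof.
move=> a0; rewrite dppartE; case: ifPn => // s0.
by rewrite mulNr expRN ler_pdivrMr ?expR_gt0// mul1r expR_ge1Dx.
Qed.

Lemma ppart_dist a s : 0 < a -> `|ppart a s - Num.max s 0| <= a.
Proof.
move=> a0; rewrite ppartE; case: ifPn => s0; last first.
  by rewrite max_r ?subrr ?normr0 ?(ltW a0)// leNgt.
rewrite max_l ?(ltW s0)// distrC ger0_norm; last first.
  rewrite -{1}[s]mulr1 -mulrBr mulr_ge0 ?(ltW s0)// subr_ge0 expR_le1 mulNr oppr_le0.
  by rewrite mulr_ge0// ?invr_ge0 ltW.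
rewrite -{1}[s]mulr1 -mulrBr.
have h : 1 - expR (- a * s^-1) <= a / s.
  by have := expR_ge1Dx (- a * s^-1); rewrite mulNr; lra.
by apply: le_trans (ler_wpM2l (ltW s0) h) _; rewrite mulrCA divff ?mulr1// gt_eqF.
Qed.

Lemma ppart_ge0 a s : 0 <= ppart a s.
Proof. by rewrite ppartE; case: ifPn => // s0; rewrite mulr_ge0 ?expR_ge0 ?ltW. Qed.

Lemma ppart_le0 a s : s <= 0 -> ppart a s = 0.
Proof. by move=> s0; rewrite ppartE ltNge s0. Qed.

Lemma ppart_gt0 a s : 0 < s -> 0 < ppart a s.
Proof. by move=> s0; rewrite ppartE s0 mulr_gt0 ?expR_gt0. Qed.

(** Every [dppart a] vanishes for s <= 0, so the limit at s = 0 is 0: this is why truncated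
    gradients are set to 0 on the level set itself. For s > 0 the lower bound 1 - a / s comes from
    expR x >= 1 + x. *)
Lemma dppart_cvg (s : R) :
  (fun k : nat => dppart k.+1%:R^-1 s) @ \oo --> ((0 < s)%R%:R : R).
Proof.
have [s0|s0] := boolP (0 < s); last first.
  under eq_fun do rewrite dppartE (negbTE s0); exact: cvg_cst.
apply: (@squeeze_cvgr _ _ _ _ (fun k : nat => 1 - k.+1%:R^-1 * s^-1) (fun=> 1)).
- near=> k; rewrite dppart_le1 ?invr_gt0// andbT dppartE s0.
  apply: le_trans (_ : expR (- k.+1%:R^-1 * s^-1) <= _).
    by have := expR_ge1Dx (- k.+1%:R^-1 * s^-1 : R); rewrite mulNr.
  rewrite -[leLHS]mul1r ler_wpM2r ?expR_ge0// lerDl divr_ge0// ltW//.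
- have h : (fun k : nat => 1 - k.+1%:R^-1 * s^-1) @ \oo --> 1 - 0 * s^-1.
    by apply: cvgB; [exact: cvg_cst|apply: cvgM; [exact: cvg_harmonic|exact: cvg_cst]].
  by move: h; rewrite mul0r subr0.
- exact: cvg_cst.
Unshelve. all: by end_near. Qed.

End flat.

(** * Smooth functions of several variables *)

Section fully_smooth.
Context {R : realType} {n : nat}.
Implicit Types (f g : 'rV[R]_n -> R) (x v : 'rV[R]_n).

(* Unlike [smooth], this asks for all directional derivatives, and that they
   depend linearly on the direction. *)
Definition fsmooth f := forall s : seq 'I_n,
  continuous (foldr partial f s) /\
  forall x v, is_derive x v (foldr partial f s) (dotv (grad (foldr partial f s) x) v).

(** Coinduction: smoothness of all orders follows from a class of once differentiable functions that
    is stable under partial derivatives, with no formula for higher derivatives. *)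
Lemma fsmooth_coind (P : ('rV[R]_n -> R) -> Prop) :
  (forall f, P f -> [/\ continuous f,
     forall x v, is_derive x v f (dotv (grad f x) v) & forall i, P (partial i f)]) ->
  forall f, P f -> fsmooth f.
Proof.
move=> hP f Pf s; suff : P (foldr partial f s) by move=> /hP[].
by elim: s => [//|i s IH] /=; have [_ _] := hP _ IH; exact.
Qed.

Lemma fsmooth_cont f : fsmooth f -> continuous f.
Proof. by move=> /(_ [::])[]. Qed.

Lemma fsmooth_is_derive f x v : fsmooth f -> is_derive x v f (dotv (grad f x) v).
Proof. by move=> /(_ [::])[_]; exact. Qed.

Lemma fsmooth_partial f i : fsmooth f -> fsmooth (partial i f).
Proof. by move=> sf s; have := sf (rcons s i); rewrite foldr_rcons. Qed.

Lemma fsmooth_smooth f : fsmooth f -> smooth f.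
Proof. by move=> sf s; have [cs ds] := sf s; split=> // i x; apply: ex_derive. Qed.

Lemma dotv_delta x i : dotv x (delta_mx 0 i) = x 0 i.
Proof.
rewrite /dotv (bigD1 i)//= mxE !eqxx mulr1 big1 ?addr0// => j ji.
by rewrite mxE eqxx (negbTE ji) mulr0.
Qed.

Lemma partialE f i x : partial i f x = grad f x 0 i.
Proof. by rewrite mxE. Qed.

Lemma is_derive_partial f i x l : is_derive x (delta_mx 0 i) f l -> partial i f x = l.
Proof. by move=> h; exact: derive_val. Qed.

Lemma grad_is_derive f x (G : 'rV[R]_n) :
  (forall v, is_derive x v f (dotv G v)) -> grad f x = G.
Proof.
move=> h; apply/rowP => i; rewrite mxE -[RHS]dotv_delta.
exact: is_derive_partial.
Qed.

(** The stable class fed to [fsmooth_coind]. Derivatives of products and compositions are sums of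
    products, hence the closure under both operations. The inner function of a composition is
    required to be [fsmooth], so that its partial derivatives are base elements and h'(f) times one
    of them stays in the class. *)
Inductive salg : ('rV[R]_n -> R) -> Prop :=
| salg_base f : fsmooth f -> salg f
| salg_add f g : salg f -> salg g -> salg (fun x => f x + g x)
| salg_mul f g : salg f -> salg g -> salg (fun x => f x * g x)
| salg_comp h f : smooth1 h -> fsmooth f -> salg (fun x => h (f x)).

Lemma salgP f : salg f -> [/\ continuous f,
  exists G : 'rV[R]_n -> 'rV[R]_n,
   (forall x v, is_derive x v f (dotv (G x) v)) & forall i, salg (partial i f)].
Proof.
elim=> {f} [f sf|f g _ [cf [F dF] sF] _ [cg [G dG] sG]|f g sf [cf [F dF] sF] sg [cg [G dG] sG]|h f sh sf].
- split; first exact: fsmooth_cont.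
    by exists (grad f) => x v; exact: fsmooth_is_derive.
  by move=> i; apply: salg_base; exact: fsmooth_partial.
- split; first exact: contD.
    exists (fun x => F x + G x) => x v; rewrite dotvDl; exact: isderD.
  move=> i; have -> : partial i (fun x => f x + g x) = (fun x => partial i f x + partial i g x).
    apply/funext => x; apply: is_derive_partial; apply: isderD.
      by have := dF x (delta_mx 0 i); rewrite -(is_derive_partial (dF x _)).
    by have := dG x (delta_mx 0 i); rewrite -(is_derive_partial (dG x _)).
  exact: salg_add.
- split; first exact: contM.
    exists (fun x => f x *: G x + g x *: F x) => x v; rewrite dotvDl !dotvZl; exact: isderM.
  move=> i; have -> : partial i (fun x => f x * g x) = (fun x => f x * partial i g x + g x * partial i f x).
    apply/funext => x; apply: is_derive_partial; apply: isderM.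
      by have := dF x (delta_mx 0 i); rewrite -(is_derive_partial (dF x _)).
    by have := dG x (delta_mx 0 i); rewrite -(is_derive_partial (dG x _)).
  by apply: salg_add; apply: salg_mul.
- have dh x v : is_derive x v (fun x => h (f x)) (derive1 h (f x) * dotv (grad f x) v).
    by apply: isder_comp; [exact: smooth1_is_derive|exact: fsmooth_is_derive].
  split.
  + apply: cont_comp; first exact: fsmooth_cont.
    by move=> t; exact: (isder_cont1 (smooth1_is_derive t sh)).
  + by exists (fun x => derive1 h (f x) *: grad f x) => x v; rewrite dotvZl.
  + move=> i; have -> : partial i (fun x => h (f x)) = (fun x => derive1 h (f x) * partial i f x).
      by apply/funext => x; rewrite (is_derive_partial (dh x _)) dotv_delta -partialE.
    apply: salg_mul; last by apply: salg_base; exact: fsmooth_partial.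
    by apply: salg_comp => //; exact: smooth1_derive.
Qed.

Lemma salg_fsmooth f : salg f -> fsmooth f.
Proof.
apply: (fsmooth_coind (P := salg)) => {}f /salgP[cf [G dG] sf]; split=> // x v.
by rewrite (grad_is_derive (dG x)); exact: dG.
Qed.

Lemma fsmoothD f g : fsmooth f -> fsmooth g -> fsmooth (fun x => f x + g x).
Proof. by move=> sf sg; apply: salg_fsmooth; apply: salg_add; exact: salg_base. Qed.

Lemma fsmoothM f g : fsmooth f -> fsmooth g -> fsmooth (fun x => f x * g x).
Proof. by move=> sf sg; apply: salg_fsmooth; apply: salg_mul; exact: salg_base. Qed.

Lemma fsmooth_comp h f : smooth1 h -> fsmooth f -> fsmooth (fun x => h (f x)).
Proof. by move=> sh sf; apply: salg_fsmooth; exact: salg_comp. Qed.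

Lemma fsmooth_cst c : fsmooth (fun _ => c).
Proof.
apply: (fsmooth_coind (P := fun f => exists c, f = fun _ => c)); last by exists c.
move=> _ [{}c ->].
have h x v : is_derive x v (fun _ : 'rV[R]_n => c) (dotv 0 v).
  by rewrite dotv0l; exact: isder_cst.
split; first exact: cont_cst.
  by move=> x v; rewrite (grad_is_derive (h x)).
by move=> i; exists 0; apply/funext => x; rewrite (is_derive_partial (h x _)) dotv0l.
Qed.

Lemma is_derive_coord i x v : is_derive x v (fun y : 'rV[R]_n => y 0 i : R) (v 0 i).
Proof.
rewrite (_ : x = x + (0 : R) *: v); last by rewrite scale0r addr0.
apply/isder_line.
have -> : (fun s : R => (x + s *: v) 0 i) = (fun s => x 0 i + s * v 0 i).
  by apply/funext => s; rewrite !mxE.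
have := isderD (isder_cst (0 : R) 1 (x 0 i))
   (isderM (is_derive_id (0 : R) 1) (isder_cst (0 : R) 1 (v 0 i))).
by move=> /is_derive_eq; apply; rewrite mulr0 !add0r mulr1.
Qed.

Lemma fsmooth_coord i : fsmooth (fun x => x 0 i).
Proof.
apply: (fsmooth_coind (P := fun f => f = (fun x => x 0 i) \/ fsmooth f)); last by left.
move=> f [->|sf]; last first.
  split; [exact: fsmooth_cont|by move=> x v; exact: fsmooth_is_derive|].
  by move=> j; right; exact: fsmooth_partial.
have h x v : is_derive x v (fun x : 'rV[R]_n => x 0 i : R) (dotv (delta_mx 0 i) v).
  by rewrite dotvC dotv_delta; exact: is_derive_coord.
split; first exact: continuous_coord.
  by move=> x v; rewrite (grad_is_derive (h x)).
move=> j; right.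
have -> : partial j (fun x : 'rV[R]_n => x 0 i) = fun=> (delta_mx 0 i : 'rV[R]_n) 0 j.
  by apply/funext => x; rewrite (is_derive_partial (h x _)) dotv_delta.
exact: fsmooth_cst.
Qed.

Lemma fsmooth_sum (I : Type) (r : seq I) (F : I -> 'rV[R]_n -> R) :
  (forall i, fsmooth (F i)) -> fsmooth (fun x => \sum_(i <- r) F i x).
Proof.
move=> sF; elim: r => [|i r IH].
  by under eq_fun do rewrite big_nil; exact: fsmooth_cst.
by under eq_fun do rewrite big_cons; exact: fsmoothD.
Qed.

Lemma fsmoothZ (c : R) f : fsmooth f -> fsmooth (fun x => c * f x).
Proof. by move=> sf; apply: fsmoothM => //; exact: fsmooth_cst. Qed.

Lemma fsmoothN f : fsmooth f -> fsmooth (fun x => - f x).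
Proof. by move=> sf; under eq_fun do rewrite -mulN1r; exact: fsmoothZ. Qed.

Lemma fsmoothB f g : fsmooth f -> fsmooth g -> fsmooth (fun x => f x - g x).
Proof. by move=> sf sg; apply: fsmoothD => //; exact: fsmoothN. Qed.

Lemma fsmooth_sqdist x : fsmooth (fun y => enorm (y - x) ^+ 2).
Proof.
under eq_fun do rewrite sqr_enormE.
apply: fsmooth_sum => i; under eq_fun do rewrite !mxE expr2.
by apply: fsmoothM; apply: fsmoothB; (exact: fsmooth_coord || exact: fsmooth_cst).
Qed.

Lemma gradD f g x : fsmooth f -> fsmooth g -> grad (fun y => f y + g y) x = grad f x + grad g x.
Proof.
move=> sf sg; apply: grad_is_derive => v; rewrite dotvDl.
by apply: isderD; exact: fsmooth_is_derive.
Qed.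

Lemma gradM f g x : fsmooth f -> fsmooth g ->
  grad (fun y => f y * g y) x = f x *: grad g x + g x *: grad f x.
Proof.
move=> sf sg; apply: grad_is_derive => v; rewrite dotvDl !dotvZl.
by apply: isderM; exact: fsmooth_is_derive.
Qed.

Lemma grad_cst (c : R) x : grad (fun _ => c) x = 0.
Proof. by apply: grad_is_derive => v; rewrite dotv0l; exact: isder_cst. Qed.

Lemma gradZ (c : R) f x : fsmooth f -> grad (fun y => c * f y) x = c *: grad f x.
Proof.
by move=> sf; rewrite gradM//; [rewrite grad_cst scaler0 addr0|exact: fsmooth_cst].
Qed.

Lemma grad_comp h f x : smooth1 h -> fsmooth f ->
  grad (fun y => h (f y)) x = derive1 h (f x) *: grad f x.
Proof.
move=> sh sf; apply: grad_is_derive => v; rewrite dotvZl.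
by apply: isder_comp; [exact: smooth1_is_derive|exact: fsmooth_is_derive].
Qed.

Lemma grad_sqdist x y : grad (fun y => enorm (y - x) ^+ 2) y = 2 *: (y - x).
Proof.
apply: grad_is_derive => v; rewrite dotvZl.
rewrite -[y](_ : y + (0 : R) *: v = y); last by rewrite scale0r addr0.
apply/isder_line.
have -> : (fun s : R => enorm (y + s *: v - x) ^+ 2) =
          (fun s => enorm (y - x) ^+ 2 + (2 * dotv (y - x) v) * s + dotv v v * (s * s)).
  apply/funext => s; rewrite addrAC !sqr_enorm; move: (y - x) => w.
  by rewrite dotvDl !dotvDr !(dotvZl, dotvZr) (dotvC v w); ring.
rewrite scale0r addr0.
have := isderD (isderD (isder_cst (0 : R) 1 (enorm (y - x) ^+ 2))
   (isderM (isder_cst (0 : R) 1 (2 * dotv (y - x) v)) (is_derive_id (0 : R) 1)))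
   (isderM (isder_cst (0 : R) 1 (dotv v v)) (isderM (is_derive_id (0 : R) 1) (is_derive_id (0 : R) 1))).
by move=> /is_derive_eq; apply; ring.
Qed.

Lemma partial_vanish f i (U : set 'rV[R]_n) : open U -> (forall x, U x -> f x = 0) ->
  forall x, U x -> partial i f x = 0.
Proof.
move=> oU fU x Ux; apply: is_derive_partial.
have h0 : is_derive x (delta_mx 0 i) (fun _ : 'rV[R]_n => 0 : R) 0 := is_derive_cst _ _ _.
apply: near_eq_is_derive h0.
have : nbhs x U by apply: open_nbhs_nbhs; split.
by apply: filterS => y Uy; rewrite fU.
Qed.

(** Supports are controlled by vanishing on this set; it is open, so all derivatives vanish on the
    same set. *)
Definition out_ball x (r : R) : set 'rV[R]_n := [set y | r < enorm (y - x)].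

Lemma open_out_ball x r : open (out_ball x r).
Proof.
rewrite (_ : out_ball x r = ~` [set y | enorm (y - x) <= r]).
  by apply: closed_openC; exact: closed_cball.
by apply/seteqP; split => y /=; rewrite /out_ball/= ltNge => /negP.
Qed.

Lemma grad_vanish f x r : (forall y, out_ball x r y -> f y = 0) ->
  forall y, out_ball x r y -> grad f y = 0.
Proof.
move=> h y yr; apply/rowP => i; rewrite !mxE.
exact: (partial_vanish i (@open_out_ball x r) h).
Qed.

Lemma test_fun_ball f x r (E : set 'rV[R]_n) : fsmooth f ->
  (forall y, out_ball x r y -> f y = 0) -> [set y | enorm (y - x) <= r] `<=` E ->
  test_fun E f.
Proof.
move=> sf fr rE.
have sub : supp f `<=` [set y | enorm (y - x) <= r].
  have h : [set y | f y != 0] `<=` [set y | enorm (y - x) <= r].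
    by move=> y /= fy; rewrite leNgt; apply/negP => /fr /eqP; rewrite (negbTE fy).
  by have := closure_subset h; rewrite -((closure_id _).1 (@closed_cball R n x r)).
split; first exact: fsmooth_smooth.
- by apply: subclosed_compact sub; [exact: closed_closure|exact: compact_cball].
- by move=> y /sub; exact: rE.
Qed.

Lemma bounded_cball f x r : continuous f -> (forall y, out_ball x r y -> f y = 0) ->
  exists2 M, 0 <= M & forall y, `|f y| <= M.
Proof.
move=> cf fr.
have : compact (f @` [set y | enorm (y - x) <= r]).
  apply: continuous_compact; last exact: compact_cball.
  exact: continuous_subspaceT.
move=> /compact_bounded[M [_ hM]]; exists (`|M| + 1) => [|y]; first by rewrite addr_ge0.
have [yr|yr] := leP (enorm (y - x)) r; last by rewrite fr// normr0 addr_ge0.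
apply: (hM (`|M| + 1)); last by exists y.
by rewrite (le_lt_trans (ler_norm _))// ltrDl.
Qed.

Lemma fsmooth_mean f x y : fsmooth f -> exists z, f y - f x = dotv (grad f z) (y - x).
Proof.
move=> sf.
have dl (t : R) : is_derive t 1 (fun s : R => f (x + s *: (y - x)))
    (dotv (grad f (x + t *: (y - x))) (y - x)).
  by apply/isder_line; exact: fsmooth_is_derive.
have [|c _] := @MVT R (fun s : R => f (x + s *: (y - x)))
   (fun t => dotv (grad f (x + t *: (y - x))) (y - x)) 0 1 ltr01 (fun t _ => dl t).
  apply: continuous_subspaceT => t; exact: (isder_cont1 (dl t)).
rewrite scale1r scale0r addr0 subr0 mulr1 (addrC x) subrK => h.
by exists (x + c *: (y - x)).
Qed.

Lemma fsmooth_lip f M x y : fsmooth f -> (forall z, enorm (grad f z) <= M) ->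
  `|f y - f x| <= M * enorm (y - x).
Proof.
move=> sf fM; have [z ->] := fsmooth_mean x y sf.
by apply: le_trans (dotv_le _ _) _; rewrite ler_wpM2r ?enorm_ge0.
Qed.

Lemma fsmooth_grad_cont f : fsmooth f -> continuous (fun x => enorm (grad f x)).
Proof.
move=> sf; have cg : continuous (grad f).
  apply: continuous_rV => i; under eq_fun do rewrite -partialE.
  by apply: fsmooth_cont; exact: fsmooth_partial.
by apply: (cont_comp (f := fun x => dotv (grad f x) (grad f x)) (g := @Num.sqrt R));
  [exact: continuous_dotv|exact: sqrt_continuous].
Qed.

Lemma grad_bounded f x r : fsmooth f -> (forall y, out_ball x r y -> f y = 0) ->
  exists2 M, 0 <= M & forall y, enorm (grad f y) <= M.
Proof.
move=> sf fr; have [|M M0 hM] := bounded_cball (x := x) (r := r) (fsmooth_grad_cont sf).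
  by move=> y yr; rewrite (grad_vanish fr)// enorm0.
by exists M => // y; rewrite (le_trans (ler_norm _)).
Qed.

End fully_smooth.

Ltac mstep := match goal with
  | H : measurable_fun _ _ |- measurable_fun _ _ => exact: H
  | H : forall _, measurable_fun _ _ |- measurable_fun _ _ => exact: H
  | |- measurable_fun _ (fun _ => (_ - _)%R) => apply: measurable_funB
  | |- measurable_fun _ (fun _ => (- _)%R) => apply: measurable_funN
  | |- measurable_fun _ (fun _ => (_ + _)%R) => apply: measurable_funD
  | |- measurable_fun _ (fun _ => (_ * _)%R) => apply: measurable_funM
  | |- measurable_fun _ (fun _ => (_ ^+ _)%R) => apply: measurable_funX
  | |- measurable_fun _ (fun _ => Num.max _ _) => apply: measurable_maxr
  | |- measurable_fun _ (fun _ => Num.min _ _) => apply: measurable_minr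
  | |- measurable_fun _ (fun _ => `|_|%R) => apply: (measurableT_comp (@normr_measurable _ setT))
  | |- measurable_fun _ _ => exact: measurable_cst
  end.
Ltac mtac := repeat mstep.

(** * Integrals *)

Section integral_tools.
Context d (T : measurableType d) (R : realType) (mu : {measure set T -> \bar R}).
Implicit Types (D : set T) (f g : T -> R).
Local Open Scope ereal_scope.

Lemma int_ge0 D f : (forall x, D x -> (0 <= f x)%R) -> 0 <= \int[mu]_(x in D) (f x)%:E.
Proof. by move=> f0; apply: integral_ge0 => x Dx; rewrite lee_fin f0. Qed.

Lemma int_le D f g : measurable D -> measurable_fun D f -> measurable_fun D g ->
  (forall x, D x -> (0 <= f x <= g x)%R) ->
  \int[mu]_(x in D) (f x)%:E <= \int[mu]_(x in D) (g x)%:E.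
Proof.
move=> mD mf mg h; apply: ge0_le_integral => //.
- by move=> x /h /andP[]; rewrite lee_fin.
- exact/measurable_EFinP.
- exact/measurable_EFinP.
- by move=> x /h /andP[]; rewrite lee_fin.
Qed.

Lemma int_add D f g : measurable D -> measurable_fun D f -> measurable_fun D g ->
  (forall x, D x -> (0 <= f x)%R) -> (forall x, D x -> (0 <= g x)%R) ->
  \int[mu]_(x in D) (f x + g x)%:E =
  \int[mu]_(x in D) (f x)%:E + \int[mu]_(x in D) (g x)%:E.
Proof.
move=> mD mf mg f0 g0; rewrite -ge0_integralD//; exact/measurable_EFinP.
Qed.

Lemma int_scale D (c : R) f : measurable D -> measurable_fun D f -> (0 <= c)%R ->
  (forall x, D x -> (0 <= f x)%R) ->
  \int[mu]_(x in D) (c * f x)%:E = c%:E * \int[mu]_(x in D) (f x)%:E.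
Proof.
move=> mD mf c0 f0; rewrite -ge0_integralZl_EFin//; exact/measurable_EFinP.
Qed.

Lemma int_sub D E f : measurable D -> measurable E -> measurable_fun E f ->
  (forall x, E x -> (0 <= f x)%R) -> D `<=` E ->
  \int[mu]_(x in D) (f x)%:E <= \int[mu]_(x in E) (f x)%:E.
Proof.
move=> mD mE mf f0 DE; apply: ge0_subset_integral => //; exact/measurable_EFinP.
Qed.

Lemma int_sqD D f g : measurable D -> measurable_fun D f -> measurable_fun D g ->
  \int[mu]_(x in D) ((f x + g x) ^+ 2)%:E <=
  (2%R)%:E * (\int[mu]_(x in D) (f x ^+ 2)%:E + \int[mu]_(x in D) (g x ^+ 2)%:E).
Proof.
move=> mD mf mg; rewrite -(@int_add D (fun x => f x ^+ 2)%R (fun x => g x ^+ 2)%R) ?measurable_funX//; last 4 first.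
- exact: measurable_funX.
- exact: measurable_funX.
- by move=> x _; exact: sqr_ge0.
- by move=> x _; exact: sqr_ge0.
rewrite -(@int_scale D 2%R (fun x => f x ^+ 2 + g x ^+ 2)%R)//; last 2 first.
- by apply: measurable_funD; exact: measurable_funX.
- by move=> x _; rewrite addr_ge0// sqr_ge0.
apply: int_le => //.
- by apply: measurable_funX; exact: measurable_funD.
- apply: measurable_funM; first exact: measurable_cst.
  by apply: measurable_funD; exact: measurable_funX.
move=> x _; rewrite sqr_ge0/=.
by have := sqr_ge0 (f x - g x); rewrite !expr2; lra.
Qed.

Lemma int_mkcond D f : measurable D ->
  \int[mu]_(x in D) (f x)%:E = \int[mu]_x (f x * \1_D x)%:E.
Proof.
move=> mD; rewrite integral_mkcond; apply: eq_integral => x _.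
by rewrite patchE indicE; case: (x \in D); rewrite ?mulr1 ?mulr0.
Qed.

Lemma int_chebyshev D f (a : R) : measurable D -> measurable_fun D f ->
  (forall x, D x -> (0 <= f x)%R) -> (0 <= a)%R ->
  a%:E * mu (D `&` [set x | (a <= f x)%R]) <= \int[mu]_(x in D) (f x)%:E.
Proof.
move=> mD mf f0 a0.
have mA : measurable (D `&` [set x | (a <= f x)%R]).
  by have := mf mD _ (measurable_itv `[a, +oo[); congr measurable;
    apply/seteqP; split => x /=; rewrite in_itv/= andbT.
apply: (@le_trans _ _ (\int[mu]_(x in D `&` [set x | (a <= f x)%R]) (cst a x)%:E)).
  by rewrite (integral_cst mu mA a%:E).
apply: (@le_trans _ _ (\int[mu]_(x in D `&` [set x | (a <= f x)%R]) (f x)%:E)).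
  apply: int_le => //; first exact: measurable_funS mf.
  by move=> x [_ /= ->]; rewrite a0.
by apply: int_sub => //; exact: subIsetl.
Qed.

Lemma int_eq0_ae D f : measurable D -> measurable_fun D f ->
  (forall x, D x -> (0 <= f x)%R) -> \int[mu]_(x in D) (f x)%:E = 0 ->
  {ae mu, forall x, D x -> f x = 0%R}.
Proof.
move=> mD mf f0 h.
have : \int[mu]_(x in D) `|(f x)%:E| = 0.
  by rewrite -h; apply: eq_integral => x /set_mem Dx /=; rewrite ger0_norm// f0.
have mE : measurable_fun D (EFin \o f) by exact/measurable_EFinP.
move/(ae_eq_integral_abs mu mD mE).1.
by apply: filterS => x h1 Dx; have /= := h1 Dx; case.
Qed.

Lemma sq_integrableM D f g : measurable D -> measurable_fun D f -> measurable_fun D g ->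
  \int[mu]_(x in D) (f x ^+ 2)%:E < +oo -> \int[mu]_(x in D) (g x ^+ 2)%:E < +oo ->
  mu.-integrable D (EFin \o (fun x => f x * g x)%R).
Proof.
move=> mD mf mg f2 g2; apply/integrableP; split.
  by apply/measurable_EFinP; exact: measurable_funM.
apply: (@le_lt_trans _ _ (\int[mu]_(x in D) (f x ^+ 2 + g x ^+ 2)%:E)); last first.
  rewrite int_add//; first exact: lte_add_pinfty.
  - exact: measurable_funX.
  - exact: measurable_funX.
  - by move=> x _; exact: sqr_ge0.
  - by move=> x _; exact: sqr_ge0.
apply: int_le => //.
- by apply: measurableT_comp => //; exact: measurable_funM.
- by apply: measurable_funD; exact: measurable_funX.
move=> x _; rewrite normr_ge0/= normrM -(real_normK (num_real (f x))) -(real_normK (num_real (g x))).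
by have := sqr_ge0 (`|f x| - `|g x|)%R; rewrite !expr2; have := mulr_ge0 (normr_ge0 (f x)) (normr_ge0 (g x)); lra.
Qed.

Lemma sq_integrable D f : measurable D -> mu D < +oo -> measurable_fun D f ->
  \int[mu]_(x in D) (f x ^+ 2)%:E < +oo -> mu.-integrable D (EFin \o f).
Proof.
move=> mD Doo mf f2.
have := @sq_integrableM D f (cst 1%R) mD mf (measurable_cst _) f2.
rewrite (_ : (fun x => f x * cst 1 x)%R = f); last by apply/funext => x; rewrite /= mulr1.
apply; under eq_integral do rewrite /= expr1n.
by rewrite (integral_cst _ mD 1) mul1e.
Qed.

Lemma sq_integrable_sq D f : measurable D -> measurable_fun D f ->
  \int[mu]_(x in D) (f x ^+ 2)%:E < +oo -> mu.-integrable D (EFin \o (fun x => f x ^+ 2)%R).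
Proof. by move=> mD mf f2; under eq_fun do rewrite expr2; exact: sq_integrableM. Qed.

Lemma integrable_mulb D f g (M : R) : measurable D -> measurable_fun D g ->
  (forall x, D x -> (`|g x| <= M)%R) -> mu.-integrable D (EFin \o f) ->
  mu.-integrable D (EFin \o (fun x => f x * g x)%R).
Proof.
move=> mD mg gM fi.
have -> : EFin \o (fun x => f x * g x)%R = (EFin \o f) \* (EFin \o g).
  by apply/funext => x /=; rewrite EFinM.
apply: integrableMl => //; exists M; split; first exact: num_real.
by move=> M' MM' x Dx /=; apply: le_trans (gM x Dx) _; rewrite ltW.
Qed.

(** Jensen's inequality for the square. With m the mean of f for the density k, (f - a)^2 - (f -
    m)^2 is affine in f and has integral (m - a)^2 against k; the subtracted term (f - m)^2 k is
    nonnegative. *)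
Lemma Rint_jensen (f k : T -> R) (a : R) : measurable_fun setT f -> measurable_fun setT k ->
  (forall x, (0 <= k x)%R) -> \int[mu]_x (k x)%:E = 1 ->
  mu.-integrable setT (EFin \o (fun x => f x * k x)%R) ->
  (((\int[mu]_x (f x * k x) - a) ^+ 2)%R)%:E <= \int[mu]_x ((f x - a) ^+ 2 * k x)%:E.
Proof.
move=> mf mk k0 k1 fki.
have ki : mu.-integrable setT (EFin \o k).
  apply/integrableP; split; first exact/measurable_EFinP.
  by under eq_integral do rewrite /= ger0_norm//; rewrite k1 ltry.
have h0 x : (0 <= (f x - a) ^+ 2 * k x)%R by rewrite mulr_ge0// sqr_ge0.
have [->|] := eqVneq (\int[mu]_x ((f x - a) ^+ 2 * k x)%:E) +oo; first by rewrite leey.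
rewrite -ltey => hoo.
set m := (\int[mu]_x (f x * k x))%R.
have hi : mu.-integrable setT (EFin \o (fun x => (f x - a) ^+ 2 * k x)%R).
  apply/integrableP; split.
    by apply/measurable_EFinP; mtac.
  by under eq_integral do rewrite /= ger0_norm//.
have -> : \int[mu]_x ((f x - a) ^+ 2 * k x)%:E = (\int[mu]_x ((f x - a) ^+ 2 * k x))%R%:E.
  by rewrite /Rintegral fineK//; exact: integrable_fin_num hi.
rewrite lee_fin.
have k1R : (\int[mu]_x k x)%R = 1%R by rewrite /Rintegral k1.
have i1 : mu.-integrable setT (EFin \o (fun x => 2 * (m - a) * (f x * k x))%R).
  exact: (integrableZl measurableT (2 * (m - a))%R fki).
have i2 : mu.-integrable setT (EFin \o (fun x => - (2 * (m - a) * a + (m - a) ^+ 2) * k x)%R).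
  exact: (integrableZl measurableT (- (2 * (m - a) * a + (m - a) ^+ 2))%R ki).
apply: (@le_trans _ _ (\int[mu]_x (2 * (m - a) * (f x * k x) +
   - (2 * (m - a) * a + (m - a) ^+ 2) * k x))%R).
  rewrite RintegralD// RintegralZl// RintegralZl// k1R -/m.
  by rewrite le_eqVlt; apply/orP; left; apply/eqP; ring.
apply: le_Rintegral => //; first exact: (integrableD measurableT i1 i2).
move=> x _.
rewrite (_ : (2 * (m - a) * (f x * k x) + - (2 * (m - a) * a + (m - a) ^+ 2) * k x =
  ((f x - a) ^+ 2 - (f x - m) ^+ 2) * k x)%R); last by ring.
by rewrite ler_wpM2r// gerBl sqr_ge0.
Qed.

Lemma Rint_sum (I : Type) (r : seq I) D (F : I -> T -> R) : measurable D ->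
  (forall i, mu.-integrable D (EFin \o F i)) ->
  mu.-integrable D (EFin \o (fun x => \sum_(i <- r) F i x)%R) /\
  (\int[mu]_(x in D) (\sum_(i <- r) F i x) = \sum_(i <- r) \int[mu]_(x in D) F i x)%R.
Proof.
move=> mD Fi; elim: r => [|i r [IH1 IH2]].
  under eq_fun do rewrite big_nil; split; first exact: integrable0.
  rewrite big_nil Rintegral_cst//.
  by rewrite mul0r.
under eq_fun do rewrite big_cons; split; first exact: (integrableD mD (Fi i) IH1).
by rewrite RintegralD// big_cons IH2.
Qed.

End integral_tools.

(** * Integrals of functions that are measurable up to a null set *)

Section nonmeasurable_integral.
Context d (T : measurableType d) (R : realType) (mu : {measure set T -> \bar R}).
Local Open Scope ereal_scope.
Import HBNNSimple.

(** The integral of a nonnegative function is a supremum over the simple functions below it, whether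
    or not f is measurable. Such a simple function is almost everywhere below the restriction of f
    to the complement of N, and this restriction is measurable. *)
Lemma ge0_integral_null (f : T -> \bar R) (N : set T) : (forall x, 0 <= f x) ->
  measurable N -> mu N = 0 -> measurable_fun setT (f \_ (~` N)) ->
  \int[mu]_x f x = \int[mu]_x (f \_ (~` N)) x.
Proof.
move=> f0 mN N0 mfN.
have fN0 x : 0 <= (f \_ (~` N)) x by rewrite patchE; case: ifP.
apply/eqP; rewrite eq_le; apply/andP; split; last first.
  rewrite !ge0_integralTE//; apply: le_ereal_sup => _ [h hf <-]; exists h => //= x.
  by apply: le_trans (hf x) _; rewrite patchE; case: ifP.
rewrite ge0_integralTE//; apply: ge_ereal_sup => _ [h hf <-].
rewrite -integralT_nnsfun.
apply: ae_ge0_le_integral => //.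
- by move=> x _; rewrite lee_fin.
- exact/measurable_EFinP.
- exists N; split => // x /=; apply: contra_notP => Nx _.
  by rewrite patchE mem_set.
Qed.

Lemma Rintegral_null (f h : T -> R) (D : set T) : measurable D ->
  measurable_fun D h -> {ae mu, forall x, D x -> f x = h x} ->
  (\int[mu]_(x in D) f x = \int[mu]_(x in D) h x)%R.
Proof.
move=> mD mh [N [mN N0 hN]]; rewrite /Rintegral; congr fine.
rewrite integral_mkcond [RHS]integral_mkcond /=.
set F := _ \_ D; set H := _ \_ D.
have FH x : ~ N x -> F x = H x.
  move=> Nx; rewrite /F /H !patchE; case: ifP => // /set_mem Dx; congr EFin.
  by apply: contrapT => h1; apply: Nx; apply: hN => /= /(_ Dx).
have mH : measurable_fun setT H.
  by apply/(measurable_restrictT _ mD); exact/measurable_EFinP.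
rewrite integralE [RHS]integralE; congr (_ - _).
- rewrite (ge0_integral_null _ mN N0)//; last first.
    have -> : F^\+ \_ (~` N) = H^\+ \_ (~` N).
      apply/funext => x; rewrite !patchE; case: ifP => // /set_mem /FH.
      by rewrite !funeposE => ->.
    by apply/(measurable_restrictT _ (measurableC mN)); apply: measurable_funTS; exact: measurable_funepos.
  rewrite [RHS](ge0_integral_null _ mN N0)//; last first.
    by apply/(measurable_restrictT _ (measurableC mN)); apply: measurable_funTS; exact: measurable_funepos.
  apply: eq_integral => x _; rewrite !patchE; case: ifP => // /set_mem /FH.
  by rewrite !funeposE => ->.
- rewrite (ge0_integral_null _ mN N0)//; last first.
    have -> : F^\- \_ (~` N) = H^\- \_ (~` N).
      apply/funext => x; rewrite !patchE; case: ifP => // /set_mem /FH.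
      by rewrite !funenegE => ->.
    by apply/(measurable_restrictT _ (measurableC mN)); apply: measurable_funTS; exact: measurable_funeneg.
  rewrite [RHS](ge0_integral_null _ mN N0)//; last first.
    by apply/(measurable_restrictT _ (measurableC mN)); apply: measurable_funTS; exact: measurable_funeneg.
  apply: eq_integral => x _; rewrite !patchE; case: ifP => // /set_mem /FH.
  by rewrite !funenegE => ->.
Qed.

Lemma integral_null (f h : T -> R) (D : set T) : measurable D ->
  measurable_fun D h -> {ae mu, forall x, D x -> f x = h x} ->
  (forall x, D x -> 0 <= f x)%R ->
  \int[mu]_(x in D) (f x)%:E = \int[mu]_(x in D) (h x)%:E.
Proof.
move=> mD mh [N [mN N0 hN]] f0.
rewrite integral_mkcond [RHS]integral_mkcond /=.
set F := _ \_ D; set H := _ \_ D.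
have FH x : ~ N x -> F x = H x.
  move=> Nx; rewrite /F /H !patchE; case: ifP => // /set_mem Dx; congr EFin.
  by apply: contrapT => h1; apply: Nx; apply: hN => /= /(_ Dx).
have mH : measurable_fun setT H.
  by apply/(measurable_restrictT _ mD); exact/measurable_EFinP.
have E : F \_ (~` N) = H \_ (~` N).
  by apply/funext => x; rewrite !patchE; case: ifP => // /set_mem /FH.
have mHN : measurable_fun setT (H \_ (~` N)).
  by apply/(measurable_restrictT _ (measurableC mN)); exact: measurable_funTS.
rewrite (ge0_integral_null _ mN N0) ?E//; last first.
  by move=> x; rewrite /F patchE; case: ifP => // /set_mem Dx; rewrite lee_fin f0.
apply: ae_eq_integral => //.
exists N; split => // x /=; apply: contra_notP => Nx _.
by rewrite patchE mem_set.
Qed.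

End nonmeasurable_integral.

Section dominated.
Context d (T : measurableType d) (R : realType) (mu : {measure set T -> \bar R}).
Local Open Scope ereal_scope.

(** Dominated convergence for (U - U_k)^2 with majorant 4 G^2: the bound by G passes to the limit U
    almost everywhere. *)
Lemma L2_dominated (D : set T) (U_ : nat -> T -> R) (U G : T -> R) : measurable D ->
  (forall k, measurable_fun D (U_ k)) -> measurable_fun D U -> measurable_fun D G ->
  {ae mu, forall x, D x -> (U_ k x @[k --> \oo] --> U x)%R} ->
  (forall k x, D x -> (`|U_ k x| <= G x)%R) -> \int[mu]_(x in D) (G x ^+ 2)%:E < +oo ->
  forall e, (0 < e)%R -> \forall k \near \oo,
    \int[mu]_(x in D) ((U x - U_ k x) ^+ 2)%:E <= e%:E.
Proof.
move=> mD mUk mU mG cU UG Goo e e0.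
have mf k : measurable_fun D (fun x => ((U x - U_ k x) ^+ 2)%:E).
  by apply/measurable_EFinP; mtac.
have UG' : {ae mu, forall x, D x -> (`|U x| <= G x)%R}.
  apply: filterS cU => x cU Dx; have {}cU := cU Dx.
  have h : (`|U_ k x| @[k --> \oo] --> `|U x|)%R by exact: cvg_norm.
  rewrite -(cvg_lim (@Rhausdorff R) h); apply: limr_le; first exact: cvgP h.
  by near=> k; exact: UG.
have [| | | | |_ _] := @dominated_convergence _ T R mu D mD
  (fun k x => ((U x - U_ k x) ^+ 2)%:E) (cst 0) (fun x => (4 * G x ^+ 2)%:E).
- by move=> k; exact: mf.
- exact: measurable_cst.
- apply: filterS cU => x cU Dx; have {}cU := cU Dx; apply: cvg_EFin; first by near=> k.
  rewrite (_ : fine \o _ = (fun k => (U x - U_ k x) ^+ 2)%R)//.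
  have hB : (U x - U_ k x @[k --> \oo] --> U x - U x)%R.
    by apply: cvgB => //; exact: cvg_cst.
  have h2 : ((U x - U_ k x) * (U x - U_ k x) @[k --> \oo] --> (U x - U x) * (U x - U x))%R.
    exact: cvgM.
  by move: h2; rewrite subrr mulr0.
- exact: (integrableZl mD 4%R (sq_integrable_sq mD mG Goo)).
- apply: filterS UG' => x UG' k Dx; rewrite /= lee_fin ger0_norm ?sqr_ge0//.
  have h1 := UG' Dx; have h2 := UG k x Dx.
  have h3 : (`|U x - U_ k x| <= 2 * G x)%R by apply: le_trans (ler_normB _ _) _; lra.
  rewrite -real_normK ?num_real// (_ : (4 * G x ^+ 2 = (2 * G x) ^+ 2)%R); last by ring.
  by rewrite lerXn2r ?nnegrE// (le_trans _ h3).
rewrite integral0_eq//.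
move=> /fine_cvgP[hf] /cvgrPdist_le /(_ _ e0) hc.
near=> k.
have h1 : \int[mu]_(x in D) ((U x - U_ k x) ^+ 2)%:E \is a fin_num by near: k.
rewrite -(fineK h1) lee_fin.
apply: le_trans (ler_norm _) _; rewrite -normrN -sub0r; near: k; exact: hc.
Unshelve. all: by end_near. Qed.

End dominated.

(** * Mollification *)

Section translation_continuity.
Context {R : realType} {n : nat}.
Implicit Types (U V : 'rV[R]_n -> R) (z : 'rV[R]_n).
Local Notation leb := (lebesgue_rV R n).
Local Open Scope ereal_scope.

(** Continuity of translations in L^2, the property that makes mollifications converge. *)
Definition tcont U := forall e : R, (0 < e)%R -> exists2 r : R, (0 < r)%R &
  forall z, (enorm z < r)%R -> \int[leb]_x ((U (x + z)%R - U x) ^+ 2)%:E <= e%:E.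

Lemma measurable_shift U z : measurable_fun setT U -> measurable_fun setT (fun x : 'rV[R]_n => U (x + z)%R).
Proof. by move=> mU; apply: (measurableT_comp mU); exact: measurable_translate. Qed.

Lemma tcontD U V : measurable_fun setT U -> measurable_fun setT V -> tcont U -> tcont V ->
  tcont (fun x => U x + V x)%R.
Proof.
move=> mU mV tU tV e e0.
have e4 : (0 < e / 4)%R by rewrite divr_gt0.
have [r1 r10 h1] := tU _ e4; have [r2 r20 h2] := tV _ e4.
exists (Num.min r1 r2) => [|z]; first by rewrite lt_min r10.
rewrite lt_min => /andP[zr1 zr2].
under eq_integral => x _.
  rewrite (_ : (U (x + z) + V (x + z) - (U x + V x) = (U (x + z) - U x) + (V (x + z) - V x))%R); last by ring.
  over.
apply: le_trans (int_sqD _ _ _ _) _ => //; first by mtac; exact: measurable_shift.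
- by mtac; exact: measurable_shift.
apply: (@le_trans _ _ (2%:E * ((e / 4)%:E + (e / 4)%:E))).
  by rewrite lee_pmul2l// leeD// ?h1// h2.
by rewrite -EFinD -EFinM lee_fin; lra.
Qed.

Lemma tcontZ (c : R) U : measurable_fun setT U -> tcont U -> tcont (fun x => c * U x)%R.
Proof.
move=> mU tU e e0.
have c0 : (0 < c ^+ 2 + 1)%R by rewrite ltr_wpDl// sqr_ge0.
have [r r0 h] := tU _ (divr_gt0 e0 c0); exists r => // z zr.
under eq_integral do rewrite -mulrBr exprMn.
rewrite (@int_scale _ _ _ leb setT (c ^+ 2)%R (fun x => (U (x + z) - U x) ^+ 2)%R)//; last 3 first.
- by mtac; exact: measurable_shift.
- exact: sqr_ge0.
- by move=> x _; exact: sqr_ge0.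
apply: (@le_trans _ _ ((c ^+ 2)%:E * (e / (c ^+ 2 + 1))%:E)).
  by rewrite lee_wpmul2l ?lee_fin ?sqr_ge0// h.
rewrite -EFinM lee_fin mulrA ler_pdivrMr// mulrC ler_wpM2l ?(ltW e0)//.
by rewrite lerDl.
Qed.

Lemma tcont_lim U : measurable_fun setT U ->
  (forall e, (0 < e)%R -> exists V, [/\ measurable_fun setT V, tcont V &
     \int[leb]_x ((U x - V x) ^+ 2)%:E <= e%:E]) -> tcont U.
Proof.
move=> mU h e e0.
(* Two nested uses of (a + b)^2 <= 2 a^2 + 2 b^2 on three terms cost 2 (1 + 2 (1 + 1)) = 10. *)
have e10 : (0 < e / 10)%R by rewrite divr_gt0.
have [V [mV tV UV]] := h _ e10; have [r r0 hr] := tV _ e10.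
exists r => // z zr.
have mW : measurable_fun setT (fun x => U x - V x)%R by mtac.
have mU' := measurable_shift z mU; have mV' := measurable_shift z mV.
under eq_integral => x _.
  rewrite (_ : (U (x + z) - U x =
    (U (x + z) - V (x + z)) + ((V (x + z) - V x) + (- 1) * (U x - V x)))%R); last by ring.
  over.
apply: le_trans (int_sqD _ _ _ _) _ => //; [by mtac|by mtac|].
have E1 : \int[leb]_x (((U (x + z) - V (x + z)) ^+ 2)%R)%:E <= (e / 10)%:E.
  rewrite (ge0_integral_translate z (f := fun x => ((U x - V x) ^+ 2)%:E))//.
    by apply/measurable_EFinP; mtac.
  by move=> x; rewrite lee_fin sqr_ge0.
have E2 : \int[leb]_x ((((V (x + z) - V x) + (- 1) * (U x - V x)) ^+ 2)%R)%:E <=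
    2%:E * ((e / 10)%:E + (e / 10)%:E).
  apply: le_trans (int_sqD _ _ _ _) _ => //; [by mtac|by mtac|].
  rewrite lee_pmul2l// leeD// ?hr//.
  by under eq_integral do rewrite mulN1r sqrrN.
apply: (@le_trans _ _ (2%:E * ((e / 10)%:E + 2%:E * ((e / 10)%:E + (e / 10)%:E)))).
  by rewrite lee_pmul2l// leeD.
by rewrite -!(EFinD,EFinM) lee_fin; lra.
Qed.

Lemma indic_sqB (A B : set 'rV[R]_n) x :
  ((\1_A x - \1_B x) ^+ 2 = \1_(A `\` B) x + \1_(B `\` A) x :> R)%R.
Proof.
rewrite !indicE !in_setD; case: (x \in A); case: (x \in B) => /=; rewrite ?expr2; ring.
Qed.

(** A translate of F by a small vector lies in the neighbourhood [G k] of F, whose measure tends to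
    that of F. This bounds one half of the symmetric difference; the other half has the same measure
    because F and its translate do. *)
Lemma tcont_compact (F : set 'rV[R]_n) : compact F -> tcont (\1_F).
Proof.
move=> cF e e0.
have clF : closed F by apply: compact_closed => //; exact: norm_hausdorff.
have mF := closed_measurable_rV clF.
have Foo := lebesgue_compact cF.
pose G k : set 'rV[R]_n := \bigcup_(y in F) eball y k.+1%:R^-1.
have mG k : measurable (G k).
  by apply: open_measurable_rV; apply: bigcup_open => y _; exact: open_eball.
have FG k : F `<=` G k by move=> y Fy; exists y => //; apply: eball_center; rewrite invr_gt0.
have capG : \bigcap_k G k = F.
  apply/seteqP; split=> [x hx|x Fx k _]; last exact: FG.
  rewrite (closure_id F).1// => B /nbhs_ballP[t /= t0 tB].
  have [k kt] : exists k : nat, (k.+1%:R^-1 < t)%R.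
    have := near_infty_natSinv_lt (PosNum t0).
    by case => N _ h; exists N; exact: (h N (leqnn N)).
  have [y Fy yx] := hx k Logic.I; exists y; split => //; apply: tB.
  split => // i j; rewrite /ball/= ord1; apply: lt_trans kt; apply: le_lt_trans yx.
  by have := coord_le_enorm (x - y) j; rewrite !mxE.
(* Continuity of the measure along a decreasing sequence needs one set of finite measure. *)
have G0oo : leb (G 0%N) < +oo.
  have [M [_ hM]] := compact_bounded cF.
  have FM y : F y -> (`|y| <= `|M| + 1)%R.
    by apply: (hM (`|M| + 1)%R); rewrite (le_lt_trans (ler_norm _))// ltrDl.
  apply: (@le_lt_trans _ _ (leb (cube 0 (`|M| + 1 + 1 + 1)%R))); last first.
    by rewrite lebesgue_cube ?ltry// !addr_gt0// ltr_wpDl.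
  apply: le_measure; rewrite ?inE//; first exact: measurable_cube.
  move=> x [y Fy yx] i; rewrite mxE subr0.
  rewrite -(subrK (y 0%R i) (x 0%R i)); apply: le_lt_trans (ler_normD _ _) _.
  have h1 : (`|x 0%R i - y 0%R i| < 1)%R.
    apply: le_lt_trans (_ : (enorm (x - y) < 1)%R); last by move: yx; rewrite /eball/= invr1.
    by have := coord_le_enorm (x - y) i; rewrite !mxE.
  have h2 := le_trans (coord_le_norm y i) (FM y Fy).
  by lra.
have := @nonincreasing_cvg_mu _ _ R leb G G0oo mG.
rewrite capG => /(_ mF) hc.
have {}hc : leb \o G @ \oo --> leb F.
  apply: hc; apply/nonincreasing_seqP => k; apply/subsetPset => x [y Fy xy]; exists y => //.
  apply: lt_le_trans xy _; rewrite lef_pV2 ?posrE//.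
  by rewrite ler_nat.
have Ffin : leb F \is a fin_num by rewrite ge0_fin_numE.
have [k hk] : exists k, leb (G k) <= leb F + (e / 2)%:E.
  move: hc; rewrite -(fineK Ffin) => /fine_cvgP[hf] /cvgrPdist_le /(_ (e / 2)%R).
  rewrite divr_gt0// => /(_ isT) hc.
  near \oo => k; exists k.
  have h1 : leb (G k) \is a fin_num by near: k.
  rewrite -(fineK h1) -EFinD lee_fin -lerBlDl.
  apply: le_trans (ler_norm _) _; rewrite distrC.
  by near: k.
exists k.+1%:R^-1%R; first by rewrite invr_gt0.
move=> z zk.
pose A := (fun x => x + z)%R @^-1` F.
have mA : measurable A by rewrite -[A]setTI; apply: measurable_translate.
have EA x : \1_F (x + z)%R = \1_A x :> R by rewrite !indicE; congr (_%:R); apply/idP/idP => /set_mem ?; apply/mem_set.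
have muA : leb A = leb F by exact: lebesgue_rV_translate.
under eq_integral do rewrite EA indic_sqB.
have mi B C : measurable B -> measurable C -> measurable_fun setT (\1_(B `\` C) : 'rV[R]_n -> R).
  by move=> mB mC; apply: measurable_indic; exact: measurableD.
rewrite (@int_add _ _ _ leb setT _ _ measurableT (mi _ _ mA mF) (mi _ _ mF mA))//.
rewrite !integral_indic ?setIT//; [|exact: measurableD|exact: measurableD].
have AG : A `<=` G k.
  move=> x Ax; exists (x + z)%R => //.
  by rewrite /eball/= opprD addrA subrr sub0r enormN.
have hAF : leb (A `\` F) <= (e / 2)%:E.
  apply: (@le_trans _ _ (leb (G k `\` F))).
    apply: le_measure; rewrite ?inE//; try exact: measurableD.
    by move=> x [Ax Fx]; split => //; exact: AG.
  rewrite measureD// ?(setIidr (FG k)); last by rewrite (le_lt_trans hk)// lte_add_pinfty// ltry.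
  by rewrite leeBlDl.
have hFA : leb (F `\` A) = leb (A `\` F).
  have Aoo : leb A < +oo by rewrite muA.
  rewrite (measureD mF mA Foo) (measureD mA mF Aoo) setIC; congr (_ - _); exact/esym.
apply: (@le_trans _ _ ((e / 2)%:E + (e / 2)%:E)).
  apply: leeD => //; apply: le_trans hAF; rewrite le_eqVlt; apply/orP; left; apply/eqP; exact: hFA.
by rewrite -EFinD lee_fin -splitr.
Unshelve. all: by end_near. Qed.

Lemma measurable_sub_closed (A : set 'rV[R]_n) : measurable A ->
  <<s [set F : set 'rV[R]_n | closed F] >> A.
Proof.
pose G : set (set 'rV[R]_n) := [set F | closed F].
suff : @measurable _ 'rV[R]_n `<=` <<s G >> by exact.
apply: smallest_sub; first exact: smallest_sigma_algebra.
rewrite -bigcup_seq => B [i _ [Y mY <-]] /=; rewrite setTI.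
pose c : g_sigma_algebraType G -> R := fun v : 'rV[R]_n => v 0%R i.
suff mc : measurable_fun setT c by have := mc measurableT Y mY; rewrite setTI.
apply: (measurability _ (RGenOInfty.measurableE R)).
move=> _ [_ [a ->] <-]; rewrite setTI.
rewrite -[X in measurable X]setCK; apply: measurableC; apply: sub_sigma_algebra.
rewrite /G/=; apply: open_closedC.
apply: (@open_comp _ _ (fun v : 'rV[R]_n => v 0%R i : R) `]a, +oo[%classic).
  by move=> v _; exact: continuous_coord.
exact: interval_open.
Qed.

(** Dynkin's pi-lambda argument, starting from closed sets. Intersecting with the compact Q keeps
    measures finite, so that increasing unions are handled by dominated convergence. *)
Lemma tcont_indic (Q A : set 'rV[R]_n) : compact Q -> measurable A -> tcont (\1_(A `&` Q)).
Proof.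
move=> cQ mA.
have clQ : closed Q by apply: compact_closed => //; exact: norm_hausdorff.
have mQ := closed_measurable_rV clQ.
pose H : set (set 'rV[R]_n) := [set A | measurable A /\ tcont (\1_(A `&` Q))].
suff [] : H A by [].
have := measurable_sub_closed mA; apply: lambda_system_subset => //.
- by move=> E F /= cE cF; exact: closedI.
- split=> //.
  + by split=> //; rewrite setTI; exact: tcont_compact.
  + move=> E F FE [mE tE] [mF tF]; split; first exact: measurableD.
    have -> : \1_((E `\` F) `&` Q) = (fun x => \1_(E `&` Q) x + (-1) * \1_(F `&` Q) x)%R :> (_ -> R).
      apply/funext => x; rewrite !indicE !in_setI ?in_setD ?in_setC.
      have : x \in F -> x \in E by move=> /set_mem /FE /mem_set.
      case: (x \in E); case: (x \in F); case: (x \in Q) => //= h; try ring.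
        by have := h isT.
    apply: tcontD => //.
    * by apply: measurable_indic; exact: measurableI.
    * by apply: measurable_funM; [exact: measurable_cst|apply: measurable_indic; exact: measurableI].
    * by apply: tcontZ => //; apply: measurable_indic; exact: measurableI.
  + move=> F ndF HF; have mF k : measurable (F k) by case: (HF k).
    split; first exact: bigcup_measurable.
    apply: tcont_lim.
      by apply: measurable_indic; apply: measurableI => //; exact: bigcup_measurable.
    move=> e e0.
    have [||||||N _ hN] := @L2_dominated _ _ R leb setT (fun k => \1_(F k `&` Q))
      (\1_(\bigcup_k F k `&` Q)) (\1_Q) measurableT _ _ _ _ _ _ e e0.
    * by move=> k; apply: measurable_indic; exact: measurableI.
    * by apply: measurable_indic; apply: measurableI => //; exact: bigcup_measurable.
    * exact: measurable_indic.
    * apply: aeW => x _; have [[k _ Fkx]|nF] := pselect ((\bigcup_k F k) x).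
        apply: cvg_near_cst; exists k => // l /= kl.
        rewrite !indicE !in_setI; congr (((_ && _) : bool)%:R).
        have -> : x \in F l by apply/mem_set; move: Fkx; apply/subsetPset; exact: ndF.
        by apply/esym/mem_set; exists k.
      apply: cvg_near_cst; near=> k.
      rewrite !indicE !in_setI; congr (((_ && _) : bool)%:R).
      by apply/idP/idP => /set_mem h; exfalso; apply: nF => //; exists k.
    * move=> k x _; rewrite !indicE in_setI; case: (x \in Q); rewrite ?andbT ?andbF/= ?normr0//.
      by case: (x \in F k); rewrite ?normr1 ?normr0.
    * have E x : (\1_Q x ^+ 2 = \1_Q x :> R)%R.
        by rewrite indicE; case: (x \in Q); rewrite ?expr1n ?expr0n.
      under eq_integral do rewrite E.
      by rewrite integral_indic// setIT; exact: lebesgue_compact.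
    exists (\1_(F N `&` Q)); split; first by apply: measurable_indic; exact: measurableI.
      by case: (HF N).
    exact: (hN N (leqnn N)).
- move=> F cF; split; first exact: closed_measurable_rV.
  by apply: tcont_compact; rewrite setIC; exact: compact_closedI.
Unshelve. all: by end_near. Qed.

Lemma tcont_sum (I : Type) (r : seq I) (F : I -> 'rV[R]_n -> R) :
  (forall i, measurable_fun setT (F i)) -> (forall i, tcont (F i)) ->
  tcont (fun x => \sum_(i <- r) F i x)%R.
Proof.
move=> mF tF; elim: r => [|i r IH].
  under eq_fun do rewrite big_nil; move=> e e0; exists 1%R => // z _.
  by rewrite integral0_eq ?lee_fin ?ltW// => x _; rewrite subrr expr0n.
by under eq_fun do rewrite big_cons; apply: tcontD => //; exact: measurable_sum.
Qed.

Import HBNNSimple.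

(** Simple functions increasing to U lie between 0 and U, hence vanish off Q and are combinations of
    indicators of subsets of Q. *)
Lemma tcont_ge0 U (Q : set 'rV[R]_n) : compact Q -> measurable_fun setT U ->
  (forall x, (0 <= U x)%R) -> (forall x, ~ Q x -> U x = 0%R) ->
  \int[leb]_x (U x ^+ 2)%:E < +oo -> tcont U.
Proof.
move=> cQ mU U0 UQ Uoo.
have clQ : closed Q by apply: compact_closed => //; exact: norm_hausdorff.
have mQ := closed_measurable_rV clQ.
have mE : measurable_fun setT (EFin \o U) by exact/measurable_EFinP.
have E0 x : setT x -> 0 <= (EFin \o U) x by rewrite lee_fin.
pose S := nnsfun_approx measurableT mE.
have cS x : S k x @[k --> \oo] --> U x.
  have /fine_cvgP[_] := @cvg_nnsfun_approx _ _ _ _ measurableT _ mE E0 x Logic.I.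
  exact.
have SU k x : (S k x <= U x)%R.
  have ndS : nondecreasing_seq (fun k => S k x).
    by move=> i j ij; exact/lefP/nd_nnsfun_approx.
  have := nondecreasing_cvgn_le ndS (cvgP _ (cS x)) k.
  by rewrite (cvg_lim _ (cS x)).
apply: tcont_lim => // e e0.
have [||||||N _ hN] := @L2_dominated _ _ R leb setT (fun k => S k) U U measurableT _ _ _ _ _ _ e e0 => //.
- by apply: aeW => x _; exact: cS.
- by move=> k x _; rewrite ger0_norm.
exists (S N); split => //; last exact: (hN N (leqnn N)).
have [s hs] : exists s : seq R, forall x,
    S N x = (\sum_(r <- s) r * \1_(S N @^-1` [set r]) x)%R.
  by eexists => x; rewrite fimfunE fsbig_finite//=.
have -> : (S N : _ -> R) = (fun x => \sum_(r <- s) r * \1_(S N @^-1` [set r] `&` Q) x)%R.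
  apply/funext => x; rewrite hs; apply: eq_bigr => i _.
  have [Qx|nQx] := pselect (Q x).
    by congr (_ * _)%R; rewrite !indicE in_setI (mem_set Qx) andbT.
  rewrite !indicE in_setI (memNset nQx) andbF mulr0.
  have SNx : S N x = 0%R.
    by apply/eqP; rewrite eq_le (le_trans (SU N x)) ?(UQ x nQx)//=.
  have [h|h] := boolP (x \in _); last by rewrite mulr0.
  by move/set_mem : h => /= <-; rewrite SNx mul0r.
apply: tcont_sum => i.
  apply: measurable_funM; first exact: measurable_cst.
  by apply: measurable_indic; exact: measurableI.
apply: tcontZ; first by apply: measurable_indic; exact: measurableI.
exact: tcont_indic.
Qed.

Lemma tcont_L2 U (Q : set 'rV[R]_n) : compact Q -> measurable_fun setT U ->
  (forall x, ~ Q x -> U x = 0%R) -> \int[leb]_x (U x ^+ 2)%:E < +oo -> tcont U.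
Proof.
move=> cQ mU UQ Uoo.
have mp : measurable_fun setT (fun x => Num.max (U x) 0%R) by mtac.
have mn : measurable_fun setT (fun x => Num.max (- U x)%R 0%R).
  by apply: measurable_maxr; [exact: measurable_funN|exact: measurable_cst].
have -> : U = (fun x => Num.max (U x) 0 + (-1) * Num.max (- U x) 0)%R.
  apply/funext => x; have [h|h] := leP 0%R (U x).
    by rewrite max_r ?oppr_le0// mulr0 addr0.
  by rewrite max_l ?oppr_ge0 ?ltW// mulN1r opprK add0r.
apply: tcontD => //; first by mtac.
- apply: (tcont_ge0 cQ) => //.
  + by move=> x; rewrite le_max lexx orbT.
  + by move=> x /UQ ->; rewrite maxxx.
  + apply: le_lt_trans Uoo; apply: int_le => //; [by mtac|by mtac|].
    by move=> x _; rewrite sqr_ge0/= maxEle; case: ifPn => // _; rewrite expr0n/= sqr_ge0.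
- apply: tcontZ => //; apply: (tcont_ge0 cQ) => //.
  + by move=> x; rewrite le_max lexx orbT.
  + by move=> x /UQ ->; rewrite oppr0 maxxx.
  + apply: le_lt_trans Uoo; apply: int_le => //; [by mtac|by mtac|].
    by move=> x _; rewrite sqr_ge0/= maxEle; case: ifPn => _; rewrite ?sqrrN// expr0n/= sqr_ge0.
Qed.

End translation_continuity.

(** * Convolution with smooth kernels *)

Section mollification.
Context {R : realType} {n : nat}.
Implicit Types (U f psi : 'rV[R]_n -> R) (x y z v : 'rV[R]_n).
Local Notation leb := (lebesgue_rV R n).

Lemma lebesgue_eball_ge x (r : R) : (0 < n)%N -> 0 < r ->
  (((r / n%:R) ^+ n)%:E <= leb (eball x r))%E.
Proof.
move=> n0 r0; have n0' : 0 < n%:R :> R by rewrite ltr0n.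
have -> : r / n%:R = 2 * (r / 2 / n%:R) by rewrite mulrA [2 * _]mulrC divfK.
rewrite -(lebesgue_cube x); last by rewrite !divr_gt0.
apply: le_measure; rewrite ?inE.
- exact: measurable_cube.
- exact: measurable_eball.
- move=> y /(cube_sub_eball n0) /= h; rewrite /eball/=; apply: le_lt_trans h _.
  by rewrite ltr_pdivrMr// ltr_pMr// ltr1n.
Qed.

Lemma Rintegral_translate z f : measurable_fun setT f ->
  \int[leb]_x f (x + z) = \int[leb]_x f x.
Proof.
move=> mf; rewrite /Rintegral; congr fine.
have mE : measurable_fun setT (EFin \o f) by exact/measurable_EFinP.
rewrite integralE [RHS]integralE; congr (_ - _)%E.
- rewrite -(ge0_integral_translate z (f := ((EFin \o f)^\+)%E))//; last exact: measurable_funepos.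
  by apply: eq_integral => x _; rewrite !funeposE.
- rewrite -(ge0_integral_translate z (f := ((EFin \o f)^\-)%E))//; last exact: measurable_funeneg.
  by apply: eq_integral => x _; rewrite !funenegE.
Qed.

Lemma isder_shift psi x y v : fsmooth psi ->
  is_derive y v (fun y => psi (y - x)) (dotv (grad psi (y - x)) v).
Proof.
move=> sp; rewrite -[y in is_derive y](_ : y + (0 : R) *: v = y); last by rewrite scale0r addr0.
apply/isder_line.
have -> : (fun s : R => psi (y + s *: v - x)) = (fun s => psi ((y - x) + s *: v)).
  by apply/funext => s; rewrite addrAC.
apply/isder_line; rewrite scale0r addr0; exact: fsmooth_is_derive.
Qed.

Lemma grad_shift psi x y : fsmooth psi -> grad (fun y => psi (y - x)) y = grad psi (y - x).
Proof. by move=> sp; apply: grad_is_derive => v; exact: isder_shift. Qed.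

Lemma continuous_translate z : continuous (fun y : 'rV[R]_n => y + z).
Proof.
apply: continuous_rV => i; under eq_fun do rewrite mxE.
by apply: contD; [exact: continuous_coord|exact: cont_cst].
Qed.

Lemma fsmooth_shift psi x : fsmooth psi -> fsmooth (fun y => psi (y - x)).
Proof.
move=> sp; apply: (fsmooth_coind (P := fun f => exists psi, fsmooth psi /\ f = fun y => psi (y - x))).
  move=> _ [{sp}psi [sp ->]]; split.
  - apply: (cont_comp (f := fun y => y - x) (g := psi)); first exact: continuous_translate.
    exact: fsmooth_cont.
  - by move=> y v; rewrite grad_shift//; exact: isder_shift.
  - move=> i; exists (partial i psi); split; first exact: fsmooth_partial.
    by apply/funext => y; rewrite partialE grad_shift// -partialE.
by exists psi.
Qed.

(** The kernel is read at y - x, not at x - y: as a function of y it is a translate of psi and can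
    serve directly as a test function. The price is the minus sign in [conv_partial]. *)
Definition convol U psi x : R := \int[leb]_y (U y * psi (y - x)).

Definition bounded_supp psi := exists r : R, forall y, out_ball 0 r y -> psi y = 0.

Lemma measurable_fsmooth psi : fsmooth psi -> measurable_fun setT psi.
Proof. by move=> sp; apply: continuous_measurable_rV; exact: fsmooth_cont. Qed.

Lemma fsmooth_bounded psi : fsmooth psi -> bounded_supp psi ->
  exists2 M, 0 <= M & forall y, `|psi y| <= M.
Proof. by move=> sp [r hr]; apply: (bounded_cball (fsmooth_cont sp) hr). Qed.

Lemma conv_integrable U psi x : leb.-integrable setT (EFin \o U) -> fsmooth psi ->
  bounded_supp psi -> leb.-integrable setT (EFin \o (fun y => U y * psi (y - x))).
Proof.
move=> iU sp bp; have [M M0 hM] := fsmooth_bounded sp bp.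
apply: (@integrable_mulb _ _ _ leb setT U (fun y => psi (y - x)) M) => //.
exact: measurable_fsmooth (fsmooth_shift x sp).
Qed.

Lemma partial_bounded_supp psi i : bounded_supp psi -> bounded_supp (partial i psi).
Proof. by move=> [r hr]; exists r => y yr; rewrite partialE (grad_vanish hr)// mxE. Qed.

Lemma measurable_of_integrable U : leb.-integrable setT (EFin \o U) -> measurable_fun setT U.
Proof. by move=> /integrableP[/measurable_EFinP]. Qed.

(** Differentiation under the integral sign along the line x + s v with |s| < 1. The derivative of
    the integrand is dominated by |U| M |v|, with M a bound of the gradient of psi. *)
Lemma conv_deriv U psi x v : leb.-integrable setT (EFin \o U) -> fsmooth psi ->
  bounded_supp psi -> is_derive x v (convol U psi) (\int[leb]_y (U y * - dotv (grad psi (y - x)) v)).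
Proof.
move=> iU sp bp.
have [M M0 hM] : exists2 M, 0 <= M & forall y, enorm (grad psi y) <= M.
  by have [r hr] := bp; exact: (grad_bounded sp hr).
pose f (s : R) y := U y * psi (y - (x + s *: v)).
have df (s : R) y : is_derive s 1 (f ^~ y) (U y * - dotv (grad psi (y - (x + s *: v))) v).
  have E (t : R) : y - (x + t *: v) = (y - x) + t *: (- v).
    by apply/rowP => j; rewrite !mxE; ring.
  have := isderM (isder_cst s 1 (U y))
    ((isder_line psi (y - x) (- v) s _).2 (fsmooth_is_derive _ (- v) sp)).
  rewrite mulr0 addr0 dotvNr -E /f.
  by under [in X in X -> _]eq_fun do rewrite -E.
have d1E (s : R) y : partial1of2 f s y = U y * - dotv (grad psi (y - (x + s *: v))) v.
  by rewrite partial1of2E; apply: derive_val.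
have intf s : leb.-integrable setT (EFin \o f s) by exact: conv_integrable.
have I0 : `]-1, 1[%classic (0 : R) by rewrite /= in_itv/= ltrN10 ltr01.
pose G y := `|U y| * (M * enorm v).
have G0 y : 0 <= G y by rewrite !mulr_ge0 ?enorm_ge0.
have iG : leb.-integrable setT (EFin \o G).
  have mU := measurable_of_integrable iU.
  apply: (@integrable_mulb _ _ _ leb setT (fun y => `|U y|) (fun _ => M * enorm v) (M * enorm v)) => //.
    by move=> y _; rewrite ger0_norm// mulr_ge0 ?enorm_ge0.
  exact: integrable_norm.
have Gub (s : R) y : `]-1, 1[%classic s -> setT y -> `|partial1of2 f s y| <= G y.
  move=> _ _; rewrite d1E normrM ler_wpM2l// normrN.
  by apply: le_trans (dotv_le _ _) _; rewrite ler_wpM2r ?enorm_ge0.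
have derf (s : R) y : `]-1, 1[%classic s -> setT y -> derivable (f ^~ y) s 1.
  by move=> _ _; exact: (@ex_derive _ _ _ _ _ _ _ (df s y)).
have h1 := @derivable_under_integral R _ _ leb f setT measurableT 0 (-1) 1 I0
   (fun s _ => intf s) derf G G0 iG Gub.
have h2 := @differentiation_under_integral R _ _ leb f setT measurableT 0 (-1) 1 I0
   (fun s _ => intf s) derf G G0 iG Gub.
have : is_derive (0 : R) 1 (fun s : R => convol U psi (x + s *: v))
   (\int[leb]_y (U y * - dotv (grad psi (y - x)) v)).
  split; first exact: h1.
  rewrite -derive1E h2; apply: eq_Rintegral => y _.
  by rewrite d1E scale0r addr0.
by move/isder_line; rewrite scale0r addr0.
Qed.

Lemma conv_partial U psi i x : leb.-integrable setT (EFin \o U) -> fsmooth psi ->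
  bounded_supp psi -> partial i (convol U psi) x = convol U (fun y => - partial i psi y) x.
Proof.
move=> iU sp bp; apply: is_derive_partial.
have := conv_deriv x (delta_mx 0 i) iU sp bp; congr is_derive.
by apply: eq_Rintegral => y _; rewrite dotv_delta partialE.
Qed.

Lemma bounded_suppN psi : bounded_supp psi -> bounded_supp (fun y => - psi y).
Proof. by move=> [r hr]; exists r => y /hr ->; rewrite oppr0. Qed.

Lemma conv_cont U psi : leb.-integrable setT (EFin \o U) -> fsmooth psi ->
  bounded_supp psi -> continuous (convol U psi).
Proof.
move=> iU sp bp.
have [M M0 hM] : exists2 M, 0 <= M & forall y, enorm (grad psi y) <= M.
  by have [r hr] := bp; exact: (grad_bounded sp hr).
have mU := measurable_of_integrable iU.
have iN : leb.-integrable setT (EFin \o (fun y => `|U y|)) by exact: integrable_norm.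
pose A := \int[leb]_y `|U y|.
have A0 : 0 <= A by apply: Rintegral_ge0.
have lip x z : `|convol U psi x - convol U psi z| <= A * (M * enorm (x - z)).
  have i1 := conv_integrable x iU sp bp; have i2 := conv_integrable z iU sp bp.
  rewrite /convol -RintegralB//.
  have i3 : leb.-integrable setT (EFin \o (fun y => U y * psi (y - x) - U y * psi (y - z))).
    exact: (integrableB measurableT i1 i2).
  apply: le_trans (le_normr_Rintegral measurableT i3) _.
  rewrite /A -RintegralZr//.
  apply: le_Rintegral => //.
  - exact: (integrable_norm i3).
  - apply: (@integrable_mulb _ _ _ leb setT (fun y => `|U y|) (fun _ => M * enorm (x - z)) (M * enorm (x - z))) => //.
    by move=> y _; rewrite ger0_norm// mulr_ge0 ?enorm_ge0.
  - move=> y _; rewrite -mulrBr normrM ler_wpM2l//.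
    apply: le_trans (fsmooth_lip (y - z) (y - x) sp hM) _.
    rewrite (_ : y - x - (y - z) = z - x); last by apply/rowP => j; rewrite !mxE; ring.
    by rewrite enormB.
move=> x; have FF : Filter (nbhs x) := nbhs_filter x.
apply/(@cvgrPdist_le _ _ _ (nbhs x) FF) => e e0.
have AM : 0 < A * M + 1 by rewrite ltr_wpDl// mulr_ge0.
have nb : nbhs x (eball x (e / (A * M + 1))).
  apply: open_nbhs_nbhs; split; first exact: open_eball.
  by apply: eball_center; rewrite divr_gt0.
apply: filterS nb => z /=; rewrite /eball/= ltr_pdivlMr// => h.
apply: le_trans (lip x z) _; rewrite enormB mulrA; apply: le_trans (ltW h).
by rewrite mulrC ler_wpM2l ?enorm_ge0// lerDl.
Qed.

(** Coinduction over all convolutions of the fixed U: a partial derivative only replaces the kernel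
    by minus its own derivative. *)
Lemma conv_fsmooth U psi : leb.-integrable setT (EFin \o U) -> fsmooth psi ->
  bounded_supp psi -> fsmooth (convol U psi).
Proof.
move=> iU sp bp.
apply: (fsmooth_coind (P := fun f => exists psi, [/\ fsmooth psi, bounded_supp psi & f = convol U psi])); last by exists psi.
move=> _ [{sp bp}psi [sp bp ->]]; split.
- exact: conv_cont.
- move=> x v; have := conv_deriv x v iU sp bp; congr is_derive.
  have iF i : leb.-integrable setT (EFin \o (fun y => U y * - partial i psi (y - x) * v 0 i)).
    have ic := conv_integrable x iU (fsmoothN (fsmooth_partial i sp)) (bounded_suppN (partial_bounded_supp i bp)).
    exact: (@integrable_mulb _ _ _ leb setT _ (fun _ => v 0 i) `|v 0 i|).
  have E i : grad (convol U psi) x 0 i * v 0 i = \int[leb]_y (U y * - partial i psi (y - x) * v 0 i).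
    rewrite -partialE conv_partial// /convol -RintegralZr//.
    exact: (conv_integrable x iU (fsmoothN (fsmooth_partial i sp)) (bounded_suppN (partial_bounded_supp i bp))).
  transitivity (\sum_i grad (convol U psi) x 0 i * v 0 i); last by [].
  rewrite (eq_bigr _ (fun i _ => E i)).
  have [_ <-] := Rint_sum (index_enum 'I_n) measurableT iF.
  apply: eq_Rintegral => y _; rewrite /dotv -sumrN mulr_sumr; apply: eq_bigr => i _.
  by rewrite partialE; ring.
- move=> i; exists (fun y => - partial i psi y); split.
  + by apply: fsmoothN; exact: fsmooth_partial.
  + by apply: bounded_suppN; exact: partial_bounded_supp.
  + by apply/funext => x; exact: conv_partial.
Qed.

Definition bump (e : R) z := ppart 1 (e ^+ 2 - enorm z ^+ 2).

Lemma bump_fsmooth e : fsmooth (bump e).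
Proof.
apply: fsmooth_comp; first exact: smooth1_flat.
apply: fsmoothB; first exact: fsmooth_cst.
by have := @fsmooth_sqdist R n 0; under eq_fun do rewrite subr0.
Qed.

Lemma bump_ge0 e z : 0 <= bump e z.
Proof. exact: ppart_ge0. Qed.

Lemma bump_out e z : 0 <= e -> e <= enorm z -> bump e z = 0.
Proof. by move=> e0 ez; rewrite /bump ppart_le0// subr_le0 lerXn2r ?nnegrE ?enorm_ge0. Qed.

Lemma bump_supp e : 0 <= e -> bounded_supp (bump e).
Proof. by move=> e0; exists e => z; rewrite /out_ball/= subr0 => /ltW; exact: bump_out. Qed.

Lemma bump_gt0 e z : 0 < e -> enorm z < e -> 0 < bump e z.
Proof. by move=> e0 ez; rewrite /bump ppart_gt0// subr_gt0 ltrXn2r ?nnegrE ?enorm_ge0// ltW. Qed.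

Lemma integrable_supp U (Q : set 'rV[R]_n) : compact Q -> measurable_fun setT U ->
  (forall x, ~ Q x -> U x = 0) -> (\int[leb]_x (U x ^+ 2)%:E < +oo)%E ->
  leb.-integrable setT (EFin \o U).
Proof.
move=> cQ mU UQ U2.
have mQ : measurable Q.
  by apply: closed_measurable_rV; apply: compact_closed => //; exact: norm_hausdorff.
have h := @sq_integrableM _ _ _ leb setT U (\1_Q) measurableT mU (measurable_indic mQ) U2.
have -> : U = (fun x => U x * \1_Q x).
  apply/funext => x; rewrite indicE; have [Qx|nQx] := pselect (Q x).
    by rewrite mem_set// mulr1.
  by rewrite UQ// mul0r.
apply: h.
have E x : \1_Q x ^+ 2 = \1_Q x :> R by rewrite indicE; case: (x \in Q); rewrite ?expr1n ?expr0n.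
under eq_integral do rewrite E.
by rewrite integral_indic// setIT; exact: lebesgue_compact.
Qed.

Lemma bump_sq_fin e : 0 <= e -> (\int[leb]_x (bump e x ^+ 2)%:E < +oo)%E.
Proof.
move=> e0; have [M M0 hM] := fsmooth_bounded (bump_fsmooth e) (bump_supp e0).
pose Q := [set y : 'rV[R]_n | enorm (y - 0) <= e].
have cQ : compact Q by exact: compact_cball.
have mQ : measurable Q by apply: closed_measurable_rV; exact: closed_cball.
apply: (@le_lt_trans _ _ (\int[leb]_x (M ^+ 2 * \1_Q x)%:E)%E).
  apply: int_le => //.
  - by apply: measurable_funX; exact: measurable_fsmooth (bump_fsmooth e).
  - by apply: measurable_funM; [exact: measurable_cst|exact: measurable_indic].
  move=> x _; rewrite sqr_ge0/= indicE; have [Qx|nQx] := pselect (Q x).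
    by rewrite mem_set// mulr1 -real_normK ?num_real// lerXn2r ?nnegrE.
  rewrite memNset// mulr0 bump_out ?expr0n//.
  by move: nQx; rewrite /Q/= subr0 => /negP; rewrite -ltNge => /ltW.
rewrite int_scale ?sqr_ge0//.
rewrite integral_indic// setIT lte_mul_pinfty ?lee_fin ?sqr_ge0//.
exact: lebesgue_compact.
Qed.

Lemma bump_integrable e : 0 <= e -> leb.-integrable setT (EFin \o bump e).
Proof.
move=> e0; apply: (@integrable_supp _ [set y | enorm (y - 0) <= e]).
- exact: compact_cball.
- exact: measurable_fsmooth (bump_fsmooth e).
- by move=> x /= /negP; rewrite -ltNge subr0 => /ltW; exact: bump_out.
- exact: bump_sq_fin.
Qed.

Definition bumpn e z := (\int[leb]_x bump e x)^-1 * bump e z.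

Lemma bump_int_gt0 e : (0 < n)%N -> 0 < e -> 0 < \int[leb]_x bump e x.
Proof.
move=> n0 e0; have ib := bump_integrable (ltW e0).
rewrite lt_neqAle Rintegral_ge0 ?andbT; last by move=> x _; exact: bump_ge0.
apply/negP => /eqP h.
have h0 : (\int[leb]_x (bump e x)%:E = 0)%E.
  by rewrite -[LHS]fineK ?(integrable_fin_num measurableT ib)//; congr EFin.
have [N [mN N0 hN]] := int_eq0_ae measurableT (measurable_of_integrable ib) (fun x _ => bump_ge0 e x) h0.
have : (leb (eball 0 e) <= leb N)%E.
  apply: le_measure; rewrite ?inE//; first exact: measurable_eball.
  move=> z; rewrite /eball/= subr0 => ze; apply: hN => /= /(_ Logic.I) h1.
  by have := bump_gt0 e0 ze; rewrite h1 ltxx.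
rewrite N0; apply/negP; rewrite -ltNge.
apply: lt_le_trans (lebesgue_eball_ge _ n0 e0).
by rewrite lte_fin exprn_gt0// divr_gt0// ltr0n.
Qed.

Lemma bumpn_fsmooth e : fsmooth (bumpn e).
Proof. by apply: fsmoothZ; exact: bump_fsmooth. Qed.

Lemma bumpn_ge0 e z : 0 <= bumpn e z.
Proof. by rewrite mulr_ge0 ?bump_ge0// invr_ge0 Rintegral_ge0// => x _; exact: bump_ge0. Qed.

Lemma bumpn_out e z : 0 <= e -> e <= enorm z -> bumpn e z = 0.
Proof. by move=> e0 ez; rewrite /bumpn bump_out// mulr0. Qed.

Lemma bumpn_supp e : 0 <= e -> bounded_supp (bumpn e).
Proof. by move=> e0; exists e => z; rewrite /out_ball/= subr0 => /ltW; exact: bumpn_out. Qed.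

Lemma bumpn_int e : (0 < n)%N -> 0 < e -> (\int[leb]_x (bumpn e x)%:E = 1)%E.
Proof.
move=> n0 e0; have h := bump_int_gt0 n0 e0.
have ib := bump_integrable (ltW e0).
rewrite /bumpn int_scale//.
- rewrite -[X in (_ * X)%E](fineK (integrable_fin_num measurableT ib)).
  by rewrite -EFinM mulVf// gt_eqF.
- exact: measurable_of_integrable.
- by rewrite invr_ge0 ltW.
- by move=> x _; exact: bump_ge0.
Qed.

Lemma convE U psi x : measurable_fun setT U -> fsmooth psi ->
  convol U psi x = \int[leb]_z (U (z + x) * psi z).
Proof.
move=> mU sp; rewrite /convol -(Rintegral_translate x (f := fun y => U y * psi (y - x))).
  by apply: eq_Rintegral => z _; rewrite addrK.
apply: measurable_funM => //; exact: measurable_fsmooth (fsmooth_shift x sp).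
Qed.

Lemma measurable_add2 : measurable_fun setT (fun p : 'rV[R]_n * 'rV[R]_n => p.2 + p.1).
Proof.
apply: measurable_fun_rV => i; under eq_fun do rewrite mxE.
by apply: measurable_funD; apply: (measurableT_comp (measurable_coord i));
  [exact: measurable_snd|exact: measurable_fst].
Qed.

(** By Jensen's inequality the squared error at x is at most the mean of (U(x + z) - U(x))^2 over z
    with density [bumpn e]. Tonelli's theorem then leaves a mean over |z| < e of translation errors,
    each at most d. *)
Lemma conv_L2 U (Q : set 'rV[R]_n) : (0 < n)%N -> compact Q -> measurable_fun setT U ->
  (forall x, ~ Q x -> U x = 0) -> (\int[leb]_x (U x ^+ 2)%:E < +oo)%E ->
  forall d, 0 < d -> exists2 e0, 0 < e0 & forall e, 0 < e -> e < e0 ->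
  (\int[leb]_x ((convol U (bumpn e) x - U x) ^+ 2)%:E <= d%:E)%E.
Proof.
move=> n0 cQ mU UQ U2 d d0.
have [e0 e00 he] := tcont_L2 cQ mU UQ U2 d0.
exists e0 => // e ep ee.
have iU := integrable_supp cQ mU UQ U2.
have sb := bumpn_fsmooth e; have bb := bumpn_supp (ltW ep).
have mb := measurable_fsmooth sb.
pose F (p : 'rV[R]_n * 'rV[R]_n) : \bar R := ((U (p.2 + p.1) - U p.1) ^+ 2 * bumpn e p.2)%:E.
have mF : measurable_fun setT F.
  apply/measurable_EFinP; apply: measurable_funM.
    apply: measurable_funX; apply: measurable_funB.
      exact: (measurableT_comp mU measurable_add2).
    exact: (measurableT_comp mU measurable_fst).
  exact: (measurableT_comp mb measurable_snd).
have F0 p : (0 <= F p)%E by rewrite lee_fin mulr_ge0 ?bumpn_ge0// sqr_ge0.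
apply: (@le_trans _ _ (\int[leb]_x \int[leb]_z F (x, z))%E).
  apply: ge0_le_integral => //.
  - by move=> x _; rewrite lee_fin sqr_ge0.
  - apply/measurable_EFinP; apply: measurable_funX; apply: measurable_funB => //.
    by apply: measurable_fsmooth; exact: conv_fsmooth.
  - by apply: measurable_fun_fubini_tonelli_F.
  - move=> x _; rewrite convE//.
    apply: (@Rint_jensen _ _ _ leb (fun z => U (z + x)) (bumpn e) (U x)) => //.
    + exact: measurable_shift.
    + exact: bumpn_ge0.
    + exact: bumpn_int.
    + apply/integrableP; split.
        by apply/measurable_EFinP; apply: measurable_funM => //; exact: measurable_shift.
      have /integrableP[mh hfin] := conv_integrable x iU sb bb.
      pose h y := `|(U y * bumpn e (y - x))%:E|%E.
      have E : (\int[leb]_y h (y + x)%R = \int[leb]_y h y)%E.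
        apply: ge0_integral_translate; last by move=> y; exact: abse_ge0.
        exact: (measurableT_comp (@abse_measurable _ setT) mh).
      have : (\int[leb]_y h (y + x)%R < +oo)%E by rewrite E.
      apply: le_lt_trans; rewrite le_eqVlt; apply/orP; left; apply/eqP.
      by apply: eq_integral => y _; rewrite /h addrK.
rewrite (@fubini_tonelli _ _ _ _ _ leb leb F)//.
apply: (@le_trans _ _ (\int[leb]_z (d * bumpn e z)%:E)%E); last first.
  rewrite int_scale//; last 2 first.
  - exact: ltW.
  - by move=> x _; exact: bumpn_ge0.
  by rewrite bumpn_int// mule1.
apply: ge0_le_integral => //.
- by move=> z _; apply: integral_ge0.
- by apply: measurable_fun_fubini_tonelli_G.
- by apply/measurable_EFinP; apply: measurable_funM => //; exact: measurable_cst.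
move=> z _; rewrite /F/=.
under eq_integral => x _ do rewrite mulrC (addrC z).
rewrite int_scale//; last 3 first.
- by apply: measurable_funX; apply: measurable_funB => //; exact: measurable_shift.
- exact: bumpn_ge0.
- by move=> x _; exact: sqr_ge0.
have [ze|ze] := ltP (enorm z) e.
  rewrite [(d * _)%R]mulrC (EFinM (bumpn e z) d); apply: lee_wpmul2l; first by rewrite lee_fin bumpn_ge0.
  by apply: he; exact: lt_trans ee.
by rewrite bumpn_out ?(ltW ep)// mul0e mulr0.
Qed.

End mollification.

(** * Strong gradients *)

Section sobolev.
Context {R : realType} {n : nat}.
Implicit Types (f u phi : 'rV[R]_n -> R) (g G : 'rV[R]_n -> 'rV[R]_n) (D : set 'rV[R]_n).
Local Notation leb := (lebesgue_rV R n).
Local Open Scope ereal_scope.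

Lemma min_pos (I : finType) (h : I -> R) : (forall i, (0 < h i)%R) ->
  exists2 m : R, (0 < m)%R & forall i, (m < h i)%R.
Proof.
move=> h0; have s0 i : (0 <= (h i)^-1)%R by rewrite invr_ge0 ltW.
(* This lies below every h i, and it also makes sense for an empty index type. *)
exists (1 + \sum_i (h i)^-1)^-1%R => [|i].
  by rewrite invr_gt0 ltr_pwDl// sumr_ge0.
rewrite -[ltRHS]invrK ltf_pV2 ?posrE ?invr_gt0//; last by rewrite ltr_pwDl// sumr_ge0.
rewrite (bigD1 i)//= addrCA ltrDl; apply: ltr_pwDl => //.
by apply: sumr_ge0 => j _.
Qed.

Lemma measurable_coordf G i : measurable_fun setT G -> measurable_fun setT (fun x => G x 0%R i : R).
Proof. by move=> mG; exact: (measurableT_comp (measurable_coord i) mG). Qed.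

Lemma measurable_enormf G : measurable_fun setT G -> measurable_fun setT (fun x => enorm (G x) : R).
Proof.
move=> mG; have := measurableT_comp (@measurable_enorm R n 0%R) mG.
by congr measurable_fun; apply/funext => x /=; rewrite subr0.
Qed.

Lemma measurable_grad phi : fsmooth phi -> measurable_fun setT (grad phi).
Proof.
move=> sp; apply: measurable_fun_rV => i; under eq_fun do rewrite -partialE.
by apply: measurable_fsmooth; exact: fsmooth_partial.
Qed.

Lemma measurable_addf g G : measurable_fun setT g ->
  measurable_fun setT G -> measurable_fun setT (fun x => g x + G x)%R.
Proof.
move=> mf mg; apply: measurable_fun_rV => i; under eq_fun do rewrite mxE.
by apply: measurable_funD; exact: measurable_coordf.
Qed.

Lemma measurable_oppf g : measurable_fun setT g -> measurable_fun setT (fun x => - g x)%R.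
Proof.
move=> mf; apply: measurable_fun_rV => i; under eq_fun do rewrite mxE.
by apply: measurable_funN; exact: measurable_coordf.
Qed.

Lemma measurable_scalef f g : measurable_fun setT f ->
  measurable_fun setT g -> measurable_fun setT (fun x => f x *: g x)%R.
Proof.
move=> mh mf; apply: measurable_fun_rV => i; under eq_fun do rewrite mxE.
by apply: measurable_funM => //; exact: measurable_coordf.
Qed.

Lemma measurable_dotvf g G : measurable_fun setT g ->
  measurable_fun setT G -> measurable_fun setT (fun x => dotv (g x) (G x) : R).
Proof.
move=> mf mg; apply: measurable_sum => i.
by apply: measurable_funM; exact: measurable_coordf.
Qed.

(* [G] is the gradient of [f] in the strong sense: the pair is an L^2(D) limit
   of smooth functions and their gradients. *)
Definition sob D f G := [/\ measurable_fun setT f, measurable_fun setT G &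
  forall e : R, (0 < e)%R -> exists phi, [/\ fsmooth phi,
    \int[leb]_(x in D) ((phi x - f x) ^+ 2)%:E <= e%:E &
    \int[leb]_(x in D) (enorm (grad phi x - G x) ^+ 2)%:E <= e%:E]].

(** Mollify u at a scale below r1 - r2. For x in the smaller ball the shifted kernel is supported in
    the larger one, so the weak identity applies to it and the gradient of the mollification is the
    mollification of g. *)
Lemma sob_of_weak (x0 : 'rV[R]_n) (r1 r2 : R) u g : (0 < n)%N -> (0 < r2)%R -> (r2 < r1)%R ->
  measurable_fun setT u -> measurable_fun setT g ->
  (forall x, out_ball x0 r1 x -> u x = 0%R) ->
  (forall x, out_ball x0 r1 x -> g x = 0%R) ->
  \int[leb]_x (u x ^+ 2)%:E < +oo ->
  \int[leb]_x (enorm (g x) ^+ 2)%:E < +oo ->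
  (forall phi i, fsmooth phi -> (forall x, out_ball x0 r1 x -> phi x = 0%R) ->
     (\int[leb]_x (u x * partial i phi x) = - \int[leb]_x (g x 0 i * phi x))%R) ->
  sob (eball x0 r2) u g.
Proof.
move=> n0 r20 r21 mu mg u0 g0 u2 g2 ibp; split => // e e_gt0.
pose Q := [set y : 'rV[R]_n | (enorm (y - x0) <= r1)%R].
have cQ : compact Q by exact: compact_cball.
have nQ x : ~ Q x -> out_ball x0 r1 x by move=> /negP; rewrite -ltNge.
have uQ x : ~ Q x -> u x = 0%R by move=> /nQ /u0.
have gQ i x : ~ Q x -> g x 0%R i = 0%R by move=> /nQ /g0 ->; rewrite mxE.
have mgi i := measurable_coordf i mg.
have g2i i : \int[leb]_x ((g x 0%R i) ^+ 2)%:E < +oo.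
  apply: le_lt_trans g2; apply: int_le => //.
  - exact: measurable_funX.
  - by apply: measurable_funX; exact: measurable_enormf.
  move=> x _; rewrite sqr_ge0/= -real_normK ?num_real// lerXn2r ?nnegrE ?enorm_ge0//.
  exact: coord_le_enorm.
(* The errors of the n coordinates then add up to at most e, and one alone is at most e as well. *)
pose e' := (e / n.+1%:R)%R.
have e'0 : (0 < e')%R by rewrite divr_gt0.
have e'e : (e' <= e)%R by rewrite ler_pdivrMr// ler_peMr ?ler1n// ltW.
have [eu eu0 hu] := conv_L2 n0 cQ mu uQ u2 e'0.
have /choice[eg heg] : forall i, exists t : R, (0 < t)%R /\ forall e, (0 < e)%R -> (e < t)%R ->
  (\int[leb]_x ((convol (fun x => g x 0%R i) (bumpn e) x - g x 0%R i) ^+ 2)%:E <= e'%:E).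
  by move=> i; have [t t0 ht] := conv_L2 n0 cQ (mgi i) (gQ i) (g2i i) e'0; exists t.
have [t' t'0 tg'] := min_pos (fun i => (heg i).1).
pose t := Num.min t' (Num.min eu (r1 - r2) / 2)%R.
have t0 : (0 < t)%R by rewrite lt_min t'0 divr_gt0// lt_min eu0 subr_gt0.
have tm : (t < Num.min eu (r1 - r2))%R.
  rewrite /t gt_min; apply/orP; right.
  by rewrite ltr_pdivrMr// ltr_pMr ?ltr1n// lt_min eu0 subr_gt0.
have /andP[tu tr] : (t < eu)%R && (t < r1 - r2)%R by rewrite -lt_min.
have tg i : (t < eg i)%R by rewrite /t gt_min tg'.
have iu := integrable_supp cQ mu uQ u2.
have ig i := integrable_supp cQ (mgi i) (gQ i) (g2i i).
have sb := bumpn_fsmooth t (R := R) (n := n); have bb := @bumpn_supp R n _ (ltW t0).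
have sphi : fsmooth (convol u (bumpn t)) by exact: conv_fsmooth.
exists (convol u (bumpn t)); split => //.
- apply: (@le_trans _ _ e'%:E); last by rewrite lee_fin.
  apply: le_trans (hu t t0 tu).
  apply: int_sub => //; first exact: measurable_eball.
  + by apply: measurable_funX; apply: measurable_funB => //; exact: measurable_fsmooth.
  + by move=> x _; exact: sqr_ge0.
have gradE x i : eball x0 r2 x -> grad (convol u (bumpn t)) x 0%R i = convol (fun x => g x 0%R i) (bumpn t) x.
  move=> xr; rewrite -partialE conv_partial//.
  have := ibp _ i (fsmooth_shift x sb); rewrite /convol => h.
  have E y : partial i (fun y => bumpn t (y - x)) y = partial i (bumpn t) (y - x)%R.
    by rewrite !partialE grad_shift.
  have i1 := conv_integrable x iu (fsmooth_partial i sb) (partial_bounded_supp i bb).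
  transitivity (- \int[leb]_y (u y * partial i (bumpn t) (y - x)%R))%R.
    rewrite -[RHS]mulN1r -RintegralZl//; apply: eq_Rintegral => y _; ring.
  under eq_Rintegral do rewrite -E.
  rewrite h ?opprK// => y yr1; apply: bumpn_out; first exact: ltW.
  move: xr yr1; rewrite /eball /out_ball/= => xr yr1.
  have := enorm_triangle x y x0; move: tr; lra.
have [mphi mge] := (measurable_grad sphi, measurable_oppf mg).
have E x : (enorm (grad (convol u (bumpn t)) x - g x) ^+ 2 =
    \sum_i (grad (convol u (bumpn t)) x - g x)%R 0%R i ^+ 2)%R by rewrite sqr_enormE.
under eq_integral do rewrite E -sumEFin.
rewrite ge0_integral_sum//; last 3 first.
- exact: measurable_eball.
- move=> i; apply: measurable_funTS; apply/measurable_EFinP; apply: measurable_funX.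
  exact: (measurable_coordf i (measurable_addf mphi mge)).
- by move=> i x _; rewrite lee_fin sqr_ge0.
apply: (@le_trans _ _ (\sum_(i < n) e'%:E)); last first.
  rewrite sumEFin lee_fin sumr_const card_ord /e' -[((_ / _) *+ n)%R]mulr_natr -mulrA ler_piMr ?(ltW e_gt0)//.
  by rewrite mulrC ler_pdivrMr// mul1r ler_nat.
apply: lee_sum => i _.
have [_ h] := heg i; apply: le_trans (h t t0 (tg i)).
have mc : measurable_fun setT (convol (fun x => g x 0%R i) (bumpn t)).
  by apply: measurable_fsmooth; exact: conv_fsmooth.
have md : measurable_fun setT (fun x => (convol (fun x0 => g x0 0 i) (bumpn t) x - g x 0 i) ^+ 2)%R.
  by apply: measurable_funX; exact: measurable_funB.
have h2 := @int_sub _ _ _ leb _ _ _ (measurable_eball x0 r2) measurableT md (fun x _ => sqr_ge0 _) (@subsetT _ _).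
apply: le_trans h2.
rewrite le_eqVlt; apply/orP; left; apply/eqP; apply: eq_integral => x /set_mem xr.
by rewrite !mxE -gradE// mxE.
Qed.

End sobolev.

Section ae_convergence.
Context d (T : measurableType d) (R : realType) (mu : {measure set T -> \bar R}).
Local Open Scope ereal_scope.

(** The sum of the squares has integral at most 1, hence is finite almost everywhere, and the terms
    of a convergent series tend to 0. *)
Lemma L2_ae_cvg (D : set T) (h : nat -> T -> R) : measurable D ->
  (forall k, measurable_fun D (h k)) ->
  (forall k, \int[mu]_(x in D) (h k x ^+ 2)%:E <= ((2 ^ k.+1)%:R^-1)%R%:E) ->
  {ae mu, forall x, D x -> (h k x @[k --> \oo] --> (0 : R))%R}.
Proof.
move=> mD mh hk.
have mE k : measurable_fun D (fun x => (h k x ^+ 2)%:E).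
  by apply/measurable_EFinP; exact: measurable_funX.
have E0 k x : D x -> 0 <= (h k x ^+ 2)%:E by rewrite lee_fin sqr_ge0.
pose S x := \sum_(k <oo) (h k x ^+ 2)%:E.
have S0 x : 0 <= S x by apply: nneseries_ge0 => k _ _; rewrite lee_fin sqr_ge0.
have mS : measurable_fun D S by apply: ge0_emeasurable_sum => // k x Dx _; exact: E0.
have iS : mu.-integrable D S.
  apply/integrableP; split => //.
  under eq_integral do rewrite gee0_abs//.
  rewrite integral_nneseries//.
  apply: (@le_lt_trans _ _ 1%:E); last exact: ltry.
  apply: le_trans (epsilon_trick0 xpredT (ler01 : (0 <= 1 :> R)%R)).
  apply: lee_nneseries => [k _ _|k _]; first by apply: integral_ge0 => x Dx; exact: E0.
  by rewrite div1r; exact: hk.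
apply: filterS (integrable_ae mD iS) => x Sx Dx; have {}Sx := Sx Dx.
have cvS : cvgn (series (fun k => (h k x ^+ 2)%R)).
  apply: nondecreasing_is_cvgn.
    apply/nondecreasing_seqP => k; rewrite /series/= big_nat_recr//= lerDl; exact: sqr_ge0.
  exists (fine (S x)) => _ [k _ <-].
  rewrite -lee_fin fineK// /series/= -sumEFin.
  apply: nneseries_lim_ge => i _ _; by rewrite lee_fin sqr_ge0.
have h2 := cvg_series_cvg_0 cvS.
apply/cvgr0Pnorm_lt => e e0.
have e20 : (0 < e ^+ 2)%R by rewrite exprn_gt0.
move/cvgr0Pnorm_lt : h2 => /(_ _ e20); apply: filterS => k.
by rewrite normrX ltr_pXn2r// nnegrE ltW.
Unshelve. all: by end_near. Qed.

End ae_convergence.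

(** * Chain rule and truncation for strong gradients *)

Section sobolev_calculus.
Context {R : realType} {n : nat}.
Implicit Types (f u phi : 'rV[R]_n -> R) (g G : 'rV[R]_n -> 'rV[R]_n) (D : set 'rV[R]_n).
Local Notation leb := (lebesgue_rV R n).
Local Open Scope ereal_scope.

Lemma int_vsqD D g G : measurable D -> measurable_fun setT g -> measurable_fun setT G ->
  \int[leb]_(x in D) (enorm (g x + G x)%R ^+ 2)%:E <=
  (2%R)%:E * (\int[leb]_(x in D) (enorm (g x) ^+ 2)%:E + \int[leb]_(x in D) (enorm (G x) ^+ 2)%:E).
Proof.
move=> mD mg mG.
have mgn := measurable_enormf mg; have mGn := measurable_enormf mG.
apply: le_trans (@int_sqD _ _ _ leb D (fun x => enorm (g x)) (fun x => enorm (G x)) mD _ _).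
- apply: int_le => //.
  + apply: measurable_funX; apply: measurable_funTS; exact: measurable_enormf (measurable_addf mg mG).
  + by apply: measurable_funX; apply: measurable_funTS; exact: measurable_funD.
  move=> x _; rewrite sqr_ge0/= lerXn2r ?nnegrE ?addr_ge0 ?enorm_ge0//; exact: enormD.
- exact: measurable_funTS.
- exact: measurable_funTS.
Qed.

Lemma sobS D E f G : measurable D -> measurable E -> D `<=` E -> sob E f G -> sob D f G.
Proof.
move=> mD mE DE [mf mG h]; split => // e e0; have [phi [sp h1 h2]] := h e e0.
exists phi; split => //.
- apply: le_trans h1; apply: int_sub => //; last by move=> x _; exact: sqr_ge0.
  apply: measurable_funTS; apply: measurable_funX; apply: measurable_funB => //; exact: measurable_fsmooth.
- apply: le_trans h2; apply: int_sub => //; last by move=> x _; exact: sqr_ge0.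
  apply: measurable_funTS; apply: measurable_funX.
  exact: (measurable_enormf (measurable_addf (measurable_grad sp) (measurable_oppf mG))).
Qed.

Lemma sobD D f G u g : measurable D -> sob D f G -> sob D u g ->
  sob D (fun x => f x + u x)%R (fun x => G x + g x)%R.
Proof.
move=> mD [mf mG hf] [mu mg hu]; split; [exact: measurable_funD|exact: measurable_addf|].
move=> e e0; have e4 : (0 < e / 4)%R by rewrite divr_gt0.
have [phi [sp h1 h2]] := hf _ e4; have [psi [ss h3 h4]] := hu _ e4.
have mp := measurable_fsmooth sp; have ms := measurable_fsmooth ss.
have mgp := measurable_grad sp; have mgs := measurable_grad ss.
exists (fun x => phi x + psi x)%R; split; first exact: fsmoothD.
- under eq_integral => x _.
    rewrite (_ : (phi x + psi x - (f x + u x) = (phi x - f x) + (psi x - u x))%R); last by ring.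
    over.
  apply: le_trans (int_sqD _ _ _ _) _ => //.
  + by apply: measurable_funTS; exact: measurable_funB.
  + by apply: measurable_funTS; exact: measurable_funB.
  apply: (@le_trans _ _ (2%:E * ((e / 4)%:E + (e / 4)%:E))).
    by rewrite lee_pmul2l// leeD.
  by rewrite -EFinD -EFinM lee_fin; lra.
- under eq_integral => x _.
    rewrite gradD// (_ : (grad phi x + grad psi x - (G x + g x) =
      (grad phi x - G x) + (grad psi x - g x))%R); last first.
      by apply/rowP => i; rewrite !mxE; ring.
    over.
  apply: le_trans (int_vsqD _ _ _) _ => //.
  + exact: measurable_addf mgp (measurable_oppf mG).
  + exact: measurable_addf mgs (measurable_oppf mg).
  apply: (@le_trans _ _ (2%:E * ((e / 4)%:E + (e / 4)%:E))).
    by rewrite lee_pmul2l// leeD.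
  by rewrite -EFinD -EFinM lee_fin; lra.
Qed.

Lemma sobZ D (c : R) f G : measurable D -> sob D f G ->
  sob D (fun x => c * f x)%R (fun x => c *: G x)%R.
Proof.
move=> mD [mf mG hf]; split.
- by apply: measurable_funM => //; exact: measurable_cst.
- by apply: measurable_scalef => //; exact: measurable_cst.
move=> e e0; have c0 : (0 < c ^+ 2 + 1)%R by rewrite ltr_wpDl// sqr_ge0.
have e' : (0 < e / (c ^+ 2 + 1))%R by rewrite divr_gt0.
have [phi [sp h1 h2]] := hf _ e'.
have mp := measurable_fsmooth sp; have mgp := measurable_grad sp.
have fin : (c ^+ 2)%:E * (e / (c ^+ 2 + 1))%:E <= e%:E.
  rewrite -EFinM lee_fin mulrA ler_pdivrMr// mulrC ler_wpM2l ?(ltW e0)//.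
  by rewrite lerDl.
exists (fun x => c * phi x)%R; split; first exact: fsmoothZ.
- under eq_integral do rewrite -mulrBr exprMn.
  rewrite (@int_scale _ _ _ leb D (c ^+ 2)%R (fun x => (phi x - f x) ^+ 2)%R)//; last 3 first.
  + by apply: measurable_funTS; apply: measurable_funX; exact: measurable_funB.
  + exact: sqr_ge0.
  + by move=> x _; exact: sqr_ge0.
  by apply: le_trans fin; rewrite lee_wpmul2l ?lee_fin ?sqr_ge0.
- under eq_integral do rewrite gradZ// -scalerBr enormZ exprMn real_normK ?num_real//.
  rewrite (@int_scale _ _ _ leb D (c ^+ 2)%R (fun x => enorm (grad phi x - G x) ^+ 2)%R)//; last 3 first.
  + apply: measurable_funTS; apply: measurable_funX.
    exact: (measurable_enormf (measurable_addf mgp (measurable_oppf mG))).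
  + exact: sqr_ge0.
  + by move=> x _; exact: sqr_ge0.
  by apply: le_trans fin; rewrite lee_wpmul2l ?lee_fin ?sqr_ge0.
Qed.

Lemma sob_cst D (c : R) : sob D (fun _ => c) (fun _ => 0%R).
Proof.
split; [exact: measurable_cst|exact: measurable_cst|move=> e e0].
exists (fun _ => c); split; first exact: fsmooth_cst.
- under eq_integral do rewrite subrr expr0n/=.
  by rewrite integral0 lee_fin ltW.
- under eq_integral do rewrite grad_cst subrr enorm0 expr0n/=.
  by rewrite integral0 lee_fin ltW.
Qed.

Lemma sob_lim D f G : measurable D -> measurable_fun setT f -> measurable_fun setT G ->
  (forall e : R, (0 < e)%R -> exists u g, [/\ sob D u g,
    \int[leb]_(x in D) ((u x - f x) ^+ 2)%:E <= e%:E &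
    \int[leb]_(x in D) (enorm (g x - G x) ^+ 2)%:E <= e%:E]) -> sob D f G.
Proof.
move=> mD mf mG h; split => // e e0.
have e4 : (0 < e / 4)%R by rewrite divr_gt0.
have [u [g [[mu mg hu] h1 h2]]] := h _ e4; have [phi [sp h3 h4]] := hu _ e4.
have mp := measurable_fsmooth sp; have mgp := measurable_grad sp.
exists phi; split => //.
- under eq_integral => x _.
    rewrite (_ : (phi x - f x = (phi x - u x) + (u x - f x))%R); last by ring.
    over.
  apply: le_trans (int_sqD _ _ _ _) _ => //.
  + by apply: measurable_funTS; exact: measurable_funB.
  + by apply: measurable_funTS; exact: measurable_funB.
  apply: (@le_trans _ _ (2%:E * ((e / 4)%:E + (e / 4)%:E))).
    by rewrite lee_pmul2l// leeD.
  by rewrite -EFinD -EFinM lee_fin; lra.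
- under eq_integral => x _.
    rewrite (_ : (grad phi x - G x = (grad phi x - g x) + (g x - G x))%R); last first.
      by rewrite addrA subrK.
    over.
  apply: le_trans (int_vsqD _ _ _) _ => //.
  + exact: measurable_addf mgp (measurable_oppf mg).
  + exact: measurable_addf mg (measurable_oppf mG).
  apply: (@le_trans _ _ (2%:E * ((e / 4)%:E + (e / 4)%:E))).
    by rewrite lee_pmul2l// leeD.
  by rewrite -EFinD -EFinM lee_fin; lra.
Qed.

Lemma smooth1_ppart (a : R) : (0 < a)%R -> smooth1 (ppart a).
Proof. exact: smooth1_flat. Qed.

Lemma ppart_lip (a s t : R) : (0 < a)%R -> (`|ppart a s - ppart a t| <= `|s - t|)%R.
Proof.
move=> a0; wlog ts : s t / (t <= s)%R.
  by move=> h; case: (leP t s) => [/h//|/ltW /h]; rewrite distrC (distrC t).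
have [c _ ->] := @MVT_segment R (ppart a) (dppart a) t s ts
   (fun x _ => is_derive_flat 1 x a0) (continuous_subspaceT (fun x => isder_cont1 (is_derive_flat 1 x a0))).
by rewrite normrM ler_piMl// ger0_norm ?dppart_ge0// dppart_le1.
Qed.

Lemma measurable_ppart (a : R) : (0 < a)%R -> measurable_fun setT (ppart a).
Proof.
move=> a0; apply: continuous_measurable_fun => t.
exact: (isder_cont1 (is_derive_flat 1 t a0)).
Qed.

Lemma continuous_dppart (a : R) : (0 < a)%R -> continuous (dppart a).
Proof. by move=> a0 t; exact: (isder_cont1 (is_derive_flat _ t a0)). Qed.

Lemma measurable_dppart (a : R) : (0 < a)%R -> measurable_fun setT (dppart a).
Proof. by move=> a0; apply: continuous_measurable_fun; exact: continuous_dppart. Qed.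

(** Smooth phi_k with errors 2^-(k+1) converge to f almost everywhere, so [dppart a] at phi_k times
    G converges in L^2 by domination. The other part of the gradient error is grad phi_k - G times a
    factor in [0, 1]. *)
Lemma sob_ppart D (a : R) f G : measurable D -> (0 < a)%R -> sob D f G ->
  \int[leb]_(x in D) (enorm (G x) ^+ 2)%:E < +oo ->
  sob D (fun x => ppart a (f x)) (fun x => dppart a (f x) *: G x).
Proof.
move=> mD a0 [mf mG hf] Goo.
have mpf : measurable_fun setT (fun x => ppart a (f x)).
  exact: (measurableT_comp (measurable_ppart a0) mf).
have mdf : measurable_fun setT (fun x => dppart a (f x)).
  exact: (measurableT_comp (measurable_dppart a0) mf).
split => //; first exact: measurable_scalef.
move=> e e0.
have pk k : (0 < (2 ^ k.+1)%:R^-1 :> R)%R by rewrite invr_gt0 ltr0n expn_gt0.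
have /choice[phi hphi] := fun k => hf _ (pk k).
have sp k : fsmooth (phi k) by case: (hphi k).
have mp k := measurable_fsmooth (sp k); have mgp k := measurable_grad (sp k).
have ae : {ae leb, forall x, D x -> (phi k x @[k --> \oo] --> f x)%R}.
  have := @L2_ae_cvg _ _ _ leb D (fun k x => phi k x - f x)%R mD _ _.
  move=> /(_ _ _)[||N [mN N0 hN]].
  - by move=> k; apply: measurable_funTS; exact: measurable_funB.
  - by move=> k; case: (hphi k).
  exists N; split => // x /= hx; apply: hN => /= h; apply: hx => Dx.
  have hc : ((phi k x - f x) + f x @[k --> \oo] --> 0 + f x)%R.
    by apply: cvgD; [exact: h|exact: cvg_cst].
  by move: hc; under eq_fun do rewrite subrK; rewrite add0r.
have mnG := measurable_enormf mG.
have e4 : (0 < e / 4)%R by rewrite divr_gt0.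
have [||||||N1 _ hN1] := @L2_dominated _ _ R leb D (fun k x => dppart a (phi k x) * enorm (G x))%R
   (fun x => dppart a (f x) * enorm (G x))%R (fun x => enorm (G x)) mD _ _ _ _ _ _ _ e4.
- move=> k; apply: measurable_funTS; apply: measurable_funM => //.
  exact: (measurableT_comp (measurable_dppart a0) (mp k)).
- by apply: measurable_funTS; exact: measurable_funM.
- exact: measurable_funTS.
- apply: filterS ae => x h Dx; apply: cvgM; last exact: cvg_cst.
  exact: (cvg_comp _ _ (h Dx) (@continuous_dppart a a0 (f x))).
- move=> k x _; rewrite normrM ger0_norm ?dppart_ge0// ger0_norm ?enorm_ge0//.
  by rewrite ler_piMl ?enorm_ge0// dppart_le1.
- exact: Goo.
have [N2 hN2] : exists N2 : nat, forall k : nat, (N2 <= k)%N -> ((2 ^ k.+1)%:R^-1 <= e / 4 :> R)%R.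
  have := near_infty_natSinv_lt (PosNum e4).
  case => N _ h; exists N => k Nk; apply: le_trans (ltW (h k Nk)).
  rewrite lef_pV2 ?posrE ?ltr0n ?expn_gt0// ler_nat.
  by apply: ltnW; exact: ltn_expl.
pose k := maxn N1 N2.
have k1 := hN1 k (leq_maxl _ _); have k2 := hN2 k (leq_maxr _ _).
have [_ h1 h2] := hphi k.
exists (fun x => ppart a (phi k x)); split.
- by apply: fsmooth_comp => //; exact: smooth1_ppart.
- apply: (@le_trans _ _ ((2 ^ k.+1)%:R^-1)%R%:E); last first.
    by rewrite lee_fin (le_trans k2)// ler_pdivrMr// ler_peMr ?ler1n// ltW.
  apply: le_trans h1; apply: int_le => //.
  + apply: measurable_funTS; apply: measurable_funX; apply: measurable_funB => //.
    exact: (measurableT_comp (measurable_ppart a0) (mp k)).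
  + by apply: measurable_funTS; apply: measurable_funX; exact: measurable_funB.
  move=> x _; rewrite sqr_ge0/= -real_normK ?num_real// -[leRHS]real_normK ?num_real//.
  by rewrite lerXn2r ?nnegrE//; exact: ppart_lip.
- have mdp : measurable_fun setT (fun x => dppart a (phi k x)).
    exact: (measurableT_comp (measurable_dppart a0) (mp k)).
  under eq_integral => x _.
    rewrite grad_comp//; last exact: smooth1_ppart.
    rewrite derive1_ppart//.
    rewrite (_ : (dppart a (phi k x) *: grad (phi k) x - dppart a (f x) *: G x =
      dppart a (phi k x) *: (grad (phi k) x - G x) + (dppart a (phi k x) - dppart a (f x)) *: G x)%R); last first.
      by rewrite scalerBl scalerBr addrA subrK.
    over.
  apply: le_trans (int_vsqD _ _ _) _ => //.
  + by apply: measurable_scalef => //; exact: measurable_addf (mgp k) (measurable_oppf mG).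
  + by apply: measurable_scalef => //; exact: measurable_funB.
  apply: (@le_trans _ _ (2%:E * ((e / 4)%:E + (e / 4)%:E))).
    rewrite lee_pmul2l//; apply: leeD.
      apply: (@le_trans _ _ ((2 ^ k.+1)%:R^-1)%R%:E); last by rewrite lee_fin.
      apply: le_trans h2; apply: int_le => //.
      * apply: measurable_funTS; apply: measurable_funX; apply: measurable_enormf.
        by apply: measurable_scalef => //; exact: measurable_addf (mgp k) (measurable_oppf mG).
      * apply: measurable_funTS; apply: measurable_funX.
        exact: (measurable_enormf (measurable_addf (mgp k) (measurable_oppf mG))).
      move=> x _; rewrite sqr_ge0/= lerXn2r ?nnegrE ?enorm_ge0//.
      by rewrite enormZ ger0_norm ?dppart_ge0// ler_piMl ?enorm_ge0// dppart_le1.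
    apply: le_trans k1; rewrite le_eqVlt; apply/orP; left; apply/eqP.
    apply: eq_integral => x _; congr EFin.
    by rewrite enormZ exprMn real_normK ?num_real// -mulrBl exprMn -sqrrN opprB.
  by rewrite -EFinD -EFinM lee_fin; lra.
Unshelve. all: by end_near. Qed.

Definition pos_grad f (k : R) G x : 'rV[R]_n := ((k < f x)%R%:R : R) *: G x.

Lemma measurable_ltind f (k : R) : measurable_fun setT f ->
  measurable_fun setT (fun x => (k < f x)%R%:R : R).
Proof.
move=> mf; have mA : measurable [set x | (k < f x)%R].
  have := mf measurableT _ (measurable_itv `]k, +oo[); rewrite setTI.
  by congr measurable; apply/seteqP; split => x /=; rewrite in_itv/= andbT.
have := @measurable_indic _ _ R setT _ mA; congr measurable_fun.
apply/funext => x; rewrite indicE; congr (_%:R); congr nat_of_bool.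
by apply/idP/idP => [/set_mem//|?]; apply/mem_set.
Qed.

(** Let a tend to 0 in [ppart a (f - k)]: the functions converge uniformly, and D has finite
    measure; the gradients converge by domination. *)
Lemma sob_pos D (k : R) f G : measurable D -> leb D < +oo -> sob D f G ->
  \int[leb]_(x in D) (enorm (G x) ^+ 2)%:E < +oo ->
  sob D (fun x => Num.max (f x - k) 0)%R (pos_grad f k G).
Proof.
move=> mD Doo sf Goo.
have [mf mG _] := sf.
have mfk : measurable_fun setT (fun x => f x - k)%R.
  by apply: measurable_funB => //; exact: measurable_cst.
have mnG := measurable_enormf mG.
have sfk : sob D (fun x => f x - k)%R G.
  have := sobD mD sf (sob_cst D (- k)%R).
  by congr sob; apply/funext => x; rewrite addr0.
apply: sob_lim => //.
- by apply: measurable_maxr => //; exact: measurable_cst.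
- by apply: measurable_scalef => //; exact: measurable_ltind.
move=> e e0.
have [||||||N1 _ hN1] := @L2_dominated _ _ R leb D (fun j x => dppart j.+1%:R^-1 (f x - k) * enorm (G x))%R
   (fun x => (k < f x)%R%:R * enorm (G x))%R (fun x => enorm (G x)) mD _ _ _ _ _ _ _ e0.
- move=> j; apply: measurable_funTS; apply: measurable_funM => //.
  by apply: (measurableT_comp _ mfk); apply: measurable_dppart; rewrite invr_gt0.
- by apply: measurable_funTS; apply: measurable_funM => //; exact: measurable_ltind.
- exact: measurable_funTS.
- apply: aeW => x _; apply: cvgM; last exact: cvg_cst.
  by have := @dppart_cvg R (f x - k)%R; rewrite subr_gt0.
- move=> j x _; rewrite normrM ger0_norm ?dppart_ge0 ?invr_gt0// ger0_norm ?enorm_ge0//.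
  by rewrite ler_piMl ?enorm_ge0// dppart_le1 ?invr_gt0.
- exact: Goo.
have [M M0 DM] : exists2 M : R, (0 < M)%R & leb D <= M%:E.
  have fD : leb D \is a fin_num by rewrite ge0_fin_numE.
  exists (fine (leb D) + 1)%R; first by rewrite ltr_wpDl// fine_ge0.
  by rewrite EFinD fineK// leeDl.
(* The bound a <= 1 gives a^2 <= a, and a <= e / M then makes a times the measure of D at most e. *)
have eM : (0 < Num.min 1 (e / M))%R by rewrite lt_min ltr01 divr_gt0.
have [N2 hN2] : exists N2 : nat, forall j : nat, (N2 <= j)%N -> (j.+1%:R^-1 <= Num.min 1 (e / M) :> R)%R.
  have := near_infty_natSinv_lt (PosNum eM).
  by case => N _ h; exists N => j Nj; exact: ltW (h j Nj).
pose j := maxn N1 N2.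
have j1 := hN1 j (leq_maxl _ _); have j2 := hN2 j (leq_maxr _ _).
set a : R := j.+1%:R^-1%R in j1 j2.
have a0 : (0 < a)%R by rewrite invr_gt0.
move: j2; rewrite le_min => /andP[a1 aM].
exists (fun x => ppart a (f x - k)%R), (fun x => dppart a (f x - k)%R *: G x); split.
- exact: sob_ppart.
- apply: (@le_trans _ _ (\int[leb]_(x in D) (cst a x)%:E)).
    apply: int_le => //.
      apply: measurable_funTS; apply: measurable_funX; apply: measurable_funB.
        exact: (measurableT_comp (measurable_ppart a0) mfk).
      by apply: measurable_maxr => //; exact: measurable_cst.
    move=> x _; rewrite sqr_ge0/= -real_normK ?num_real//.
    apply: (@le_trans _ _ (a ^+ 2)%R).
      by rewrite lerXn2r ?nnegrE ?(ltW a0)//; exact: ppart_dist.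
    by rewrite expr2 ler_piMl// ltW.
  rewrite (integral_cst leb mD a%:E).
  apply: (@le_trans _ _ (a%:E * M%:E)); first by rewrite lee_pmul2l// lte_fin.
  by rewrite -EFinM lee_fin -ler_pdivlMr.
- apply: le_trans j1; rewrite le_eqVlt; apply/orP; left; apply/eqP.
  apply: eq_integral => x _; congr EFin.
  by rewrite /pos_grad -scalerBl enormZ exprMn real_normK ?num_real// -mulrBl exprMn -sqrrN opprB.
Qed.

End sobolev_calculus.

(** The constant is (2 Lam^2 / lam) (2 r)^2 divided by (lam / 2) s0^2, where s0 is a lower bound of
    the cut-off on the inner ball and 2 r an upper bound of its gradient. For s0 = r (r - rho) / 2
    the radius r cancels and 64 remains. *)
Lemma cacc_arith (R : realType) (lam Lam r rho s0 : R) (a b t1 t2 : \bar R) :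
  0 < lam -> rho < r -> 0 < r -> s0 = r * (r - rho) / 2 -> 0 < s0 ->
  ((s0 ^+ 2)%:E * a <= t1 -> t2 <= ((2 * r) ^+ 2)%:E * b ->
   (lam / 2)%:E * t1 <= (2 * Lam ^+ 2 / lam)%:E * t2 ->
   a <= (64 * Lam ^+ 2 / lam ^+ 2 / (r - rho) ^+ 2)%:E * b)%E.
Proof.
move=> l0 pr r_gt0 s0E s00 L1 L2 L3.
have lam2 : 0 < lam / 2 by rewrite divr_gt0.
have C0 : 0 <= 2 * Lam ^+ 2 / lam.
  by apply: divr_ge0; [apply: mulr_ge0 => //; exact: sqr_ge0|exact: ltW].
have K0 : 0 < lam / 2 * s0 ^+ 2 by apply: mulr_gt0 => //; exact: exprn_gt0.
have rr : r - rho != 0 by rewrite gt_eqF// subr_gt0.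
rewrite -(@lee_pmul2l _ (lam / 2 * s0 ^+ 2)%:E)// ?lte_fin//.
rewrite EFinM -muleA; apply: le_trans (lee_wpmul2l _ L1) _; first by rewrite lee_fin ltW.
apply: le_trans L3 _; apply: le_trans (lee_wpmul2l _ L2) _; first by rewrite lee_fin.
rewrite !muleA -!EFinM le_eqVlt; apply/orP; left; apply/eqP; congr (_%:E * _)%E.
rewrite s0E; field.
by rewrite rr gt_eqF.
Qed.

(** * The Caccioppoli inequality *)

Section caccioppoli.
Context {R : realType} {n : nat}.
Implicit Types (f u phi : 'rV[R]_n -> R) (g G F : 'rV[R]_n -> 'rV[R]_n) (D : set 'rV[R]_n).
Local Notation leb := (lebesgue_rV R n).

Lemma cacc_bound (lam Lam X Y : R) : 0 < lam ->
  lam / 2 * X ^+ 2 <= 2 * Lam ^+ 2 / lam * Y ^+ 2 + (lam * X ^+ 2 - 2 * Lam * X * Y).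
Proof.
move=> l0; have := mulr_ge0 (ltW (divr_gt0 l0 (ltr0n R 2))) (sqr_ge0 (X - 2 * Lam / lam * Y)).
have -> : lam / 2 * (X - 2 * Lam / lam * Y) ^+ 2 =
  lam / 2 * X ^+ 2 - 2 * Lam * X * Y + 2 * Lam ^+ 2 / lam * Y ^+ 2.
  by field; rewrite gt_eqF.
by lra.
Qed.

(** Young's inequality with a free parameter: a^2 has a merely finite integral, which eta makes
    small, and p and q are made small afterwards for fixed eta. *)
Lemma err_bound (eta a p q : R) : 0 < eta ->
  a * (p + q) <= eta * a ^+ 2 + eta^-1 * (p ^+ 2 + q ^+ 2).
Proof.
move=> e0; have h := mulr_ge0 (ltW e0) (sqr_ge0 (a - (p + q) / (2 * eta))).
have E : eta * (a - (p + q) / (2 * eta)) ^+ 2 =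
  eta * a ^+ 2 - a * (p + q) + eta^-1 * ((p + q) ^+ 2 / 4) by field; rewrite gt_eqF.
have h2 : eta^-1 * ((p + q) ^+ 2 / 4) <= eta^-1 * (p ^+ 2 + q ^+ 2).
  rewrite ler_wpM2l ?invr_ge0 ?(ltW e0)//.
  by have := sqr_ge0 (p - q); have := sqr_ge0 (p + q); rewrite !expr2; lra.
by move: h; rewrite E; lra.
Qed.

(* The integrand of the weak formulation tested with chi^2 * phi, compared with
   the energy density of the truncation (f, G); t, S and phi - f are the errors
   made by replacing the truncation by a smooth approximation phi. *)
Lemma cacc_pointwise (lam Lam eta chi f phi c gG t a P Qd S : R) :
  0 < lam -> 0 <= Lam -> 0 < eta -> 0 <= chi -> 0 <= f -> 0 <= c -> 0 <= gG -> 0 <= t -> 0 <= a ->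
  (f = 0 /\ P = 0 /\ gG = 0 \/ a <= Lam * gG /\ lam * gG ^+ 2 <= P) ->
  `|Qd| <= a * c -> `|S| <= a * t ->
  lam / 2 * (chi ^+ 2 * gG ^+ 2) <=
    2 * Lam ^+ 2 / lam * (c ^+ 2 * f ^+ 2) + (2 * chi * phi * Qd + chi ^+ 2 * (P + S)) +
    (eta * a ^+ 2 + eta^-1 * ((2 * chi * c * (phi - f)) ^+ 2 + (chi ^+ 2 * t) ^+ 2)).
Proof.
move=> l0 L0 e0 x0 f0 c0 g0 t0 a0 hP hQ hS.
have h1 : lam / 2 * (chi ^+ 2 * gG ^+ 2) <=
    2 * Lam ^+ 2 / lam * (c ^+ 2 * f ^+ 2) + (2 * chi * f * Qd + chi ^+ 2 * P).
  case: hP => [[-> [-> ->]]|[ha hP]]; first by rewrite !expr0n/= !(mulr0, mul0r, addr0).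
  have := cacc_bound Lam (chi * gG) (f * c) l0.
  have hq : - (2 * Lam * (chi * gG) * (f * c)) <= 2 * chi * f * Qd.
    rewrite -(opprK (2 * chi * f * Qd)) lerN2 -mulrN.
    apply: (@le_trans _ _ (2 * chi * f * (a * c))).
      rewrite ler_wpM2l ?mulr_ge0//; apply: le_trans hQ; by rewrite -normrN ler_norm.
    apply: (@le_trans _ _ (2 * chi * f * (Lam * gG * c))); last by rewrite le_eqVlt; apply/orP; left; apply/eqP; ring.
    by rewrite ler_wpM2l ?mulr_ge0// ler_wpM2r.
  have hp : lam * (chi * gG) ^+ 2 <= chi ^+ 2 * P.
    by rewrite exprMn mulrCA ler_wpM2l ?sqr_ge0.
  by rewrite !exprMn [f ^+ 2 * _]mulrC; lra.
have h2 := err_bound a (2 * chi * c * `|phi - f|) (chi ^+ 2 * t) e0.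
have h3 : - (a * (2 * chi * c * `|phi - f| + chi ^+ 2 * t)) <= 2 * chi * (phi - f) * Qd + chi ^+ 2 * S.
  have i1 : - (2 * chi * `|phi - f| * (a * c)) <= 2 * chi * (phi - f) * Qd.
    rewrite lerNl; apply: le_trans (ler_norm _) _; rewrite normrN !normrM.
    rewrite (ger0_norm (ler0n R 2)) (ger0_norm x0) -!mulrA !ler_wpM2l// mulrC ler_wpM2r//.
  have i2 : - (chi ^+ 2 * (a * t)) <= chi ^+ 2 * S.
    rewrite lerNl -mulrN ler_wpM2l ?sqr_ge0//; apply: le_trans hS; by rewrite -normrN ler_norm.
  by lra.
have E : (2 * chi * c * `|phi - f|) ^+ 2 = (2 * chi * c * (phi - f)) ^+ 2.
  by rewrite exprMn real_normK ?num_real// -exprMn.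
have id : 2 * chi * phi * Qd + chi ^+ 2 * (P + S) =
  (2 * chi * f * Qd + chi ^+ 2 * P) + (2 * chi * (phi - f) * Qd + chi ^+ 2 * S) by ring.
rewrite id; move: h1 h2 h3; rewrite E; set A := a * _; set W := eta * _ + _.
set X1 := 2 * chi * f * Qd + _; set X2 := 2 * chi * (phi - f) * Qd + _.
set Z := 2 * Lam ^+ 2 / lam * _; set Y := lam / 2 * _.
lra.
Qed.

(** F stands for the flux A grad u: the equation says that F has zero divergence. *)
Definition weak_sol (x0 : 'rV[R]_n) (r0 : R) F := forall phi (y : 'rV[R]_n) (r : R),
  fsmooth phi -> (forall x, out_ball y r x -> phi x = 0) ->
  [set x | enorm (x - y) <= r] `<=` eball x0 r0 ->
  \int[leb]_(x in eball x0 r0) dotv (F x) (grad phi x) = 0.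

(** A smoothed positive part of r^2 - |x - y|^2, with values in [0, r^2] and gradient at most 2 r.
    It is not normalized to 1 inside; its positive lower bound on smaller balls, [cutoff_lower], is
    carried in the estimates instead. *)
Definition cutoff (y : 'rV[R]_n) (r a : R) x := ppart a (r ^+ 2 - enorm (x - y) ^+ 2).

Lemma cutoff_fsmooth y r a : 0 < a -> fsmooth (cutoff y r a).
Proof.
move=> a0; apply: fsmooth_comp; first exact: smooth1_ppart.
by apply: fsmoothB; [exact: fsmooth_cst|exact: fsmooth_sqdist].
Qed.

Lemma cutoff_out y r a x : 0 < r -> out_ball y r x -> cutoff y r a x = 0.
Proof.
move=> r0 xr; rewrite /cutoff ppart_le0// subr_le0 lerXn2r ?nnegrE ?enorm_ge0 ?(ltW r0)//.
exact: ltW.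
Qed.

Lemma cutoff_ge0 y r a x : 0 <= cutoff y r a x.
Proof. exact: ppart_ge0. Qed.

Lemma ppart_le (a s : R) : 0 < a -> ppart a s <= Num.max s 0.
Proof.
move=> a0; rewrite ppartE; case: ifPn => s0; last by rewrite le_max lexx orbT.
rewrite max_l ?(ltW s0)// ler_piMr ?(ltW s0)// expR_le1 mulNr oppr_le0.
by rewrite mulr_ge0// ?invr_ge0 ltW.
Qed.

Lemma ppart_ge (a s : R) : 0 < a -> s - a <= ppart a s.
Proof.
move=> a0; have := ppart_dist s a0; rewrite ler_distl => /andP[h _]; apply: le_trans h.
by rewrite lerD2r le_max lexx.
Qed.

Lemma cutoff_le y r a x : 0 < a -> cutoff y r a x <= r ^+ 2.
Proof.
move=> a0; apply: le_trans (ppart_le _ a0) _.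
by rewrite ge_max sqr_ge0 andbT gerBl sqr_ge0.
Qed.

(** On the inner ball r^2 - |x - y|^2 is at least r (r - rho), twice the smoothing parameter, and
    smoothing costs at most the parameter itself. *)
Lemma cutoff_lower y r rho x : 0 < rho -> rho < r -> enorm (x - y) < rho ->
  r * (r - rho) / 2 <= cutoff y r (r * (r - rho) / 2) x.
Proof.
move=> p0 pr xr; have r0 := lt_trans p0 pr.
have a0 : 0 < r * (r - rho) / 2 by rewrite divr_gt0// mulr_gt0// subr_gt0.
apply: le_trans (ppart_ge _ a0).
have : enorm (x - y) ^+ 2 <= rho * r.
  apply: (@le_trans _ _ (rho * rho)); last by rewrite ler_wpM2l ?ltW.
  by rewrite -expr2 lerXn2r ?nnegrE ?enorm_ge0// ltW.
by rewrite expr2; lra.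
Qed.

Lemma grad_cutoff_le y r a x : 0 < a -> 0 < r -> enorm (grad (cutoff y r a) x) <= 2 * r.
Proof.
move=> a0 r0; have [xr|xr] := ltP r (enorm (x - y)).
  rewrite (grad_vanish (x := y) (r := r)) ?enorm0 ?mulr_ge0 ?ltW//.
  by move=> z; exact: cutoff_out.
have sq : fsmooth (fun x => r ^+ 2 - enorm (x - y) ^+ 2).
  by apply: fsmoothB; [exact: fsmooth_cst|exact: fsmooth_sqdist].
rewrite grad_comp//; last exact: smooth1_ppart.
rewrite derive1_ppart// enormZ ger0_norm ?dppart_ge0//.
apply: (@le_trans _ _ (enorm (grad (fun x => r ^+ 2 - enorm (x - y) ^+ 2) x))).
  by rewrite ler_piMl ?enorm_ge0// dppart_le1.
have -> : (fun x => r ^+ 2 - enorm (x - y) ^+ 2) = (fun x => r ^+ 2 + (- 1) * enorm (x - y) ^+ 2).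
  by apply/funext => z; rewrite mulN1r.
rewrite gradD; [|exact: fsmooth_cst|by apply: fsmoothZ; exact: fsmooth_sqdist].
rewrite grad_cst add0r gradZ; last exact: fsmooth_sqdist.
by rewrite grad_sqdist !enormZ normrN1 mul1r ger0_norm// ler_wpM2l.
Qed.

(** The truncation f is not a test function, so the equation is tested with chi^2 phi for a smooth
    phi close to f. Integrating [cacc_pointwise] gives the inequality up to errors that disappear in
    the limit; the equation removes the term containing the gradient of chi^2 phi. *)
Lemma caccioppoli (x0 : 'rV[R]_n) (r0 lam Lam : R) u g F :
  0 < lam -> 0 <= Lam -> measurable_fun setT F -> sob (eball x0 r0) u g ->
  (\int[leb]_(x in eball x0 r0) (u x ^+ 2)%:E < +oo)%E ->
  (\int[leb]_(x in eball x0 r0) (enorm (g x) ^+ 2)%:E < +oo)%E ->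
  (forall x, eball x0 r0 x -> lam * enorm (g x) ^+ 2 <= dotv (F x) (g x)) ->
  (forall x, eball x0 r0 x -> enorm (F x) <= Lam * enorm (g x)) ->
  weak_sol x0 r0 F ->
  forall (k : R) y rho r, 0 < rho -> rho < r -> [set x | enorm (x - y) <= r] `<=` eball x0 r0 ->
  (\int[leb]_(x in eball y rho) (enorm (pos_grad u k g x) ^+ 2)%:E <=
   (64 * Lam ^+ 2 / lam ^+ 2 / (r - rho) ^+ 2)%:E *
   \int[leb]_(x in eball y r) (Num.max (u x - k) 0 ^+ 2)%:E)%E.
Proof.
move=> l0 L0 mF su u2 g2 hlam hLam hw k y rho r p0 pr sub.
have r_gt0 := lt_trans p0 pr.
set D := eball x0 r0 in su u2 g2 hlam hLam sub *.
have mD : measurable D by exact: measurable_eball.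
have Doo : (leb D < +oo)%E.
  apply: (@le_lt_trans _ _ (leb (eball x0 (Num.max r0 1)))).
    apply: le_measure; rewrite ?inE//; first exact: measurable_eball.
    by apply: eball_subr; rewrite le_max lexx.
  by apply: le_lt_trans (lebesgue_eball_le _ _) _; rewrite ?ltry// lt_max ltr01 orbT.
have [mu mg _] := su.
set f := fun x => Num.max (u x - k) 0; set G := pos_grad u k g.
have sf : sob D f G by exact: sob_pos.
have [mf mG hf] := sf.
have mfn := measurable_enormf mF; have mgn := measurable_enormf mg; have mGn := measurable_enormf mG.
pose s0 := r * (r - rho) / 2.
have s00 : 0 < s0 by rewrite divr_gt0// mulr_gt0// subr_gt0.
pose chi := cutoff y r s0.
have schi : fsmooth chi by exact: cutoff_fsmooth.
have mchi := measurable_fsmooth schi; have mgchi := measurable_grad schi.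
have mc := measurable_enormf mgchi.
have f0 x : 0 <= f x by rewrite le_max lexx orbT.
have chi0 x : 0 <= chi x by exact: cutoff_ge0.
have chir x : `|chi x| <= r ^+ 2 by rewrite ger0_norm//; exact: cutoff_le.
have c2r x : enorm (grad chi x) <= 2 * r by exact: grad_cutoff_le.
have c2r' x : `|enorm (grad chi x)| <= 2 * r by rewrite ger0_norm ?enorm_ge0.
have Gg x : enorm (G x) <= enorm (g x).
  rewrite /G /pos_grad enormZ; case: (k < u x); first by rewrite normr1 mul1r.
  by rewrite normr0 mul0r enorm_ge0.
have G2 : (\int[leb]_(x in D) (enorm (G x) ^+ 2)%:E < +oo)%E.
  apply: le_lt_trans g2; apply: int_le => //; try by apply: measurable_funTS; exact: measurable_funX.
  by move=> x _; rewrite sqr_ge0/= lerXn2r ?nnegrE ?enorm_ge0.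
have F2 : (\int[leb]_(x in D) (enorm (F x) ^+ 2)%:E < +oo)%E.
  apply: (@le_lt_trans _ _ (\int[leb]_(x in D) (Lam ^+ 2 * enorm (g x) ^+ 2)%:E)%E).
    apply: int_le => //.
    - by apply: measurable_funTS; exact: measurable_funX.
    - by apply: measurable_funTS; apply: measurable_funM; [exact: measurable_cst|exact: measurable_funX].
    move=> x Dx; rewrite sqr_ge0/= -exprMn lerXn2r ?nnegrE ?mulr_ge0 ?enorm_ge0//; exact: hLam.
  rewrite int_scale ?sqr_ge0//.
  - by rewrite lte_mul_pinfty// ?lee_fin ?sqr_ge0.
  - by apply: measurable_funTS; exact: measurable_funX.
  - by move=> x _; exact: sqr_ge0.
have f2 : (\int[leb]_(x in D) (f x ^+ 2)%:E < +oo)%E.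
  apply: (@le_lt_trans _ _ (\int[leb]_(x in D) ((u x + cst (- k) x) ^+ 2)%:E)%E).
    apply: int_le => //.
    - by apply: measurable_funTS; exact: measurable_funX.
    - by apply: measurable_funTS; apply: measurable_funX; apply: measurable_funD => //; exact: measurable_cst.
    move=> x _; rewrite sqr_ge0/= /f maxEle; case: ifPn => // _; rewrite expr0n/= sqr_ge0//.
  apply: le_lt_trans (int_sqD _ _ _ _) _ => //.
  - exact: measurable_funTS.
  rewrite lte_mul_pinfty//.
  rewrite lte_add_pinfty//.
  rewrite (integral_cst leb mD ((- k) ^+ 2)%:E) lte_mul_pinfty// ?lee_fin ?sqr_ge0//.
pose T1 x := chi x ^+ 2 * enorm (G x) ^+ 2.
pose T2 x := enorm (grad chi x) ^+ 2 * f x ^+ 2.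
have mT1 : measurable_fun setT T1 by apply: measurable_funM; exact: measurable_funX.
have mT2 : measurable_fun setT T2 by apply: measurable_funM; exact: measurable_funX.
have iT1 : leb.-integrable D (EFin \o T1).
  rewrite (_ : T1 = fun x => enorm (G x) ^+ 2 * chi x ^+ 2); last by apply/funext => x; rewrite mulrC.
  apply: (@integrable_mulb _ _ _ leb D _ _ (r ^+ 2 ^+ 2)) => //.
  - by apply: measurable_funTS; exact: measurable_funX.
  - by move=> x _; rewrite normrX lerXn2r ?nnegrE ?sqr_ge0.
  - apply: sq_integrable_sq => //; exact: measurable_funTS.
have iT2 : leb.-integrable D (EFin \o T2).
  rewrite (_ : T2 = fun x => f x ^+ 2 * enorm (grad chi x) ^+ 2); last by apply/funext => x; rewrite mulrC.
  apply: (@integrable_mulb _ _ _ leb D _ _ ((2 * r) ^+ 2)) => //.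
  - by apply: measurable_funTS; exact: measurable_funX.
  - by move=> x _; rewrite normrX lerXn2r ?nnegrE ?mulr_ge0 ?(ltW r_gt0).
  - apply: sq_integrable_sq => //; exact: measurable_funTS.
have iT3 : leb.-integrable D (EFin \o (fun x => enorm (F x) ^+ 2)).
  by apply: sq_integrable_sq => //; exact: measurable_funTS.
set A3 := \int[leb]_(x in D) (enorm (F x) ^+ 2).
(* M dominates the squares of 2 chi |grad chi| <= 4 r^3 and of chi^2 <= r^4, the factors of the
   approximation errors in [cacc_pointwise]. *)
pose M := (4 * r ^+ 3) ^+ 2 + (r ^+ 4) ^+ 2.
have main (eta e : R) : 0 < eta -> 0 < e ->
  lam / 2 * \int[leb]_(x in D) T1 x <= 2 * Lam ^+ 2 / lam * \int[leb]_(x in D) T2 x +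
    (eta * A3 + eta^-1 * (M * (e + e))).
  move=> eta0 e0; have [phi [sp h1 h2]] := hf e e0.
  have mp := measurable_fsmooth sp; have mgp := measurable_grad sp.
  pose T4 x := (phi x - f x) ^+ 2; pose T5 x := enorm (grad phi x - G x) ^+ 2.
  have mpf : measurable_fun setT (fun x => phi x - f x) by exact: measurable_funB.
  have mpg : measurable_fun setT (fun x => enorm (grad phi x - G x)).
    exact: (measurable_enormf (measurable_addf mgp (measurable_oppf mG))).
  have iT4 : leb.-integrable D (EFin \o T4).
    apply: sq_integrable_sq => //; first exact: measurable_funTS.
    exact: le_lt_trans h1 (ltry _).
  have iT5 : leb.-integrable D (EFin \o T5).
    apply: sq_integrable_sq => //; first exact: measurable_funTS.
    exact: le_lt_trans h2 (ltry _).
  have I4 : \int[leb]_(x in D) T4 x <= e.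
    by rewrite -lee_fin /Rintegral fineK//; exact: integrable_fin_num iT4.
  have I5 : \int[leb]_(x in D) T5 x <= e.
    by rewrite -lee_fin /Rintegral fineK//; exact: integrable_fin_num iT5.
  pose zeta x := chi x * (chi x * phi x).
  have sz : fsmooth zeta by apply: fsmoothM => //; exact: fsmoothM.
  have gz x : grad zeta x = (2 * chi x * phi x) *: grad chi x + (chi x ^+ 2) *: grad phi x.
    rewrite (gradM x schi (fsmoothM schi sp)) (gradM x schi sp); apply/rowP => i; rewrite !mxE; ring.
  pose T6 x := dotv (F x) (grad zeta x).
  have I6 : \int[leb]_(x in D) T6 x = 0.
    apply: (hw zeta y r) => // x xr; by rewrite /zeta /chi cutoff_out// mul0r.
  have zr x : out_ball y r x -> zeta x = 0 by move=> xr; rewrite /zeta /chi cutoff_out// mul0r.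
  have [M6 M60 hM6] := grad_bounded sz zr.
  have iT6 : leb.-integrable D (EFin \o T6).
    have iF : leb.-integrable D (EFin \o (fun x => enorm (F x) * M6)).
      apply: (@integrable_mulb _ _ _ leb D _ (fun _ => M6) M6) => //.
        by move=> x _; rewrite ger0_norm.
      by apply: sq_integrable => //; exact: measurable_funTS.
    apply: le_integrable iF => //.
      by apply/measurable_EFinP; apply: measurable_funTS; apply: measurable_dotvf => //; exact: measurable_grad.
    move=> x _; rewrite /= lee_fin [leRHS]ger0_norm ?mulr_ge0 ?enorm_ge0//.
    by apply: le_trans (dotv_le _ _) _; rewrite ler_wpM2l ?enorm_ge0.
  have pw x : D x -> lam / 2 * T1 x <= (2 * Lam ^+ 2 / lam * T2 x + T6 x) +
     (eta * enorm (F x) ^+ 2 + eta^-1 * M * (T4 x + T5 x)).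
    move=> Dx.
    (* Where u > k the truncated gradient is g and the ellipticity bounds hold; elsewhere f and its
       gradient both vanish. *)
    have hP : f x = 0 /\ dotv (F x) (G x) = 0 /\ enorm (G x) = 0 \/
       enorm (F x) <= Lam * enorm (G x) /\ lam * enorm (G x) ^+ 2 <= dotv (F x) (G x).
      rewrite /G /pos_grad /f; case: (ltP k (u x)) => ku.
        by right; rewrite scale1r; split; [exact: hLam|exact: hlam].
      by left; rewrite scale0r dotv0r enorm0 max_r// subr_le0.
    have hQ := dotv_le (F x) (grad chi x).
    have hS := dotv_le (F x) (grad phi x - G x).
    have := @cacc_pointwise lam Lam eta (chi x) (f x) (phi x) (enorm (grad chi x))
      (enorm (G x)) (enorm (grad phi x - G x)) (enorm (F x)) (dotv (F x) (G x))
      (dotv (F x) (grad chi x)) (dotv (F x) (grad phi x - G x))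
      l0 L0 eta0 (chi0 x) (f0 x) (enorm_ge0 _) (enorm_ge0 _) (enorm_ge0 _) (enorm_ge0 _) hP hQ hS.
    have ES : dotv (F x) (G x) + dotv (F x) (grad phi x - G x) = dotv (F x) (grad phi x).
      by rewrite -dotvDr addrC subrK.
    have EZ : dotv (F x) (grad zeta x) = 2 * chi x * phi x * dotv (F x) (grad chi x) +
        chi x ^+ 2 * dotv (F x) (grad phi x) by rewrite gz dotvDr !dotvZr.
    rewrite ES => h; rewrite /T1 /T2 /T6 EZ; apply: le_trans h _; rewrite !lerD2l -(mulrA eta^-1 M) ler_wpM2l ?invr_ge0 ?(ltW eta0)//.
    rewrite (mulrDr M); apply: lerD.
      rewrite exprMn ler_wpM2r ?sqr_ge0//; apply: (@le_trans _ _ ((4 * r ^+ 3) ^+ 2)); last by rewrite lerDl sqr_ge0.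
      rewrite lerXn2r ?nnegrE ?mulr_ge0 ?enorm_ge0 ?exprn_ge0 ?(ltW r_gt0)//.
      have -> : 4 * r ^+ 3 = 2 * r ^+ 2 * (2 * r) by ring.
      apply: ler_pM => //; rewrite ?mulr_ge0 ?enorm_ge0//.
      by rewrite ler_wpM2l// (le_trans (ler_norm _)).
    rewrite exprMn ler_wpM2r ?sqr_ge0//; apply: (@le_trans _ _ ((r ^+ 4) ^+ 2)); last by rewrite lerDr sqr_ge0.
    rewrite lerXn2r ?nnegrE ?sqr_ge0 ?exprn_ge0 ?(ltW r_gt0)//.
    have -> : r ^+ 4 = (r ^+ 2) ^+ 2 by ring.
    by rewrite lerXn2r ?nnegrE ?sqr_ge0// (le_trans (ler_norm _)).
  have iZ c h : leb.-integrable D (EFin \o h) -> leb.-integrable D (EFin \o (fun x => c * h x)).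
    by move=> ih; exact: (integrableZl mD c ih).
  have iA h h' : leb.-integrable D (EFin \o h) -> leb.-integrable D (EFin \o h') ->
     leb.-integrable D (EFin \o (fun x => h x + h' x)).
    by move=> ih ih'; exact: (integrableD mD ih ih').
  have := le_Rintegral mD (iZ _ _ iT1) (iA _ _ (iA _ _ (iZ (2 * Lam ^+ 2 / lam) _ iT2) iT6)
     (iA _ _ (iZ eta _ iT3) (iZ (eta^-1 * M) _ (iA _ _ iT4 iT5)))) pw.
  rewrite RintegralZl// RintegralD//; last 2 first.
  - exact: iA _ _ (iZ _ _ iT2) iT6.
  - exact: iA _ _ (iZ _ _ iT3) (iZ _ _ (iA _ _ iT4 iT5)).
  rewrite RintegralD//; [|exact: iZ].
  rewrite I6 addr0 RintegralZl//.
  rewrite RintegralD//; [|exact: iZ|by apply: iZ; exact: iA].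
  rewrite RintegralZl// RintegralZl//; [|exact: iA].
  rewrite RintegralD//.
  move=> h; apply: le_trans h _; rewrite lerD2l lerD2l -(mulrA eta^-1 M) ler_wpM2l ?invr_ge0 ?(ltW eta0)//.
  rewrite ler_wpM2l ?lerD//.
  by rewrite addr_ge0 ?sqr_ge0.
have A30 : 0 <= A3 by apply: Rintegral_ge0 => x _; exact: sqr_ge0.
have M0 : 0 <= M by rewrite addr_ge0 ?sqr_ge0.
have lim : lam / 2 * \int[leb]_(x in D) T1 x <= 2 * Lam ^+ 2 / lam * \int[leb]_(x in D) T2 x.
  apply/ler_addgt0Pl => e e0.
  (* eta is fixed first, so that eta A3 is at most e / 2; the accuracy e' of the approximation is
     chosen afterwards, against eta^-1. The summands 1 keep the denominators positive. *)
  pose eta := e / 2 / (A3 + 1).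
  have eta0 : 0 < eta by rewrite !divr_gt0// ltr_wpDl.
  pose e' := e / 2 * eta / (2 * (M + 1)).
  have M1 : 0 < M + 1 by rewrite ltr_wpDl.
  have e'0 : 0 < e' by apply: divr_gt0; apply: mulr_gt0 => //; exact: divr_gt0.
  apply: le_trans (main eta e' eta0 e'0) _; rewrite addrC lerD2r.
  have i1 : eta * A3 <= e / 2.
    rewrite /eta -mulrA ler_piMr ?divr_ge0 ?(ltW e0)// mulrC ler_pdivrMr ?ltr_wpDl// mul1r.
    by rewrite lerDl.
  have i2 : eta^-1 * (M * (e' + e')) <= e / 2.
    have -> : eta^-1 * (M * (e' + e')) = e / 2 * (M / (M + 1)).
      by rewrite /e'; clearbody eta M; field; rewrite !gt_eqF.
    rewrite ler_piMr ?divr_ge0 ?(ltW e0)// ler_pdivrMr// mul1r.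
    by rewrite lerDl.
  by apply: le_trans (lerD i1 i2) _; rewrite -splitr.
have subr : eball y r `<=` D by move=> x /ltW; exact: sub.
have subp : eball y rho `<=` D by move=> x xp; apply: subr; exact: lt_trans pr.
have mrho := @measurable_eball R n y rho; have mr := @measurable_eball R n y r.
have fT1 : \int[leb]_(x in D) T1 x = fine (\int[leb]_(x in D) (T1 x)%:E)%E by [].
have ET1 : (\int[leb]_(x in D) (T1 x)%:E = (\int[leb]_(x in D) T1 x)%:E)%E.
  by rewrite fT1 fineK//; exact: integrable_fin_num iT1.
have ET2 : (\int[leb]_(x in D) (T2 x)%:E = (\int[leb]_(x in D) T2 x)%:E)%E.
  by rewrite /Rintegral fineK//; exact: integrable_fin_num iT2.
have T10 x : 0 <= T1 x by rewrite mulr_ge0 ?sqr_ge0.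
have T20 x : 0 <= T2 x by rewrite mulr_ge0 ?sqr_ge0.
have L1 : ((s0 ^+ 2)%:E * \int[leb]_(x in eball y rho) (enorm (G x) ^+ 2)%:E <=
    \int[leb]_(x in D) (T1 x)%:E)%E.
  apply: (@le_trans _ _ (\int[leb]_(x in eball y rho) (T1 x)%:E)%E); last first.
    by apply: int_sub => //; exact: measurable_funTS.
  have mG2 : measurable_fun setT (fun x => enorm (G x) ^+ 2) by exact: measurable_funX.
  rewrite -(@int_scale _ _ _ leb _ (s0 ^+ 2) (fun x => enorm (G x) ^+ 2) mrho (measurable_funTS mG2) (sqr_ge0 _) (fun x _ => sqr_ge0 _)).
  apply: int_le => //.
  - by apply: measurable_funTS; apply: measurable_funM; [exact: measurable_cst|exact: measurable_funX].
  - exact: measurable_funTS.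
  move=> x xp; rewrite mulr_ge0 ?sqr_ge0//= ler_wpM2r ?sqr_ge0//.
  by rewrite lerXn2r ?nnegrE ?(ltW s00)//; exact: cutoff_lower.
have L2 : (\int[leb]_(x in D) (T2 x)%:E <=
    ((2 * r) ^+ 2)%:E * \int[leb]_(x in eball y r) (f x ^+ 2)%:E)%E.
  have mf2 : measurable_fun setT (fun x => f x ^+ 2) by exact: measurable_funX.
  rewrite -(@int_scale _ _ _ leb _ ((2 * r) ^+ 2) (fun x => f x ^+ 2) mr (measurable_funTS mf2) (sqr_ge0 _) (fun x _ => sqr_ge0 _)).
  have mh : measurable_fun setT (fun x => (2 * r) ^+ 2 * f x ^+ 2 * \1_(eball y r) x).
    apply: measurable_funM; last exact: measurable_indic.
    by apply: measurable_funM; [exact: measurable_cst|exact: mf2].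
  have h0 x : 0 <= (2 * r) ^+ 2 * f x ^+ 2 * \1_(eball y r) x 
    by apply: mulr_ge0; [apply: mulr_ge0; exact: sqr_ge0|rewrite indicE ler0n].
  rewrite (@int_mkcond _ _ _ leb _ (fun x => (2 * r) ^+ 2 * f x ^+ 2) mr).
  apply: (le_trans _ (@int_sub _ _ _ leb D setT _ mD measurableT mh (fun x _ => h0 x) (@subsetT _ _))).
  apply: int_le => //; [exact: measurable_funTS|exact: measurable_funTS|].
  move=> x _; rewrite T20/=; have [xr|xr] := pselect (eball y r x).
    rewrite indicE (mem_set xr) mulr1 ler_wpM2r ?sqr_ge0//.
    by rewrite lerXn2r ?nnegrE ?enorm_ge0 ?mulr_ge0 ?(ltW r_gt0).
  rewrite indicE (memNset xr) mulr0 /T2.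
  (* The gradient also vanishes on the sphere |x - y| = r, where [dppart] is read at 0; hence the
     integral over the open ball suffices. *)
  suff -> : grad chi x = 0 by rewrite enorm0 expr0n/= mul0r.
  have xr' : r <= enorm (x - y) by move/negP: xr; rewrite -leNgt.
  rewrite /chi /cutoff grad_comp//; last 2 first.
  - exact: smooth1_ppart.
  - by apply: fsmoothB; [exact: fsmooth_cst|exact: fsmooth_sqdist].
  rewrite derive1_ppart// dppartE ifF ?scale0r//.
  apply/negbTE; rewrite -leNgt subr_le0 lerXn2r ?nnegrE ?enorm_ge0 ?(ltW r_gt0)//.
have L3 : ((lam / 2)%:E * \int[leb]_(x in D) (T1 x)%:E <=
   (2 * Lam ^+ 2 / lam)%:E * \int[leb]_(x in D) (T2 x)%:E)%E.
  by rewrite ET1 ET2 -!EFinM lee_fin.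
exact: (cacc_arith l0 pr r_gt0 _ s00 L1 L2 L3).
Qed.

End caccioppoli.

(** * Difference quotients controlled by gradients *)

Section segments.
Context {R : realType} {n : nat}.
Implicit Types (f phi h : 'rV[R]_n -> R) (G : 'rV[R]_n -> 'rV[R]_n) (x y z : 'rV[R]_n) (Q D : set 'rV[R]_n).
Local Notation leb := (lebesgue_rV R n).
Local Notation mu := (@lebesgue_measure R).

(** The uniform density on [0, 1]: integrals over a segment become integrals over the whole line, in
    the form used by [Rint_jensen] and by Tonelli's theorem. *)
Definition unit_itv (t : R) : R := \1_(`[0, 1]%classic : set R) t.

Lemma unit_itv_ge0 t : 0 <= unit_itv t.
Proof. by rewrite /unit_itv indicE. Qed.

Lemma measurable_unit_itv : measurable_fun [set: measurableTypeR R] (unit_itv : measurableTypeR R -> R).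
Proof. by apply: measurable_indic; exact: measurable_itv. Qed.

Lemma int_unit_itv : (\int[mu]_t (unit_itv t)%:E = 1)%E.
Proof.
rewrite /unit_itv integral_indic//.
have E : lebesgue_measure (`[0, 1]%classic : set R) = 1%E.
  by rewrite lebesgue_measure_itv/= lte_fin ltr01 oppr0 adde0.
by rewrite setIT; exact: E.
Qed.

Section pointwise.
Variables (phi : 'rV[R]_n -> R) (x z : 'rV[R]_n).
Hypothesis sp : fsmooth phi.

Let w (t : R) := dotv (grad phi (x + t *: z)) z.

Let cline : continuous (fun t : R => x + t *: z).
Proof.
apply: continuous_rV => i; under eq_fun do rewrite !mxE.
apply: contD; first exact: cont_cst.
by apply: contM; [move=> t; exact: cvg_id|exact: cont_cst].
Qed.

Let cw : continuous w.
Proof.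
apply: continuous_dotv; last by move=> t; exact: cvg_cst.
apply: (cont_comp (f := fun t : R => x + t *: z) (g := grad phi)) => //.
apply: continuous_rV => i; under eq_fun do rewrite -partialE.
by apply: fsmooth_cont; exact: fsmooth_partial.
Qed.

Let dF (t : R) : is_derive t 1 (fun s : R => phi (x + s *: z)) (w t).
Proof. by apply/isder_line; exact: fsmooth_is_derive. Qed.

Let mw : measurable_fun [set: measurableTypeR R] (w : measurableTypeR R -> R).
Proof. by apply: continuous_measurable_fun; exact: cw. Qed.

Let iw : mu.-integrable setT (EFin \o (fun t => w t * unit_itv t)).
Proof.
have h : mu.-integrable `[0, 1]%classic (EFin \o w).
  apply: continuous_compact_integrable; first exact: segment_compact.
  by apply: continuous_subspaceT; exact: cw.
have m01 : measurable (`[0, 1]%classic : set (measurableTypeR R)) by exact: measurable_itv.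
have := iffLR (@integrable_mkcond _ (measurableTypeR R) R mu `[0, 1]%classic (EFin \o w) m01) h.
congr (_.-integrable); apply/funext => t; rewrite patchE /= /unit_itv indicE.
by case: ifP => _; rewrite ?mulr1 ?mulr0.
Qed.

Let ftc : \int[mu]_t (w t * unit_itv t) = phi (x + z) - phi x.
Proof.
have h1 : {within `[0, 1], continuous w} by apply: continuous_subspaceT; exact: cw.
have h2 : derivable_oo_LRcontinuous (fun t : R => phi (x + t *: z)) 0 1.
  split.
  - by move=> t _; exact: (@ex_derive _ _ _ _ _ _ _ (dF t)).
  - apply: cvg_at_right_filter; exact: (isder_cont1 (dF 0)).
  - apply: cvg_at_left_filter; exact: (isder_cont1 (dF 1)).
have h3 : {in `]0, 1[, (fun t : R => phi (x + t *: z))^`()%classic =1 w}.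
  by move=> t _; rewrite derive1E; apply: derive_val; exact: dF.
have := continuous_FTC2 ltr01 h1 h2 h3.
rewrite scale1r scale0r addr0 -EFinB => h.
rewrite /Rintegral -[RHS]/(fine (phi (x + z) - phi x)%:E) -h; congr fine.
rewrite [RHS]integral_mkcond; apply: eq_integral => t _.
rewrite patchE /= /unit_itv indicE.
by case: ifP => _; rewrite ?mulr1 ?mulr0.
Qed.

Let wle t : `|w t| <= enorm z * enorm (grad phi (x + t *: z)).
Proof. by rewrite mulrC; exact: dotv_le. Qed.

Let mgr : measurable_fun [set: measurableTypeR R] (fun t : measurableTypeR R => enorm (grad phi (x + t *: z))).
Proof.
apply: continuous_measurable_fun.
apply: (cont_comp (f := fun t : R => x + t *: z) (g := fun y => enorm (grad phi y))) => //.
exact: fsmooth_grad_cont.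
Qed.

(** The increment is the mean over [0, 1] of the derivative along the segment, by the fundamental
    theorem of calculus; Jensen's inequality brings the square inside. *)
Lemma segment_sq : (((phi (x + z) - phi x) ^+ 2)%:E <=
  (enorm z ^+ 2)%:E * \int[mu]_t (enorm (grad phi (x + t *: z)) ^+ 2 * unit_itv t)%:E)%E.
Proof.
have := @Rint_jensen _ _ R mu w unit_itv 0 mw measurable_unit_itv unit_itv_ge0 int_unit_itv iw.
rewrite ftc subr0 => h; apply: le_trans h _.
rewrite -int_scale ?sqr_ge0//.
- apply: int_le => //.
  + apply: measurable_funM; last exact: measurable_unit_itv.
    by apply: measurable_funX; apply: measurable_funB; [exact: mw|exact: measurable_cst].
  + apply: measurable_funM; first exact: measurable_cst.
    by apply: measurable_funM; [exact: measurable_funX|exact: measurable_unit_itv].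
  move=> t _; rewrite subr0 mulr_ge0 ?sqr_ge0 ?unit_itv_ge0//= mulrA ler_wpM2r ?unit_itv_ge0//.
  rewrite -exprMn -real_normK ?num_real// lerXn2r ?nnegrE ?mulr_ge0 ?enorm_ge0//.
- by apply: measurable_funM; [exact: measurable_funX|exact: measurable_unit_itv].
- by move=> t _; rewrite mulr_ge0 ?sqr_ge0 ?unit_itv_ge0.
Qed.

Lemma segment_abs : (`|phi (x + z) - phi x|%:E <=
  (enorm z)%:E * \int[mu]_t (enorm (grad phi (x + t *: z)) * unit_itv t)%:E)%E.
Proof.
rewrite -ftc.
have h1 : (`|\int[mu]_t (w t * unit_itv t)|%:E <= \int[mu]_t (`|w t * unit_itv t|)%:E)%E.
  have [mi _] := integrableP _ _ _ iw.
  by rewrite (EFin_normr_Rintegral measurableT iw); exact: (le_abse_integral mu measurableT mi).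
apply: le_trans h1 _; rewrite -int_scale ?enorm_ge0//.
- apply: int_le => //.
  + apply: (measurableT_comp (@normr_measurable _ setT)).
    by apply: measurable_funM; [exact: mw|exact: measurable_unit_itv].
  + apply: measurable_funM; first exact: measurable_cst.
    by apply: measurable_funM => //; exact: measurable_unit_itv.
  move=> t _; rewrite normr_ge0/= normrM (ger0_norm (unit_itv_ge0 t)) mulrA.
  by rewrite ler_wpM2r ?unit_itv_ge0.
- by apply: measurable_funM => //; exact: measurable_unit_itv.
- by move=> t _; rewrite mulr_ge0 ?enorm_ge0 ?unit_itv_ge0.
Qed.

End pointwise.

(** The x at which the increment f(x + z) - f(x) uses only values of f on Q. For convex Q the whole
    segment stays in Q. *)
Definition both Q z : set 'rV[R]_n := Q `&` [set x | Q (x + z)].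

Lemma measurable_both Q z : measurable Q -> measurable (both Q z).
Proof.
move=> mQ; apply: measurableI => //.
by have := measurable_translate z measurableT mQ; rewrite setTI.
Qed.

Definition segment_closed Q := forall x z (t : R), 0 <= t <= 1 -> Q x -> Q (x + z) -> Q (x + t *: z).

Lemma eball_segment y (r : R) : segment_closed (eball y r).
Proof.
move=> x z t t01 h1 h2; have := eball_convex t01 h1 h2.
by rewrite [x + z]addrC addrK.
Qed.

Lemma measurable_line z : measurable_fun setT
  (fun p : 'rV[R]_n * measurableTypeR R => p.1 + p.2 *: z).
Proof.
apply: measurable_fun_rV => i; under eq_fun do rewrite !mxE.
apply: measurable_funD; first exact: (measurableT_comp (measurable_coord i) measurable_fst).
by apply: measurable_funM; [exact: measurable_snd|exact: measurable_cst].
Qed.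

(** For fixed t in [0, 1] the translation by t z preserves measure and sends [both Q z] into Q; the
    resulting bound is averaged over t. *)
Lemma segment_fubini Q h z : measurable Q -> segment_closed Q ->
  measurable_fun setT h -> (forall x, 0 <= h x) ->
  (\int[leb]_(x in both Q z) \int[mu]_t (h (x + t *: z)%R * unit_itv t)%:E <=
   \int[leb]_(x in Q) (h x)%:E)%E.
Proof.
move=> mQ cQ mh h0; have mA := measurable_both z mQ.
pose F (p : 'rV[R]_n * measurableTypeR R) : \bar R :=
  (\1_(both Q z) p.1 * (h (p.1 + p.2 *: z) * unit_itv p.2))%:E.
have mF : measurable_fun setT F.
  apply/measurable_EFinP; apply: measurable_funM.
    exact: (measurableT_comp (measurable_indic mA) measurable_fst).
  apply: measurable_funM; first exact: (measurableT_comp mh (measurable_line z)).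
  exact: (measurableT_comp measurable_unit_itv measurable_snd).
have F0 p : (0 <= F p)%E by rewrite lee_fin !mulr_ge0 ?unit_itv_ge0// indicE.
have -> : (\int[leb]_(x in both Q z) \int[mu]_t (h (x + t *: z)%R * unit_itv t)%:E =
   \int[leb]_x \int[mu]_t F (x, t))%E.
  rewrite integral_mkcond; apply: eq_integral => x _.
  rewrite patchE /F/= indicE; case: ifP => _.
    by apply: eq_integral => t _; rewrite mul1r.
  by rewrite integral0_eq// => t _; rewrite mul0r.
rewrite (@fubini_tonelli _ _ _ _ _ leb mu F)//.
pose I := (\int[leb]_(x in Q) (h x)%:E)%E.
have I0 : (0 <= I)%E by apply: int_ge0.
have mQh : measurable_fun setT (fun x => (h x * \1_Q x)%:E).
  by apply/measurable_EFinP; apply: measurable_funM => //; exact: measurable_indic.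
apply: (@le_trans _ _ (\int[mu]_t ((unit_itv t)%:E * I))%E); last first.
  rewrite ge0_integralZr//; last 2 first.
  - by apply/measurable_EFinP; exact: measurable_unit_itv.
  - by move=> t _; rewrite lee_fin unit_itv_ge0.
  by rewrite int_unit_itv mul1e.
apply: ge0_le_integral => //.
- by move=> t _; apply: integral_ge0.
- by apply: measurable_fun_fubini_tonelli_G.
- by apply: emeasurable_funM; [apply/measurable_EFinP; exact: measurable_unit_itv|exact: measurable_cst].
move=> t _; have [t01|t01] := boolP (t \in `[0, 1]%classic); last first.
  rewrite integral0_eq; first by rewrite mule_ge0// lee_fin unit_itv_ge0.
  by move=> x _; rewrite /F/= /unit_itv [\1_`[_, _]%classic _]indicE (negbTE t01) !mulr0.
have -> : unit_itv t = 1 by rewrite /unit_itv indicE t01.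
rewrite mul1e /I [leRHS]int_mkcond//.
rewrite -(ge0_integral_translate (t *: z) mQh); last first.
  by move=> x; rewrite lee_fin mulr_ge0// indicE.
apply: ge0_le_integral => //.
- have mh2 : measurable_fun setT (fun x => \1_(both Q z) x * (h (x + t *: z) * unit_itv t)).
    apply: measurable_funM; first exact: measurable_indic.
    by apply: measurable_funM; [exact: measurable_shift|exact: measurable_cst].
  by apply/measurable_EFinP; exact: mh2.
- exact: (measurableT_comp mQh (measurable_translate (t *: z))).
move=> x _; rewrite /F/= /unit_itv [\1_`[_, _]%classic _]indicE t01 mulr1 lee_fin mulrC ler_wpM2l//.
rewrite !indicE; have [|//] := boolP (x \in both Q z) => /set_mem[Qx Qxz].
rewrite mem_set//; apply: cQ => //.
by move/set_mem : t01; rewrite /= in_itv.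
Qed.

Lemma smooth_trans2 Q phi z : measurable Q -> segment_closed Q -> fsmooth phi ->
  (\int[leb]_(x in both Q z) ((phi (x + z)%R - phi x) ^+ 2)%:E <=
   (enorm z ^+ 2)%:E * \int[leb]_(x in Q) (enorm (grad phi x) ^+ 2)%:E)%E.
Proof.
move=> mQ cQ sp; have mp := measurable_fsmooth sp; have mA := measurable_both z mQ.
have mg : measurable_fun setT (fun x => enorm (grad phi x) ^+ 2).
  by apply: measurable_funX; exact: measurable_enormf (measurable_grad sp).
pose J x := (\int[mu]_t (enorm (grad phi (x + t *: z)%R) ^+ 2 * unit_itv t)%:E)%E.
have J0 x : (0 <= J x)%E by apply: int_ge0 => t _; rewrite mulr_ge0 ?sqr_ge0 ?unit_itv_ge0.
have mJ : measurable_fun setT J.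
  pose F (p : 'rV[R]_n * measurableTypeR R) : \bar R :=
    (enorm (grad phi (p.1 + p.2 *: z)) ^+ 2 * unit_itv p.2)%:E.
  apply: (@measurable_fun_fubini_tonelli_F _ _ _ _ _ mu F).
    apply/measurable_EFinP; apply: measurable_funM.
      exact: (measurableT_comp mg (measurable_line z)).
    exact: (measurableT_comp measurable_unit_itv measurable_snd).
  by move=> p; rewrite lee_fin mulr_ge0 ?sqr_ge0 ?unit_itv_ge0.
apply: (@le_trans _ _ (\int[leb]_(x in both Q z) ((enorm z ^+ 2)%:E * J x))%E).
  apply: ge0_le_integral => //.
  - by move=> x _; rewrite lee_fin sqr_ge0.
  - apply/measurable_EFinP; apply: measurable_funTS; apply: measurable_funX.
    by apply: measurable_funB => //; exact: measurable_shift.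
  - apply: measurable_funTS; apply: emeasurable_funM => //; exact: measurable_cst.
  - by move=> x _; exact: segment_sq.
rewrite ge0_integralZl//; last 2 first.
- exact: measurable_funTS.
- by rewrite lee_fin sqr_ge0.
apply: lee_wpmul2l; first by rewrite lee_fin sqr_ge0.
by apply: (@segment_fubini Q (fun x => enorm (grad phi x) ^+ 2)) => // x; exact: sqr_ge0.
Qed.

Lemma smooth_trans1 Q phi z : measurable Q -> segment_closed Q -> fsmooth phi ->
  (\int[leb]_(x in both Q z) `|phi (x + z)%R - phi x|%:E <=
   (enorm z)%:E * \int[leb]_(x in Q) (enorm (grad phi x))%:E)%E.
Proof.
move=> mQ cQ sp; have mp := measurable_fsmooth sp; have mA := measurable_both z mQ.
have mg : measurable_fun setT (fun x => enorm (grad phi x)).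
  exact: measurable_enormf (measurable_grad sp).
pose J x := (\int[mu]_t (enorm (grad phi (x + t *: z)%R) * unit_itv t)%:E)%E.
have J0 x : (0 <= J x)%E by apply: int_ge0 => t _; rewrite mulr_ge0 ?enorm_ge0 ?unit_itv_ge0.
have mJ : measurable_fun setT J.
  pose F (p : 'rV[R]_n * measurableTypeR R) : \bar R :=
    (enorm (grad phi (p.1 + p.2 *: z)) * unit_itv p.2)%:E.
  apply: (@measurable_fun_fubini_tonelli_F _ _ _ _ _ mu F).
    apply/measurable_EFinP; apply: measurable_funM.
      exact: (measurableT_comp mg (measurable_line z)).
    exact: (measurableT_comp measurable_unit_itv measurable_snd).
  by move=> p; rewrite lee_fin mulr_ge0 ?enorm_ge0 ?unit_itv_ge0.
apply: (@le_trans _ _ (\int[leb]_(x in both Q z) ((enorm z)%:E * J x))%E).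
  apply: ge0_le_integral => //.
  - apply/measurable_EFinP; apply: measurable_funTS.
    apply: (measurableT_comp (@normr_measurable _ setT)).
    by apply: measurable_funB => //; exact: measurable_shift.
  - apply: measurable_funTS; apply: emeasurable_funM => //; exact: measurable_cst.
  - by move=> x _; exact: segment_abs.
rewrite ge0_integralZl//; last 2 first.
- exact: measurable_funTS.
- by rewrite lee_fin enorm_ge0.
apply: lee_wpmul2l; first by rewrite lee_fin enorm_ge0.
by apply: (@segment_fubini Q (fun x => enorm (grad phi x))) => // x; exact: enorm_ge0.
Qed.

Lemma int_both_shift Q h z : measurable Q -> measurable_fun setT h -> (forall x, 0 <= h x) ->
  (\int[leb]_(x in both Q z) (h (x + z)%R)%:E <= \int[leb]_(x in Q) (h x)%:E)%E.
Proof.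
move=> mQ mh h0; have mA := measurable_both z mQ.
rewrite int_mkcond// [leRHS]int_mkcond//.
have mQh : measurable_fun setT (fun x => (h x * \1_Q x)%:E).
  by apply/measurable_EFinP; apply: measurable_funM => //; exact: measurable_indic.
rewrite -(ge0_integral_translate z mQh); last first.
  by move=> x; rewrite lee_fin mulr_ge0// indicE.
apply: ge0_le_integral => //.
- by move=> x _; rewrite lee_fin mulr_ge0// indicE.
- apply/measurable_EFinP; apply: measurable_funM; last exact: measurable_indic.
  exact: measurable_shift.
- exact: (measurableT_comp mQh (measurable_translate z)).
move=> x _; rewrite lee_fin ler_wpM2l// !indicE.
have [|//] := boolP (x \in both Q z) => /set_mem[Qx Qxz].
by rewrite mem_set.
Qed.

(** The constant is 8 and not 1 because (a + b)^2 <= 2 a^2 + 2 b^2 is used three times in passing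
    from a smooth approximation to f. *)
Lemma sob_trans2 Q f G z : measurable Q -> segment_closed Q -> sob Q f G ->
  (\int[leb]_(x in both Q z) ((f (x + z)%R - f x) ^+ 2)%:E <=
   (8 * enorm z ^+ 2)%:E * \int[leb]_(x in Q) (enorm (G x) ^+ 2)%:E)%E.
Proof.
move=> mQ cQ [mf mG hf]; have mA := measurable_both z mQ.
apply/lee_addgt0Pr => e e0.
(* The errors add up to (6 + 8 |z|^2) e'. *)
have d0 : 0 < 6 + 8 * enorm z ^+ 2 by rewrite ltr_wpDr// mulr_ge0 ?sqr_ge0.
have [phi [sp h1 h2]] := hf _ (divr_gt0 e0 d0).
set e' := e / _ in h1 h2.
have mp := measurable_fsmooth sp; have mgp := measurable_grad sp.
have mpf : measurable_fun setT (fun x => phi x - f x) by exact: measurable_funB.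
have mgG : measurable_fun setT (fun x => grad phi x - G x).
  exact: measurable_addf mgp (measurable_oppf mG).
have subA : both Q z `<=` Q by move=> x [].
have A1 : (\int[leb]_(x in both Q z) ((phi x - f x) ^+ 2)%:E <= e'%:E)%E.
  apply: le_trans h1; apply: int_sub => //; last by move=> x _; exact: sqr_ge0.
  by apply: measurable_funTS; exact: measurable_funX.
have A2 : (\int[leb]_(x in both Q z) ((phi (x + z)%R - f (x + z)%R) ^+ 2)%:E <= e'%:E)%E.
  apply: le_trans h1; apply: (@int_both_shift Q (fun x => (phi x - f x) ^+ 2)) => //.
    exact: measurable_funX.
  by move=> x; exact: sqr_ge0.
set I := (\int[leb]_(x in Q) (enorm (G x) ^+ 2)%:E)%E.
have A3 : (\int[leb]_(x in Q) (enorm (grad phi x) ^+ 2)%:E <= (2%:E * (I + e'%:E)))%E.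
  have E3 x : grad phi x = G x + (grad phi x - G x) by rewrite addrC subrK.
  under eq_integral => x _ do rewrite (E3 x).
  apply: le_trans (int_vsqD _ _ _) _ => //.
  by rewrite lee_pmul2l// leeD.
have A4 := le_trans (smooth_trans2 z mQ cQ sp) (lee_wpmul2l (_ : (0 <= (enorm z ^+ 2)%:E)%E) A3).
have {}A4 : (\int[leb]_(x in both Q z) ((phi (x + z)%R - phi x) ^+ 2)%:E <=
    (enorm z ^+ 2)%:E * (2%:E * (I + e'%:E)))%E by apply: A4; rewrite lee_fin sqr_ge0.
have mfz := measurable_shift z mf; have mpz := measurable_shift z mp.
under eq_integral => x _.
  rewrite (_ : f (x + z) - f x = (-1) * (phi (x + z) - f (x + z)) +
    ((phi (x + z) - phi x) + (phi x - f x))); last by ring.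
  over.
have B1 : (\int[leb]_(x in both Q z) (((phi (x + z)%R - phi x) + (phi x - f x)) ^+ 2)%:E <=
   2%:E * ((enorm z ^+ 2)%:E * (2%:E * (I + e'%:E)) + e'%:E))%E.
  apply: le_trans (int_sqD _ _ _ _) _ => //; try by apply: measurable_funTS; exact: measurable_funB.
  by rewrite lee_pmul2l// leeD.
apply: (@le_trans _ _ (2%:E * (e'%:E + 2%:E * ((enorm z ^+ 2)%:E * (2%:E * (I + e'%:E)) + e'%:E)))%E).
  apply: le_trans (int_sqD _ _ _ _) _ => //.
  - apply: measurable_funTS; apply: measurable_funM; first exact: measurable_cst.
    exact: measurable_funB.
  - apply: measurable_funTS; apply: measurable_funD; exact: measurable_funB.
  rewrite lee_pmul2l//; apply: leeD => //.
  by under eq_integral do rewrite mulN1r sqrrN.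
have I0 : (0 <= I)%E by apply: int_ge0 => x _; exact: sqr_ge0.
case: (I) I0 => [c| |]; last by [].
  rewrite lee_fin => c0; rewrite -!(EFinM,EFinD) lee_fin.
  have E : e = 6 * e' + 8 * enorm z ^+ 2 * e'.
    by rewrite -mulrDl /e' mulrC divfK// gt_eqF.
  by rewrite [X in _ <= _ + X]E; lra.
(* Infinite gradient energy: the right-hand side is +oo unless z = 0, where 0 times +oo counts as 0
   and only the errors remain. *)
move=> _; have [z0|z0] := eqVneq (enorm z) 0.
  rewrite z0 expr0n/= mulr0 !mul0e add0e add0e -!(EFinM,EFinD) lee_fin.
  rewrite /e' z0 expr0n/= mulr0 addr0; lra.
have z2 : 0 < enorm z ^+ 2 by rewrite exprn_gt0// lt_neqAle eq_sym z0 enorm_ge0.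
have z8 : (0 < (8 * enorm z ^+ 2)%:E)%E by rewrite lte_fin mulr_gt0.
by rewrite (gt0_muley z8) leey.
Qed.

(** From |h| <= eta + h^2 / eta: on a set of finite measure, a small L^2 norm gives a small L^1
    norm. *)
Lemma int_abs_le D h (eta : R) : measurable D -> measurable_fun setT h -> 0 < eta ->
  (\int[leb]_(x in D) `|h x|%:E <=
   eta%:E * leb D + (eta^-1)%:E * \int[leb]_(x in D) (h x ^+ 2)%:E)%E.
Proof.
move=> mD mh e0; have me : 0 <= eta^-1 by rewrite invr_ge0 ltW.
have mh2 : measurable_fun D (fun x => h x ^+ 2) by apply: measurable_funTS; exact: measurable_funX.
rewrite -int_scale//; last by move=> x _; exact: sqr_ge0.
rewrite -(integral_cst leb mD eta%:E) -(@int_add _ _ _ leb D (fun _ => eta) (fun x => eta^-1 * h x ^+ 2))//; last 3 first.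
- by apply: measurable_funM => //; exact: measurable_cst.
- by move=> x _; exact: ltW.
- by move=> x _; rewrite mulr_ge0 ?sqr_ge0.
apply: int_le => //.
- by apply: measurable_funTS; apply: (measurableT_comp (@normr_measurable _ setT)).
- apply: measurable_funD; first exact: measurable_cst.
  by apply: measurable_funM => //; exact: measurable_cst.
move=> x _; rewrite normr_ge0/= -(real_normK (num_real (h x))).
have h1 : eta * `|h x| <= eta ^+ 2 + `|h x| ^+ 2.
  have := sqr_ge0 (eta - `|h x|); have := mulr_ge0 (ltW e0) (normr_ge0 (h x)).
  by rewrite !expr2; lra.
have -> : eta + eta^-1 * `|h x| ^+ 2 = eta^-1 * (eta ^+ 2 + `|h x| ^+ 2).
  by field; rewrite gt_eqF.
by rewrite -ler_pdivrMl ?invr_gt0// invrK.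
Qed.

Lemma sob_trans1 Q f G z : measurable Q -> (leb Q < +oo)%E -> segment_closed Q -> sob Q f G ->
  (\int[leb]_(x in both Q z) `|f (x + z)%R - f x|%:E <=
   (enorm z)%:E * \int[leb]_(x in Q) (enorm (G x))%:E)%E.
Proof.
move=> mQ Qoo cQ [mf mG hf]; have mA := measurable_both z mQ.
have Qfin : leb Q \is a fin_num by rewrite ge0_fin_numE.
set m := fine (leb Q); have mE : leb Q = m%:E by rewrite fineK.
have m0 : 0 <= m by rewrite fine_ge0.
apply/lee_addgt0Pr => e e0.
have K0 : 0 < 2 + enorm z by rewrite ltr_wpDr ?enorm_ge0.
pose d := e / (2 + enorm z).
have d0 : 0 < d by rewrite divr_gt0.
(* eta m is at most d / 2, and a squared L^2 error of d / 2 times eta contributes d / 2 after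
   multiplication by eta^-1. *)
pose eta := d / 2 / (m + 1).
have eta0 : 0 < eta by rewrite !divr_gt0// ltr_wpDl.
have e'0 : 0 < d / 2 * eta by rewrite mulr_gt0// divr_gt0.
have [phi [sp h1 h2]] := hf _ e'0.
have mp := measurable_fsmooth sp; have mgp := measurable_grad sp.
have mpf : measurable_fun setT (fun x => phi x - f x) by exact: measurable_funB.
have mgG : measurable_fun setT (fun x => enorm (grad phi x - G x)).
  exact: measurable_enormf (measurable_addf mgp (measurable_oppf mG)).
have small h : measurable_fun setT h -> (\int[leb]_(x in Q) (h x ^+ 2)%:E <= (d / 2 * eta)%:E)%E ->
    (\int[leb]_(x in Q) `|h x|%:E <= d%:E)%E.
  move=> mh hh; apply: le_trans (int_abs_le mQ mh eta0) _.
  apply: (@le_trans _ _ (eta%:E * m%:E + (eta^-1)%:E * (d / 2 * eta)%:E)%E).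
    by rewrite mE leeD2l// lee_pmul2l// lte_fin invr_gt0.
  rewrite -!(EFinM,EFinD) lee_fin.
  have -> : eta^-1 * (d / 2 * eta) = d / 2 by field; rewrite gt_eqF.
  have : eta * m <= d / 2.
    rewrite /eta mulrAC ler_pdivrMr ?ltr_wpDl// ler_wpM2l ?lerDl//.
    by apply: divr_ge0 => //; exact: ltW.
  by lra.
have S1 := small _ mpf h1.
have S2 : (\int[leb]_(x in Q) (enorm (grad phi x - G x))%:E <= d%:E)%E.
  have := small _ mgG h2; under eq_integral do rewrite ger0_norm ?enorm_ge0//.
  by [].
have mna : measurable_fun setT (fun x => `|phi x - f x|).
  exact: (measurableT_comp (@normr_measurable _ setT)).
have A1 : (\int[leb]_(x in both Q z) `|phi x - f x|%:E <= d%:E)%E.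
  apply: le_trans S1; apply: int_sub => //; [exact: measurable_funTS|by move=> x []].
have A2 : (\int[leb]_(x in both Q z) `|phi (x + z)%R - f (x + z)%R|%:E <= d%:E)%E.
  by apply: le_trans S1; apply: (@int_both_shift Q (fun x => `|phi x - f x|)).
set I := (\int[leb]_(x in Q) (enorm (G x))%:E)%E.
have mGn := measurable_enormf mG; have mgn := measurable_enormf mgp.
have A3 : (\int[leb]_(x in Q) (enorm (grad phi x))%:E <= I + d%:E)%E.
  apply: (@le_trans _ _ (\int[leb]_(x in Q) (enorm (G x) + enorm (grad phi x - G x))%:E)%E).
    apply: int_le => //; [exact: measurable_funTS|by apply: measurable_funTS; exact: measurable_funD|].
    move=> x _; rewrite enorm_ge0/= -{1}[grad phi x](subrK (G x)) addrC; exact: enormD.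
  rewrite int_add//; [exact: leeD2l|exact: measurable_funTS|exact: measurable_funTS| |];
    by move=> x _; exact: enorm_ge0.
have A4 : (\int[leb]_(x in both Q z) `|phi (x + z)%R - phi x|%:E <= (enorm z)%:E * (I + d%:E))%E.
  apply: le_trans (smooth_trans1 z mQ cQ sp) _; apply: lee_wpmul2l => //.
  by rewrite lee_fin enorm_ge0.
have mfz := measurable_shift z mf; have mpz := measurable_shift z mp.
have mab (a b : 'rV[R]_n -> R) : measurable_fun setT a -> measurable_fun setT b ->
  measurable_fun (both Q z) (fun x => `|a x - b x|).
  move=> ma mb; apply: measurable_funTS; apply: (measurableT_comp (@normr_measurable _ setT)).
  exact: measurable_funB.
apply: (@le_trans _ _ (\int[leb]_(x in both Q z)
   (`|phi (x + z)%R - f (x + z)%R| + (`|phi (x + z)%R - phi x| + `|phi x - f x|))%:E)%E).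
  apply: int_le => //; first exact: mab.
    by apply: measurable_funD; [exact: mab|apply: measurable_funD; exact: mab].
  move=> x _; rewrite normr_ge0/=.
  rewrite (_ : f (x + z) - f x = - (phi (x + z) - f (x + z)) +
    ((phi (x + z) - phi x) + (phi x - f x))); last by ring.
  by rewrite (le_trans (ler_normD _ _))// normrN lerD2l ler_normD.
rewrite int_add//; [|exact: mab|by apply: measurable_funD; exact: mab].
rewrite int_add//; [|exact: mab|exact: mab].
apply: (@le_trans _ _ (d%:E + ((enorm z)%:E * (I + d%:E) + d%:E))%E).
  by apply: leeD => //; exact: leeD.
have I0 : (0 <= I)%E by apply: int_ge0 => x _; exact: enorm_ge0.
rewrite muleDr//; last by rewrite ge0_adde_def ?inE// lee_fin ltW.
rewrite addeCA -!addeA; apply: leeD2l.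
rewrite -!(EFinM,EFinD) lee_fin.
have E : e = 2 * d + enorm z * d by rewrite -mulrDl /d mulrC divfK// gt_eqF.
by rewrite E; lra.
Qed.

End segments.

(** * Poincare and isoperimetric estimates by averaging over shifts *)

Section averaging.
Context {R : realType} {n : nat}.
Implicit Types (f : 'rV[R]_n -> R) (G : 'rV[R]_n -> 'rV[R]_n) (x y z : 'rV[R]_n) (Q C E P Z : set 'rV[R]_n).
Local Notation leb := (lebesgue_rV R n).

(** One integrand on pairs (x, z) for both estimates, with H the square or the absolute value. Its
    integral is bounded from above by fixing the shift z and from below by fixing the point x. *)
Definition pair_shift Q C f (H : R -> R) (p : 'rV[R]_n * 'rV[R]_n) : R :=
  \1_Q p.1 * \1_Q (p.1 + p.2) * \1_C p.2 * H (f (p.1 + p.2) - f p.1).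

Lemma measurable_add_rV : measurable_fun setT (fun p : 'rV[R]_n * 'rV[R]_n => p.1 + p.2).
Proof.
apply: measurable_fun_rV => i; under eq_fun do rewrite !mxE.
apply: measurable_funD; first exact: (measurableT_comp (measurable_coord i) measurable_fst).
exact: (measurableT_comp (measurable_coord i) measurable_snd).
Qed.

Lemma measurable_pair_shift Q C f H : measurable Q -> measurable C ->
  measurable_fun setT f -> measurable_fun setT H -> measurable_fun setT (pair_shift Q C f H).
Proof.
move=> mQ mC mf mH; apply: measurable_funM; last first.
  apply: (measurableT_comp mH); apply: measurable_funB.
    exact: (measurableT_comp mf measurable_add_rV).
  exact: (measurableT_comp mf measurable_fst).
apply: measurable_funM; last exact: (measurableT_comp (measurable_indic mC) measurable_snd).
apply: measurable_funM; first exact: (measurableT_comp (measurable_indic mQ) measurable_fst).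
exact: (measurableT_comp (measurable_indic mQ) measurable_add_rV).
Qed.

Lemma pair_shift_ge0 Q C f H p : (forall t, 0 <= H t) -> 0 <= pair_shift Q C f H p.
Proof. by move=> H0; rewrite /pair_shift !indicE !mulr_ge0. Qed.

Lemma shift_fubini Q C f (H : R -> R) (c : \bar R) : measurable Q -> measurable C ->
  measurable_fun setT f -> measurable_fun setT H -> (forall t, 0 <= H t) -> (0 <= c)%E ->
  (forall z, C z -> (\int[leb]_(x in both Q z) (H (f (x + z)%R - f x))%:E <= c)%E) ->
  (\int[leb]_x \int[leb]_z (pair_shift Q C f H (x, z))%:E <= c * leb C)%E.
Proof.
move=> mQ mC mf mH H0 c0 hc.
have mF : measurable_fun setT (fun p => (pair_shift Q C f H p)%:E).
  by apply/measurable_EFinP; exact: measurable_pair_shift.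
have F0 p : (0 <= (pair_shift Q C f H p)%:E)%E by rewrite lee_fin pair_shift_ge0.
rewrite (@fubini_tonelli _ _ _ _ _ leb leb (fun p => (pair_shift Q C f H p)%:E))//.
rewrite -(integral_cst leb mC c) [leRHS]integral_mkcond.
apply: ge0_le_integral => //.
- by move=> z _; apply: integral_ge0 => x _; exact: F0.
- exact: (@measurable_fun_fubini_tonelli_G _ _ _ _ _ leb (fun p => (pair_shift Q C f H p)%:E) mF F0).
- by apply/(measurable_restrictT _ mC); exact: measurable_cst.
move=> z _; rewrite patchE; case: ifPn => [/set_mem Cz|Cz].
  apply: le_trans (hc z Cz); rewrite [leRHS]integral_mkcond.
  rewrite le_eqVlt; apply/orP; left; apply/eqP; apply: eq_integral => x _.
  rewrite patchE /pair_shift/= !indicE (mem_set Cz) mulr1.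
  have [Qx|Qx] := boolP (x \in Q); last first.
    rewrite !mul0r ifF//; apply/negbTE; apply: contra Qx => /set_mem[Qx _]; exact: mem_set.
  have [Qz|Qz] := boolP (x + z \in Q); last first.
    rewrite mulr0 mul0r ifF//; apply/negbTE; apply: contra Qz => /set_mem[_ Qz]; exact: mem_set.
  by rewrite !mul1r ifT//; apply: mem_set; split; exact: set_mem.
rewrite integral0_eq// => x _.
by rewrite /pair_shift/= [\1_C _]indicE (negbTE Cz) mulr0 mul0r.
Qed.

(* More than half of the shifts z in a cube of side 2 h / n lead out of the support
   of f, and there (f (x + z) - f x)^2 = (f x)^2. *)
Lemma small_support y (r h : R) f G : (0 < n)%N -> 0 < h ->
  sob (eball y (r + h)) f G ->
  (leb (eball y (r + h) `&` [set x | f x != 0%R]) <= ((2 * (h / n%:R)) ^+ n / 2)%:E)%E ->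
  (\int[leb]_(x in eball y r) (f x ^+ 2)%:E <=
   (16 * h ^+ 2)%:E * \int[leb]_(x in eball y (r + h)) (enorm (G x) ^+ 2)%:E)%E.
Proof.
move=> n0 h0 sf hN; have [mf mG _] := sf.
set Q := eball y (r + h) in sf hN *.
have mQ : measurable Q by exact: measurable_eball.
have hn0 : 0 < h / n%:R by rewrite divr_gt0// ltr0n.
set c := (2 * (h / n%:R)) ^+ n in hN.
have c0 : 0 < c by rewrite exprn_gt0// mulr_gt0.
pose C := cube (0 : 'rV[R]_n) (h / n%:R).
have mC : measurable C by exact: measurable_cube.
have lC : leb C = c%:E by exact: lebesgue_cube.
have Ch z : C z -> enorm z <= h by move=> /(cube_sub_eball n0)/=; rewrite subr0.
set I := (\int[leb]_(x in Q) (enorm (G x) ^+ 2)%:E)%E.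
have I0 : (0 <= I)%E by apply: int_ge0 => x _; exact: sqr_ge0.
pose sq (t : R) := t ^+ 2.
have msq : measurable_fun setT sq by apply: measurable_funX; exact: measurable_id.
have sq0 t : 0 <= sq t by exact: sqr_ge0.
have up : (\int[leb]_x \int[leb]_z (pair_shift Q C f sq (x, z))%:E <=
   (8 * h ^+ 2)%:E * I * leb C)%E.
  apply: shift_fubini => //.
    by rewrite mule_ge0// lee_fin mulr_ge0 ?sqr_ge0.
  move=> z Cz; apply: le_trans (sob_trans2 z mQ (@eball_segment _ _ _ _) sf) _.
  apply: lee_wpmul2r => //; rewrite lee_fin ler_wpM2l//.
  by rewrite lerXn2r ?nnegrE ?enorm_ge0 ?(ltW h0)//; exact: Ch.
have mr := @measurable_eball R n y r.
pose N := Q `&` [set x | f x != 0].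
have mN : measurable N.
  apply: measurableI => //.
  have := mf measurableT _ (measurableC (measurable_set1 (0 : R))).
  rewrite setTI; congr measurable; apply/seteqP; split => x /=; first by move/eqP.
  by move=> fx /eqP; rewrite (negbTE fx).
have mF : measurable_fun setT (fun p => (pair_shift Q C f sq p)%:E).
  by apply/measurable_EFinP; exact: measurable_pair_shift.
have F0 p : (0 <= (pair_shift Q C f sq p)%:E)%E by rewrite lee_fin pair_shift_ge0.
have low : ((c / 2)%:E * \int[leb]_(x in eball y r) (f x ^+ 2)%:E <=
   \int[leb]_x \int[leb]_z (pair_shift Q C f sq (x, z))%:E)%E.
  have mf2 : measurable_fun setT (fun x => f x ^+ 2) by exact: measurable_funX.
  have c20 : 0 <= c / 2 by rewrite divr_ge0// ltW.
  rewrite -(@int_scale _ _ _ leb _ (c / 2) (fun x => f x ^+ 2) mr (measurable_funTS mf2) c20 (fun x _ => sqr_ge0 _)).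
  have mFF := @measurable_fun_fubini_tonelli_F _ _ _ _ _ leb (fun p => (pair_shift Q C f sq p)%:E) mF F0.
  have FF0 x : (0 <= \int[leb]_z (pair_shift Q C f sq (x, z))%:E)%E.
    by apply: integral_ge0 => z _; exact: F0.
  apply: (@le_trans _ _ (\int[leb]_(x in eball y r) \int[leb]_z (pair_shift Q C f sq (x, z))%:E)%E); last first.
    by apply: ge0_subset_integral => //.
  apply: ge0_le_integral => //.
  - by move=> x _; rewrite lee_fin mulr_ge0 ?sqr_ge0.
  - apply/measurable_EFinP; apply: measurable_funTS; apply: measurable_funM => //; exact: measurable_cst.
  - exact: measurable_funTS.
  move=> x xr.
  have Qxz z : C z -> Q (x + z).
    move=> /Ch hz; rewrite /Q /eball/= addrAC; apply: le_lt_trans (enormD _ _) _; exact: ltr_leD.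
  have Qx : Q x by apply: eball_subr xr; rewrite lerDl ltW.
  pose N' := (fun z => z + x) @^-1` N; pose M := C `\` N'.
  have mpN : measurable N'.
    by have := measurable_translate x measurableT mN; rewrite setTI.
  have mM : measurable M by exact: measurableD.
  have lM : ((c / 2)%:E <= leb M)%E.
    have : (leb C <= leb M + leb N')%E.
      apply: le_trans (measureU2 _ _ _) => //; apply: le_measure; rewrite ?inE//.
        exact: measurableU.
      by move=> z Cz; have [h1|h1] := pselect (N (z + x)); [right|left].
    rewrite lC lebesgue_rV_translate// => h1.
    have {}h1 := le_trans h1 (leeD2l (leb M) hN).
    have {h1} : (c%:E - (c / 2)%:E <= leb M)%E by rewrite leeBlDr.
    rewrite -EFinB; congr (_ <= _)%E; congr EFin; lra.
  apply: (@le_trans _ _ (\int[leb]_(z in M) (f x ^+ 2)%:E)%E).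
    rewrite (integral_cst leb mM (f x ^+ 2)%:E) EFinM muleC lee_wpmul2l// lee_fin sqr_ge0.
    by [].
  apply: (@le_trans _ _ (\int[leb]_(z in M) (pair_shift Q C f sq (x, z))%:E)%E); last first.
    apply: ge0_subset_integral => //.
    by apply: (measurableT_comp mF); exact: measurable_pair1.
  apply: ge0_le_integral => //.
  - by move=> z _; rewrite lee_fin sqr_ge0.
  - by apply: measurable_funTS; apply: (measurableT_comp mF); exact: measurable_pair1.
  move=> z [Cz Nz]; rewrite /pair_shift/= !indicE (mem_set Qx) (mem_set (Qxz z Cz)) (mem_set Cz) !mul1r.
  suff -> : f (x + z) = 0 by rewrite /sq sub0r sqrrN.
  apply: contrapT => fz; apply: Nz; rewrite /N'/= addrC; split; first exact: Qxz.
  exact/eqP.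
have := le_trans low up; rewrite lC => h1.
have c2 : (0 < (c / 2)%:E)%E by rewrite lte_fin divr_gt0.
rewrite -(@lee_pmul2l _ (c / 2)%:E)//; apply: le_trans h1 _.
rewrite muleAC -EFinM muleA -EFinM le_eqVlt; apply/orP; left; apply/eqP; congr (_%:E * _)%E.
by field.
Qed.

(* Integrate |f (x + z) - f x| over the pairs with x in P and x + z in Z. *)
Lemma isoperimetric y (r a : R) f G P Z : 0 < r -> 0 <= a ->
  sob (eball y r) f G -> measurable P -> measurable Z ->
  P `<=` eball y r -> Z `<=` eball y r ->
  (forall x, P x -> f x = 0) -> (forall x, Z x -> a <= f x) ->
  (a%:E * leb Z * leb P <=
   (2 * r * (4 * r) ^+ n)%:E * \int[leb]_(x in eball y r) (enorm (G x))%:E)%E.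
Proof.
move=> r0 a0 sf mP mZ PQ ZQ fP fZ; have [mf mG _] := sf.
set Q := eball y r in sf PQ ZQ *.
have mQ : measurable Q by exact: measurable_eball.
(* Two points of a ball of radius r differ by less than 2 r, so each pair in P and Z is joined by a
   shift in C. *)
pose C := eball (0 : 'rV[R]_n) (2 * r).
have mC : measurable C by exact: measurable_eball.
have r20 : 0 < 2 * r by rewrite mulr_gt0.
have lC : (leb C <= ((4 * r) ^+ n)%:E)%E.
  have -> : 4 * r = 2 * (2 * r) by ring.
  exact: lebesgue_eball_le.
set I := (\int[leb]_(x in Q) (enorm (G x))%:E)%E.
have I0 : (0 <= I)%E by apply: int_ge0 => x _; exact: enorm_ge0.
have mno : measurable_fun setT (fun t : R => `|t|) by exact: normr_measurable.
have Qoo : (leb Q < +oo)%E by apply: le_lt_trans (lebesgue_eball_le _ _) _; rewrite ?ltry.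
have up : (\int[leb]_x \int[leb]_z (pair_shift Q C f Num.norm (x, z))%:E <=
   (2 * r)%:E * I * leb C)%E.
  apply: shift_fubini => //.
    by rewrite mule_ge0// lee_fin ltW.
  move=> z Cz; apply: le_trans (sob_trans1 z mQ Qoo (@eball_segment _ _ _ _) sf) _.
  apply: lee_wpmul2r => //; rewrite lee_fin.
  by move: Cz; rewrite /C /eball/= subr0 => /ltW.
have mF : measurable_fun setT (fun p => (pair_shift Q C f Num.norm p)%:E).
  by apply/measurable_EFinP; exact: measurable_pair_shift.
have F0 p : (0 <= (pair_shift Q C f Num.norm p)%:E)%E by rewrite lee_fin pair_shift_ge0.
have low : (a%:E * leb Z * leb P <=
   \int[leb]_x \int[leb]_z (pair_shift Q C f Num.norm (x, z))%:E)%E.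
  rewrite -(integral_cst leb mP (a%:E * leb Z)%E).
  have mFF := @measurable_fun_fubini_tonelli_F _ _ _ _ _ leb (fun p => (pair_shift Q C f Num.norm p)%:E) mF F0.
  have FF0 x : (0 <= \int[leb]_z (pair_shift Q C f Num.norm (x, z))%:E)%E.
    by apply: integral_ge0 => z _; exact: F0.
  apply: (@le_trans _ _ (\int[leb]_(x in P) \int[leb]_z (pair_shift Q C f Num.norm (x, z))%:E)%E); last first.
    by apply: ge0_subset_integral => //.
  apply: ge0_le_integral => //.
  - by move=> x _; rewrite mule_ge0.
  - exact: measurable_funTS.
  move=> x Px; have Qx := PQ _ Px.
  pose M := (fun z => z + x) @^-1` Z.
  have mM : measurable M by have := measurable_translate x measurableT mZ; rewrite setTI.
  rewrite /cst -(lebesgue_rV_translate x mZ) -/M -(integral_cst leb mM a%:E).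
  apply: (@le_trans _ _ (\int[leb]_(z in M) (pair_shift Q C f Num.norm (x, z))%:E)%E); last first.
    apply: ge0_subset_integral => //.
    by apply: (measurableT_comp mF); exact: measurable_pair1.
  apply: ge0_le_integral => //.
  - by apply: measurable_funTS; apply: (measurableT_comp mF); exact: measurable_pair1.
  move=> z Mz; have Zz : Z (x + z) by rewrite addrC.
  have Qz := ZQ _ Zz.
  have Cz : C z.
    rewrite /C /eball/= subr0 (_ : z = (x + z - y) - (x - y)); last first.
      by rewrite opprB addrA subrK addrAC subrr add0r.
    apply: le_lt_trans (enorm_triangle 0 _ _) _.
    by rewrite subr0 sub0r enormN [2 * r](_ : _ = r + r); [exact: ltrD|ring].
  rewrite /pair_shift/= !indicE (mem_set Qx) (mem_set Qz) (mem_set Cz) !mul1r lee_fin.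
  by rewrite (fP _ Px) subr0; apply: le_trans (fZ _ Zz) (ler_norm _).
apply: le_trans low _; apply: le_trans up _.
rewrite muleAC lee_wpmul2r//.
rewrite EFinM; apply: lee_wpmul2l lC; by rewrite lee_fin ltW.
Qed.

(** The balls of radius rho / 2 with rational centres cover E, and one that meets E at x lies in the
    ball of radius rho around x, where the hypothesis applies. Balls that miss E are replaced by the
    empty set. *)
Lemma null_cover (rho : R) E : (0 < n)%N -> 0 < rho -> measurable E ->
  (forall x, E x -> leb (E `&` eball x rho) = 0%E) -> leb E = 0%E.
Proof.
move=> n0 r0 mE hE.
pose B (q : 'rV[rat]_n) := E `&` eball (map_mx ratr q : 'rV[R]_n) (rho / 2).
pose F k := if unpickle k is Some q then (if pselect (B q !=set0) then B q else set0) else set0.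
have mF k : measurable (F k).
  rewrite /F; case: unpickle => // q; case: pselect => _ //=.
  by apply: measurableI => //; exact: measurable_eball.
have F0 k : leb (F k) = 0%E.
  rewrite /F; case: unpickle => [q|]; last by rewrite measure0.
  case: pselect => /= [[x [Ex xq]]|_]; last exact: measure0.
  apply/eqP; rewrite -measure_le0 -(hE x Ex); apply: le_measure; rewrite ?inE.
  - by apply: measurableI => //; exact: measurable_eball.
  - by apply: measurableI => //; exact: measurable_eball.
  move=> z [Ez zq]; split => //; rewrite /eball/=.
  apply: le_lt_trans (enorm_triangle (map_mx ratr q) _ _) _.
  rewrite [rho]splitr ltrD// -enormN opprB; exact: xq.
have EF : E `<=` \bigcup_k F k.
  move=> x Ex.
  have h i : exists q : rat, `|x 0 i - ratr q| < rho / 2 / n%:R.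
    have d0 : 0 < rho / 2 / n%:R by rewrite !divr_gt0// ltr0n.
    have := @rat_in_itvoo R (x 0 i - rho / 2 / n%:R) (x 0 i + rho / 2 / n%:R).
    case=> [|q]; first by rewrite ltrD2l gtrN.
    by rewrite in_itv/= -ltr_distl distrC => hq; exists q.
  pose q : 'rV[rat]_n := \row_i projT1 (cid (h i)).
  have xq : eball (map_mx ratr q) (rho / 2) x.
    have n0' : 0 < n%:R :> R by rewrite ltr0n.
    pose m := \big[Num.max/0]_i `|x 0 i - ratr (q 0 i)|.
    have mi i : `|x 0 i - ratr (q 0 i)| <= m by exact: le_bigmax.
    rewrite /eball/=; apply: (@le_lt_trans _ _ (n%:R * m)).
      by apply: enorm_le_coord => i; apply: le_trans (mi i); rewrite !mxE.
    rewrite -ltr_pdivlMl// mulrC; apply: bigmax_lt => [|i _].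
      by rewrite !divr_gt0.
    by rewrite mxE; case: cid.
  exists (pickle q) => //; rewrite /F pickleK; case: pselect => /= [_|nB]; first by split.
  by apply: nB; exists x; split.
apply/eqP; rewrite -measure_le0.
apply: le_trans (measure_sigma_subadditive leb mF mE EF) _.
by rewrite eseries0// => *; exact: F0.
Qed.

End averaging.

Section measure_helpers.
Context d (T : measurableType d) (R : realType) (mu : {measure set T -> \bar R}).

Lemma int_le_support (D S : set T) (f : T -> R) (b : R) : measurable D -> measurable S ->
  measurable_fun D f -> (forall x, D x -> 0 <= f x) -> (forall x, D x -> S x -> f x <= b) ->
  (forall x, D x -> ~ S x -> f x = 0) ->
  (\int[mu]_(x in D) (f x)%:E <= b%:E * mu (D `&` S))%E.
Proof.
move=> mD mS mf f0 fb fS; have mDS := measurableI _ _ mD mS.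
rewrite -(integral_cst mu mDS b%:E) [leLHS]integral_mkcond [leRHS]integral_mkcond.
apply: ge0_le_integral => //.
- by move=> x _; rewrite patchE; case: ifP => // /set_mem Dx; rewrite lee_fin f0.
- by apply/(measurable_restrictT _ mD); exact/measurable_EFinP.
- by apply/(measurable_restrictT _ mDS); exact: measurable_cst.
move=> x _; rewrite !patchE; have [Dx|Dx] := pselect (D x); last first.
  by rewrite memNset// memNset// => -[].
rewrite (mem_set Dx); have [Sx|Sx] := pselect (S x).
  by rewrite mem_set//= lee_fin fb.
by rewrite memNset ?fS// => -[].
Qed.

Lemma ae_null (A : set T) (P : T -> Prop) : measurable A -> {ae mu, forall x, P x} ->
  A `<=` [set x | ~ P x] -> mu A = 0%E.
Proof.
move=> mA [N [mN N0 hN]] hA; apply/eqP; rewrite -measure_le0 -N0; apply: le_measure; rewrite ?inE//.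
by move=> x /hA h; exact: hN.
Qed.

Lemma null_sub (A B : set T) : measurable A -> measurable B -> A `<=` B -> mu B = 0%E -> mu A = 0%E.
Proof.
by move=> mA mB AB B0; apply/eqP; rewrite -measure_le0 -B0; apply: le_measure; rewrite ?inE.
Qed.

End measure_helpers.

(** Otherwise each of the first s steps loses m, and a s would be at most A - s m < 0. *)
Lemma decay_stop (R : realType) (a : nat -> R) (A m e : R) (s : nat) :
  (forall j, 0 <= a j) -> a 0%N <= A -> (forall j, e <= a j.+1 -> a j.+1 <= a j - m) ->
  A < s%:R * m -> exists2 j, (j < s)%N & a j.+1 < e.
Proof.
move=> a0 aA ha hs; apply: contrapT => hn.
have h j : (j < s)%N -> e <= a j.+1.
  by move=> js; rewrite leNgt; apply/negP => h; apply: hn; exists j.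
have ind j : (j <= s)%N -> a j <= A - j%:R * m.
  elim: j => [|j IH] js; first by rewrite mul0r subr0.
  apply: le_trans (ha _ (h _ js)) _; have := IH (ltnW js); rewrite -natr1; lra.
by have := ind _ (leqnn s); have := a0 s; lra.
Qed.

(** * De Giorgi classes and the Harnack inequality *)

Section de_giorgi.
Context {R : realType} {n : nat}.
Implicit Types (u v : 'rV[R]_n -> R) (g : 'rV[R]_n -> 'rV[R]_n) (x y z : 'rV[R]_n).
Local Notation leb := (lebesgue_rV R n).

(* The De Giorgi class: every truncation satisfies the Caccioppoli inequality. *)
Definition dg x0 (r0 Gam : R) v g := [/\ sob (eball x0 r0) v g,
  (\int[leb]_(x in eball x0 r0) (v x ^+ 2)%:E < +oo)%E,
  (\int[leb]_(x in eball x0 r0) (enorm (g x) ^+ 2)%:E < +oo)%E &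
  forall (k : R) y rho r, 0 < rho -> rho < r -> [set x | enorm (x - y) <= r] `<=` eball x0 r0 ->
  (\int[leb]_(x in eball y rho) (enorm (pos_grad v k g x) ^+ 2)%:E <=
   (Gam / (r - rho) ^+ 2)%:E * \int[leb]_(x in eball y r) (Num.max (v x - k) 0 ^+ 2)%:E)%E].

Lemma leb_eball_fin x (r : R) : (leb (eball x r) < +oo)%E.
Proof.
apply: (@le_lt_trans _ _ (leb (eball x (Num.max r 1)))).
  apply: le_measure; rewrite ?inE; [exact: measurable_eball..|].
  by apply: eball_subr; rewrite le_max lexx.
by apply: le_lt_trans (lebesgue_eball_le _ _) _; rewrite ?ltry// lt_max ltr01 orbT.
Qed.

Lemma measurable_lt v (k : R) : measurable_fun setT v -> measurable [set x | v x < k].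
Proof.
move=> mv; have := mv measurableT _ (measurable_itv `]-oo, k[).
by rewrite setTI; congr measurable; apply/seteqP; split => x /=; rewrite in_itv.
Qed.

Lemma measurable_gt v (k : R) : measurable_fun setT v -> measurable [set x | k < v x].
Proof.
move=> mv; have := mv measurableT _ (measurable_itv `]k, +oo[).
by rewrite setTI; congr measurable; apply/seteqP; split => x /=; rewrite in_itv/= andbT.
Qed.

Lemma measurable_ge v (k : R) : measurable_fun setT v -> measurable [set x | k <= v x].
Proof.
move=> mv; have := mv measurableT _ (measurable_itv `[k, +oo[).
by rewrite setTI; congr measurable; apply/seteqP; split => x /=; rewrite in_itv/= andbT.
Qed.

Lemma measurable_pos v (k : R) : measurable_fun setT v ->
  measurable_fun setT (fun x => Num.max (v x - k) 0).
Proof.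
move=> mv; apply: measurable_maxr; last exact: measurable_cst.
by apply: measurable_funB => //; exact: measurable_cst.
Qed.

Lemma sqr_pos_le (a k k' : R) : k <= k' -> Num.max (a - k') 0 ^+ 2 <= Num.max (a - k) 0 ^+ 2.
Proof.
move=> kk; have p (c : R) : 0 <= Num.max c 0 by rewrite le_max lexx orbT.
rewrite lerXn2r ?nnegrE ?p//.
by rewrite ge_max !le_max lexx orbT andbT lerD2l lerN2 kk.
Qed.

(** By Chebyshev's inequality (v - k)^+ exceeds k' - k only on a set of measure Z / (k' - k)^2, so
    (v - k')^+ has small support at scale h. [small_support] bounds it by h times its gradient, and
    the Caccioppoli inequality between the radii rho + h and r returns to Z. *)
Lemma dg_step x0 (r0 Gam : R) v g y (k k' rho h r Z : R) : (0 < n)%N -> 0 <= Gam ->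
  dg x0 r0 Gam v g -> 0 < h -> 0 < rho -> rho + h < r ->
  [set x | enorm (x - y) <= r] `<=` eball x0 r0 -> k < k' ->
  (\int[leb]_(x in eball y r) (Num.max (v x - k) 0 ^+ 2)%:E <= Z%:E)%E ->
  Z / (k' - k) ^+ 2 <= (2 * (h / n%:R)) ^+ n / 2 ->
  (\int[leb]_(x in eball y rho) (Num.max (v x - k') 0 ^+ 2)%:E <=
   (16 * h ^+ 2 * (Gam / (r - rho - h) ^+ 2) * Z)%:E)%E.
Proof.
move=> n0 G0 [sv v2 g2 hC] h0 rho0 rhr sub kk hZ hs.
have [mv mg _] := sv.
have mD := @measurable_eball R n x0 r0; have mr := @measurable_eball R n y r.
have mrh := @measurable_eball R n y (rho + h).
have subr : eball y (rho + h) `<=` eball x0 r0.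
  by move=> x xr; apply: sub; apply: ltW; apply: lt_trans rhr.
have sf := sob_pos k' mD (leb_eball_fin x0 r0) sv g2.
have {}sf := sobS mrh mD subr sf.
have mk := measurable_pos k mv; have mk' := measurable_pos k' mv.
have mk2 : measurable_fun setT (fun x => Num.max (v x - k) 0 ^+ 2) by exact: measurable_funX.
have mk2' : measurable_fun setT (fun x => Num.max (v x - k') 0 ^+ 2) by exact: measurable_funX.
have a0 : 0 < (k' - k) ^+ 2 by rewrite exprn_gt0// subr_gt0.
have cheb := int_chebyshev leb mr (measurable_funTS mk2) (fun x _ => sqr_ge0 _) (ltW a0).
have small : (leb (eball y (rho + h) `&` [set x | (Num.max (v x - k') 0 != 0)%R]) <=
   ((2 * (h / n%:R)) ^+ n / 2)%:E)%E.
  apply: (@le_trans _ _ (Z / (k' - k) ^+ 2)%:E); last by rewrite lee_fin.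
  rewrite -(@lee_pmul2l _ ((k' - k) ^+ 2)%:E)// -EFinM [(_ * (Z / _))%R]mulrC divfK ?gt_eqF//.
  apply: le_trans hZ; apply: le_trans cheb; apply: lee_wpmul2l; first by rewrite lee_fin ltW.
  have mA : measurable (eball y r `&` [set x | (k' - k) ^+ 2 <= Num.max (v x - k) 0 ^+ 2]).
    by apply: measurableI => //; exact: (measurable_ge _ mk2).
  apply: le_measure; rewrite ?inE//.
    apply: measurableI => //.
    have := mk' measurableT _ (measurableC (measurable_set1 (0 : R))).
    rewrite setTI; congr measurable; apply/seteqP; split => x /=; first by move/eqP.
    by move=> fx /eqP; rewrite (negbTE fx).
  move=> x [xr /= xk]; split; first by apply: eball_subr xr; exact: ltW.
  have : k' < v x.
    by rewrite ltNge; apply/negP => h1; move: xk; rewrite max_r ?eqxx// subr_le0.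
  move=> h1 /=; rewrite lerXn2r ?nnegrE ?le_max ?lexx ?orbT ?subr_ge0 ?(ltW kk)//.
  by rewrite lerD2r (ltW h1).
apply: le_trans (small_support n0 h0 sf small) _.
have h16 : 0 <= 16 * h ^+ 2 by apply: mulr_ge0 => //; exact: sqr_ge0.
have rho1 : 0 < rho + h by rewrite addr_gt0.
rewrite -(mulrA (16 * h ^+ 2)) [leRHS]EFinM; apply: lee_wpmul2l; first by rewrite lee_fin.
apply: le_trans (hC k' y (rho + h) r rho1 rhr sub) _.
rewrite opprD addrA [leRHS]EFinM; apply: lee_wpmul2l.
  by rewrite lee_fin; apply: divr_ge0 => //; exact: sqr_ge0.
apply: le_trans hZ; apply: int_le => //; [exact: measurable_funTS|exact: measurable_funTS|].
by move=> x _; rewrite sqr_ge0/= sqr_pos_le// ltW.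
Qed.

(** The ratio of the shift length h to the scale R0 2^-j of step j, small enough for 16 h^2 Gam /
    gap^2 <= 2^-(n+2), where gap is the difference of radii left to the Caccioppoli inequality. *)
Definition dg_tau (Gam : R) : R := (32 * 2 ^+ n.+2 * Gam)^-1.
(** Solves 4 eps = (2 tau / n)^n / 2, which turns the smallness condition of [dg_step] into an
    equality at every step. *)
Definition dg_eps (Gam : R) : R := (2 * dg_tau Gam / n%:R) ^+ n / 8.

Lemma dg_tau_gt0 Gam : 1 <= Gam -> 0 < dg_tau Gam.
Proof.
move=> G1; rewrite invr_gt0; apply: mulr_gt0; last exact: lt_le_trans G1.
by apply: mulr_gt0 => //; exact: exprn_gt0.
Qed.

Lemma dg_eps_gt0 Gam : (0 < n)%N -> 1 <= Gam -> 0 < dg_eps Gam.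
Proof.
move=> n0 G1; apply: divr_gt0 => //; apply: exprn_gt0; apply: divr_gt0; last by rewrite ltr0n.
by apply: mulr_gt0 => //; exact: dg_tau_gt0.
Qed.

Lemma dg_contract (Gam R0 Q : R) : 1 <= Gam -> 0 < R0 -> 0 < Q ->
  [/\ R0 / 2 * (1 + 2^-1 * Q) + dg_tau Gam * R0 * Q < R0 / 2 * (1 + Q) &
   16 * (dg_tau Gam * R0 * Q) ^+ 2 *
    (Gam / (R0 / 2 * (1 + Q) - R0 / 2 * (1 + 2^-1 * Q) - dg_tau Gam * R0 * Q) ^+ 2) <=
   2^-1 ^+ n.+2].
Proof.
move=> G1 R00 Q0; have t0 := dg_tau_gt0 G1.
have G0 : 0 < Gam by exact: lt_le_trans G1.
set K : R := 2 ^+ n.+2; have K1 : 1 <= K by rewrite exprn_ege1// ler1n.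
have K0 : 0 < K by exact: lt_le_trans K1.
have tE : dg_tau Gam * (32 * K * Gam) = 1.
  rewrite /dg_tau -/K mulVf// gt_eqF//; apply: mulr_gt0 => //; exact: mulr_gt0.
set t := dg_tau Gam in t0 tE *.
have tE' : 32 * (t * (K * Gam)) = 1 by transitivity (t * (32 * K * Gam)); [ring|exact: tE].
have K4 : 4 <= K.
  have -> : 4 = (2 : R) ^+ 2 by rewrite expr2; ring.
  by rewrite ler_eXn2l ?ltr1n.
have KG4 : 4 <= K * Gam by rewrite -[leLHS]mulr1 ler_pM.
have t4 : t * 4 <= t * (K * Gam) by rewrite ler_wpM2l// ltW.
have t8 : 8 * t <= 1 by lra.
have RQ : 0 < R0 * Q by rewrite mulr_gt0.
(* Consecutive radii differ by R0 Q / 4, of which the shift takes tau R0 Q; as tau <= 1/8, at least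
   half is left. *)
have w : R0 / 2 * (1 + Q) - R0 / 2 * (1 + 2^-1 * Q) - t * R0 * Q = R0 * Q * (4^-1 - t) by field.
have w8 : 8^-1 <= 4^-1 - t by lra.
split.
  rewrite -subr_gt0 opprD addrA w mulr_gt0//; lra.
rewrite w.
have w0 : 0 < 4^-1 - t by lra.
have -> : 16 * (t * R0 * Q) ^+ 2 * (Gam / (R0 * Q * (4^-1 - t)) ^+ 2) =
   16 * t ^+ 2 * Gam / (4^-1 - t) ^+ 2.
  by field; rewrite !gt_eqF//; lra.
rewrite ler_pdivrMr ?exprn_gt0//.
have -> : (2^-1 : R) ^+ n.+2 = K^-1 by rewrite exprVn.
apply: (@le_trans _ _ (K^-1 * (8^-1) ^+ 2)); last first.
  by rewrite ler_wpM2l ?invr_ge0 ?(ltW K0)// lerXn2r ?nnegrE ?invr_ge0 ?(ltW w0).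
rewrite -(ler_pM2l K0) [K * (K^-1 * _)]mulrA mulfV ?gt_eqF// mul1r.
have -> : K * (16 * t ^+ 2 * Gam) = (t * (32 * K * Gam)) * (16 / 32 * t) by field.
rewrite tE mul1r.
rewrite expr2; lra.
Qed.

(* De Giorgi iteration with levels k0 + M (1 - 2^-j) and radii (R0/2) (1 + 2^-j): each
   step divides the energy by 2^(n+2), which is what keeps the smallness assumption of
   dg_step true along the iteration. *)
Lemma dg_sup x0 (r0 Gam : R) v g y (R0 k0 M : R) : (0 < n)%N -> 1 <= Gam ->
  dg x0 r0 Gam v g -> 0 < R0 -> 0 < M ->
  [set x | enorm (x - y) <= R0] `<=` eball x0 r0 ->
  (\int[leb]_(x in eball y R0) (Num.max (v x - k0) 0 ^+ 2)%:E <=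
   (dg_eps Gam * M ^+ 2 * R0 ^+ n)%:E)%E ->
  leb (eball y (R0 / 2) `&` [set x | k0 + M < v x]) = 0%E.
Proof.
move=> n0 G1 hv R00 M0 sub hM; have [[mv mg _] _ _ _] := hv.
have G0 : 0 <= Gam by exact: le_trans G1.
have t0 := dg_tau_gt0 G1.
pose q : R := 2^-1.
have q0 : 0 < q by rewrite invr_gt0.
set Z := dg_eps Gam * M ^+ 2 * R0 ^+ n in hM.
have Z0 : 0 <= Z.
  by apply: mulr_ge0; [apply: mulr_ge0; [exact/ltW/dg_eps_gt0|exact: sqr_ge0]|exact/exprn_ge0/ltW].
have ind j : (\int[leb]_(x in eball y (R0 / 2 * (1 + q ^+ j)))
    (Num.max (v x - (k0 + M * (1 - q ^+ j))) 0 ^+ 2)%:E <= ((q ^+ j) ^+ n.+2 * Z)%:E)%E.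
  elim: j => [|j IH].
    rewrite expr0 subrr mulr0 addr0 expr1n mul1r.
    by have -> : R0 / 2 * (1 + 1) = R0 by field.
  set Q := q ^+ j in IH.
  have Q0 : 0 < Q by exact: exprn_gt0.
  have Q1 : Q <= 1 by rewrite exprn_ile1 ?(ltW q0)// invf_le1 ?ler1n.
  have E1 : q ^+ j.+1 = q * Q by rewrite exprS.
  rewrite E1.
  have [c1 c2] := dg_contract G1 R00 Q0.
  have p1 : 0 < dg_tau Gam * R0 * Q by rewrite !mulr_gt0.
  have p2 : 0 < R0 / 2 * (1 + q * Q).
    by apply: mulr_gt0; [exact: divr_gt0|apply: addr_gt0 => //; exact: mulr_gt0].
  have p3 : [set x | enorm (x - y) <= R0 / 2 * (1 + Q)] `<=` eball x0 r0.
    move=> x /= xr; apply: sub => /=; apply: le_trans xr _.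
    rewrite -mulrA ler_piMr ?(ltW R00)//; lra.
  have kE : k0 + M * (1 - q * Q) - (k0 + M * (1 - Q)) = M * Q / 2 by rewrite /q; field.
  have p4 : k0 + M * (1 - Q) < k0 + M * (1 - q * Q).
    by rewrite -subr_gt0 kE divr_gt0// mulr_gt0.
  have := dg_step n0 G0 hv p1 p2 c1 p3 p4 IH _.
  rewrite kE => hh; apply: le_trans (hh _) _ => {hh}.
    (* Of the n + 2 powers of Q in the energy, two are used by (k' - k)^2 = (M Q / 2)^2 and n match
       the n-th power of h; the constants agree by the choice of [dg_eps]. *)
    rewrite le_eqVlt; apply/orP; left; apply/eqP.
    have nn : n%:R != 0 :> R by rewrite pnatr_eq0 -lt0n.
    have -> : 2 * (dg_tau Gam * R0 * Q / n%:R) = 2 * dg_tau Gam / n%:R * R0 * Q.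
      by field.
    rewrite /Z /dg_eps !exprMn.
    rewrite -(addn2 n) exprD.
    have MQ : M != 0 /\ Q != 0 by rewrite !gt_eqF.
    case: MQ => M1 Q2.
    move: (R0 ^+ n) (Q ^+ n) (dg_tau Gam ^+ n) (n%:R^-1 ^+ n) ((2 : R) ^+ n) => a b c e f.
    by field; rewrite ?M1 ?Q2.
  rewrite lee_fin; apply: le_trans (ler_wpM2r _ c2) _.
    by apply: mulr_ge0 => //; exact/exprn_ge0/ltW.
  by rewrite exprMn mulrA.
have mB := @measurable_eball R n y (R0 / 2).
have mS : measurable (eball y (R0 / 2) `&` [set x | k0 + M < v x]).
  by apply: measurableI => //; exact: measurable_gt.
have mf2 : measurable_fun setT (fun x => Num.max (v x - (k0 + M)) 0 ^+ 2).
  by apply: measurable_funX; exact: measurable_pos.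
have I0 : (\int[leb]_(x in eball y (R0 / 2)) (Num.max (v x - (k0 + M)) 0 ^+ 2)%:E = 0)%E.
  apply/eqP; rewrite eq_le; apply/andP; split; last by apply: int_ge0 => x _; exact: sqr_ge0.
  (* Each step of the iteration bounds the energy at the limit level k0 + M on the limit ball, since
     levels increase and radii decrease. *)
  have bd j : (\int[leb]_(x in eball y (R0 / 2)) (Num.max (v x - (k0 + M)) 0 ^+ 2)%:E <=
     (q ^+ j * Z)%:E)%E.
    have Q0 : 0 < q ^+ j by exact: exprn_gt0.
    have Q1 : q ^+ j <= 1 by rewrite exprn_ile1 ?(ltW q0)// invf_le1 ?ler1n.
    apply: (@le_trans _ _ ((q ^+ j) ^+ n.+2 * Z)%:E); last first.
      by rewrite lee_fin ler_wpM2r// exprS ler_piMr ?(ltW Q0)// exprn_ile1// ltW.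
    apply: le_trans (ind j).
    have sb : eball y (R0 / 2) `<=` eball y (R0 / 2 * (1 + q ^+ j)).
      by apply: eball_subr; rewrite ler_peMr ?divr_ge0 ?(ltW R00)// lerDl ltW.
    have mk2 : measurable_fun setT (fun x => Num.max (v x - (k0 + M * (1 - q ^+ j))) 0 ^+ 2).
      by apply: measurable_funX; exact: measurable_pos.
    refine (le_trans _ (int_sub leb mB (measurable_eball _ _) (measurable_funTS mk2) (fun x _ => sqr_ge0 _) sb)).
    apply: int_le => //; [exact: measurable_funTS|exact: measurable_funTS|].
    move=> x _; rewrite sqr_ge0/= sqr_pos_le// lerD2l ler_piMr ?(ltW M0)//.
    by rewrite gerBl ltW.
  apply/lee_addgt0Pr => e e0; rewrite add0e.
  have Z1 : 0 < Z + 1 by rewrite ltr_wpDl.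
  have [j hj] : exists j, q ^+ j < e / (Z + 1).
    have h : (q ^+ j @[j --> \oo] --> 0)%R by apply: cvg_expr; rewrite ger0_norm ?(ltW q0)// invf_lt1 ?ltr1n.
    have de : 0 < e / (Z + 1) by rewrite divr_gt0.
    have /cvgrPdist_lt/(_ _ de)[N _ hN] := h.
    by exists N; have := hN N (leqnn N); rewrite /= sub0r normrN ger0_norm// exprn_ge0// ltW.
  apply: le_trans (bd j) _; rewrite lee_fin.
  apply: (@le_trans _ _ (e / (Z + 1) * Z)); first by rewrite ler_wpM2r// ltW.
  by rewrite mulrAC ler_pdivrMr// ler_wpM2l ?(ltW e0)// lerDl.
apply: (ae_null mS (int_eq0_ae mB (measurable_funTS mf2) (fun x _ => sqr_ge0 _) I0)).
move=> x [xr /= xk] /(_ xr) /eqP; rewrite sqrf_eq0 => /eqP h.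
have : v x - (k0 + M) <= 0 by rewrite -h le_max lexx.
by rewrite subr_le0 leNgt xk.
Qed.

End de_giorgi.

(** * Expansion of positivity and the Harnack inequality in De Giorgi classes *)

Section harnack.
Context {R : realType} {n : nat}.
Implicit Types (u v : 'rV[R]_n -> R) (g : 'rV[R]_n -> 'rV[R]_n) (x y z : 'rV[R]_n).
Local Notation leb := (lebesgue_rV R n).

Definition dg_mu (Gam nu eta : R) : R := (nu * eta) ^+ 2 / (16 * (8 ^+ n) ^+ 3 * Gam).

(** t is chosen so that the energy term amounts to half of the left-hand side: after division by l X
    the inequality reads nu eta X / 2 <= (4 Gam E^3 / (nu eta)) al + nu eta X / 4. Solving for al
    gives the formula of [dg_mu], where E = 8^n. *)
Lemma expand_arith (Gam nu eta l R0 X E al : R) : 0 < Gam -> 0 < nu -> 0 < eta -> 0 < l ->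
  0 < R0 -> 0 < X -> 0 < E ->
  let t := 2 * Gam * E ^+ 2 / (nu * eta) * l / R0 in
  l / 2 * (eta * X) * (nu * X) <=
   2 * (2 * R0) * (E * X) * (t / 2 * al + (2 * t)^-1 * (Gam / (4 * R0 - 2 * R0) ^+ 2 * (l ^+ 2 * (E * X)))) ->
  (nu * eta) ^+ 2 / (16 * E ^+ 3 * Gam) * X <= al.
Proof.
move=> G0 nu0 eta0 l0 R00 X0 E0 t.
have R1 : 4 * R0 - 2 * R0 != 0 by rewrite gt_eqF//; lra.
have -> : l / 2 * (eta * X) * (nu * X) = l * X * (nu * eta * X / 2) by field.
have -> : 2 * (2 * R0) * (E * X) * (t / 2 * al + (2 * t)^-1 * (Gam / (4 * R0 - 2 * R0) ^+ 2 * (l ^+ 2 * (E * X)))) =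
  l * X * (4 * Gam * E ^+ 3 / (nu * eta) * al + nu * eta * X / 4).
  by rewrite /t; field; rewrite R1 !gt_eqF.
rewrite ler_pM2l ?mulr_gt0// => h.
have {}h : nu * eta * X / 4 <= 4 * Gam * E ^+ 3 / (nu * eta) * al by lra.
have c0 : 0 < 4 * Gam * E ^+ 3 / (nu * eta).
  by apply: divr_gt0; [apply: mulr_gt0; [exact: mulr_gt0|exact: exprn_gt0]|exact: mulr_gt0].
rewrite -(ler_pM2l c0); apply: le_trans h; rewrite le_eqVlt; apply/orP; left; apply/eqP.
by field; rewrite !gt_eqF.
Qed.

Lemma young_half (t a : R) : 0 < t -> a <= t / 2 + (2 * t)^-1 * a ^+ 2.
Proof.
move=> t0; rewrite -subr_ge0.
have -> : t / 2 + (2 * t)^-1 * a ^+ 2 - a = (2 * t)^-1 * (t - a) ^+ 2 by field; rewrite gt_eqF.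
by apply: mulr_ge0; [rewrite invr_ge0 mulr_ge0// ltW|exact: sqr_ge0].
Qed.

(** De Giorgi's isoperimetric argument: u cannot pass from the set u >= l to the set u < l / 2
    without a gradient in between. That gradient lives on the intermediate set and its energy is
    bounded by the Caccioppoli inequality, so the intermediate set cannot be small. *)
Lemma expand_step x0 (r0 Gam : R) u g y (R0 l nu eta : R) : (0 < n)%N -> 1 <= Gam ->
  dg x0 r0 Gam (fun x => - u x) g -> 0 < R0 -> 0 < l -> 0 < nu -> 0 < eta ->
  [set x | enorm (x - y) <= 4 * R0] `<=` eball x0 r0 -> (forall x, eball x0 r0 x -> 0 <= u x) ->
  ((nu * R0 ^+ n)%:E <= leb (eball y (2 * R0) `&` [set x | (l <= u x)%R]))%E ->
  ((eta * R0 ^+ n)%:E <= leb (eball y (2 * R0) `&` [set x | (u x < l / 2)%R]))%E ->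
  ((dg_mu Gam nu eta * R0 ^+ n)%:E <=
    leb (eball y (2 * R0) `&` [set x | (l / 2 <= u x < l)%R]))%E.
Proof.
move=> n0 G1 hv R00 l0 nu0 eta0 sub u0 hP hZ.
have [sv v2 g2 hC] := hv; have [mv mg _] := sv.
have G0 : 0 < Gam by exact: lt_le_trans G1.
have mu : measurable_fun setT u.
  rewrite (_ : u = fun x => - (- u x)); first exact: measurableT_comp.
  by apply/funext => x; rewrite opprK.
set Q := eball y (2 * R0) in hP hZ *.
have mQ : measurable Q by exact: measurable_eball.
have mD := @measurable_eball R n x0 r0.
have QD : Q `<=` eball x0 r0.
  move=> x /ltW xQ; apply: sub; apply: le_trans xQ _; lra.
pose v x := - u x; pose G1' := pos_grad v (- l) g; pose G2' := pos_grad v (- (l / 2)) g.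
have s1 : sob Q (fun x => Num.max (v x - - l) 0) G1'.
  exact: sobS mQ mD QD (sob_pos (- l) mD (leb_eball_fin x0 r0) sv g2).
have s2 : sob Q (fun x => Num.max (v x - - (l / 2)) 0) G2'.
  exact: sobS mQ mD QD (sob_pos (- (l / 2)) mD (leb_eball_fin x0 r0) sv g2).
(* f is 0 where u >= l and l / 2 where u < l / 2. It is written as a difference of two truncations
   of v = - u, the function that belongs to the De Giorgi class. *)
pose f x := Num.max (v x - - l) 0 + (-1) * Num.max (v x - - (l / 2)) 0.
pose G x := G1' x + (-1) *: G2' x.
have sf : sob Q f G by exact: sobD mQ s1 (sobZ (-1) mQ s2).
have [_ mG1 _] := s1; have [mf mG _] := sf.
pose P := Q `&` [set x | l <= u x]; pose Z := Q `&` [set x | (u x < l / 2)%R].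
have mP : measurable P by apply: measurableI => //; exact: measurable_ge.
have mZ : measurable Z by apply: measurableI => //; exact: measurable_lt.
have mS : measurable [set x | (l / 2 <= u x < l)%R].
  have := measurableI _ _ (measurable_ge (l / 2) mu) (measurable_lt l mu).
  by congr measurable; apply/seteqP; split => x /= => [[-> ->]|/andP[]].
set S := [set x | (l / 2 <= u x < l)%R] in mS *.
have l20 : 0 <= l / 2 by rewrite divr_ge0// ltW.
have iso : ((l / 2)%:E * leb Z * leb P <=
   (2 * (2 * R0) * (4 * (2 * R0)) ^+ n)%:E * \int[leb]_(x in Q) (enorm (G x))%:E)%E.
  apply: (@isoperimetric _ _ y (2 * R0) (l / 2) f G P Z) => //.
  - by rewrite mulr_gt0.
  - by move=> x [].
  - by move=> x [].
  - move=> x [_ /= lu]; rewrite /f /v !max_r ?mulr0 ?addr0//; lra.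
  - move=> x [_ /= lu]; rewrite /f /v !max_l; lra.
have QS := measurableI _ _ mQ mS.
have alf : leb (Q `&` S) \is a fin_num.
  rewrite ge0_fin_numE//; apply: le_lt_trans (leb_eball_fin y (2 * R0)).
  by apply: le_measure; rewrite ?inE// => x [].
set al := fine (leb (Q `&` S)).
have alE : leb (Q `&` S) = al%:E by rewrite fineK.
set X := R0 ^+ n in hP hZ *; have X0 : 0 < X by exact: exprn_gt0.
(* E X is the measure of a cube of side 8 R0: it bounds both the ball of radius 4 R0 and the set of
   shifts in [isoperimetric]. *)
pose E : R := 8 ^+ n; have E0 : 0 < E by exact: exprn_gt0.
pose t := 2 * Gam * E ^+ 2 / (nu * eta) * l / R0.
have t0 : 0 < t.
  apply: divr_gt0 => //; apply: mulr_gt0 => //; apply: divr_gt0; last exact: mulr_gt0.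
  by apply: mulr_gt0; [exact: mulr_gt0|exact: exprn_gt0].
have mGn := measurable_enormf mG; have mG1n := measurable_enormf mG1.
have mG12 : measurable_fun setT (fun x => enorm (G1' x) ^+ 2) by exact: measurable_funX.
have it0 : 0 <= (2 * t)^-1 by rewrite invr_ge0 mulr_ge0// ltW.
have t20 : 0 <= t / 2 by apply: divr_ge0 => //; exact: ltW.
have B1 : (\int[leb]_(x in Q) (enorm (G x))%:E <= (t / 2)%:E * leb (Q `&` S) +
   ((2 * t)^-1)%:E * \int[leb]_(x in Q) (enorm (G1' x) ^+ 2)%:E)%E.
  have mI : measurable_fun setT (fun x => t / 2 * \1_S x).
    by apply: measurable_funM; [exact: measurable_cst|exact: measurable_indic].
  have mJ : measurable_fun setT (fun x => (2 * t)^-1 * enorm (G1' x) ^+ 2).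
    by apply: measurable_funM; [exact: measurable_cst|].
  have I0 x : 0 <= t / 2 * \1_S x by rewrite indicE; apply: mulr_ge0.
  have J0 x : 0 <= (2 * t)^-1 * enorm (G1' x) ^+ 2 by apply: mulr_ge0 => //; exact: sqr_ge0.
  apply: (@le_trans _ _ (\int[leb]_(x in Q) (t / 2 * \1_S x + (2 * t)^-1 * enorm (G1' x) ^+ 2)%:E)%E).
    apply: int_le => //; [exact: measurable_funTS|by apply: measurable_funTS; exact: measurable_funD|].
    move=> x _; rewrite enorm_ge0/= /G /G1' /G2' /pos_grad /v !ltrN2 scalerA -scalerDl indicE.
    have [ul2|ul2] := ltP (u x) (l / 2).
      have ul : u x < l by lra.
      rewrite ul mulr1 subrr scale0r enorm0 addr_ge0//.
        exact: mulr_ge0.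
      by apply: mulr_ge0 => //; exact: sqr_ge0.
    have [ul|ul] := ltP (u x) l.
      rewrite mulr0 addr0 mem_set ?mulr1; last by rewrite /S/= ul2 ul.
      exact: young_half.
    rewrite mulr0 addr0 scale0r enorm0 expr0n/= mulr0 addr0.
    exact: mulr_ge0.
  rewrite (@int_add _ _ _ leb Q (fun x => t / 2 * \1_S x) (fun x => (2 * t)^-1 * enorm (G1' x) ^+ 2))//; last 2 first.
  - exact: measurable_funTS.
  - exact: measurable_funTS.
  apply: leeD.
    apply: int_le_support => //; first exact: measurable_funTS.
      by move=> x _ Sx; rewrite indicE mem_set// mulr1.
    by move=> x _ Sx; rewrite indicE memNset// mulr0.
  rewrite (@int_scale _ _ _ leb Q _ (fun x => enorm (G1' x) ^+ 2) mQ (measurable_funTS mG12) it0 (fun x _ => sqr_ge0 _)).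
  exact: lexx.
have B2 : (\int[leb]_(x in Q) (enorm (G1' x) ^+ 2)%:E <=
   (Gam / (4 * R0 - 2 * R0) ^+ 2 * (l ^+ 2 * (E * X)))%:E)%E.
  have p1 : 0 < 2 * R0 by rewrite mulr_gt0.
  have p2 : 2 * R0 < 4 * R0 by lra.
  apply: le_trans (hC (- l) y (2 * R0) (4 * R0) p1 p2 sub) _.
  rewrite [leRHS]EFinM; apply: lee_wpmul2l; first by rewrite lee_fin; apply: divr_ge0; [exact: ltW|exact: sqr_ge0].
  have mB := @measurable_eball R n y (4 * R0).
  apply: (@le_trans _ _ ((l ^+ 2)%:E * leb (eball y (4 * R0) `&` setT))%E).
    apply: int_le_support => //; last by move=> x _ [].
    - by apply: measurable_funTS; apply: measurable_funX; exact: measurable_pos.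
    - by move=> x _; exact: sqr_ge0.
    move=> x xB _; have ux : 0 <= u x by apply: u0; apply: sub; exact: ltW.
    have m0 (c : R) : 0 <= Num.max c 0 by rewrite le_max lexx orbT.
    rewrite lerXn2r ?nnegrE ?m0 ?(ltW l0)// ge_max (ltW l0) andbT; lra.
  rewrite setIT [leRHS]EFinM; apply: lee_wpmul2l; first by rewrite lee_fin sqr_ge0.
  have -> : E * X = (2 * (4 * R0)) ^+ n by rewrite /E /X -exprMn; congr (_ ^+ _); ring.
  by apply: lebesgue_eball_le; rewrite mulr_gt0.
rewrite alE lee_fin /dg_mu -/E.
apply: (@expand_arith Gam nu eta l R0 X E al) => //=; rewrite -/t -lee_fin.
have B3 : (\int[leb]_(x in Q) (enorm (G x))%:E <= (t / 2 * al + (2 * t)^-1 *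
    (Gam / (4 * R0 - 2 * R0) ^+ 2 * (l ^+ 2 * (E * X))))%:E)%E.
  apply: le_trans B1 _; rewrite alE [leRHS]EFinD -EFinM; apply: leeD2l; rewrite [leRHS]EFinM.
  by apply: lee_wpmul2l; rewrite ?lee_fin.
have EX : (4 * (2 * R0)) ^+ n = E * X by rewrite /E /X -exprMn; congr (_ ^+ _); ring.
rewrite EX in iso.
have c0 : 0 <= 2 * (2 * R0) * (E * X).
  by apply: mulr_ge0; apply/ltW; [rewrite !mulr_gt0|exact: mulr_gt0].
rewrite [leRHS]EFinM; apply: le_trans (lee_wpmul2l _ B3); last by rewrite lee_fin.
apply: le_trans iso; rewrite [leLHS]EFinM [((l / 2) * (eta * X))%:E]EFinM.
have c1 : (0 <= (l / 2)%:E)%E by rewrite lee_fin.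
apply: lee_pmul => //.
- by rewrite mule_ge0// lee_fin mulr_ge0// ltW.
- by rewrite lee_fin mulr_ge0// ltW.
by apply: lee_wpmul2l.
Qed.



Lemma leb_le (A B : set 'rV[R]_n) : measurable A -> measurable B -> A `<=` B -> (leb A <= leb B)%E.
Proof. by move=> mA mB AB; apply: le_measure; rewrite ?inE. Qed.

Lemma measure_split_lt u (Q : set 'rV[R]_n) (a b : R) : measurable Q -> measurable_fun setT u -> a <= b ->
  (leb (Q `&` [set x | (u x < b)%R]) =
   leb (Q `&` [set x | (u x < a)%R]) + leb (Q `&` [set x | (a <= u x < b)%R]))%E.
Proof.
move=> mQ mu ab.
have mS : measurable [set x | (a <= u x < b)%R].
  have := measurableI _ _ (measurable_ge a mu) (measurable_lt b mu).
  by congr measurable; apply/seteqP; split => x /= => [[-> ->]|/andP[]].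
rewrite -measureU; last 3 first.
- by apply: measurableI => //; exact: measurable_lt.
- exact: measurableI.
- rewrite -subset0 => x [[_ /= h1] [_ /= /andP[h2 _]]].
  by move: (le_lt_trans h2 h1); rewrite ltxx.
congr (leb _); rewrite -setIUr; congr (_ `&` _); apply/seteqP; split => x /=.
  by move=> xb; have [h|h] := ltP (u x) a; [left|right; rewrite xb].
by move=> [h|/andP[]//]; exact: lt_le_trans ab.
Qed.

(* Halving the level removes a fixed amount of measure from {u < l} (expand_step), so
   that after boundedly many halvings dg_sup applies to - u. *)
Lemma dg_expand (Gam nu : R) : (0 < n)%N -> 1 <= Gam -> 0 < nu ->
  exists2 c : R, 0 < c & forall x0 (r0 : R) u g y (R0 k : R),
    dg x0 r0 Gam (fun x => - u x) g -> 0 < R0 -> 0 < k ->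
    [set x | enorm (x - y) <= 4 * R0] `<=` eball x0 r0 -> (forall x, eball x0 r0 x -> 0 <= u x) ->
    ((nu * R0 ^+ n)%:E <= leb (eball y (2 * R0) `&` [set x | (k <= u x)%R]))%E ->
    leb (eball y R0 `&` [set x | (u x < c * k)%R]) = 0%E.
Proof.
move=> n0 G1 nu0; have G0 : 0 < Gam by exact: lt_le_trans G1.
have e0 := dg_eps_gt0 n0 G1; set e := dg_eps Gam in e0.
(* Then l^2 eta R0^n = e (l / 2)^2 (2 R0)^n, the energy that [dg_sup] allows on the ball of radius 2
   R0. *)
pose eta := e / 4 * 2 ^+ n.
have eta0 : 0 < eta by apply: mulr_gt0; [exact: divr_gt0|exact: exprn_gt0].
set mu := dg_mu Gam nu eta.
have mu0 : 0 < mu.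
  apply: divr_gt0; first by apply: exprn_gt0; exact: mulr_gt0.
  by apply: mulr_gt0 => //; apply: mulr_gt0 => //; do 2 apply: exprn_gt0.
(* Each halving removes at least mu R0^n from a set of measure at most 4^n R0^n. *)
pose s := (Num.truncn (4 ^+ n / mu)).+1.
have hs : 4 ^+ n < s%:R * mu by rewrite -ltr_pdivrMr//; exact: truncnS_gt.
pose q : R := 2^-1; have q0 : 0 < q by rewrite invr_gt0.
have q1 : q <= 1 by rewrite invf_le1 ?ler1n.
(* At most s halvings of the level, and a last one in [dg_sup]. *)
exists (q ^+ s.+1); first exact: exprn_gt0.
move=> x0 r0 u g y R0 k hv R00 k0 sub u0 hP.
have [[mv _ _] _ _ _] := hv.
have mu' : measurable_fun setT u.
  rewrite (_ : u = fun x => - (- u x)); first exact: measurableT_comp.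
  by apply/funext => x; rewrite opprK.
set Q := eball y (2 * R0) in hP *.
have mQ : measurable Q by exact: measurable_eball.
have Qoo : (leb Q < +oo)%E by exact: leb_eball_fin.
have fin S : measurable S -> leb (Q `&` S) \is a fin_num.
  move=> mS; rewrite ge0_fin_numE//; apply: le_lt_trans Qoo.
  by apply: leb_le; [exact: measurableI|exact: mQ|move=> x []].
pose a j := fine (leb (Q `&` [set x | u x < k * q ^+ j])).
have aE j : leb (Q `&` [set x | u x < k * q ^+ j]) = (a j)%:E.
  by rewrite fineK//; apply: fin; exact: measurable_lt.
set X := R0 ^+ n in hP *; have X0 : 0 < X by exact: exprn_gt0.
have lpos j : 0 < k * q ^+ j by apply: mulr_gt0 => //; exact: exprn_gt0.
have lhalf j : k * q ^+ j.+1 = k * q ^+ j / 2 by rewrite exprS /q; field.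
have [||||j js hj] := @decay_stop R a (4 ^+ n * X) (mu * X) (eta * X) s.
- by move=> j; rewrite fine_ge0.
- rewrite -lee_fin -aE; apply: (@le_trans _ _ (leb Q)).
    by apply: leb_le; [apply: measurableI => //; exact: measurable_lt|exact: mQ|move=> x []].
  have -> : 4 ^+ n * X = (2 * (2 * R0)) ^+ n by rewrite /X -exprMn; congr (_ ^+ _); ring.
  by apply: lebesgue_eball_le; exact: mulr_gt0.
- move=> j hj.
  have h : ((mu * X)%:E <= leb (Q `&` [set x | (k * q ^+ j / 2 <= u x < k * q ^+ j)%R]))%E.
    apply: (expand_step n0 G1 hv R00 (lpos j) nu0 eta0 sub u0).
      apply: le_trans hP _; apply: le_measure; rewrite ?inE.
      - by apply: measurableI => //; exact: measurable_ge.
      - by apply: measurableI => //; exact: measurable_ge.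
      move=> x [Qx /= kx]; split => //=; apply: le_trans kx.
      by rewrite ler_piMr ?(ltW k0)// exprn_ile1// ltW.
    by rewrite -lhalf aE lee_fin.
  have kq : k * q ^+ j / 2 <= k * q ^+ j by have := lpos j; lra.
  have := measure_split_lt mQ mu' kq.
  rewrite -lhalf !aE => h2; rewrite -lhalf in h.
  have := leeD2l (a j.+1)%:E h; rewrite -h2 -EFinD lee_fin; lra.
- by rewrite mulrA ltr_pM2r.
set l := k * q ^+ j.+1.
have l0 : 0 < l by exact: lpos.
have l2 : 0 < l / 2 by rewrite divr_gt0.
have R20 : 0 < 2 * R0 by exact: mulr_gt0.
have sub2 : [set x | enorm (x - y) <= 2 * R0] `<=` eball x0 r0.
  by move=> x /= xy; apply: sub => /=; apply: le_trans xy _; lra.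
(* For - u from the level - l to - l / 2, that is, u >= l / 2 almost everywhere on the ball of
   radius R0. *)
have := @dg_sup _ _ x0 r0 Gam _ _ y (2 * R0) (- l) (l / 2) n0 G1 hv R20 l2 sub2 _.
move=> hh; apply: null_sub (hh _) => {hh}.
- by apply: measurableI; [exact: measurable_eball|exact: measurable_lt].
- by apply: measurableI; [exact: measurable_eball|exact: measurable_gt].
- move=> x [xB /= ux]; split; first by have -> : 2 * R0 / 2 = R0 by field.
  rewrite /=; have : q ^+ s.+1 * k <= l / 2.
    rewrite /l -lhalf mulrC ler_wpM2l ?(ltW k0)//.
    by apply: ler_wiXn2l => //; exact: ltW.
  lra.
apply: (@le_trans _ _ ((l ^+ 2)%:E * leb (Q `&` [set x | (u x < l)%R]))%E).
  apply: int_le_support => //.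
  - exact: measurable_lt.
  - by apply: measurable_funTS; apply: measurable_funX; exact: measurable_pos.
  - by move=> x _; exact: sqr_ge0.
  - move=> x /ltW xQ _; have ux : 0 <= u x by apply: u0; apply: sub2.
    have m0 (c : R) : 0 <= Num.max c 0 by rewrite le_max lexx orbT.
    rewrite lerXn2r ?nnegrE ?m0 ?(ltW l0)// ge_max (ltW l0) andbT; lra.
  move=> x _ /= /negP; rewrite -leNgt => lu.
  by rewrite max_r ?expr0n//; lra.
rewrite /l aE -/l -EFinM lee_fin -/e.
have -> : e * (l / 2) ^+ 2 * (2 * R0) ^+ n = l ^+ 2 * (eta * X).
  by rewrite [(2 * R0) ^+ n]exprMn /eta -/X; field.
by rewrite ler_wpM2l ?sqr_ge0// ltW.
Qed.

(** A full ball of radius rho is a fixed proportion of the ball of radius 4 rho, so [dg_expand]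
    applies with R0 = 2 rho. The density (2 n)^-n comes from a cube inside the small ball. *)
Lemma dg_double (Gam : R) : (0 < n)%N -> 1 <= Gam ->
  exists2 c : R, 0 < c & forall x0 (r0 : R) u g y (rho k : R),
    dg x0 r0 Gam (fun x => - u x) g -> 0 < rho -> 0 < k ->
    [set x | enorm (x - y) <= 8 * rho] `<=` eball x0 r0 -> (forall x, eball x0 r0 x -> 0 <= u x) ->
    leb (eball y rho `&` [set x | (u x < k)%R]) = 0%E ->
    leb (eball y (2 * rho) `&` [set x | (u x < c * k)%R]) = 0%E.
Proof.
move=> n0 G1; have n0' : 0 < n%:R :> R by rewrite ltr0n.
have nu0 : 0 < ((2 * n%:R)^-1 : R) ^+ n by rewrite exprn_gt0// invr_gt0 mulr_gt0.
have [c c0 hc] := dg_expand n0 G1 nu0; exists c => // x0 r0 u g y rho k hv rho0 k0 sub u0 h.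
have [[mv _ _] _ _ _] := hv.
have mu' : measurable_fun setT u.
  rewrite (_ : u = fun x => - (- u x)); first exact: measurableT_comp.
  by apply/funext => x; rewrite opprK.
apply: (hc x0 r0 u g y (2 * rho) k hv) => //; first exact: mulr_gt0.
  by move=> x /= xy; apply: sub => /=; apply: le_trans xy _; lra.
have -> : (2 * n%:R)^-1 ^+ n * (2 * rho) ^+ n = (rho / n%:R) ^+ n.
  by rewrite -exprMn; congr (_ ^+ _); field; rewrite gt_eqF.
apply: le_trans (lebesgue_eball_ge y n0 rho0) _.
have mB := @measurable_eball R n y rho.
apply: (@le_trans _ _ (leb (eball y rho `&` [set x | (u x < k)%R]) +
    leb (eball y rho `&` [set x | (k <= u x)%R]))%E).
  apply: le_trans (measureU2 _ _ _) => //; last 2 first.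
  - by apply: measurableI => //; exact: measurable_lt.
  - by apply: measurableI => //; exact: measurable_ge.
  apply: le_measure; rewrite ?inE//.
    by apply: measurableU; apply: measurableI => //; [exact: measurable_lt|exact: measurable_ge].
  by move=> x xB; have [ux|ux] := ltP (u x) k; [left|right].
rewrite h add0e; apply: le_measure; rewrite ?inE.
- by apply: measurableI => //; exact: measurable_ge.
- by apply: measurableI; [exact: measurable_eball|exact: measurable_ge].
move=> x [xB ux]; split => //; apply: eball_subr xB; lra.
Qed.

Lemma exists_dyadic (R1 S : R) : 0 < R1 -> R1 < 2 * S ->
  exists j : nat, 2 ^+ j * R1 < 2 * S /\ 2 * S <= 2 ^+ j.+1 * R1.
Proof.
move=> R10 RS.
have [m hm] : exists m : nat, 2 * S <= 2 ^+ m * R1.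
  pose m := (Num.truncn (2 * S / R1)).+1; exists m.
  rewrite -ler_pdivrMr//; apply: le_trans (ltW (truncnS_gt _)) _.
  by rewrite -/m -natrX ler_nat; apply: ltnW; exact: ltn_expl.
have [i hi imin] := find_ex_minn (ex_intro (fun m : nat => 2 * S <= 2 ^+ m * R1) m hm).
case: i hi imin => [|j] hi imin; first by move: hi; rewrite expr0 mul1r leNgt RS.
exists j; split => //; rewrite ltNge; apply/negP => /imin; by rewrite ltnn.
Qed.

(** A doubling from radius rho looks at radius 8 rho. The last one has 2 rho <= 4 S, so it looks at
    16 S around y, hence at 17 S around y0. *)
Lemma double_iter (c0 : R) x0 (r0 : R) u y0 y (S R1 k : R) :
  (forall y' (rho k' : R), 0 < rho -> 0 < k' ->
    [set x | enorm (x - y') <= 8 * rho] `<=` eball x0 r0 ->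
    leb (eball y' rho `&` [set x | (u x < k')%R]) = 0%E ->
    leb (eball y' (2 * rho) `&` [set x | (u x < c0 * k')%R]) = 0%E) ->
  0 < c0 -> 0 < R1 -> 0 < k -> [set x | enorm (x - y0) <= 17 * S] `<=` eball x0 r0 ->
  enorm (y - y0) <= S -> leb (eball y R1 `&` [set x | (u x < k)%R]) = 0%E ->
  forall i : nat, 2 ^+ i * R1 <= 4 * S ->
  leb (eball y (2 ^+ i * R1) `&` [set x | (u x < c0 ^+ i * k)%R]) = 0%E.
Proof.
move=> hd c00 R10 k0 sub yS h; elim=> [|i IH] hi; first by rewrite !expr0 !mul1r.
rewrite exprS -mulrA in hi.
have p0 : 0 < 2 ^+ i * R1 by apply: mulr_gt0 => //; exact: exprn_gt0.
rewrite !exprS -!mulrA; apply: hd => //.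
- by apply: mulr_gt0 => //; exact: exprn_gt0.
- move=> x /= xy; apply: sub => /=; apply: le_trans (enorm_triangle y _ _) _.
  apply: le_trans (lerD xy yS) _; lra.
- by apply: IH; lra.
Qed.

(** The exponent b turns the loss c0 per doubling into a power of the scale: c0^j >= (2^-j)^b. *)
Lemma pow_half_le (c0 : R) : 0 < c0 -> exists b : nat, (2^-1 : R) ^+ b <= c0.
Proof.
move=> c00; exists (Num.truncn c0^-1).+1.
rewrite exprVn -[leRHS]invrK lef_pV2 ?posrE ?invr_gt0 ?exprn_gt0//.
apply: le_trans (ltW (truncnS_gt _)) _.
by rewrite -natrX ler_nat; apply: ltnW; exact: ltn_expl.
Qed.

(** From R1 = (S - s) / 4 the j + 1 doublings satisfy 2^(j+1) < 16 S / (S - s), so they cost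
    c0^(j+1) >= ((S - s) / (16 S))^b. The weight (S - s)^b compensates: (S / 2)^b t0 <= N < 2 (S -
    s)^b t returns to t0, and (S / 2) / (16 S) = 1 / 32 gives the constant. *)
Lemma harnack_arith (c0 c1 S s t t0 N R1 : R) (b j : nat) : 0 < c0 -> 0 < c1 -> (2^-1 : R) ^+ b <= c0 ->
  0 < s -> s < S -> 0 < t -> 0 < t0 -> R1 = (S - s) / 4 ->
  2 ^+ j * R1 < 2 * S -> N / 2 < (S - s) ^+ b * t -> (S / 2) ^+ b * t0 <= N ->
  c1 / (4 * 32 ^+ b) * t0 <= c0 ^+ j.+1 * (c1 * (t / 2)).
Proof.
move=> c00 c10 hb s0 sS t_gt0 t00 RE hj hN hN0.
have S0 : 0 < S by exact: lt_trans sS.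
have Ss : 0 < S - s by rewrite subr_gt0.
have R10 : 0 < R1 by rewrite RE divr_gt0.
pose P : R := 2 ^+ j.+1; have P0 : 0 < P by exact: exprn_gt0.
have h1 : (S - s) / (16 * S) <= P^-1.
  rewrite -[leRHS]mul1r ler_pdivlMr// mulrAC ler_pdivrMr ?mulr_gt0// mul1r.
  by move: hj; rewrite RE /P exprS; lra.
have h2 : ((S - s) / (16 * S)) ^+ b <= c0 ^+ j.+1.
  apply: (@le_trans _ _ (P^-1 ^+ b)).
    by rewrite lerXn2r ?nnegrE ?invr_ge0 ?(ltW P0)// divr_ge0 ?mulr_ge0// ltW.
  rewrite /P -exprVn -exprM mulnC exprM lerXn2r ?nnegrE ?exprn_ge0 ?invr_ge0// ltW//.
have h3 : c1 / (4 * 32 ^+ b) * t0 <= c1 / 2 * (((S - s) / (16 * S)) ^+ b * t).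
  have -> : c1 / (4 * 32 ^+ b) * t0 = c1 / 2 * (((S / 2) ^+ b * t0) / 2 / (16 * S) ^+ b).
    rewrite (_ : (32 : R) = 16 * 2); last by ring.
    rewrite !exprMn !exprVn; field; rewrite !expf_neq0 ?gt_eqF//.
  rewrite ler_pM2l ?divr_gt0// [((S - s) / _) ^+ b]exprMn exprVn -[leRHS]mulrA [_^-1 * t]mulrC [leRHS]mulrA ler_wpM2r//.
    by rewrite invr_ge0 exprn_ge0// mulr_ge0// ltW.
  lra.
apply: le_trans h3 _.
have -> : c0 ^+ j.+1 * (c1 * (t / 2)) = c1 / 2 * (c0 ^+ j.+1 * t) by field.
by rewrite ler_pM2l ?divr_gt0// ler_pM2r.
Qed.

(** Otherwise (u - t / 2)^+, at most K t, would have energy at most eps (t / 2)^2 R1^n, and [dg_sup]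
    from the level t / 2 would give u <= t on the half ball. The factor 4 K^2 is (K t)^2 / (t /
    2)^2. *)
Lemma density_of_sup (Gam K t : R) x0 (r0 : R) u g y (R1 : R) : (0 < n)%N -> 1 <= Gam -> 0 < K ->
  dg x0 r0 Gam u g -> 0 < R1 -> 0 < t -> [set x | enorm (x - y) <= R1] `<=` eball x0 r0 ->
  leb (eball y R1 `&` [set x | (K * t < u x)%R]) = 0%E ->
  leb (eball y (R1 / 2) `&` [set x | (t < u x)%R]) <> 0%E ->
  ((dg_eps (n := n) Gam / (4 * K ^+ 2) * R1 ^+ n)%:E <= leb (eball y R1 `&` [set x | (t / 2 <= u x)%R]))%E.
Proof.
move=> n0 G1 K0 hu R10 t0 sub hK ht; rewrite leNgt; apply/negP => hlt; apply: ht.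
have [[mu _ _] _ _ _] := hu.
have tE : t = t / 2 + t / 2 by field.
have t20 : 0 < t / 2 by rewrite divr_gt0.
rewrite {1}tE; apply: (dg_sup n0 G1 hu R10 t20 sub).
have mB := @measurable_eball R n y R1.
have mf2 : measurable_fun setT (fun x => Num.max (u x - t / 2) 0 ^+ 2).
  by apply: measurable_funX; exact: measurable_pos.
have m0 (c : R) : 0 <= Num.max c 0 by rewrite le_max lexx orbT.
(* The bound u <= K t holds only almost everywhere; the cap makes it hold everywhere without
   changing the integral. *)
pose h x := Num.min (Num.max (u x - t / 2) 0 ^+ 2) ((K * t) ^+ 2).
have mh : measurable_fun setT h by apply: measurable_minr => //; exact: measurable_cst.
have Kt : 0 < K * t by exact: mulr_gt0.
have E : {ae leb, forall x, eball y R1 x -> Num.max (u x - t / 2) 0 ^+ 2 = h x}.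
  exists (eball y R1 `&` [set x | (K * t < u x)%R]); split => //.
    by apply: measurableI => //; exact: measurable_gt.
  move=> x /= hx; apply: contrapT => nx; apply: hx => xB; rewrite /h min_l//.
  have ux : u x <= K * t by rewrite leNgt; apply/negP => ux; apply: nx.
  by rewrite lerXn2r ?nnegrE ?m0 ?(ltW Kt)// ge_max (ltW Kt) andbT; lra.
rewrite (integral_null mB (measurable_funTS mh) E); last by move=> x _; exact: sqr_ge0.
have mS : measurable [set x | (t / 2 <= u x)%R] by exact: measurable_ge.
apply: (@le_trans _ _ (((K * t) ^+ 2)%:E * leb (eball y R1 `&` [set x | (t / 2 <= u x)%R]))%E).
  apply: int_le_support => //.
  - exact: measurable_funTS.
  - by move=> x _; rewrite le_min !sqr_ge0.
  - by move=> x _ _; rewrite ge_min lexx orbT.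
  - move=> x _ /= /negP; rewrite -ltNge => xt.
    by rewrite /h max_r ?expr0n/= ?min_l ?sqr_ge0//; lra.
have Kt2 : 0 < (K * t) ^+ 2 by exact: exprn_gt0.
apply: (@le_trans _ _ (((K * t) ^+ 2)%:E * (dg_eps (n := n) Gam / (4 * K ^+ 2) * R1 ^+ n)%:E)%E).
  by apply: lee_wpmul2l; [rewrite lee_fin ltW|exact: ltW].
rewrite -EFinM lee_fin le_eqVlt; apply/orP; left; apply/eqP.
by field; rewrite gt_eqF.
Qed.

(* Almost maximize (S - s)^b t over the pairs (s, t) such that u > t on a non-null part
   of the ball of radius s. Near a suitable point, u is then at most a constant times t
   on a ball of radius (S - s) / 2, so that by dg_sup it exceeds t / 2 on a fixed
   proportion of that ball. The lower bound spreads to the ball of radius S by doubling;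
   b is chosen so that the loss is compensated by the weight (S - s)^b. *)
Lemma harnack_small (Gam : R) : (0 < n)%N -> 1 <= Gam ->
  exists2 c : R, 0 < c & forall x0 (r0 : R) u g gm y0 (S t : R),
    dg x0 r0 Gam u g -> dg x0 r0 Gam (fun x => - u x) gm -> 0 < S ->
    [set x | enorm (x - y0) <= 17 * S] `<=` eball x0 r0 -> (forall x, eball x0 r0 x -> 0 <= u x) ->
    0 < t -> leb (eball y0 (S / 2) `&` [set x | (t < u x)%R]) <> 0%E ->
    leb (eball y0 S `&` [set x | (u x < c * t)%R]) = 0%E.
Proof.
move=> n0 G1; have [c0 c00 hd] := dg_double n0 G1.
have [b hb] := pow_half_le c00.
have e0 := dg_eps_gt0 n0 G1; set e := dg_eps Gam in e0.
(* Moving to the midpoint of s and S divides the weight by 2^b, so a value above 4 2^b t there would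
   produce an element of [T] larger than 2 N. *)
pose K : R := 2 ^+ b.+2; have K0 : 0 < K by exact: exprn_gt0.
pose nu := e / (4 * K ^+ 2) * 2 ^+ n.
have nu0 : 0 < nu.
  by rewrite mulr_gt0 ?exprn_gt0// divr_gt0// mulr_gt0// exprn_gt0.
have [c1 c10 he] := dg_expand n0 G1 nu0.
exists (c1 / (4 * 32 ^+ b)); first by rewrite divr_gt0// mulr_gt0// exprn_gt0.
move=> x0 r0 u g gm y0 S t0 hu hm S0 sub u0 t00 ht0.
have [[mu _ _] u2 _ _] := hu.
have mB x r := @measurable_eball R n x r.
have mBg x r (k : R) : measurable (eball x r `&` [set z | (k < u z)%R]).
  by apply: measurableI => //; exact: measurable_gt.
have mBl x r (k : R) : measurable (eball x r `&` [set z | (u z < k)%R]).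
  by apply: measurableI => //; exact: measurable_lt.
pose T := [set w | exists s t, [/\ 0 < s < S, 0 < t,
  leb (eball y0 s `&` [set x | (t < u x)%R]) <> 0%E & w = (S - s) ^+ b * t]].
have T0 : T ((S / 2) ^+ b * t0).
  exists (S / 2), t0; split => //; first by apply/andP; split; lra.
  by congr (_ ^+ _ * _); lra.
(* A bound of u on the ball of radius S is needed for [T] to have a supremum; M does not enter the
   constant. *)
have [M M0 hM] : exists2 M : R, 0 < M & leb (eball y0 S `&` [set x | (M < u x)%R]) = 0%E.
  have S20 : 0 < 2 * S by exact: mulr_gt0.
  have sub2 : [set x | enorm (x - y0) <= 2 * S] `<=` eball x0 r0.
    by move=> x /= xy; apply: sub => /=; apply: le_trans xy _; lra.
  have sub2' : eball y0 (2 * S) `<=` eball x0 r0 by move=> x /ltW; exact: sub2.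
  have mp2 : measurable_fun setT (fun x => Num.max (u x - 0) 0 ^+ 2).
    by apply: measurable_funX; exact: measurable_pos.
  have Vfin : (\int[leb]_(x in eball y0 (2 * S)) (Num.max (u x - 0) 0 ^+ 2)%:E < +oo)%E.
    apply: le_lt_trans u2; apply: (@le_trans _ _ (\int[leb]_(x in eball x0 r0) (Num.max (u x - 0) 0 ^+ 2)%:E)%E).
      by apply: int_sub => //; [exact: measurable_funTS|move=> x _; exact: sqr_ge0].
    apply: int_le => //; [exact: measurable_funTS|by apply: measurable_funTS; exact: measurable_funX|].
    move=> x _; rewrite sqr_ge0/= subr0 maxEle; case: ifP => // _; by rewrite expr0n/= sqr_ge0.
  set V := (\int[leb]_(x in _) _)%E in Vfin.
  have V0 : (0 <= V)%E by apply: int_ge0 => x _; exact: sqr_ge0.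
  have VE : V = (fine V)%:E by rewrite fineK// ge0_fin_numE.
  have f0 : 0 <= fine V by exact: fine_ge0.
  pose C := e * (2 * S) ^+ n; have C0 : 0 < C by apply: mulr_gt0 => //; exact: exprn_gt0.
  (* As M >= 1, C M^2 >= C M >= V, which is the smallness required by [dg_sup]. *)
  pose M := fine V / C + 1; have M1 : 1 <= M by rewrite lerDr divr_ge0// ltW.
  have M0 : 0 < M by exact: lt_le_trans M1.
  exists M => //.
  have := @dg_sup _ _ x0 r0 Gam _ _ y0 (2 * S) 0 M n0 G1 hu S20 M0 sub2 _.
  rewrite add0r (_ : 2 * S / 2 = S); last by field.
  apply; rewrite -/V VE lee_fin -/e.
  have -> : e * M ^+ 2 * (2 * S) ^+ n = C * M ^+ 2 by rewrite /C; ring.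
  apply: (@le_trans _ _ (C * M)); last by rewrite ler_pM2l// expr2 ler_peMl// ltW.
  by rewrite mulrC -ler_pdivrMr// lerDl.
have supT : has_sup T.
  split; first by exists ((S / 2) ^+ b * t0).
  exists (S ^+ b * M) => w [s [t [/andP[s0 sS] t_gt0 hs ->]]].
  apply: ler_pM.
  - by rewrite exprn_ge0// subr_ge0 ltW.
  - exact: ltW.
  - by rewrite lerXn2r ?nnegrE ?subr_ge0 ?(ltW sS) ?(ltW S0)// gerBl ltW.
  rewrite leNgt; apply/negP => Mt; apply: hs; apply: null_sub hM => //.
  by move=> x [xs /= tx]; split; [apply: eball_subr xs; exact: ltW|exact: lt_trans tx].
set N := sup T.
have hN0 : (S / 2) ^+ b * t0 <= N by exact: (sup_upper_bound supT).
have N0 : 0 < N.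
  by apply: lt_le_trans hN0; apply: mulr_gt0 => //; apply: exprn_gt0; exact: divr_gt0.
have N20 : 0 < N / 2 by rewrite divr_gt0.
have [w [s [t [/andP[s0 sS] t_gt0 hs wE]]] hw] := sup_adherent N20 supT.
have {hw wE} hN : N / 2 < (S - s) ^+ b * t by move: hw; rewrite wE -/N; lra.
pose R1 := (S - s) / 2; have R10 : 0 < R1 by rewrite divr_gt0// subr_gt0.
have R20 : 0 < R1 / 2 by rewrite divr_gt0.
pose s' := (s + S) / 2.
have hK : leb (eball y0 s' `&` [set x | (K * t < u x)%R]) = 0%E.
  apply: contrapT => h.
  have : T ((S - s') ^+ b * (K * t)).
    exists s', (K * t); split => //; last exact: mulr_gt0.
    by rewrite /s'; apply/andP; split; lra.
  move/(sup_upper_bound supT); rewrite -/N.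
  have -> : S - s' = (S - s) * 2^-1 by rewrite /s'; field.
  have -> : ((S - s) * 2^-1) ^+ b * (K * t) = 4 * ((S - s) ^+ b * t).
    rewrite /K exprMn exprVn -(addn2 b) exprD; field.
    by rewrite expf_neq0.
  lra.
(* The non-null set where u > t is localized near one point y at scale R1 / 2; the ball of radius R1
   around y stays in the ball of radius s', where u <= K t almost everywhere. *)
have [y yE hy] : exists2 y, eball y0 s y & leb (eball y (R1 / 2) `&` [set x | (t < u x)%R]) <> 0%E.
  apply: contrapT => h; apply: hs; apply: (null_cover n0 R20) => // y [ys _].
  apply: contrapT => hy; apply: h; exists y => // h0; apply: hy.
  apply: null_sub h0 => //; first by apply: measurableI.
  by move=> x [[_ xt] xy]; split.
have yS : enorm (y - y0) <= S by apply/ltW; exact: lt_trans yE sS.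
have sy : eball y R1 `<=` eball y0 s'.
  by apply: eball_sub; rewrite /s' /R1; move: yE; rewrite /eball/=; lra.
have hK' : leb (eball y R1 `&` [set x | (K * t < u x)%R]) = 0%E.
  by apply: null_sub hK => // x [xR xt]; split => //; exact: sy.
have subD (a : R) : a <= 16 * S -> [set x | enorm (x - y) <= a] `<=` eball x0 r0.
  move=> aS x /= xy; apply: sub => /=; apply: le_trans (enorm_triangle y _ _) _.
  apply: le_trans (lerD xy yS) _; lra.
have RS : R1 <= S by rewrite /R1; lra.
have dens := density_of_sup n0 G1 K0 hu R10 t_gt0 (subD _ _) hK' hy.
have {}dens : ((nu * (R1 / 2) ^+ n)%:E <= leb (eball y (2 * (R1 / 2)) `&` [set x | (t / 2 <= u x)%R]))%E.
  have -> : 2 * (R1 / 2) = R1 by field.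
  have -> : nu * (R1 / 2) ^+ n = e / (4 * K ^+ 2) * R1 ^+ n.
    rewrite /nu [(R1 / 2) ^+ n]exprMn exprVn; field.
    by rewrite (gt_eqF K0) expf_neq0.
  by apply: dens; lra.
have t20 : 0 < t / 2 by rewrite divr_gt0.
have start := he x0 r0 u gm y (R1 / 2) (t / 2) hm R20 t20 (subD _ _) u0 dens.
have {}start : leb (eball y (R1 / 2) `&` [set x | (u x < c1 * (t / 2))%R]) = 0%E.
  by apply: start; lra.
have RS2 : R1 / 2 < 2 * S by lra.
(* Doubling stops at the first radius that is at least 2 S: the ball around y then contains the ball
   of radius S around y0. *)
have [j [j1 j2]] := exists_dyadic R20 RS2.
have ct0 : 0 < c1 * (t / 2) by exact: mulr_gt0.
have it := double_iter (fun y' rho k' h1 h2 h3 => hd x0 r0 u gm y' rho k' hm h1 h2 h3 u0)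
  c00 R20 ct0 sub yS start.
have jS : 2 ^+ j.+1 * (R1 / 2) <= 4 * S by rewrite exprS; lra.
apply: null_sub (it j.+1 jS) => // x [xS /= ux]; split.
  apply: (@eball_sub _ _ y y0 S (2 ^+ j.+1 * (R1 / 2))) xS.
  by rewrite -enormN opprB; lra.
rewrite /=; apply: lt_le_trans ux _.
apply: (@harnack_arith c0 c1 S s t t0 N (R1 / 2) b j) => //.
by rewrite /R1; field.
Qed.

(** A Harnack chain: if u >= k almost everywhere on the ball of radius S at z_j, then u > k / 2 on a
    non-null part of the ball of radius S / 2 at the next centre, which lies inside, and
    [harnack_small] applies there. The number of links is absolute because S is a fixed fraction of
    r. *)
Lemma harnack_core (Gam : R) : (0 < n)%N -> 1 <= Gam ->
  exists2 c : R, 0 < c & forall x0 (r : R) u g gm (t : R),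
    0 < r -> dg x0 (2 * r) Gam u g -> dg x0 (2 * r) Gam (fun x => - u x) gm ->
    (forall x, eball x0 (2 * r) x -> 0 <= u x) -> 0 < t ->
    leb (eball x0 r `&` [set x | (t < u x)%R]) <> 0%E ->
    leb (eball x0 r `&` [set x | (u x < c * t)%R]) = 0%E.
Proof.
move=> n0 G1; have [c c0 hc] := harnack_small n0 G1.
have c20 : 0 < c / 2 by rewrite divr_gt0.
exists (c * (c / 2) ^+ 72); first by apply: mulr_gt0 => //; exact: exprn_gt0.
move=> x0 r u g gm t r0 hu hm u0 t0 ht.
have [[mu _ _] _ _ _] := hu.
have mB x r := @measurable_eball R n x r.
have mBg x s (k : R) : measurable (eball x s `&` [set z | (k < u z)%R]).
  by apply: measurableI => //; exact: measurable_gt.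
have mBl x s (k : R) : measurable (eball x s `&` [set z | (u z < k)%R]).
  by apply: measurableI => //; exact: measurable_lt.
(* 17 S < r keeps every ball used inside the ball of radius 2 r. A segment of length at most 2 r
   splits into 72 steps of length at most r / 36 = S / 2. *)
pose S := r / 18; have S0 : 0 < S by rewrite divr_gt0.
have S20 : 0 < S / 2 by rewrite divr_gt0.
have sub y : eball x0 r y -> [set x | enorm (x - y) <= 17 * S] `<=` eball x0 (2 * r).
  move=> yr x /= xy; apply: le_lt_trans (enorm_triangle y _ _) _.
  by apply: le_lt_trans (lerD xy (lexx _)) _; move: yr; rewrite /eball/= /S; lra.
have [y yr hy] : exists2 y, eball x0 r y & leb (eball y (S / 2) `&` [set x | (t < u x)%R]) <> 0%E.
  apply: contrapT => h; apply: ht; apply: (null_cover n0 S20) => // y [ys _].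
  apply: contrapT => hy; apply: h; exists y => // h0; apply: hy.
  apply: null_sub h0 => //; first by apply: measurableI.
  by move=> x [[_ xt] xy]; split.
apply: (null_cover n0 S0) => // y' [yr' _].
pose z (j : nat) := y + (j%:R / 72) *: (y' - y).
have zr j : (j <= 72)%N -> eball x0 r (z j).
  move=> j72; apply: eball_convex => //; apply/andP; split; first exact: divr_ge0.
  by rewrite ler_pdivrMr// mul1r ler_nat.
have zz j : enorm (z j.+1 - z j) <= S / 2.
  have -> : z j.+1 - z j = (72^-1 : R) *: (y' - y).
    rewrite /z -natr1 mulrDl mul1r scalerDl.
    by rewrite opprD addrACA subrr add0r addrAC subrr add0r.
  rewrite enormZ ger0_norm ?invr_ge0//.
  have : enorm (y' - y) <= 2 * r.
    apply: le_trans (enorm_triangle x0 _ _) _; rewrite -(enormN (x0 - y)) opprB.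
    by move: yr yr'; rewrite /eball/=; lra.
  by rewrite /S; lra.
have chain j : (j <= 72)%N ->
    leb (eball (z j) S `&` [set x | (u x < c * (c / 2) ^+ j * t)%R]) = 0%E.
  elim: j => [|j IH] j72.
    rewrite expr0 mulr1 /z mul0r scale0r addr0.
    exact: (hc x0 (2 * r) u g gm y S t hu hm S0 (sub _ yr) u0 t0 hy).
  have {}IH := IH (ltnW j72); set k := c * (c / 2) ^+ j * t in IH.
  have k0 : 0 < k by apply: mulr_gt0 => //; apply: mulr_gt0 => //; exact: exprn_gt0.
  have -> : c * (c / 2) ^+ j.+1 * t = c * (k / 2) by rewrite exprS /k; field.
  apply: (hc x0 (2 * r) u g gm (z j.+1) S (k / 2) hu hm S0 (sub _ (zr _ j72)) u0).
    by rewrite divr_gt0.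
  move=> h.
  have := lebesgue_eball_ge (z j.+1) n0 S20; apply/negP; rewrite -ltNge.
  apply: (@le_lt_trans _ _ (leb (eball (z j.+1) (S / 2) `&` [set x | (k / 2 < u x)%R]) +
     leb (eball (z j) S `&` [set x | (u x < k)%R]))%E).
    apply: le_trans (measureU2 _ _ _) => //; apply: leb_le => //; first exact: measurableU.
    move=> x xz; have [ux|ux] := ltP (k / 2) (u x); first by left.
    right; split; last by rewrite /=; lra.
    by apply: (@eball_sub _ _ (z j) (z j.+1) (S / 2) S) xz; have := zz j; lra.
  by rewrite h IH adde0 lte_fin exprn_gt0// divr_gt0// ltr0n.
have := chain 72 (leqnn _); rewrite (_ : z 72 = y'); last first.
  have e72 : (72%:R / 72 : R) = 1 by rewrite divff.
  by rewrite /z e72 scale1r addrC subrK.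
move=> h; apply: null_sub h => //; first by apply: measurableI.
by move=> x [[_ xt] xy]; split.
Qed.

End harnack.

(** * From weak solutions to De Giorgi classes *)

Section fundamental_lemma.
Context {R : realType} {n : nat}.
Implicit Types (f U psi : 'rV[R]_n -> R) (x y : 'rV[R]_n).
Local Notation leb := (lebesgue_rV R n).

(* The test functions are mollifications of the sign of f: they are bounded by 1 and a
   subsequence of them converges almost everywhere. *)
Lemma weak_zero x0 (r1 r2 : R) f : (0 < n)%N -> r2 < r1 -> leb.-integrable setT (EFin \o f) ->
  (forall psi, fsmooth psi -> (forall x, out_ball x0 r1 x -> psi x = 0) ->
     \int[leb]_x (f x * psi x) = 0) ->
  {ae leb, forall x, eball x0 r2 x -> f x = 0}.
Proof.
move=> n0 r21 fi hf; have mf := measurable_of_integrable fi.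
pose B := eball x0 r2; have mB : measurable B by exact: measurable_eball.
pose P := B `&` [set x | 0 < f x]; pose N := B `&` [set x | f x < 0].
have mP : measurable P by apply: measurableI => //; exact: measurable_gt.
have mN : measurable N by apply: measurableI => //; exact: measurable_lt.
pose U x : R := \1_P x - \1_N x.
have mU : measurable_fun setT U by apply: measurable_funB; exact: measurable_indic.
have UE x : f x * U x = `|f x| * \1_B x.
  rewrite /U !indicE; have [Bx|Bx] := pselect (B x); last first.
    by rewrite (memNset Bx) !memNset ?subrr ?mulr0// => -[].
  rewrite (mem_set Bx) mulr1; case: (ltgtP (f x) 0) => fx.
  - rewrite [x \in P]memNset ?mem_set ?sub0r ?mulrN1 ?ltr0_norm//.
    by move=> [_ /= h]; move: (lt_trans fx h); rewrite ltxx.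
  - rewrite mem_set ?memNset ?subr0 ?mulr1 ?gtr0_norm//.
    by move=> [_ /= h]; move: (lt_trans fx h); rewrite ltxx.
  - by rewrite fx mul0r normr0.
have U1 x : `|U x| <= 1.
  rewrite /U !indicE; case: (x \in P); case: (x \in N);
    by rewrite ?subrr ?subr0 ?sub0r ?normrN ?normr0 ?normr1.
pose Q := [set y | enorm (y - x0) <= r2].
have cQ : compact Q by exact: compact_cball.
have mQ : measurable Q by apply: closed_measurable_rV; exact: closed_cball.
have UQ x : ~ Q x -> U x = 0.
  move=> Qx; have Bx : ~ B x by move=> h; apply: Qx; exact: ltW.
  by rewrite /U !indicE !memNset ?subrr// => -[].
have U2 : (\int[leb]_x (U x ^+ 2)%:E < +oo)%E.
  apply: (@le_lt_trans _ _ (1%:E * leb (setT `&` Q))%E).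
    apply: int_le_support => //.
    - exact: measurable_funX.
    - by move=> x _; exact: sqr_ge0.
    - by move=> x _ _; rewrite -real_normK ?num_real// expr_le1.
    - by move=> x _ Qx; rewrite UQ// expr0n.
  by rewrite setTI mul1e; exact: lebesgue_compact.
have iU := integrable_supp cQ mU UQ U2.
(* Errors 2^-(k+1) make the mollifications converge almost everywhere; a scale below r1 - r2 keeps
   their supports in the ball of radius r1. *)
have h (k : nat) : exists e : R, [/\ 0 < e, e < r1 - r2 &
    (\int[leb]_x ((convol U (bumpn e) x - U x) ^+ 2)%:E <= ((2 ^ k.+1)%:R^-1)%:E)%E].
  have d0 : 0 < ((2 ^ k.+1)%:R^-1 : R) by rewrite invr_gt0 ltr0n expn_gt0.
  have [e0 e00 he] := conv_L2 n0 cQ mU UQ U2 d0.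
  have m0 : 0 < Num.min e0 (r1 - r2) by rewrite lt_min e00 subr_gt0.
  have hm : Num.min e0 (r1 - r2) / 2 < Num.min e0 (r1 - r2) by lra.
  exists (Num.min e0 (r1 - r2) / 2); split.
  - by rewrite divr_gt0.
  - by apply: lt_le_trans hm _; rewrite ge_min lexx orbT.
  - apply: he; first by rewrite divr_gt0.
    by apply: lt_le_trans hm _; rewrite ge_min lexx.
pose e k := projT1 (cid (h k)).
have he k : [/\ 0 < e k, e k < r1 - r2 &
    (\int[leb]_x ((convol U (bumpn (e k)) x - U x) ^+ 2)%:E <= ((2 ^ k.+1)%:R^-1)%:E)%E].
  by rewrite /e; case: cid.
pose psi k := convol U (bumpn (e k)).
have sb k := @bumpn_fsmooth R n (e k).
have bb k : bounded_supp (bumpn (n := n) (e k)) by apply: bumpn_supp; case: (he k) => /ltW.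
have sp k : fsmooth (psi k) by exact: conv_fsmooth.
have p0 k x : out_ball x0 r1 x -> psi k x = 0.
  move=> xr; rewrite /psi /convol /Rintegral integral0_eq// => y _.
  have [Qy|Qy] := pselect (Q y); last by rewrite UQ// mul0r.
  have [e0 e1 _] := he k.
  rewrite bumpn_out ?mulr0 ?(ltW e0)//.
  have := enorm_triangle y x x0; rewrite -(enormN (x - y)) opprB.
  by move: xr Qy; rewrite /out_ball/Q/=; lra.
have p1 k x : `|psi k x| <= 1.
  have [e0 _ _] := he k.
  have ic := conv_integrable x iU (sb k) (bb k).
  apply: le_trans (le_normr_Rintegral measurableT ic) _.
  have ib : leb.-integrable setT (EFin \o (fun y => bumpn (e k) (y - x))).
    apply/integrableP; split.
      by apply/measurable_EFinP; exact: measurable_fsmooth (fsmooth_shift x (sb k)).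
    under eq_integral do rewrite /= ger0_norm ?bumpn_ge0//.
    rewrite (@ge0_integral_translate _ _ (- x) (fun y => (bumpn (e k) y)%:E)); last 2 first.
    - by apply/measurable_EFinP; exact: measurable_fsmooth.
    - by move=> y; rewrite lee_fin bumpn_ge0.
    by rewrite bumpn_int ?ltry.
  have E1 : \int[leb]_y bumpn (e k) (y - x) = 1.
    rewrite /Rintegral (@ge0_integral_translate _ _ (- x) (fun y => (bumpn (e k) y)%:E)); last 2 first.
    - by apply/measurable_EFinP; exact: measurable_fsmooth.
    - by move=> y; rewrite lee_fin bumpn_ge0.
    by rewrite bumpn_int.
  rewrite -[leRHS]E1; apply: le_Rintegral => //; first exact: integrable_norm.
  by move=> y _; rewrite normrM [`|bumpn _ _|]ger0_norm ?bumpn_ge0// ler_piMl// bumpn_ge0.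
have mpsi k : measurable_fun setT (psi k) by exact: measurable_fsmooth.
have hc : {ae leb, forall x, setT x -> (psi k x - U x @[k --> \oo] --> (0 : R))%R}.
  apply: L2_ae_cvg => //; first by move=> k; exact: measurable_funB.
  by move=> k; case: (he k).
have [|||||_ _ hd] := @dominated_convergence _ _ R leb setT measurableT
   (fun k => EFin \o (fun x => f x * psi k x)) (EFin \o (fun x => f x * U x)) (EFin \o (fun x => `|f x|)).
- by move=> k; apply/measurable_EFinP; exact: measurable_funM.
- by apply/measurable_EFinP; exact: measurable_funM.
- apply: filterS hc => x hx _; apply: cvg_EFin; first by near=> k.
  have {}hx := hx I.
  have h1 : (psi k x - U x + U x @[k --> \oo] --> 0 + U x)%R by apply: cvgD => //; exact: cvg_cst.
  have h2 : (psi k x @[k --> \oo] --> U x)%R.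
    by move: h1; rewrite add0r; under eq_fun do rewrite subrK.
  by have h3 : (f x * psi k x @[k --> \oo] --> f x * U x)%R by apply: cvgM => //; exact: cvg_cst.
- exact: integrable_norm.
- by apply: aeW => x k _ /=; rewrite lee_fin normrM ler_piMr.
have z k : (\int[leb]_x (EFin \o (fun x => (f x * psi k x)%R)) x = 0)%E.
  have ifp : leb.-integrable setT (EFin \o (fun x => f x * psi k x)).
    by apply: (@integrable_mulb _ _ _ leb setT f (psi k) 1).
  rewrite -[LHS]fineK; last exact: integrable_fin_num ifp.
  by congr EFin; exact: hf (p0 k).
have {}hd : (\int[leb]_x (`|f x| * \1_B x)%:E = 0)%E.
  have zz : [sequence (\int[leb]_x (EFin \o (fun x => (f x * psi k x)%R)) x)%E]_k = fun=> 0%E.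
    by apply/funext => k; exact: z.
  rewrite zz in hd.
  rewrite -[RHS](cvg_unique (@ereal_hausdorff R) hd (cvg_cst _)).
  by apply: eq_integral => x _ /=; rewrite UE.
have mfB : measurable_fun setT (fun x => `|f x| * \1_B x).
  by apply: measurable_funM; [exact: measurableT_comp|exact: measurable_indic].
have fB0 x : setT x -> 0 <= `|f x| * \1_B x by move=> _; rewrite indicE mulr_ge0.
apply: filterS (int_eq0_ae measurableT mfB fB0 hd) => x hx Bx.
have := hx I; rewrite indicE mem_set// mulr1 => /eqP; by rewrite normr_eq0 => /eqP.
Unshelve. all: by end_near. Qed.

End fundamental_lemma.

(** * Distance to the closed set and size of the weight *)

Section weight_bounds.
Context {R : realType} {n : nat}.
Implicit Types (Gam : set 'rV[R]_n) (x y z : 'rV[R]_n).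

Lemma edist_has_inf z Gam : Gam !=set0 -> has_inf [set enorm (z - y) | y in Gam].
Proof.
move=> [y0 Gy0]; split; first by exists (enorm (z - y0)), y0.
by exists 0 => _ [y _ <-]; exact: enorm_ge0.
Qed.

Lemma edist_lip Gam z z' : Gam !=set0 -> edist_set z Gam <= edist_set z' Gam + enorm (z - z').
Proof.
move=> G0; rewrite -lerBlDr; apply: lb_le_inf; first by case: (edist_has_inf z' G0).
move=> _ [y Gy <-]; rewrite lerBlDr addrC.
apply: le_trans (enorm_triangle z' z y).
by apply: ge_inf; [case: (edist_has_inf z G0)|exists y].
Qed.

Lemma edist_ge Gam x (r : R) : Gam !=set0 -> eball x r `<=` ~` Gam -> r <= edist_set x Gam.
Proof.
move=> G0 h; apply: lb_le_inf; first by case: (edist_has_inf x G0).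
move=> _ [y Gy <-]; rewrite leNgt; apply/negP => hy; apply: (h y) => //.
by rewrite /eball/= -enormN opprB.
Qed.

Lemma powR_anti (a b e : R) : 0 < a -> a <= b -> e <= 0 -> b `^ e <= a `^ e.
Proof.
move=> a0 ab e0; have b0 := lt_le_trans a0 ab.
move: e0; rewrite -oppr_ge0; move: (- e) (opprK e) => e' <- e0.
rewrite !powRN lef_pV2 ?posrE ?powR_gt0//.
by apply: ge0_ler_powR => //; rewrite ?nnegrE ltW.
Qed.

Lemma weight_le Gam (d D0 : R) z : d + 1 - n%:R <= 0 -> 0 < D0 -> D0 <= edist_set z Gam ->
  weight Gam d z <= D0 `^ (d + 1 - n%:R).
Proof. by move=> e0 D00 h; exact: powR_anti. Qed.

Lemma weight_ge Gam (d D1 : R) z : d + 1 - n%:R <= 0 -> 0 < edist_set z Gam -> edist_set z Gam <= D1 ->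
  D1 `^ (d + 1 - n%:R) <= weight Gam d z.
Proof. by move=> e0 D00 h; exact: powR_anti. Qed.

End weight_bounds.

Section ess_bounds.
Context {R : realType} {n : nat}.
Implicit Types (u : 'rV[R]_n -> R) (x : 'rV[R]_n).
Local Notation leb := (lebesgue_rV R n).

Lemma ae_mrestr x (r : R) (P : 'rV[R]_n -> Prop) :
  {ae leb, forall z, eball x r z -> P z} ->
  {ae mrestr leb (measurable_eball x r), forall z, P z}.
Proof.
move=> [N [mN N0 hN]]; have mB := @measurable_eball R n x r.
exists (N `|` ~` eball x r); split; first by apply: measurableU => //; exact: measurableC.
  apply/eqP; rewrite -measure_le0 -N0 /mrestr; apply: le_measure; rewrite ?inE//.
    by apply: measurableI => //; apply: measurableU => //; exact: measurableC.
  by move=> z [[Nz|nB] Bz].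
move=> z /= Pz; have [Bz|Bz] := pselect (eball x r z); last by right.
by left; apply: hN => /= h; apply: Pz; exact: h.
Qed.

(** If the essential infimum is a and b > a, the set u' < b is not null; by contraposition the set
    u' > b / c is null, so the essential supremum is at most b / c. With b = a + e c the excess is
    exactly e. *)
Lemma ess_harnack x (r c : R) u u' : 0 < c -> measurable_fun setT u' ->
  {ae leb, forall z, eball x r z -> u z = u' z} -> (forall z, 0 <= u' z) ->
  (forall t, 0 < t -> leb (eball x r `&` [set z | t < u' z]) <> 0%E ->
     leb (eball x r `&` [set z | u' z < c * t]) = 0%E) ->
  (ess_sup_ball x r u <= (c^-1)%:E * ess_inf_ball x r u)%E.
Proof.
move=> c0 mu hu u0 h; have mB := @measurable_eball R n x r.
have inf0 : (0 <= ess_inf_ball x r u)%E.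
  apply/ess_infP; apply: ae_mrestr; apply: filterS hu => z hz Bz.
  by rewrite /= lee_fin hz.
case E : (ess_inf_ball x r u) inf0 => [a| |]//; last first.
  by move=> _; rewrite gt0_muley ?lte_fin ?invr_gt0// leey.
rewrite lee_fin => a0; apply/lee_addgt0Pr => e e0.
pose b := a + e * c; have b0 : 0 < b by rewrite ltr_wpDl// mulr_gt0.
pose t := b / c; have t0 : 0 < t by rewrite divr_gt0.
have ct : c * t = b by rewrite /t mulrCA mulfV ?mulr1// gt_eqF.
have mA : measurable (eball x r `&` [set z | u' z < c * t]).
  by apply: measurableI => //; exact: measurable_lt.
have mA' : measurable (eball x r `&` [set z | t < u' z]).
  by apply: measurableI => //; exact: measurable_gt.
have n1 : leb (eball x r `&` [set z | t < u' z]) = 0%E.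
  apply: contrapT => /(h _ t0) A0.
  have : (b%:E <= ess_inf_ball x r u)%E.
    apply/ess_infP; apply: ae_mrestr.
    have aA : {ae leb, forall z, ~ (eball x r `&` [set z | u' z < c * t]) z}.
      by exists (eball x r `&` [set z | u' z < c * t]); split => // z /= /contrapT.
    apply: filterS2 hu aA => z hz nz Bz; rewrite /= lee_fin hz// leNgt.
    by apply/negP => zb; apply: nz; split => //=; rewrite ct.
  by rewrite E lee_fin /b gerDl leNgt mulr_gt0.
apply: (@le_trans _ _ t%:E); last first.
  rewrite -EFinM -EFinD lee_fin le_eqVlt; apply/orP; left; apply/eqP.
  by rewrite /t /b; field; rewrite gt_eqF.
apply/ess_supP; apply: ae_mrestr.
have aA : {ae leb, forall z, ~ (eball x r `&` [set z | t < u' z]) z}.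
  by exists (eball x r `&` [set z | t < u' z]); split => // z /= /contrapT.
apply: filterS2 hu aA => z hz nz Bz; rewrite /= lee_fin hz// leNgt.
by apply/negP => zb; apply: nz; split.
Qed.

End ess_bounds.

(** * Cutting functions off a null set *)

Section nonmeasurable_cuts.
Context {R : realType} {n : nat}.
Implicit Types (f h u phi : 'rV[R]_n -> R) (x y : 'rV[R]_n) (E N S : set 'rV[R]_n).
Local Notation leb := (lebesgue_rV R n).

(** Monotonicity read on the supremum over simple functions, for the integrands of the definitions,
    which are measurable only up to null sets. *)
Lemma ge0_le_integral_nm (f g : 'rV[R]_n -> \bar R) : (forall x, (0 <= f x)%E) ->
  (forall x, (f x <= g x)%E) -> (\int[leb]_x f x <= \int[leb]_x g x)%E.
Proof.
move=> f0 fg; have g0 x : (0 <= g x)%E by exact: le_trans (fg x).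
rewrite !ge0_integralTE//; apply: le_ereal_sup => _ [h hf <-]; exists h => // x.
exact: le_trans (hf x) (fg x).
Qed.

Lemma measurable_cut S E f h : measurable S -> measurable E -> S `<=` E -> measurable_fun E h ->
  (forall y, S y -> f y = h y) -> measurable_fun setT (fun y => \1_S y * f y).
Proof.
move=> mS mE SE mh fh.
have -> : (fun y => \1_S y * f y) = h \_ S.
  apply/funext => y; rewrite patchE indicE; case: ifPn => [/set_mem/fh ->|_]; first by rewrite mul1r.
  by rewrite mul0r.
by apply/(measurable_restrictT _ mS); exact: measurable_funS mE SE mh.
Qed.

Lemma Rint_cut E N f h : measurable E -> measurable N -> leb N = 0%E -> measurable_fun setT h ->
  (forall y, E y -> ~ N y -> f y = h y) -> (forall y, ~ E y -> h y = 0) ->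
  \int[leb]_(y in E) f y = \int[leb]_y h y.
Proof.
move=> mE mN N0 mh fh h0.
rewrite (@Rintegral_null _ _ _ leb f h E mE (measurable_funTS mh)); last first.
  exists N; split => // y /= hy; apply: contrapT => Ny; apply: hy => Ey; exact: fh.
rewrite Rintegral_mkcond; apply: eq_Rintegral => y _; rewrite patchE; case: ifPn => // yE.
by rewrite h0// => /mem_set; apply/negP.
Qed.

Lemma integrable_cut E x (rho : R) N f h : measurable E -> [set y | enorm (y - x) <= rho] `<=` E ->
  measurable N -> leb N = 0%E -> measurable_fun E h ->
  (forall y, E y -> ~ N y -> f y = h y) -> L1loc E f ->
  leb.-integrable setT (EFin \o (fun y => \1_([set y | enorm (y - x) <= rho] `\` N) y * f y)).
Proof.
move=> mE cE mN N0 mh fh [_ lf]; set C := [set y | _] in cE *.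
have cC : compact C by exact: compact_cball.
have mC : measurable C by apply: closed_measurable_rV; exact: closed_cball.
have mS : measurable (C `\` N) by exact: measurableD.
have mf : measurable_fun setT (fun y => \1_(C `\` N) y * f y).
  by apply: (measurable_cut mS mE _ mh) => [y [/cE]|y [/cE Ey Ny]] //; exact: fh.
apply/integrableP; split; first exact/measurable_EFinP.
apply: le_lt_trans (lf C cC cE).
rewrite (@integral_null _ _ _ leb _ (fun y => `|\1_(C `\` N) y * f y|) C mC)//; last 2 first.
- by apply: measurable_funTS; exact: measurableT_comp.
- exists N; split => // y /= hy; apply: contrapT => Ny; apply: hy => Cy.
  by rewrite indicE mem_set// mul1r.
rewrite [leRHS]integral_mkcond; apply: ge0_le_integral_nm => y; first by rewrite lee_fin.
rewrite patchE; case: ifPn => //= yC; rewrite indicE memNset ?mul0r ?normr0// => -[/mem_set].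
by rewrite (negbTE yC).
Qed.

Lemma grad_coord (i : 'I_n) x : grad (fun y : 'rV[R]_n => y 0 i) x = delta_mx 0 i.
Proof.
by apply: grad_is_derive => v; rewrite dotvC dotv_delta; exact: is_derive_coord.
Qed.

Lemma sq_fin_add (b : set 'rV[R]_n) f h : measurable b -> measurable_fun setT f -> measurable_fun setT h ->
  (\int[leb]_(y in b) (f y ^+ 2)%:E < +oo)%E -> (\int[leb]_(y in b) (h y ^+ 2)%:E < +oo)%E ->
  (\int[leb]_(y in b) ((f y + h y) ^+ 2)%:E < +oo)%E.
Proof.
move=> mb mf mh f2 h2; apply: le_lt_trans (int_sqD _ mb (measurable_funTS mf) (measurable_funTS mh)) _.
by rewrite lte_mul_pinfty// lte_add_pinfty.
Qed.

Lemma sq_fin_mulb (b : set 'rV[R]_n) f h (M : R) : measurable b -> measurable_fun setT f -> measurable_fun setT h ->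
  (forall y, b y -> `|h y| <= M) -> (\int[leb]_(y in b) (f y ^+ 2)%:E < +oo)%E ->
  (\int[leb]_(y in b) ((h y * f y) ^+ 2)%:E < +oo)%E.
Proof.
move=> mb mf mh hM f2.
have mf2 : measurable_fun setT (fun y => f y ^+ 2) by exact: measurable_funX.
apply: (@le_lt_trans _ _ (\int[leb]_(y in b) (M ^+ 2 * f y ^+ 2)%:E)%E).
  apply: int_le => //.
  - by apply: measurable_funTS; apply: measurable_funX; exact: measurable_funM.
  - by apply: measurable_funTS; apply: measurable_funM => //; exact: measurable_cst.
  move=> y yb; rewrite sqr_ge0/= exprMn ler_wpM2r ?sqr_ge0//.
  rewrite -(real_normK (num_real (h y))) lerXn2r ?nnegrE// ?hM//.
  exact: le_trans (hM y yb).
rewrite (@int_scale _ _ _ leb _ (M ^+ 2) (fun y => f y ^+ 2) mb (measurable_funTS mf2) (sqr_ge0 _) (fun y _ => sqr_ge0 _)).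
by rewrite lte_mul_pinfty// ?lee_fin ?sqr_ge0.
Qed.

End nonmeasurable_cuts.

(** * Local square integrability and bounds for the cut functions *)

Section reduction.
Context {R : realType} {n : nat}.
Implicit Types (u phi : 'rV[R]_n -> R) (g : 'rV[R]_n -> 'rV[R]_n) (x y : 'rV[R]_n) (E N Gam : set 'rV[R]_n).
Local Notation leb := (lebesgue_rV R n).
Local Notation cball x r := [set y | enorm (y - x) <= r].

(** A single null set N for u and all components of g: multiplied by the indicator of a closed ball
    in E minus N, they become Borel on the whole space, with the same integrals against functions
    supported in the ball. *)
Definition borel_off E N u g := [/\ measurable E, measurable N, leb N = 0%E,
  exists2 h : 'rV[R]_n -> R, measurable_fun E h & forall y, E y -> ~ N y -> u y = h y &
  forall i, exists2 h : 'rV[R]_n -> R, measurable_fun E h & forall y, E y -> ~ N y -> g y 0 i = h y].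

Definition cutf S (u : 'rV[R]_n -> R) y : R := \1_S y * u y.
Definition cutv S g y : 'rV[R]_n := \1_S y *: g y.

Lemma cut_facts E N u g x (rho : R) : borel_off E N u g -> cball x rho `<=` E ->
  L1loc E u -> (forall i, L1loc E (fun y => g y 0 i)) ->
  let S := cball x rho `\` N in
  [/\ measurable_fun setT (cutf S u), measurable_fun setT (cutv S g),
   leb.-integrable setT (EFin \o cutf S u) &
   forall i, leb.-integrable setT (EFin \o (fun y => cutv S g y 0 i))].
Proof.
move=> [mE mN N0 [hu mhu uE] hg] cE lu lg S.
have iu := integrable_cut mE cE mN N0 mhu uE lu.
have ig i : leb.-integrable setT (EFin \o (fun y => cutv S g y 0 i)).
  have [h mh gE] := hg i.
  have := integrable_cut mE cE mN N0 mh gE (lg i).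
  by congr (_.-integrable); apply/funext => y /=; rewrite /cutv mxE.
split => //; first exact: measurable_of_integrable.
by apply: measurable_fun_rV => i; exact: measurable_of_integrable.
Qed.

(** phi and its derivatives vanish off the ball, so cutting changes the two integrands on E only on
    the null set N. *)
Lemma cut_ibp E N u g x (rho : R) phi i : borel_off E N u g -> cball x rho `<=` E ->
  distr_grad E u g -> fsmooth phi -> (forall y, out_ball x rho y -> phi y = 0) ->
  let S := cball x rho `\` N in
  \int[leb]_y (cutf S u y * partial i phi y) = - \int[leb]_y (cutv S g y 0 i * phi y).
Proof.
move=> bo cE [lu lg ibp] sp p0 S.
have [mu mg _ _] := cut_facts bo cE lu lg.
have [mE mN N0 _ _] := bo.
have t := test_fun_ball sp p0 cE.
have mp := measurable_fsmooth sp; have mpp := measurable_fsmooth (fsmooth_partial i sp).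
have nC y : ~ cball x rho y -> out_ball x rho y by move=> /negP; rewrite -ltNge.
rewrite -(@Rint_cut _ _ E N (fun y => u y * partial i phi y) _ mE mN N0); last 3 first.
- exact: measurable_funM.
- move=> y Ey Ny; rewrite /cutf indicE; have [Cy|Cy] := pselect (cball x rho y).
    by rewrite mem_set// mul1r.
  by rewrite partialE (grad_vanish p0) ?mxE ?mulr0//; exact: nC.
- by move=> y Ey; rewrite /cutf indicE memNset ?mul0r// => -[/cE].
rewrite -(@Rint_cut _ _ E N (fun y => g y 0 i * phi y) _ mE mN N0); last 3 first.
- by apply: measurable_funM => //; exact: measurable_coordf.
- move=> y Ey Ny; rewrite /cutv mxE indicE; have [Cy|Cy] := pselect (cball x rho y).
    by rewrite mem_set// mul1r.
  by rewrite p0 ?mulr0//; exact: nC.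
- by move=> y Ey; rewrite /cutv mxE indicE memNset ?mul0r// => -[/cE].
exact: ibp.
Qed.

Lemma common_null (I : finType) E (f : I -> 'rV[R]_n -> R) :
  (forall i, lebesgue_measurable_fun E (f i)) ->
  exists N, [/\ measurable N, leb N = 0%E & forall i, exists2 h : 'rV[R]_n -> R, measurable_fun E h &
    forall y, E y -> ~ N y -> f i y = h y].
Proof.
move=> hf.
pose h i := projT1 (cid2 (hf i)).
have mh i : measurable_fun E (h i) by rewrite /h; case: cid2.
have ae i : {ae leb, forall y, E y -> f i y = h i y} by rewrite /h; case: cid2.
have [N [mN N0 hN]] := filter_forall _ ae.
exists N; split => // i; exists (h i) => // y Ey Ny.
by apply: contrapT => ne; apply: Ny; apply: hN => /= /(_ i Ey).
Qed.

Lemma ibp_balance (a b c : R) : - a + b = - c -> a - (c + b) = 0.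
Proof. by lra. Qed.

(** The integrand is component i of phi g + u grad phi. This field and the gradient G provided by
    [W] are both weak gradients of phi u, hence equal almost everywhere by [weak_zero]; the weight
    is at least m on the ball, so the weighted bound on G gives a plain one. *)
Lemma product_sq_fin E N u g Gam (d m : R) x (r2 rho : R) phi i : (0 < n)%N ->
  closed Gam -> E `<=` ~` Gam -> borel_off E N u g -> cball x rho `<=` E -> r2 < rho ->
  distr_grad E u g -> 0 < m -> (forall y, cball x rho y -> m <= weight Gam d y) ->
  fsmooth phi -> (forall y, out_ball x rho y -> phi y = 0) -> W Gam d (fun y => phi y * u y) ->
  forall S, S = cball x rho `\` N ->
  (\int[leb]_(y in eball x r2) ((phi y * cutv S g y 0 i + cutf S u y * partial i phi y) ^+ 2)%:E < +oo)%E.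
Proof.
move=> n0 cG EG bo cE r2r dg m0 hm sp p0 [G [lG1 lG2 ibpG] G2] _ ->.
set S := cball x rho `\` N.
have [lu lg _] := dg; have [mu mg iu ig] := cut_facts bo cE lu lg.
have [mE mN N0 _ _] := bo.
have mO : measurable (~` Gam) by apply: open_measurable_rV; exact: closed_openC.
have cO : cball x rho `<=` ~` Gam by move=> y /cE /EG.
have [NG [mNG NG0 hG]] := common_null (fun i => (lG2 i).1).
have mp := measurable_fsmooth sp; have spi := fsmooth_partial i sp.
have mpp := measurable_fsmooth spi.
pose SG := cball x rho `\` NG.
have iG j : leb.-integrable setT (EFin \o (fun y => cutv SG G y 0 j)).
  have [h mh GE] := hG j.
  have := integrable_cut mO cO mNG NG0 mh GE (lG2 j).
  by congr (_.-integrable); apply/funext => y /=; rewrite /cutv mxE.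
pose P y := phi y * cutv S g y 0 i + cutf S u y * partial i phi y.
have [M M0 hM] := bounded_cball (fsmooth_cont sp) p0.
have pp0 y : out_ball x rho y -> partial i phi y = 0.
  by move=> yr; rewrite partialE (grad_vanish p0)// mxE.
have [M' M'0 hM'] := bounded_cball (fsmooth_cont spi) pp0.
have i1 : leb.-integrable setT (EFin \o (fun y => cutv S g y 0 i * phi y)).
  exact: (@integrable_mulb _ _ _ leb setT _ phi M).
have i2 : leb.-integrable setT (EFin \o (fun y => cutf S u y * partial i phi y)).
  exact: (@integrable_mulb _ _ _ leb setT _ _ M').
have iP : leb.-integrable setT (EFin \o P).
  have := integrableD measurableT i1 i2; congr (_.-integrable); apply/funext => y.
  by rewrite /= /P [phi y * _]mulrC EFinD.
have mP := measurable_of_integrable iP.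
have mGi := measurable_of_integrable (iG i).
have iD : leb.-integrable setT (EFin \o (fun y => cutv SG G y 0 i - P y)).
  exact: (integrableB measurableT (iG i) iP).
have nC y : ~ cball x rho y -> out_ball x rho y by move=> /negP; rewrite -ltNge.
have z : {ae leb, forall y, eball x r2 y -> cutv SG G y 0 i - P y = 0}.
  apply: (weak_zero n0 r2r iD) => psi ss s0.
  have ms := measurable_fsmooth ss; have sps := fsmooth_partial i ss.
  have [K K0 hK] := bounded_cball (fsmooth_cont ss) s0.
  have ps0 y : out_ball x rho y -> partial i psi y = 0.
    by move=> yr; rewrite partialE (grad_vanish s0)// mxE.
  have tO := ibpG psi i (test_fun_ball ss s0 cO).
  have bI f : leb.-integrable setT (EFin \o f) -> leb.-integrable setT (EFin \o (fun y => f y * psi y)).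
    by move=> fi; apply: (@integrable_mulb _ _ _ leb setT f psi K).
  have eG : \int[leb]_(y in ~` Gam) (G y 0 i * psi y) = \int[leb]_y (cutv SG G y 0 i * psi y).
    apply: (Rint_cut mO mNG NG0); first exact: measurable_funM.
      move=> y Oy Ny; rewrite /cutv mxE indicE; have [Cy|Cy] := pselect (cball x rho y).
        by rewrite mem_set// mul1r.
      by rewrite s0 ?mulr0//; exact: nC.
    by move=> y Oy; rewrite /cutv mxE indicE memNset ?mul0r// => -[/cO].
  have eu : \int[leb]_(y in ~` Gam) (phi y * u y * partial i psi y) =
      \int[leb]_y (cutf S u y * (phi y * partial i psi y)).
    apply: (Rint_cut mO mN N0).
      by apply: measurable_funM => //; apply: measurable_funM => //; exact: measurable_fsmooth.
      move=> y Oy Ny; rewrite /cutf indicE; have [Cy|Cy] := pselect (cball x rho y).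
        by rewrite mem_set// mul1r; ring.
      by rewrite p0 ?mul0r ?mulr0//; exact: nC.
    by move=> y Oy; rewrite /cutf indicE memNset ?mul0r// => -[/cO].
  rewrite eG eu in tO.
  have pq0 y : out_ball x rho y -> phi y * psi y = 0 by move=> yr; rewrite p0// mul0r.
  (* Testing the gradient of u with phi psi is the product rule for phi u tested with psi. *)
  have /= t := cut_ibp i bo cE dg (fsmoothM sp ss) pq0.
  have j1 := bI _ i1; have j2 := bI _ i2.
  have j3 : leb.-integrable setT (EFin \o (fun y => cutf S u y * (phi y * partial i psi y))).
    have pp1 y : out_ball x rho y -> phi y * partial i psi y = 0 by move=> yr; rewrite p0// mul0r.
    have [K' K'0 hK'] := bounded_cball (fsmooth_cont (fsmoothM sp sps)) pp1.
    apply: (@integrable_mulb _ _ _ leb setT _ _ K') => //.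
    exact: measurable_fsmooth (fsmoothM sp sps).
  have t1 : \int[leb]_y (cutf S u y * partial i (fun y0 => phi y0 * psi y0) y) =
     \int[leb]_y (cutf S u y * (phi y * partial i psi y)) +
     \int[leb]_y (cutf S u y * partial i phi y * psi y).
    rewrite -RintegralD//; apply: eq_Rintegral => y _.
    by rewrite !partialE gradM// !mxE; ring.
  have t2 : \int[leb]_y (cutv S g y 0 i * (phi y * psi y)) = \int[leb]_y (cutv S g y 0 i * phi y * psi y).
    by apply: eq_Rintegral => y _; rewrite mulrA.
  rewrite t1 t2 tO in t.
  have -> : \int[leb]_y ((cutv SG G y 0 i - P y) * psi y) = \int[leb]_y (cutv SG G y 0 i * psi y) -
     (\int[leb]_y (cutv S g y 0 i * phi y * psi y) + \int[leb]_y (cutf S u y * partial i phi y * psi y)).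
    rewrite -RintegralD// -RintegralB//; last 2 first.
    - exact: bI.
    - by have := integrableD measurableT j1 j2; congr (_.-integrable); apply/funext => y; rewrite /= EFinD.
    by apply: eq_Rintegral => y _; rewrite /P; ring.
  exact: ibp_balance t.
have mb := @measurable_eball R n x r2.
have mP2 : measurable_fun setT (fun y => P y ^+ 2) by exact: measurable_funX.
have mG2 : measurable_fun setT (fun y => cutv SG G y 0 i ^+ 2) by exact: measurable_funX.
have -> : (\int[leb]_(y in eball x r2) (P y ^+ 2)%:E = \int[leb]_(y in eball x r2) (cutv SG G y 0 i ^+ 2)%:E)%E.
  apply: (integral_null mb (measurable_funTS mG2)); last by move=> y _; exact: sqr_ge0.
  by apply: filterS z => y hy yb; move/eqP: (hy yb); rewrite subr_eq0 => /eqP ->.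
apply: (@le_lt_trans _ _ (\int[leb]_y (cutv SG G y 0 i ^+ 2)%:E)%E).
  by apply: int_sub => //; move=> y _; exact: sqr_ge0.
have mV : (m%:E * \int[leb]_y (cutv SG G y 0 i ^+ 2)%:E < +oo)%E.
  rewrite -(@int_scale _ _ _ leb setT m (fun y => cutv SG G y 0 i ^+ 2) measurableT mG2 (ltW m0) (fun y _ => sqr_ge0 _)).
  apply: le_lt_trans G2; rewrite [leRHS]integral_mkcond; apply: ge0_le_integral_nm => y.
    by rewrite lee_fin mulr_ge0 ?sqr_ge0// ltW.
  have w0 : 0 <= weight Gam d y by exact: powR_ge0.
  rewrite patchE /cutv mxE indicE; have [[Cy Ny]|Sy] := pselect (SG y); last first.
    rewrite memNset// mul0r expr0n/= mulr0; case: ifP => // _.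
    by rewrite lee_fin mulr_ge0 ?sqr_ge0.
  rewrite mem_set// mul1r mem_set; last exact: cO.
  rewrite lee_fin mulrC; apply: ler_pM; rewrite ?sqr_ge0 ?(ltW m0)//; last exact: hm.
  rewrite -(real_normK (num_real (G y 0 i))) lerXn2r ?nnegrE ?enorm_ge0//; exact: coord_le_enorm.
move: mV; case E0 : (\int[leb]_y _)%E => [c| |]//; rewrite ?ltry//.
by rewrite gt0_muley ?lte_fin.
Qed.

(* The gradient of phi u is phi g + u grad phi; comparing phi = chi and phi = y_j chi
   isolates u chi, which is therefore square integrable. *)
Lemma loc_sq_fin E N u g Gam (d m : R) x (r2 rho : R) : (0 < n)%N ->
  closed Gam -> E `<=` ~` Gam -> borel_off E N u g -> cball x rho `<=` E -> 0 < r2 -> r2 < rho ->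
  distr_grad E u g -> 0 < m -> (forall y, cball x rho y -> m <= weight Gam d y) ->
  (forall phi, test_fun E phi -> W Gam d (fun y => phi y * u y)) ->
  forall S, S = cball x rho `\` N ->
  (\int[leb]_(y in eball x r2) (cutf S u y ^+ 2)%:E < +oo)%E /\
  forall j, (\int[leb]_(y in eball x r2) (cutv S g y 0 j ^+ 2)%:E < +oo)%E.
Proof.
move=> n0 cG EG bo cE r20 r2r dg m0 hm hW S SE.
have [lu lg _] := dg; have := cut_facts bo cE lu lg; rewrite /= -SE => -[mu mg iu ig].
have rho0 : 0 < rho by exact: lt_trans r2r.
pose s0 := rho * (rho - r2) / 2.
have s00 : 0 < s0 by rewrite divr_gt0// mulr_gt0// subr_gt0.
pose chi := cutoff x rho s0.
have sc : fsmooth chi by exact: cutoff_fsmooth.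
have c0 y : out_ball x rho y -> chi y = 0 by exact: cutoff_out.
have mb := @measurable_eball R n x r2.
have P phi j : fsmooth phi -> (forall y, out_ball x rho y -> phi y = 0) ->
    (\int[leb]_(y in eball x r2) ((phi y * cutv S g y 0%R j + cutf S u y * partial j phi y) ^+ 2)%:E < +oo)%E.
  move=> sp p0; apply: (product_sq_fin j n0 cG EG bo cE r2r dg m0 hm sp p0 _ SE).
  by apply: hW; exact: test_fun_ball sp p0 cE.
have mP phi j : fsmooth phi ->
    measurable_fun setT (fun y => phi y * cutv S g y 0 j + cutf S u y * partial j phi y).
  move=> sp; apply: measurable_funD; apply: measurable_funM => //.
  - exact: measurable_fsmooth.
  - exact: measurable_coordf.
  - exact: measurable_fsmooth (fsmooth_partial j sp).
have uc : (\int[leb]_(y in eball x r2) ((cutf S u y * chi y) ^+ 2)%:E < +oo)%E.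
  pose j : 'I_n := Ordinal n0.
  pose phi y := y 0 j * chi y.
  have sj := @fsmooth_coord R n j.
  have sp : fsmooth phi by exact: fsmoothM.
  have p0 y : out_ball x rho y -> phi y = 0 by move=> yr; rewrite /phi c0// mulr0.
  have mcj : measurable_fun setT (fun y : 'rV[R]_n => - y 0 j).
    by apply: measurableT_comp => //; exact: measurable_coord.
  have bj y : eball x r2 y -> `|- y 0 j| <= enorm x + r2.
    move=> yb; rewrite normrN; apply: le_trans (coord_le_enorm _ _) _.
    have := enorm_triangle x y 0; rewrite !subr0 => h; apply: le_trans h _.
    by rewrite addrC lerD2l ltW.
  have h := sq_fin_add mb (mP phi j sp) (measurable_funM mcj (mP chi j sc)) (P phi j sp p0)
    (sq_fin_mulb mb (mP chi j sc) mcj bj (P chi j sc c0)).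
  move: h; under eq_integral => y _.
    rewrite (_ : phi y * cutv S g y 0 j + cutf S u y * partial j phi y + - y 0 j *
      (chi y * cutv S g y 0 j + cutf S u y * partial j chi y) = cutf S u y * chi y); last first.
      by rewrite !partialE /phi gradM// grad_coord !mxE !eqxx /=; ring.
    over.
  by [].
have muc : measurable_fun setT (fun y => cutf S u y * chi y).
  by apply: measurable_funM => //; exact: measurable_fsmooth.
(* On the smaller ball chi is at least s0 > 0, so the factor chi can be divided out. *)
have inv_le (f : 'rV[R]_n -> R) : measurable_fun setT f ->
    (\int[leb]_(y in eball x r2) ((f y * chi y) ^+ 2)%:E < +oo)%E ->
    (\int[leb]_(y in eball x r2) (f y ^+ 2)%:E < +oo)%E.
  move=> mf fc.
  have mfc : measurable_fun setT (fun y => f y * chi y).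
    by apply: measurable_funM => //; exact: measurable_fsmooth.
  have hb y : eball x r2 y -> `|cst s0^-1 y| <= s0^-1 by move=> _; rewrite ger0_norm// invr_ge0 ltW.
  have := sq_fin_mulb mb mfc (measurable_cst (s0^-1 : R)) hb fc.
  apply: le_lt_trans; apply: int_le => //.
  - by apply: measurable_funTS; exact: measurable_funX.
  - apply: measurable_funTS; apply: measurable_funX; apply: measurable_funM => //.
  move=> y yb; rewrite sqr_ge0/= /cst.
  have hc : 1 <= s0^-1 * chi y.
    by rewrite mulrC ler_pdivlMr// mul1r; exact: cutoff_lower.
  rewrite (_ : s0^-1 * (f y * chi y) = s0^-1 * chi y * f y); last by ring.
  by rewrite exprMn ler_peMl ?sqr_ge0// exprn_ege1.
have u2 := inv_le _ mu uc; split => // j.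
have mgj := measurable_coordf j mg.
apply: inv_le => //.
have [M M0 hM] := grad_bounded sc c0.
have mpc : measurable_fun setT (fun y => - partial j chi y).
  by apply: measurableT_comp => //; exact: measurable_fsmooth (fsmooth_partial j sc).
have bpc y : eball x r2 y -> `|- partial j chi y| <= M.
  by move=> _; rewrite normrN partialE; apply: le_trans (coord_le_enorm _ _) (hM y).
have := sq_fin_add mb (mP chi j sc) (measurable_funM mpc mu) (P chi j sc c0) (sq_fin_mulb mb mu mpc bpc u2).
under eq_integral => y _.
  rewrite (_ : chi y * cutv S g y 0 j + cutf S u y * partial j chi y + - partial j chi y * cutf S u y =
    cutv S g y 0 j * chi y); last by ring.
  over.
by [].
Qed.

(** By linearity - u has the flux - F, with the same bounds; truncations of u from below are
    truncations of - u from above. *)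
Lemma dg_of_weak_sol x0 (r0 lam Lam : R) u g F : 0 < lam -> 0 <= Lam -> measurable_fun setT F ->
  sob (eball x0 r0) u g ->
  (\int[leb]_(x in eball x0 r0) (u x ^+ 2)%:E < +oo)%E ->
  (\int[leb]_(x in eball x0 r0) (enorm (g x) ^+ 2)%:E < +oo)%E ->
  (forall x, eball x0 r0 x -> lam * enorm (g x) ^+ 2 <= dotv (F x) (g x)) ->
  (forall x, eball x0 r0 x -> enorm (F x) <= Lam * enorm (g x)) ->
  weak_sol x0 r0 F ->
  dg x0 r0 (64 * Lam ^+ 2 / lam ^+ 2) u g /\
  dg x0 r0 (64 * Lam ^+ 2 / lam ^+ 2) (fun x => - u x) (fun x => - g x).
Proof.
move=> l0 L0 mF su u2 g2 hl hL hw; split.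
  by split => // k y rho r p0 pr sub; exact: caccioppoli hw k y rho r p0 pr sub.
have mD := @measurable_eball R n x0 r0.
have sn : sob (eball x0 r0) (fun x => - u x) (fun x => - g x).
  have := sobZ (-1) mD su; congr sob; apply/funext => x; rewrite ?mulN1r ?scaleN1r//.
have un2 : (\int[leb]_(x in eball x0 r0) ((- u x) ^+ 2)%:E < +oo)%E.
  by under eq_integral do rewrite sqrrN.
have gn2 : (\int[leb]_(x in eball x0 r0) (enorm (- g x) ^+ 2)%:E < +oo)%E.
  by under eq_integral do rewrite enormN.
split => // k y rho r p0 pr sub.
apply: (@caccioppoli _ _ x0 r0 lam Lam _ _ (fun x => - F x)) => //.
- exact: measurable_oppf.
- by move=> x xr; rewrite enormN dotvNl dotvNr opprK; exact: hl.
- by move=> x xr; rewrite !enormN; exact: hL.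
move=> phi z s sp ps zs.
have ps' x : out_ball z s x -> - phi x = 0 by move=> xs; rewrite ps// oppr0.
have h := hw (fun x => - phi x) z s (fsmoothN sp) ps' zs.
apply: etrans h; apply: eq_Rintegral => x _; rewrite dotvNl -dotvNr; congr dotv.
by rewrite -scaleN1r -gradZ//; congr (grad _ x); apply/funext => t; rewrite mulN1r.
Qed.

Lemma cutv_dotv S g G y : dotv (cutv S g y) (cutv S G y) = \1_S y * dotv (g y) (G y).
Proof. by rewrite /cutv dotvZl dotvZr indicE; case: (y \in S); rewrite ?mul1r ?mul0r. Qed.

(** The bound on the flux is the bilinear bound with zeta = A xi, divided by |A xi|. Off S both
    sides of the two inequalities vanish. *)
Lemma elliptic_cut Gam (C1 d : R) (A : 'rV[R]_n -> 'M[R]_n) S g y (m M : R) :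
  1 <= C1 -> elliptic Gam d C1 A -> (forall z, S z -> ~ Gam z) -> 0 <= M ->
  (S y -> m <= weight Gam d y) -> (S y -> weight Gam d y <= M) ->
  C1^-1 * m * enorm (cutv S g y) ^+ 2 <= dotv (cutv S (fun z => g z *m (A z)^T) y) (cutv S g y) /\
  enorm (cutv S (fun z => g z *m (A z)^T) y) <= C1 * M * enorm (cutv S g y).
Proof.
move=> C11 [_ up low] SG M0 hm hM; have C10 : 0 < C1 by exact: lt_le_trans C11.
rewrite cutv_dotv /cutv !enormZ !indicE.
have [Sy|Sy] := pselect (S y); last first.
  by rewrite memNset// normr0 !mul0r expr0n/= !mulr0.
rewrite mem_set// normr1 !mul1r; have Oy := SG y Sy; split.
  apply: le_trans (low y (g y) Oy); rewrite ler_wpM2r ?sqr_ge0// ler_wpM2l ?invr_ge0 ?(ltW C10)//.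
  exact: hm.
set v := g y *m _; have w0 : 0 <= weight Gam d y by exact: powR_ge0.
have h : enorm v ^+ 2 <= C1 * weight Gam d y * enorm (g y) * enorm v.
  by rewrite sqr_enorm; apply: le_trans (ler_norm _) _; exact: up.
apply: (@le_trans _ _ (C1 * weight Gam d y * enorm (g y))); last first.
  by rewrite ler_wpM2r ?enorm_ge0// ler_wpM2l ?(ltW C10)// hM.
have [v0|v0] := eqVneq (enorm v) 0; first by rewrite v0 !mulr_ge0 ?enorm_ge0 ?(ltW C10).
have vp : 0 < enorm v by rewrite lt_neqAle eq_sym v0 enorm_ge0.
by rewrite -(ler_pM2r vp) -expr2.
Qed.

End reduction.

(** * Choice of the null set and of the constants *)

Section assembly.
Context {R : realType} {n : nat}.
Implicit Types (u phi : 'rV[R]_n -> R) (g : 'rV[R]_n -> 'rV[R]_n) (x y : 'rV[R]_n) (E N Gam : set 'rV[R]_n).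
Local Notation leb := (lebesgue_rV R n).
Local Notation cball x r := [set y | enorm (y - x) <= r].

Lemma sum_sq_fin (b : set 'rV[R]_n) g : measurable b -> measurable_fun setT g ->
  (forall j, (\int[leb]_(y in b) (g y 0%R j ^+ 2)%:E < +oo)%E) ->
  (\int[leb]_(y in b) (enorm (g y) ^+ 2)%:E < +oo)%E.
Proof.
move=> mb mg hg; under eq_integral => y _ do rewrite sqr_enormE -sumEFin.
rewrite ge0_integral_sum//; first by apply: lte_sum_pinfty => j _; exact: hg.
  move=> j; apply/measurable_EFinP; apply: measurable_funTS; apply: measurable_funX.
  exact: measurable_coordf.
by move=> j y _; rewrite lee_fin sqr_ge0.
Qed.

(** D0 / 3 and 5 D0 / 3 bound the distance to the closed set on 2B when the centre is at distance D0
    >= 3 r, so 5^(-e) is the ratio of the two bounds of the weight. *)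
Lemma weight_ratio (D0 e : R) : 0 < D0 ->
  (D0 / 3) `^ e = 5 `^ (- e) * (5 * (D0 / 3)) `^ e.
Proof.
move=> D00; have h3 : 0 <= D0 / 3 by rewrite divr_ge0// ltW.
by rewrite [(5 * (D0 / 3)) `^ e]powRM// mulrA powRN mulVf ?mul1r// gt_eqF// powR_gt0.
Qed.

Lemma distance_bounds Gam x y (a : R) : Gam !=set0 -> enorm (y - x) <= a ->
  edist_set x Gam - a <= edist_set y Gam <= edist_set x Gam + a.
Proof.
move=> G0 ya; have h1 := edist_lip x y G0; have h2 := edist_lip y x G0.
rewrite -(enormN (x - y)) opprB in h1.
by apply/andP; split; lra.
Qed.

(** N collects the exceptional sets of u, of the components of g, of the entries of A and of the
    sign condition. *)
Lemma borel_off_solution Gam (d C1 : R) A E u g : closed Gam -> measurable E -> E `<=` ~` Gam ->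
  elliptic Gam d C1 A -> distr_grad E u g -> {ae leb, forall z, E z -> 0 <= u z} ->
  exists N, [/\ borel_off E N u g, forall y, E y -> ~ N y -> 0 <= u y &
    forall i j, exists2 h : 'rV[R]_n -> R, measurable_fun E h &
      forall y, E y -> ~ N y -> A y i j = h y].
Proof.
move=> cG mE EG [mA _ _] [[lu _] lg _] [N4 [mN4 N40 hN4]].
have [N1 [mN1 N10 h1]] := common_null (fun _ : unit => lu).
have [N2 [mN2 N20 h2]] := common_null (fun i => (lg i).1).
have lA (p : 'I_n * 'I_n) : lebesgue_measurable_fun E (fun y => A y p.1 p.2).
  have [h mh [M [mM M0 hM]]] := mA p.1 p.2; exists h.
    by apply: measurable_funS mh => //; apply: open_measurable_rV; exact: closed_openC.
  exists M; split => // y /= hy; apply: hM => /= h'; apply: hy => Ey; apply: h'; exact: EG.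
have [N3 [mN3 N30 h3]] := common_null lA.
exists (N1 `|` N2 `|` (N3 `|` N4)).
have U0 (B C : set 'rV[R]_n) : measurable B -> measurable C -> leb B = 0%E -> leb C = 0%E -> leb (B `|` C) = 0%E.
  by move=> mB mC B0 C0; rewrite measureU0.
have mN : measurable (N1 `|` N2 `|` (N3 `|` N4)).
  by apply: measurableU; exact: measurableU.
split.
- split => //.
  + by apply: (U0 _ _ (measurableU _ _ mN1 mN2) (measurableU _ _ mN3 mN4)); exact: U0.
  + have [h mh hh] := h1 tt; exists h => // y Ey Ny; apply: hh => // Nz; apply: Ny; by left; left.
  + move=> i; have [h mh hh] := h2 i; exists h => // y Ey Ny; apply: hh => // Nz; apply: Ny; by left; right.
- move=> y Ey Ny; apply: contrapT => h; apply: Ny; right; right; apply: hN4 => /= h'; exact: h (h' Ey).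
- move=> i j; have [h mh hh] := h3 (i, j); exists h => // y Ey Ny; apply: (hh y Ey) => Nz.
  by apply: Ny; right; left.
Qed.

End assembly.

Theorem lemma8p9 (R : realType) (n : nat) (d C1 : R) :
  (2 <= n)%N -> 0 < d -> d < n%:R - 1 -> 1 <= C1 ->
  exists2 C : R, 0 < C &
    forall (Gam : set 'rV[R]_n) (A : 'rV[R]_n -> 'M[R]_n)
      (x : 'rV[R]_n) (r : R) (u : 'rV[R]_n -> R),
    Gam !=set0 -> closed Gam -> ahlfors_regular d Gam ->
    elliptic Gam d C1 A ->
    0 < r -> eball x (3 * r) `<=` ~` Gam ->
    {ae lebesgue_rV R n, forall z, eball x (3 * r) z -> 0 <= u z} ->
    solution Gam d A (eball x (3 * r)) u ->
    (ess_sup_ball x r u <= C%:E * ess_inf_ball x r u)%E.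
Proof.
move=> n2 d0 dn C11; have n0 : (0 < n)%N by exact: ltn_trans n2.
have C10 : 0 < C1 by exact: lt_le_trans C11.
pose e := d + 1 - n%:R; have e0 : e < 0 by rewrite /e; lra.
pose K : R := 5 `^ (- e).
have K1 : 1 <= K by rewrite /K -[leLHS](powRr0 (5 : R)) ler_powR ?ler1n// oppr_ge0 ltW.
(* With weight bounds m and M on 2B, the ellipticity ratio is C1 M / (C1^-1 m) = C1^2 K. *)
pose Gm := 64 * (C1 ^+ 2 * K) ^+ 2.
have Gm1 : 1 <= Gm.
  have h : 1 <= C1 ^+ 2 * K by rewrite -[leLHS]mulr1 ler_pM// exprn_ege1.
  by rewrite /Gm -[leLHS]mulr1 ler_pM ?ler1n// exprn_ege1.
have [c c0 hc] := @harnack_core R n Gm n0 Gm1.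
exists c^-1; first by rewrite invr_gt0.
move=> Gam A x r u G0 cG _ ell r0 sub upos [[lu hW] [g dg eq]].
set leb := lebesgue_rV R n in upos eq *.
pose E := eball x (3 * r); have mE : measurable E by exact: measurable_eball.
have [N [bo uN hA]] := borel_off_solution cG mE sub ell dg upos.
have [_ mN N0 _ _] := bo; have [_ lg _] := dg.
have D0r := edist_ge G0 sub; set D0 := edist_set x Gam in D0r.
have D00 : 0 < D0 by apply: lt_le_trans D0r; rewrite mulr_gt0.
(* Working inwards: the cut-offs for square integrability live in radius r3, integrability holds in
   r2, u is cut at r1, and strong gradients are obtained on the ball of radius 2 r. *)
pose r1 := 5 / 2 * r; pose r2 := 13 / 5 * r; pose r3 := 14 / 5 * r.
have rr : [/\ 0 < r2, r1 < r2, r2 < r3, r3 < 3 * r & 2 * r < r1].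
  by rewrite /r1 /r2 /r3; split; lra.
case: rr => r20 r12 r23 r33 r2r1.
have cE a : a < 3 * r -> [set y | enorm (y - x) <= a] `<=` E.
  by move=> ar y /= ya; exact: le_lt_trans ar.
have r13 : r1 < 3 * r by exact: lt_trans r12 (lt_trans r23 r33).
(* A lower bound of the weight on the ball of radius r3, where the distance is below 2 D0. It serves
   only for finiteness and does not enter the constant. *)
pose m1 := (2 * D0) `^ e; have m10 : 0 < m1 by rewrite powR_gt0// mulr_gt0.
have hm1 y : enorm (y - x) <= r3 -> m1 <= weight Gam d y.
  move=> /(distance_bounds G0); rewrite -/D0 /r3 => /andP[h1 h2].
  by apply: weight_ge; rewrite -/e; lra.
have [u2 g2] := loc_sq_fin n0 cG sub bo (cE _ r33) r20 r23 dg m10 hm1 hW erefl.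
pose S := [set y | enorm (y - x) <= r1] `\` N.
have [mu mg _ _] := cut_facts bo (cE _ r13) lu lg.
rewrite -/S in mu mg.
have SE y : S y -> E y by move=> [/= yr _]; exact: cE r13 _ yr.
have S3 y : S y -> ([set y | enorm (y - x) <= r3] `\` N) y.
  by move=> [/= yr Ny]; split => //=; apply: le_trans yr (ltW (lt_trans r12 r23)).
have Sb y : S y -> eball x r2 y by move=> [/= yr _]; exact: le_lt_trans r12.
have mC a : measurable [set y | enorm (y - x) <= a].
  by apply: closed_measurable_rV; exact: closed_cball.
have mS : measurable S by exact: measurableD.
have m3 := cut_facts bo (cE _ r33) lu lg; case: m3 => mu3 mg3 _ _.
set S' := [set y | enorm (y - x) <= r3] `\` N in u2 g2 mu3 mg3 S3.
have mB a := @measurable_eball R n x a.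
have uS2 : (\int[leb]_y (cutf S u y ^+ 2)%:E < +oo)%E.
  apply: le_lt_trans u2; rewrite [leRHS]integral_mkcond.
  apply: ge0_le_integral_nm => y; first by rewrite lee_fin sqr_ge0.
  rewrite patchE /cutf !indicE; have [Sy|Sy] := pselect (S y).
    by rewrite (mem_set (S3 _ Sy)) (mem_set (Sb _ Sy)) (mem_set Sy).
  by rewrite memNset// mul0r expr0n/=; case: ifP => // _; rewrite lee_fin sqr_ge0.
have gS2 : (\int[leb]_y (enorm (cutv S g y) ^+ 2)%:E < +oo)%E.
  apply: le_lt_trans (sum_sq_fin (mB r2) mg3 g2); rewrite [leRHS]integral_mkcond.
  apply: ge0_le_integral_nm => y; first by rewrite lee_fin sqr_ge0.
  rewrite patchE /cutv !indicE; have [Sy|Sy] := pselect (S y).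
    by rewrite (mem_set (S3 _ Sy)) (mem_set (Sb _ Sy)) (mem_set Sy).
  by rewrite memNset// scale0r enorm0 expr0n/=; case: ifP => // _; rewrite lee_fin sqr_ge0.
have Sout y : out_ball x r1 y -> ~ S y.
  by move=> yr [/= h _]; move: (lt_le_trans yr h); rewrite ltxx.
have sb : sob (eball x (2 * r)) (cutf S u) (cutv S g).
  apply: (sob_of_weak n0 _ r2r1 mu mg) => //.
  - by rewrite mulr_gt0.
  - by move=> y /Sout Sy; rewrite /cutf indicE memNset ?mul0r.
  - by move=> y /Sout Sy; rewrite /cutv indicE memNset ?scale0r.
  - by move=> phi i sp p0; exact: (cut_ibp i bo (cE _ r13) dg sp p0).
pose F := cutv S (fun y => g y *m (A y)^T).
have mF : measurable_fun setT F.
  apply: measurable_fun_rV => i.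
  have [hg mhg hgE] : exists2 hg : 'I_n -> 'rV[R]_n -> R, forall j, measurable_fun E (hg j) &
      forall j y, E y -> ~ N y -> g y 0 j = hg j y.
    have [_ _ _ _ h] := bo.
    exists (fun j => projT1 (cid2 (h j))) => j; by case: cid2.
  pose ha j := projT1 (cid2 (hA i j)).
  have [mha haE] : (forall j, measurable_fun E (ha j)) /\
      (forall j y, E y -> ~ N y -> A y i j = ha j y).
    by split=> j; rewrite /ha; case: cid2.
  have -> : (fun y => F y 0 i) = (fun y => \1_S y * (\sum_j g y 0 j * A y i j)).
    apply/funext => y; rewrite /F /cutv !mxE; congr (_ * _).
    by apply: eq_bigr => j _; rewrite mxE.
  apply: (measurable_cut mS mE SE (h := fun y => \sum_j hg j y * ha j y)).
    by apply: measurable_sum => j; exact: measurable_funM.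
  move=> y [/= yr Ny]; have Ey : E y by exact: cE r13 _ yr.
  by apply: eq_bigr => j _; rewrite hgE// haE.
(* As 3 r <= D0, the distance on 2B lies between D0 - 2 r >= D0 / 3 and D0 + 2 r <= 5 D0 / 3; the
   exponent e is negative, so the larger distance gives the lower bound. *)
pose m := (5 * (D0 / 3)) `^ e; pose M := (D0 / 3) `^ e.
have D3 : 0 < D0 / 3 by rewrite divr_gt0.
have m0 : 0 < m by rewrite powR_gt0// mulr_gt0.
have M0 : 0 < M by rewrite powR_gt0.
have wb y : eball x (2 * r) y -> m <= weight Gam d y /\ weight Gam d y <= M.
  move=> /ltW /(distance_bounds G0); rewrite -/D0 => /andP[h1 h2]; split.
    by apply: weight_ge; rewrite -/e; lra.
  by apply: weight_le => //; rewrite -/e; lra.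
have lam0 : 0 < C1^-1 * m by rewrite mulr_gt0// invr_gt0.
have Lam0 : 0 <= C1 * M by rewrite mulr_ge0// ltW.
have m2r := mB (2 * r).
have sub2 (f : 'rV[R]_n -> R) : measurable_fun setT f -> (\int[leb]_y (f y ^+ 2)%:E < +oo)%E ->
    (\int[leb]_(y in eball x (2 * r)) (f y ^+ 2)%:E < +oo)%E.
  move=> mf; apply: le_lt_trans; apply: int_sub => //; first exact: measurable_funX.
  by move=> y _; exact: sqr_ge0.
have SG y : (S `&` eball x (2 * r)) y -> ~ Gam y by move=> [/SE Ey _]; exact: sub.
(* A test function supported in the ball of radius 2 r does not see the cut at r1, so the equation
   for u becomes one for the Borel flux F. *)
have ws : weak_sol x (2 * r) F.
  move=> phi z s sp p0 zs.
  have zE : [set y | enorm (y - z) <= s] `<=` E.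
    by move=> y /zs yb; apply: eball_subr yb; rewrite ler_wpM2r ?ler_nat// ltW.
  have mO : measurable (~` Gam) by apply: open_measurable_rV; exact: closed_openC.
  have g0 y : ~ eball x (2 * r) y -> grad phi y = 0.
    by move=> yb; apply: (grad_vanish p0); rewrite /out_ball/= ltNge; apply/negP => /zs.
  have mh : measurable_fun setT (fun y => dotv (F y) (grad phi y)).
    by apply: measurable_dotvf => //; exact: measurable_grad.
  rewrite (@Rint_cut _ _ (eball x (2 * r)) set0 _ (fun y => dotv (F y) (grad phi y)) m2r)//; last by move=> y yb; rewrite g0// dotv0r.
  have := eq phi (test_fun_ball sp p0 zE).
  rewrite (@Rint_cut _ _ (~` Gam) N _ (fun y => dotv (F y) (grad phi y)) mO)// => y Oy.
    move=> Ny; have [yb|yb] := pselect (eball x (2 * r) y); last by rewrite g0// !dotv0r.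
    rewrite /F /cutv indicE mem_set ?scale1r//; split => //=.
    exact: le_trans (ltW yb) (ltW r2r1).
  rewrite g0 ?dotv0r// => yb; apply: Oy; apply: sub; apply: eball_subr yb.
  by rewrite ler_wpM2r ?ler_nat// ltW.
have el y : eball x (2 * r) y ->
    C1^-1 * m * enorm (cutv S g y) ^+ 2 <= dotv (F y) (cutv S g y) /\
    enorm (F y) <= C1 * M * enorm (cutv S g y).
  move=> yb; have [wm wM] := wb y yb.
  apply: (elliptic_cut g C11 ell _ (ltW M0)) => // z Sz; apply: sub; exact: SE.
have [dg1 dg2] := dg_of_weak_sol lam0 Lam0 mF sb (sub2 _ mu uS2)
  (sub2 _ (measurable_enormf mg) gS2) (fun y yb => (el y yb).1) (fun y yb => (el y yb).2) ws.
(* D0 cancels: the De Giorgi constant depends only on n, d and C1. *)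
have GE : 64 * (C1 * M) ^+ 2 / (C1^-1 * m) ^+ 2 = Gm.
  rewrite /M weight_ratio// -/m -/K /Gm; field.
  by rewrite !gt_eqF.
rewrite GE in dg1 dg2.
have u0 y : 0 <= cutf S u y.
  rewrite /cutf indicE; have [Sy|Sy] := pselect (S y); last by rewrite memNset// mul0r.
  by rewrite mem_set// mul1r; apply: uN; [exact: SE|case: Sy].
apply: (ess_harnack c0 mu) => //.
  exists N; split => // y /= hy; apply: contrapT => Ny; apply: hy => yb.
  rewrite /cutf indicE mem_set ?mul1r//; split => //=.
  by apply: le_trans (ltW yb) _; rewrite /r1; lra.
by move=> t t0; exact: (hc x r _ _ _ t r0 dg1 dg2 (fun y _ => u0 y) t0).
Qed.
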